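(* For every sufficiently small $\epsilon>0$, every $G\in(-\epsilon,\epsilon)$ and all sufficiently large $H$ there exists a solution (for some constants $\Omega,B,Q\in\mathbb R$) of the finite-depth water wave problem $$\Delta\psi=-\Omega \ \text{ in } D,\qquad \psi=0\ \text{ on } S,\qquad \tfrac12|\nabla\psi|^2+Gy=B\ \text{ on } S,\qquad \psi=Q\ \text{ on } \{y=-H\},$$ whose profile $S$ is vertical at a point but never overhanging.
   Context: Here $G,\Omega,B,Q$ are real constants (dimensionless gravity, constant vorticity, Bernoulli constant, and an a priori unknown constant value of $\psi$ on the bottom), and $H>0$. Solutions. For $0<d<\infty$ let $\mathbb S_d=\{\alpha+i\beta\in\mathbb C:-d<\beta<0\}$ and identify $\mathbb R^2$ with $\mathbb C$. A solution consists of $\Omega,B,Q\in\mathbb R$, a domain $D\subset\mathbb R^2$ which is $2\pi$-periodic in $x$, bounded below by the line $\{y=-H\}$ and bounded above by a free surface $S$, and a stream function $\psi$ on $\overline D$, such that the displayed equations hold. $D$ and $\psi$ are $2\pi$-periodic in $x$ and symmetric under reflection in the vertical lines beneath the crest and the trough. The domain is described by a unique $d\in(0,\infty)$ and a conformal bijection $z=x+iy:\mathbb S_d\to D$ that extends continuously to $\{\beta=-d\}$, mapping it onto $\{y=-H\}$, and extends in a $C^1$ and injective fashion to $\{\beta=0\}$ with $z_\alpha\ne0$ there, such that $x-\alpha$ and $y$ are $2\pi$-periodic in $\alpha$ and $S$ is the curve $\alpha\mapsto z(\alpha+i0)$. The profile is vertical at a point if $x_\alpha(\alpha_0+i0)=0$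 for some $\alpha_0$. It is overhanging if $x_\alpha(\alpha+i0)<0$ for some $\alpha$ (so that $S$ is not a graph over the $x$-axis). ''Never overhanging'' means $x_\alpha(\alpha+i0)\ge0$ for all $\alpha$. *)

(* Defs.v *)
From Stdlib Require Import Reals.
From Coquelicot Require Import Coquelicot.
Open Scope R_scope.

(* R^2 is identified with Coquelicot's [C := R * R], so that [Re p] and [Im p]
   are the abscissa and the ordinate of the point p. *)

Definition closure (A : C -> Prop) (p : C) : Prop :=
  forall U : C -> Prop, locally p U -> exists q, U q /\ A q.

Definition frontier (A : C -> Prop) (p : C) : Prop :=
  closure A p /\ closure (fun q => ~ A q) p.

Definition connected (A : C -> Prop) : Prop :=
  forall U V : C -> Prop, open U -> open V ->
    (forall p, A p -> U p \/ V p) ->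
    (exists p, A p /\ U p) -> (exists p, A p /\ V p) ->
    exists p, A p /\ U p /\ V p.

Definition strip (d : R) (w : C) : Prop := - d < Im w < 0.

Definition strip_top (d : R) (w : C) : Prop := - d < Im w <= 0.

Definition strip_closed (d : R) (w : C) : Prop := - d <= Im w <= 0.

Definition surface (z : C -> C) (p : C) : Prop := exists a : R, p = z (a, 0).

(* The real part of d/da z(a + i0). *)
Definition x_alpha (z : C -> C) (a : R) : R := Derive (fun t => Re (z (t, 0))) a.

Definition bottom (H : R) (p : C) : Prop := Im p = - H.

Record is_fluid_domain (H : R) (D S : C -> Prop) : Prop := {
  dom_open : open D;
  dom_connected : connected D;
  dom_periodic : forall x y, D (x + 2 * PI, y) <-> D (x, y);
  dom_above_bottom : forall p, D p \/ S p -> - H < Im p;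
  dom_frontier : forall p, frontier D p <-> S p \/ bottom H p
}.

(* [z] denotes both the conformal bijection and its extension to the boundary
   lines of the strip; its values outside the closed strip are irrelevant. *)
Record is_conformal_parametrization (H d : R) (D : C -> Prop) (z : C -> C)
  : Prop := {
  conf_image : forall p, D p <-> exists w, strip d w /\ z w = p;
  conf_inj : forall w1 w2, strip_top d w1 -> strip_top d w2 ->
    z w1 = z w2 -> w1 = w2;
  conf_continuous :
    @continuous_on C_UniformSpace C_UniformSpace (strip_closed d) z;
  conf_bottom : forall p, bottom H p <-> exists a : R, z (a, - d) = p;
  (* z is holomorphic, its complex derivative extends continuously to the top
     line, where it is the tangential derivative of the trace of z. *)
  conf_C1 : exists dz : C -> C,
    (forall w, strip d w -> @is_derive C_AbsRing C_NormedModule z w (dz w)) /\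
    @continuous_on C_UniformSpace C_UniformSpace (strip_top d) dz /\
    (forall a : R,
       @is_derive R_AbsRing C_R_NormedModule (fun t => z (t, 0)) a (dz (a, 0))) /\
    (forall a : R, dz (a, 0) <> RtoC 0);
  conf_periodic_x : forall a b, strip_closed d (a, b) ->
    Re (z (a + 2 * PI, b)) - (a + 2 * PI) = Re (z (a, b)) - a;
  conf_periodic_y : forall a b, strip_closed d (a, b) ->
    Im (z (a + 2 * PI, b)) = Im (z (a, b))
}.

Definition is_crest (S : C -> Prop) (p : C) : Prop :=
  S p /\ forall q, S q -> Im q <= Im p.

Definition is_trough (S : C -> Prop) (p : C) : Prop :=
  S p /\ forall q, S q -> Im p <= Im q.

Definition symmetric_about (c : R) (D : C -> Prop) (psi : R -> R -> R) : Prop :=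
  (forall x y, D (2 * c - x, y) <-> D (x, y)) /\
  (forall x y, closure D (x, y) -> psi (2 * c - x) y = psi x y).

(* Only the values of [psi] on the closure of D matter: psi is of class C^2 in D,
   C^1 up to S and continuous up to the bottom.  On S, where psi has no
   two-sided partial derivatives, the gradient is (px, py), the continuous
   extension to D \cup S of the gradient in D. *)
Record is_stream_function (G Omega B Q H : R) (D S : C -> Prop)
  (psi : R -> R -> R) : Prop := {
  psi_continuous :
    @continuous_on C_UniformSpace R_UniformSpace
      (closure D) (fun p => psi (Re p) (Im p));
  psi_C2 : forall x y, D (x, y) -> ex_diff_n psi 2 x y;
  psi_periodic : forall x y, closure D (x, y) -> psi (x + 2 * PI) y = psi x y;
  psi_poisson : forall x y, D (x, y) ->
    Derive_n (fun t => psi t y) 2 x + Derive_n (fun t => psi x t) 2 y = - Omega;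
  psi_surface : forall p, S p -> psi (Re p) (Im p) = 0;
  psi_bernoulli : exists px py : C -> R,
    (forall x y, D (x, y) -> px (x, y) = Derive (fun t => psi t y) x) /\
    (forall x y, D (x, y) -> py (x, y) = Derive (fun t => psi x t) y) /\
    @continuous_on C_UniformSpace R_UniformSpace (fun p => D p \/ S p) px /\
    @continuous_on C_UniformSpace R_UniformSpace (fun p => D p \/ S p) py /\
    (forall p, S p -> / 2 * (px p ^ 2 + py p ^ 2) + G * Im p = B);
  psi_bottom : forall p, bottom H p -> psi (Re p) (Im p) = Q
}.

(* S is a continuous curve, periodic in x, so crests and troughs exist; the
   symmetry condition is therefore never vacuous. *)
Record is_water_wave (G H Omega B Q d : R) (D : C -> Prop) (psi : R -> R -> R)
  (z : C -> C) : Prop := {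
  ww_depth : 0 < d;
  ww_domain : is_fluid_domain H D (surface z);
  ww_conformal : is_conformal_parametrization H d D z;
  ww_stream : is_stream_function G Omega B Q H D (surface z) psi;
  ww_symmetric : forall p,
    is_crest (surface z) p \/ is_trough (surface z) p ->
    symmetric_about (Re p) D psi
}.

Definition vertical_at_a_point (z : C -> C) : Prop :=
  exists a : R, x_alpha z a = 0.

Definition never_overhanging (z : C -> C) : Prop :=
  forall a : R, 0 <= x_alpha z a.

(* Main.v *)
(* Write zeta = e^{-iw} and represent z' on the strip by a Laurent series with real
   coefficients in the Wiener algebra with weight e^{|n|/4}; holomorphy and the flat
   bottom say that the coefficient of zeta^{-n} is e^{-2nH} times that of zeta^n.
   With z' = f^2 / c, the Bernoulli condition on S says that P f^* + 2 y f, where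
   P^2 / 2 + c^2 G y is constant and f^* is the conjugate of f on S, extends
   holomorphically to the strip.  For G = 0 and H = infinity Crapper's waves
   f = (1 - A zeta) / (1 + A zeta) solve this for every A, and at A = sqrt 2 - 1, where
   their profile first becomes vertical, the linearized equation has an explicit bounded
   right inverse.  A contraction argument then gives, for small G and e^{-2H}, a
   Lipschitz family of solutions near the Crapper waves with A close to sqrt 2 - 1.
   The minimum of x_alpha changes sign along the family, so it vanishes for some A.
   For that wave Re z' > 0 in the strip by the minimum principle, hence z is injective,
   and y_alpha has the sign of sin alpha, which locates the crests and the troughs. *)

Require Import Defs.
From Stdlib Require Import Reals Lra Lia Psatz ZArith.
From Stdlib Require Import FunctionalExtensionality ProofIrrelevance ClassicalEpsilon.
From Coquelicot Require Import Coquelicot.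
Open Scope R_scope.

(** * Absolutely convergent sums over the integers *)

(** The unknown domain is replaced by a fixed strip, and the depth enters only through e = e^{-2H};
    infinite depth, e = 0, is thereby a regular point. The vorticity is normalized to 2, so the
    stream function is Im F - y^2 with F holomorphic, and Bernoulli's law prescribes |F' / z' - 2 y|
    on S. Writing z' as f^2 / c turns the unknown phase into f^* / f: with F' / z' - 2 y = (P / c)
    f^* / f and P real, both conditions are polynomial in f, P and the elevation. The mean of P is
    an unknown to which no equation corresponds. Hence only a right inverse of the linearization is
    sought, and the Crapper parameter A survives the perturbation as a free parameter. The
    difficulty is one of scale. Over a parameter interval of radius tau the minimum of x_alpha for
    the Crapper waves is only known to move by a multiple of tau, so the perturbed waves must stay
    within a small fraction of tau of them. Strict differentiability at the single wave A = A0, with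
    one linear operator serving the perturbed and the unperturbed map, gives this accuracy. *)

Definition fold (a : Z -> R) (n : nat) : R :=
  match n with
  | O => a 0%Z
  | S _ => a (Z.of_nat n) + a (- Z.of_nat n)%Z
  end.

Definition summable (a : Z -> R) : Prop := ex_series (fold (fun n => Rabs (a n))).

(** The terms of index n and -n are grouped, so that a sum over the integers is a [Series] over nat.
    Reversal of the index leaves each group unchanged; a shift does not, which is why translation
    invariance needs a limiting argument. *)
Definition sumZ (a : Z -> R) : R := Series (fold a).

Definition psum (a : Z -> R) (N : nat) : R := sum_n (fold a) N.

Lemma fold_le a b : (forall n, a n <= b n) -> forall n, fold a n <= fold b n.
Proof.
  intros H [|n]; simpl; [apply H|]. apply Rplus_le_compat; apply H.
Qed.

Lemma fold_ext a b : (forall n, a n = b n) -> forall n, fold a n = fold b n.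
Proof. intros H [|n]; simpl; rewrite ?H; reflexivity. Qed.

Lemma fold_abs a n : Rabs (fold a n) <= fold (fun k => Rabs (a k)) n.
Proof. destruct n; simpl; [lra|apply Rabs_triang]. Qed.

Lemma ex_series_fold a : summable a -> ex_series (fold a).
Proof.
  intros H. apply ex_series_Rabs.
  apply @ex_series_le with (b := fold (fun k => Rabs (a k))); [|exact H].
  intros n. change norm with Rabs. rewrite Rabs_Rabsolu. apply fold_abs.
Qed.

Lemma summable_le a b : (forall n, Rabs (a n) <= b n) -> summable b -> summable a.
Proof.
  intros H Hb. apply @ex_series_le with (b := fold (fun k => Rabs (b k))); [|exact Hb].
  intros n. change norm with Rabs.
  eapply Rle_trans; [apply fold_abs|]. apply fold_le. intros k.
  rewrite Rabs_Rabsolu. eapply Rle_trans; [apply H|apply Rle_abs].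
Qed.

Lemma summable_ext a b : (forall n, a n = b n) -> summable a -> summable b.
Proof.
  intros H. apply ex_series_ext. apply fold_ext. intros; now rewrite H.
Qed.

Lemma summable_abs a : summable a -> summable (fun n => Rabs (a n)).
Proof.
  apply ex_series_ext. apply fold_ext. intros; now rewrite Rabs_Rabsolu.
Qed.

Lemma summable_plus a b : summable a -> summable b -> summable (fun n => a n + b n).
Proof.
  intros Ha Hb. apply summable_le with (b := fun n => Rabs (a n) + Rabs (b n)).
  - intros; apply Rabs_triang.
  - eapply ex_series_ext; [|exact (ex_series_plus _ _ Ha Hb)].
    intros [|n]; simpl; unfold plus; simpl; rewrite ?(Rabs_right (_ + _));
      try ring; pose proof Rabs_pos; apply Rle_ge, Rplus_le_le_0_compat; auto.
Qed.

Lemma summable_scal c a : summable a -> summable (fun n => c * a n).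
Proof.
  intros Ha. apply (ex_series_scal_l (Rabs c)) in Ha.
  eapply ex_series_ext; [|exact Ha].
  intros [|n]; simpl; unfold scal; simpl; unfold mult; simpl; rewrite !Rabs_mult; ring.
Qed.

Lemma summable_opp a : summable a -> summable (fun n => - a n).
Proof.
  apply ex_series_ext. apply fold_ext. intros; now rewrite Rabs_Ropp.
Qed.

Lemma sumZ_ext a b : (forall n, a n = b n) -> sumZ a = sumZ b.
Proof. intros H. apply Series_ext. now apply fold_ext. Qed.

Lemma sumZ_plus a b : summable a -> summable b ->
  sumZ (fun n => a n + b n) = sumZ a + sumZ b.
Proof.
  intros Ha Hb. unfold sumZ. rewrite <- Series_plus by now apply ex_series_fold.
  apply Series_ext. intros [|n]; simpl; ring.
Qed.

Lemma sumZ_scal c a : sumZ (fun n => c * a n) = c * sumZ a.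
Proof.
  unfold sumZ. rewrite <- Series_scal_l.
  apply Series_ext. intros [|n]; simpl; ring.
Qed.

Lemma sumZ_opp a : sumZ (fun n => - a n) = - sumZ a.
Proof.
  rewrite (sumZ_ext _ (fun n => -1 * a n)) by (intros; ring).
  rewrite sumZ_scal. ring.
Qed.

Lemma sumZ_0 : sumZ (fun _ => 0) = 0.
Proof.
  rewrite (sumZ_ext _ (fun n => 0 * 0)) by (intros; ring). rewrite sumZ_scal. ring.
Qed.

Lemma summable_0 : summable (fun _ => 0).
Proof.
  exists 0. apply is_series_Reals. intros e He. exists 0%nat. intros n _.
  rewrite (sum_eq _ (fun _ => 0)).
  2:{ intros [|i] _; simpl; rewrite !Rabs_R0; ring. }
  rewrite sum_cte. unfold Rdist. replace (0 * INR (S n) - 0) with 0 by ring.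
  now rewrite Rabs_R0.
Qed.

Lemma sumZ_le a b : summable a -> summable b -> (forall n, a n <= b n) -> sumZ a <= sumZ b.
Proof.
  intros Ha Hb H.
  assert (0 <= sumZ b - sumZ a); [|lra].
  unfold Rminus. rewrite <- sumZ_opp, <- sumZ_plus by auto using summable_opp.
  rewrite <- sumZ_0. apply Series_le.
  - intros n. split; [destruct n; simpl; lra|]. apply fold_le. intros k. specialize (H k). lra.
  - apply ex_series_fold. apply summable_plus; auto using summable_opp.
Qed.

Lemma sumZ_pos a : (forall n, 0 <= a n) -> summable a -> 0 <= sumZ a.
Proof. intros H Ha. rewrite <- sumZ_0. apply sumZ_le; auto using summable_0. Qed.

Lemma sumZ_abs a : summable a -> Rabs (sumZ a) <= sumZ (fun n => Rabs (a n)).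
Proof.
  intros Ha. apply Rabs_le. rewrite <- sumZ_opp.
  split; apply sumZ_le; auto using summable_opp, summable_abs;
    intros n; generalize (Rle_abs (a n)), (Rle_abs (- a n)); rewrite Rabs_Ropp; lra.
Qed.

Lemma psum_0 a : psum a 0 = a 0%Z.
Proof. unfold psum. now rewrite sum_O. Qed.

Lemma psum_S a N : psum a (S N) = psum a N + (a (Z.of_nat (S N)) + a (- Z.of_nat (S N))%Z).
Proof. unfold psum. rewrite sum_Sn. reflexivity. Qed.

Lemma psum_le_sumZ a N : (forall n, 0 <= a n) -> summable a -> psum a N <= sumZ a.
Proof.
  intros H Ha.
  pose proof (Series_correct _ (ex_series_fold _ Ha)) as Hs.
  unfold psum, sumZ.
  apply (is_lim_seq_incr_compare (sum_n (fold a)) _ Hs).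
  intros n. rewrite sum_Sn. unfold plus; simpl.
  generalize (H (Z.of_nat (S n))) (H (- Z.of_nat (S n))%Z). simpl. lra.
Qed.

Lemma summable_bounded a M : (forall n, 0 <= a n) -> (forall N, psum a N <= M) ->
  summable a /\ sumZ a <= M.
Proof.
  intros H HM.
  assert (Hs : summable a).
  { apply ex_series_ext with (a := fold a).
    { apply fold_ext. intros; symmetry; apply Rabs_right. now apply Rle_ge. }
    destruct (ex_finite_lim_seq_incr (sum_n (fold a)) M) as [l Hl].
    - intros n. rewrite sum_Sn. unfold plus; simpl.
      generalize (H (Z.of_nat (S n))) (H (- Z.of_nat (S n))%Z). simpl. lra.
    - exact HM.
    - exists l. exact Hl. }
  split; [exact Hs|].
  pose proof (Series_correct _ (ex_series_fold _ Hs)) as Hl.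
  apply (is_lim_seq_le (sum_n (fold a)) (fun _ => M) (sumZ a) M HM Hl).
  apply is_lim_seq_const.
Qed.

Lemma summable_term a : summable a -> forall n, Rabs (a n) <= sumZ (fun k => Rabs (a k)).
Proof.
  intros Ha n.
  eapply Rle_trans; [|apply (psum_le_sumZ (fun k => Rabs (a k)) (Z.abs_nat n))];
    [|intros; apply Rabs_pos|now apply summable_abs].
  destruct (Z.abs_nat n) as [|m] eqn:E.
  - rewrite psum_0. replace n with 0%Z by lia. lra.
  - rewrite psum_S.
    assert (0 <= psum (fun k => Rabs (a k)) m).
    { unfold psum. clear. induction m. rewrite sum_O. apply Rabs_pos.
      rewrite sum_Sn. apply Rplus_le_le_0_compat; [assumption|].
      apply Rplus_le_le_0_compat; apply Rabs_pos. }
    generalize (Rabs_pos (a (Z.of_nat (S m)))) (Rabs_pos (a (- Z.of_nat (S m))%Z)). 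
    assert (n = Z.of_nat (S m) \/ n = - Z.of_nat (S m))%Z as [->| ->] by lia; lra.
Qed.

Lemma psum_succ a N : psum (fun n => a (n + 1)%Z) N
  = psum a N + a (Z.of_nat (S N)) - a (- Z.of_nat N)%Z.
Proof.
  induction N.
  - rewrite !psum_0. simpl. ring.
  - rewrite !psum_S, IHN.
    replace (Z.of_nat (S N) + 1)%Z with (Z.of_nat (S (S N))) by lia.
    replace (- Z.of_nat (S N) + 1)%Z with (- Z.of_nat N)%Z by lia. ring.
Qed.

Lemma summable_succ a : summable a -> summable (fun n => a (n + 1)%Z).
Proof.
  intros Ha. apply summable_le with (b := fun n => Rabs (a (n + 1)%Z)); [intros; lra|].
  pose proof (fun n => Rabs_pos (a n)) as Hp.
  refine (proj1 (summable_bounded _ (2 * sumZ (fun n => Rabs (a n))) _ _)).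
  - intros; apply Hp.
  - intros N. rewrite (psum_succ (fun n => Rabs (a n))).
    pose proof (psum_le_sumZ _ N Hp (summable_abs _ Ha)).
    pose proof (summable_term _ Ha (Z.of_nat (S N))).
    pose proof (Hp (- Z.of_nat N)%Z). lra.
Qed.

Lemma lim_term_0 a : summable a ->
  is_lim_seq (fun N => Rabs (a (Z.of_nat (S N))) + Rabs (a (- Z.of_nat (S N))%Z)) 0.
Proof.
  intros Ha. apply ex_series_lim_0 in Ha. apply is_lim_seq_incr_1 in Ha. exact Ha.
Qed.

(** The symmetric partial sums of the shifted and of the original family differ by two boundary
    terms, which tend to 0 by [lim_term_0]. *)
Lemma sumZ_succ a : summable a -> sumZ (fun n => a (n + 1)%Z) = sumZ a.
Proof.
  intros Ha.
  pose proof (Series_correct _ (ex_series_fold _ (summable_succ _ Ha))) as H1.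
  pose proof (Series_correct _ (ex_series_fold _ Ha)) as H2.
  apply (proj1 (is_lim_seq_incr_1 (sum_n _) (Finite _))) in H1.
  apply (proj1 (is_lim_seq_incr_1 (sum_n _) (Finite _))) in H2.
  pose proof (lim_term_0 _ Ha) as H3.
  assert (H4 : is_lim_seq (fun N => a (Z.of_nat (S (S N))) - a (- Z.of_nat (S N))%Z) 0).
  { apply is_lim_seq_abs_0.
    pose proof H3 as H5. apply is_lim_seq_incr_1 in H5.
    pose proof (is_lim_seq_plus _ _ _ _ 0 H3 H5) as H6.
    refine (is_lim_seq_le_le (fun _ => 0) _
      (fun N => (Rabs (a (Z.of_nat (S N))) + Rabs (a (- Z.of_nat (S N))%Z))
        + (Rabs (a (Z.of_nat (S (S N)))) + Rabs (a (- Z.of_nat (S (S N)))%Z))) 0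
      _ (is_lim_seq_const 0) _).
    - intros n; split; [apply Rabs_pos|].
      generalize (Rabs_triang (a (Z.of_nat (S (S n)))) (- a (- Z.of_nat (S n))%Z)).
      rewrite Rabs_Ropp. unfold Rminus.
      generalize (Rabs_pos (a (Z.of_nat (S n)))) (Rabs_pos (a (- Z.of_nat (S (S n)))%Z)). lra.
    - apply H6. unfold is_Rbar_plus; simpl. do 2 f_equal. ring. }
  assert (H5 : is_lim_seq (fun N => psum (fun n => a (n + 1)%Z) (S N)) (sumZ a + 0)).
  { eapply is_lim_seq_ext; [|apply (is_lim_seq_plus' _ _ _ _ H2 H4)].
    intros n. rewrite psum_succ. unfold psum. simpl. ring. }
  apply is_lim_seq_unique in H1. apply is_lim_seq_unique in H5.
  unfold psum in H5. rewrite H5 in H1. injection H1. unfold sumZ. intros <-. ring.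
Qed.

Lemma sumZ_shift a k : summable a ->
  summable (fun n => a (n + k)%Z) /\ sumZ (fun n => a (n + k)%Z) = sumZ a.
Proof.
  intros Ha.
  assert (Hpos : forall b, summable b -> forall m, summable (fun n => b (n + Z.of_nat m)%Z) /\
    sumZ (fun n => b (n + Z.of_nat m)%Z) = sumZ b).
  { intros b Hb. induction m as [|m [IH1 IH2]].
    - split; [apply summable_ext with (a := b)|apply sumZ_ext]; trivial;
      intros; f_equal; lia.
    - split.
      + apply summable_ext with (a := fun n => b (n + 1 + Z.of_nat m)%Z).
        { intros; f_equal; lia. }
        apply (summable_succ _ IH1).
      + rewrite <- IH2, <- (sumZ_succ _ IH1). apply sumZ_ext. intros; f_equal; lia. }
  assert (Hrev : forall b, summable b -> summable (fun n => b (- n)%Z) /\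
     sumZ (fun n => b (- n)%Z) = sumZ b).
  { intros b Hb. split; [eapply ex_series_ext; [|exact Hb]|apply Series_ext];
    intros [|n]; simpl; try reflexivity; try apply Rplus_comm. }
  destruct (Z_le_gt_dec 0 k).
  - replace k with (Z.of_nat (Z.to_nat k)) by lia. now apply Hpos.
  (* A negative shift is a positive one conjugated by reversal of the index. *)
  - destruct (Hrev a Ha) as [R1 R2].
    destruct (Hpos _ R1 (Z.to_nat (- k))) as [P1 P2].
    destruct (Hrev _ P1) as [Q1 Q2]. rewrite P2, R2 in Q2.
    split.
    + eapply summable_ext; [|exact Q1]. intros; cbv beta; f_equal; lia.
    + rewrite <- Q2. apply sumZ_ext. intros; cbv beta; f_equal; lia.
Qed.

Lemma sumZ_rev a : sumZ (fun n => a (- n)%Z) = sumZ a.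
Proof. apply Series_ext. intros [|n]; simpl; try reflexivity; try apply Rplus_comm. Qed.

Lemma summable_rev a : summable a -> summable (fun n => a (- n)%Z).
Proof.
  apply ex_series_ext. intros [|n]; simpl; try reflexivity; try apply Rplus_comm.
Qed.

Lemma sumZ_single0 a : (forall n, n <> 0%Z -> a n = 0) -> summable a /\ sumZ a = a 0%Z.
Proof.
  intros H.
  assert (Hf : forall b : Z -> R, (forall n, n <> 0%Z -> b n = 0) ->
    is_series (fold b) (b 0%Z)).
  { intros b Hb. apply is_series_Reals. intros e He. exists 0%nat. intros n _.
    replace (sum_f_R0 (fold b) n) with (b 0%Z).
    { unfold Rdist. replace (b 0%Z - b 0%Z) with 0 by ring. now rewrite Rabs_R0. }
    induction n; [reflexivity|]. rewrite tech5, <- IHn. simpl.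
    rewrite (Hb (Z.pos _)), (Hb (Z.neg _)) by lia. ring. }
  split.
  - exists (Rabs (a 0%Z)). apply (Hf (fun n => Rabs (a n))). intros n Hn. rewrite H by auto. apply Rabs_R0.
  - apply is_series_unique. now apply Hf.
Qed.

Lemma sumZ_single m a : (forall n, n <> m -> a n = 0) -> summable a /\ sumZ a = a m.
Proof.
  intros H. destruct (sumZ_single0 (fun n => a (n + m)%Z)) as [S1 S2].
  { intros n Hn. apply H. lia. }
  destruct (sumZ_shift _ (- m) S1) as [T1 T2]. split.
  - eapply summable_ext; [|exact T1]. intros; cbv beta; f_equal; lia.
  - rewrite S2 in T2. simpl in T2. rewrite <- T2. apply sumZ_ext.
    intros; cbv beta; f_equal; lia.
Qed.

Lemma psum_sumZ (a : Z -> Z -> R) N : (forall n, summable (a n)) ->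
  summable (fun k => psum (fun n => a n k) N) /\
  psum (fun n => sumZ (a n)) N = sumZ (fun k => psum (fun n => a n k) N).
Proof.
  intros H. induction N as [|N [IH1 IH2]].
  - split.
    + eapply summable_ext; [|apply (H 0%Z)]. intros; now rewrite psum_0.
    + rewrite psum_0. apply sumZ_ext. intros; now rewrite psum_0.
  - assert (Hs := summable_plus _ _ (H (Z.of_nat (S N))) (H (- Z.of_nat (S N))%Z)).
    split.
    + eapply summable_ext; [|exact (summable_plus _ _ IH1 Hs)].
      intros k. cbv beta. now rewrite psum_S.
    + rewrite psum_S, IH2, <- sumZ_plus, <- sumZ_plus; trivial.
      apply sumZ_ext. intros. now rewrite psum_S.
Qed.

Lemma psum_le a b N : (forall n, a n <= b n) -> psum a N <= psum b N.
Proof.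
  intros H. induction N.
  - rewrite !psum_0. apply H.
  - rewrite !psum_S. generalize (H (Z.of_nat (S N))) (H (- Z.of_nat (S N))%Z). lra.
Qed.

(** Partial sums in one index commute with the sum in the other, and each is dominated by the
    iterated sum. An inequality is enough: a second application with the indices exchanged yields
    the reverse one. *)
Lemma tonelli (a : Z -> Z -> R) : (forall n k, 0 <= a n k) ->
  (forall n, summable (a n)) -> summable (fun n => sumZ (a n)) ->
  (forall k, summable (fun n => a n k)) /\
  summable (fun k => sumZ (fun n => a n k)) /\
  sumZ (fun k => sumZ (fun n => a n k)) <= sumZ (fun n => sumZ (a n)).
Proof.
  intros H H1 H2.
  assert (Hp : forall n, 0 <= sumZ (a n)) by (intros; apply sumZ_pos; auto).
  assert (H3 : forall k, summable (fun n => a n k)).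
  { intros k. refine (proj1 (summable_bounded _ (sumZ (fun n => sumZ (a n))) _ _)); auto.
    intros N. eapply Rle_trans; [|apply (psum_le_sumZ _ N Hp H2)].
    apply psum_le. intros n.
    eapply Rle_trans; [apply Rle_abs|]. eapply Rle_trans; [apply summable_term; auto|].
    right. apply sumZ_ext. intros j. apply Rabs_right, Rle_ge, H. }
  split; [exact H3|].
  apply summable_bounded.
  - intros k. apply sumZ_pos; auto.
  - intros N. destruct (psum_sumZ (fun k n => a n k) N H3) as [S1 ->].
    apply sumZ_le; auto. intros n.
    apply (psum_le_sumZ (a n)); auto.
Qed.

(** For nonnegative families two applications of [tonelli] give equality. The general case follows
    by subtraction, from a = |a| - (|a| - a) with both terms nonnegative. *)
Lemma fubini (a : Z -> Z -> R) :
  (forall n, summable (a n)) -> summable (fun n => sumZ (fun k => Rabs (a n k))) ->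
  (forall k, summable (fun n => a n k)) /\
  summable (fun k => sumZ (fun n => Rabs (a n k))) /\
  sumZ (fun k => sumZ (fun n => a n k)) = sumZ (fun n => sumZ (a n)).
Proof.
  intros H1 H2.
  assert (Heq : forall b : Z -> Z -> R, (forall n k, 0 <= b n k) ->
    (forall n, summable (b n)) -> summable (fun n => sumZ (b n)) ->
    sumZ (fun k => sumZ (fun n => b n k)) = sumZ (fun n => sumZ (b n))).
  { intros b Hb Hb1 Hb2. destruct (tonelli b Hb Hb1 Hb2) as (T1 & T2 & T3).
    destruct (tonelli (fun k n => b n k) (fun k n => Hb n k) T1 T2) as (_ & _ & T4).
    apply Rle_antisym; assumption. }
  assert (A1 : forall n, summable (fun k => Rabs (a n k))).
  { intros; now apply summable_abs. }
  destruct (tonelli (fun n k => Rabs (a n k)) (fun _ _ => Rabs_pos _) A1 H2) as (T1 & T2 & _).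
  assert (S1 : forall k, summable (fun n => a n k)).
  { intros k. apply (summable_le _ _ (fun n => Rle_refl _) (T1 k)). }
  split; [exact S1|]. split; [exact T2|].
  set (b := fun n k => Rabs (a n k) - a n k).
  assert (Hb : forall n k, 0 <= b n k).
  { intros. unfold b. generalize (Rle_abs (a n k)). lra. }
  assert (Hb1 : forall n, summable (b n)).
  { intros. apply summable_plus; auto using summable_opp. }
  assert (Hb2e : forall n, sumZ (b n) = sumZ (fun k => Rabs (a n k)) + - sumZ (a n)).
  { intros. rewrite <- sumZ_opp, <- sumZ_plus; auto using summable_opp. }
  assert (H2' : summable (fun n => sumZ (a n))).
  { apply (summable_le _ _ (fun n => sumZ_abs _ (H1 n)) H2). }
  assert (Hb2 : summable (fun n => sumZ (b n))).
  { apply summable_ext with (1 := fun n => eq_sym (Hb2e n)).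
    apply summable_plus; auto using summable_opp. }
  pose proof (Heq b Hb Hb1 Hb2) as E1.
  pose proof (Heq _ (fun n k => Rabs_pos (a n k)) A1 H2) as E2. cbv beta in E2.
  rewrite (sumZ_ext _ _ Hb2e), sumZ_plus, sumZ_opp in E1; auto using summable_opp.
  rewrite (sumZ_ext (fun k => sumZ (fun n => b n k))
    (fun k => sumZ (fun n => Rabs (a n k)) + - sumZ (fun n => a n k))) in E1.
  2:{ intros. rewrite <- sumZ_opp, <- sumZ_plus; auto using summable_opp. }
  rewrite sumZ_plus, sumZ_opp in E1; auto using summable_opp.
  2:{ apply summable_opp. apply (summable_le _ _ (fun n => sumZ_abs _ (S1 n)) T2). }
  lra.
Qed.

(** * The weighted Wiener algebra of real Laurent series *)

(** The growth rate 1/4 makes the series converge up to Im w = 1/4, hence beyond the surface, where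
    ordinary complex derivatives then exist. As e^{1/4} is at most 1.32, geometric series of ratio
    1/2 remain summable, so the Crapper waves with |A| <= 1/2 belong to the algebra. *)
Definition wt (n : Z) : R := exp (IZR (Z.abs n) / 4).

Lemma wt_pos n : 0 < wt n.
Proof. apply exp_pos. Qed.

Lemma wt_ge1 n : 1 <= wt n.
Proof.
  unfold wt. generalize (exp_ineq1_le (IZR (Z.abs n) / 4)).
  assert (0 <= IZR (Z.abs n)) by (apply IZR_le; lia). lra.
Qed.

Lemma wt_0 : wt 0 = 1.
Proof. unfold wt. simpl. replace (0 / 4) with 0 by lra. apply exp_0. Qed.

Lemma wt_opp n : wt (- n) = wt n.
Proof. unfold wt. now rewrite Z.abs_opp. Qed.

Lemma wt_sub n k : wt n <= wt k * wt (n - k).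
Proof.
  unfold wt. rewrite <- exp_plus.
  assert (H : IZR (Z.abs n) <= IZR (Z.abs k) + IZR (Z.abs (n - k))).
  { rewrite <- plus_IZR. apply IZR_le. lia. }
  destruct (Rle_lt_or_eq_dec (IZR (Z.abs n) / 4) (IZR (Z.abs k) / 4 + IZR (Z.abs (n - k)) / 4)).
  - lra.
  - left. now apply exp_increasing.
  - right. now f_equal.
Qed.

(** The coefficients are real, which builds in the symmetry of the wave under x -> -x. By proof
    irrelevance, elements with equal coefficients are equal. *)
Record W := mkW { cf :> Z -> R; cf_summable : summable (fun n => cf n * wt n) }.

Lemma W_ext (a b : W) : (forall n, a n = b n) -> a = b.
Proof.
  destruct a as [a Ha], b as [b Hb]; simpl. intros H.
  apply functional_extensionality in H. subst b. f_equal. apply proof_irrelevance.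
Qed.

Definition nrm (a : W) : R := sumZ (fun n => Rabs (a n) * wt n).

Lemma abs_wt (a : W) n : Rabs (a n * wt n) = Rabs (a n) * wt n.
Proof. rewrite Rabs_mult, (Rabs_right (wt n)); [reflexivity|]. left. apply wt_pos. Qed.

Lemma W_summable_abs (a : W) : summable (fun n => Rabs (a n) * wt n).
Proof.
  eapply summable_ext; [apply abs_wt|]. apply summable_abs, cf_summable.
Qed.

Lemma W_summable (a : W) : summable (fun n => a n).
Proof.
  apply summable_le with (2 := W_summable_abs a). intros n.
  rewrite <- (Rmult_1_r (Rabs (a n))) at 1.
  apply Rmult_le_compat_l; [apply Rabs_pos|apply wt_ge1].
Qed.

Lemma nrm_pos a : 0 <= nrm a.
Proof.
  apply sumZ_pos; [|apply W_summable_abs]. intros n.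
  apply Rmult_le_pos; [apply Rabs_pos|left; apply wt_pos].
Qed.

Lemma coef_le_nrm (a : W) n : Rabs (a n) * wt n <= nrm a.
Proof.
  generalize (summable_term _ (W_summable_abs a) n).
  rewrite Rabs_right.
  2:{ apply Rle_ge, Rmult_le_pos; [apply Rabs_pos|left; apply wt_pos]. }
  intros H. eapply Rle_trans; [exact H|]. right. apply sumZ_ext. intros k.
  apply Rabs_right, Rle_ge, Rmult_le_pos; [apply Rabs_pos|left; apply wt_pos].
Qed.

Lemma coef_le (a : W) n : Rabs (a n) <= nrm a.
Proof.
  eapply Rle_trans; [|apply coef_le_nrm with (n := n)].
  rewrite <- (Rmult_1_r (Rabs (a n))) at 1.
  apply Rmult_le_compat_l; [apply Rabs_pos|apply wt_ge1].
Qed.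

Lemma sum_abs_le (a : W) : sumZ (fun n => Rabs (a n)) <= nrm a.
Proof.
  apply sumZ_le; [apply summable_abs, W_summable|apply W_summable_abs|]. intros n.
  rewrite <- (Rmult_1_r (Rabs (a n))) at 1.
  apply Rmult_le_compat_l; [apply Rabs_pos|apply wt_ge1].
Qed.

Lemma nrm_eq0 a : nrm a <= 0 -> forall n, a n = 0.
Proof.
  intros H n. generalize (coef_le a n), (Rabs_pos (a n)). intros H1 H2.
  destruct (Req_dec (a n) 0) as [E|E]; [exact E|].
  generalize (Rabs_pos_lt _ E). lra.
Qed.

(* Multipliers are clipped to [-1, 1] so that every sequence defines one. *)
Definition clip (x : R) : R := Rmax (-1) (Rmin 1 x).

Lemma clip_bound x : Rabs (clip x) <= 1.
Proof.
  unfold clip. apply Rabs_le. split; [apply Rmax_l|].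
  apply Rmax_lub; [lra|apply Rmin_l].
Qed.

Lemma clip_id x : Rabs x <= 1 -> clip x = x.
Proof.
  intros H. apply Rabs_le_between in H. unfold clip.
  rewrite Rmin_right, Rmax_right; lra.
Qed.

Lemma clip_0 : clip 0 = 0.
Proof. apply clip_id. rewrite Rabs_R0. lra. Qed.

Lemma clip_1 : clip 1 = 1.
Proof. apply clip_id. rewrite Rabs_R1. lra. Qed.

Lemma summ_mulop (m : Z -> R) (a : W) : summable (fun n => clip (m n) * a n * wt n).
Proof.
  apply summable_le with (2 := W_summable_abs a). intros n.
  rewrite Rmult_assoc, Rabs_mult, abs_wt.
  rewrite <- (Rmult_1_l (_ * wt n)) at 2.
  apply Rmult_le_compat_r; [|apply clip_bound].
  apply Rmult_le_pos; [apply Rabs_pos|left; apply wt_pos].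
Qed.

Definition mulop (m : Z -> R) (a : W) : W := mkW _ (summ_mulop m a).

Lemma summ_plus (a b : W) : summable (fun n => (a n + b n) * wt n).
Proof.
  eapply summable_ext; [|apply (summable_plus _ _ (cf_summable a) (cf_summable b))].
  intros; simpl; ring.
Qed.
Definition Wplus (a b : W) : W := mkW _ (summ_plus a b).

Lemma summ_opp (a : W) : summable (fun n => (- a n) * wt n).
Proof.
  eapply summable_ext; [|apply (summable_opp _ (cf_summable a))].
  intros; simpl; ring.
Qed.
Definition Wopp (a : W) : W := mkW _ (summ_opp a).
Definition Wminus (a b : W) : W := Wplus a (Wopp b).

Lemma summ_star (a : W) : summable (fun n => a (- n)%Z * wt n).
Proof.
  eapply summable_ext; [|apply (summable_rev _ (cf_summable a))].
  intros; simpl. now rewrite wt_opp.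
Qed.
(** On the circle |X| = 1 this is complex conjugation, because the coefficients are real. *)
Definition star (a : W) : W := mkW _ (summ_star a).

Lemma summ_delta (m : Z) (c : R) :
  summable (fun n => (if Z.eq_dec n m then c else 0) * wt n).
Proof.
  refine (proj1 (sumZ_single m _ _)). intros n Hn.
  destruct (Z.eq_dec n m); [contradiction|ring].
Qed.
Definition delta (m : Z) (c : R) : W := mkW _ (summ_delta m c).
Definition cst (c : R) : W := delta 0 c.
Definition X : W := delta 1 1.

Definition conv (a b : Z -> R) (n : Z) : R := sumZ (fun k => a k * b (n - k)%Z).

Lemma shifted (b : Z -> R) k : summable b ->
  summable (fun n => b (n - k)%Z) /\ sumZ (fun n => b (n - k)%Z) = sumZ b.
Proof. apply (sumZ_shift b (- k)). Qed.

(** One exchange of summations in the family of products of weighted absolute values, whose sum over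
    n is a translate of the norm of b, yields both the convergence of the convolution and the
    submultiplicativity of the norm. *)
Lemma summ_mult_aux (a b : W) :
  (forall n, summable (fun k => a k * b (n - k)%Z)) /\
  summable (fun n => sumZ (fun k => (Rabs (a k) * wt k) * (Rabs (b (n - k)%Z) * wt (n - k)))) /\
  (forall n, summable (fun k => (Rabs (a k) * wt k) * (Rabs (b (n - k)%Z) * wt (n - k)))) /\
  sumZ (fun n => sumZ (fun k => (Rabs (a k) * wt k) * (Rabs (b (n - k)%Z) * wt (n - k))))
   = nrm a * nrm b.
Proof.
  set (A := fun k n => (Rabs (a k) * wt k) * (Rabs (b (n - k)%Z) * wt (n - k))).
  pose proof (fun k => shifted _ k (W_summable_abs b)) as Hs. simpl in Hs.
  assert (E : forall k, sumZ (A k) = nrm b * (Rabs (a k) * wt k)).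
  { intros k. unfold A. rewrite sumZ_scal, (proj2 (Hs k)). unfold nrm. ring. }
  assert (Hp : forall k n, 0 <= A k n).
  { intros. unfold A. repeat apply Rmult_le_pos; try apply Rabs_pos; left; apply wt_pos. }
  destruct (fubini A) as (F1 & F2 & F3).
  - intros k. apply summable_scal, Hs.
  - eapply summable_ext; [|apply (summable_scal (nrm b) _ (W_summable_abs a))].
    intros k. cbv beta. rewrite <- E. apply sumZ_ext. intros n.
    symmetry. apply Rabs_right, Rle_ge, Hp.
  - assert (G : forall n, summable (fun k => a k * b (n - k)%Z)).
    { intros n. apply summable_le with (2 := F1 n). intros k.
      rewrite Rabs_mult. apply Rmult_le_compat; try apply Rabs_pos.
      - rewrite <- (Rmult_1_r (Rabs (a k))) at 1.
        apply Rmult_le_compat_l; [apply Rabs_pos|apply wt_ge1].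
      - rewrite <- (Rmult_1_r (Rabs (b _))) at 1.
        apply Rmult_le_compat_l; [apply Rabs_pos|apply wt_ge1]. }
    split; [exact G|]. split.
    { eapply summable_ext; [|exact F2]. intros n. cbv beta. apply sumZ_ext. intros k.
      apply Rabs_right, Rle_ge, Hp. }
    split; [exact F1|].
    unfold A in F3 at 1. rewrite F3.
    rewrite (sumZ_ext _ (fun k => nrm b * (Rabs (a k) * wt k))) by apply E.
    rewrite sumZ_scal. unfold nrm. ring.
Qed.

Lemma conv_bound (a b : W) n : Rabs (conv a b n * wt n) <=
  sumZ (fun k => (Rabs (a k) * wt k) * (Rabs (b (n - k)%Z) * wt (n - k))).
Proof.
  destruct (summ_mult_aux a b) as (G1 & _ & G2 & _).
  rewrite Rabs_mult, (Rabs_right (wt n)) by (left; apply wt_pos).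
  rewrite Rmult_comm.
  eapply Rle_trans.
  { apply Rmult_le_compat_l; [left; apply wt_pos|]. apply sumZ_abs, G1. }
  rewrite <- sumZ_scal. apply sumZ_le; auto.
  - apply summable_scal, summable_abs, G1.
  - intros k. rewrite Rabs_mult.
    replace (Rabs (a k) * wt k * (Rabs (b (n - k)%Z) * wt (n - k)))
      with ((wt k * wt (n - k)) * (Rabs (a k) * Rabs (b (n - k)%Z))) by ring.
    apply Rmult_le_compat_r; [|apply wt_sub].
    apply Rmult_le_pos; apply Rabs_pos.
Qed.

Lemma summ_mult (a b : W) : summable (fun n => conv a b n * wt n).
Proof. apply summable_le with (1 := conv_bound a b). apply summ_mult_aux. Qed.

Definition Wmult (a b : W) : W := mkW _ (summ_mult a b).

Lemma conv_summable (a b : W) n : summable (fun k => a k * b (n - k)%Z).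
Proof. apply summ_mult_aux. Qed.

Lemma conv_comm (a b : W) n : conv a b n = conv b a n.
Proof.
  unfold conv.
  rewrite <- (sumZ_rev (fun k => b k * a (n - k)%Z)).
  destruct (sumZ_shift _ (- n) (summable_rev _ (conv_summable b a n))) as [_ <-].
  apply sumZ_ext. intros k.
  replace (n - - (k + - n))%Z with k by lia. replace (- (k + - n))%Z with (n - k)%Z by lia. ring.
Qed.

Lemma conv_assoc (a b c : W) n :
  sumZ (fun k => conv a b k * c (n - k)%Z) = sumZ (fun j => a j * conv b c (n - j)%Z).
Proof.
  assert (Hb : forall j, summable (fun k => Rabs (b (k - j)%Z)) /\
     sumZ (fun k => Rabs (b (k - j)%Z)) = sumZ (fun k => Rabs (b k))).
  { intros j. apply (shifted (fun k => Rabs (b k))), summable_abs, W_summable. }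
  set (A := fun j k => a j * (b (k - j)%Z * c (n - k)%Z)).
  assert (HA : forall j k, Rabs (A j k) <= nrm c * Rabs (a j) * Rabs (b (k - j)%Z)).
  { intros. unfold A. rewrite !Rabs_mult.
    generalize (coef_le c (n - k)), (Rabs_pos (c (n - k)%Z)), (Rabs_pos (a j)),
      (Rabs_pos (b (k - j)%Z)). intros.
    replace (nrm c * Rabs (a j) * Rabs (b (k - j)%Z))
     with (Rabs (a j) * (Rabs (b (k - j)%Z) * nrm c)) by ring.
    apply Rmult_le_compat_l; auto. apply Rmult_le_compat_l; auto. }
  assert (S1 : forall j, summable (A j)).
  { intros j. apply summable_le with (1 := HA j). apply summable_scal, Hb. }
  destruct (fubini A S1) as (F1 & F2 & F3).
  { apply summable_le with (b := fun j => (nrm c * sumZ (fun k => Rabs (b k))) * Rabs (a j)).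
    - intros j. rewrite Rabs_right.
      2:{ apply Rle_ge, sumZ_pos; [intros; apply Rabs_pos|now apply summable_abs]. }
      replace (nrm c * sumZ (fun k => Rabs (b k)) * Rabs (a j))
        with (sumZ (fun k => nrm c * Rabs (a j) * Rabs (b (k - j)%Z))).
      { apply sumZ_le; [now apply summable_abs| |intros; apply HA].
        apply summable_scal, Hb. }
      rewrite sumZ_scal, (proj2 (Hb j)). ring.
    - apply summable_scal, summable_abs, W_summable. }
  rewrite (sumZ_ext _ (fun k => sumZ (fun j => A j k))).
  - rewrite F3. apply sumZ_ext. intros j. unfold A. rewrite sumZ_scal. f_equal.
    unfold conv.
    destruct (shifted (fun k => b k * c (n - j - k)%Z) j) as [_ <-]; [apply conv_summable|].
    apply sumZ_ext. intros k. do 2 f_equal. lia.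
  - intros k. unfold conv. rewrite Rmult_comm, <- sumZ_scal. apply sumZ_ext.
    intros j. unfold A. ring.
Qed.

Lemma Wring_theory : ring_theory (cst 0) (cst 1) Wplus Wmult Wminus Wopp (@eq W).
Proof.
  constructor; intros; apply W_ext; intros n; simpl; try ring.
  - destruct (Z.eq_dec n 0); ring.
  - unfold conv. destruct (sumZ_single 0 (fun k => (if Z.eq_dec k 0 then 1 else 0) * x (n - k)%Z)) as [_ E].
    { intros k Hk. destruct (Z.eq_dec k 0); [contradiction|ring]. }
    transitivity ((if Z.eq_dec 0 0 then 1 else 0) * x (n - 0)%Z); [exact E|].
    destruct (Z.eq_dec 0 0) as [_|[]]; [|reflexivity]. rewrite Z.sub_0_r. ring.
  - apply conv_comm.
  - symmetry. apply (conv_assoc x y z n).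
  - unfold conv. simpl. rewrite <- sumZ_plus by apply conv_summable.
    apply sumZ_ext. intros; ring.
  - destruct (Z.eq_dec n 0); ring.
Qed.

Declare Scope W_scope.
Delimit Scope W_scope with W.
Bind Scope W_scope with W.
Infix "+" := Wplus : W_scope.
Infix "-" := Wminus : W_scope.
Infix "*" := Wmult : W_scope.
Notation "- x" := (Wopp x) : W_scope.
Add Ring Wring : Wring_theory.

Lemma nrm_plus a b : nrm (a + b)%W <= nrm a + nrm b.
Proof.
  unfold nrm. rewrite <- sumZ_plus by apply W_summable_abs.
  apply sumZ_le; [apply W_summable_abs|apply summable_plus; apply W_summable_abs|].
  intros n. simpl. rewrite <- Rmult_plus_distr_r.
  apply Rmult_le_compat_r; [left; apply wt_pos|apply Rabs_triang].
Qed.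

Lemma nrm_opp a : nrm (- a)%W = nrm a.
Proof. apply sumZ_ext. intros n; simpl. now rewrite Rabs_Ropp. Qed.

Lemma nrm_minus a b : nrm (a - b)%W <= nrm a + nrm b.
Proof. unfold Wminus. rewrite <- (nrm_opp b). apply nrm_plus. Qed.

Lemma nrm_minus_sym a b : nrm (a - b)%W = nrm (b - a)%W.
Proof. rewrite <- nrm_opp. f_equal. ring. Qed.

Lemma nrm_star a : nrm (star a) = nrm a.
Proof.
  unfold nrm. rewrite <- sumZ_rev. apply sumZ_ext. intros n. simpl.
  now rewrite wt_opp, Z.opp_involutive.
Qed.

Lemma nrm_delta m c : nrm (delta m c) = Rabs c * wt m.
Proof.
  unfold nrm.
  destruct (sumZ_single m (fun n => Rabs (delta m c n) * wt n)) as [_ ->].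
  - intros n Hn. simpl. destruct (Z.eq_dec n m); [contradiction|]. rewrite Rabs_R0; ring.
  - simpl. destruct (Z.eq_dec m m) as [_|[]]; reflexivity.
Qed.

Lemma nrm_cst c : nrm (cst c) = Rabs c.
Proof. unfold cst. rewrite nrm_delta, wt_0. ring. Qed.

Lemma nrm_mult a b : nrm (a * b)%W <= nrm a * nrm b.
Proof.
  destruct (summ_mult_aux a b) as (_ & G2 & _ & <-).
  unfold nrm at 1. apply sumZ_le; [apply W_summable_abs|exact G2|].
  intros n. rewrite <- abs_wt. apply conv_bound.
Qed.

Lemma nrm_mulop_scal e m a : 0 <= e -> (forall n, Rabs (m n) <= e) ->
  nrm (mulop m a) <= e * nrm a.
Proof.
  intros He Hm. unfold nrm. rewrite <- sumZ_scal.
  apply sumZ_le; [apply W_summable_abs|apply summable_scal, W_summable_abs|].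
  intros n. simpl. rewrite Rabs_mult, Rmult_assoc.
  apply Rmult_le_compat_r.
  { apply Rmult_le_pos; [apply Rabs_pos|left; apply wt_pos]. }
  eapply Rle_trans; [|apply (Hm n)].
  unfold clip. generalize (Rle_abs (m n)), (Rle_abs (- m n)). rewrite Rabs_Ropp.
  intros. apply Rabs_le. unfold Rmax, Rmin.
  generalize (Rabs_pos (m n)). intros.
  destruct (Rle_dec 1 (m n)); destruct (Rle_dec (-1) _); lra.
Qed.

Lemma nrm_mulop m a : nrm (mulop m a) <= nrm a.
Proof.
  unfold nrm.
  apply sumZ_le; [apply W_summable_abs|apply W_summable_abs|].
  intros n. simpl. rewrite Rabs_mult.
  apply Rmult_le_compat_r; [left; apply wt_pos|].
  rewrite <- (Rmult_1_l (Rabs (a n))) at 2.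
  apply Rmult_le_compat_r; [apply Rabs_pos|apply clip_bound].
Qed.

Lemma mulop_plus m a b : mulop m (a + b)%W = (mulop m a + mulop m b)%W.
Proof. apply W_ext; intros; simpl; ring. Qed.
Lemma mulop_minus m a b : mulop m (a - b)%W = (mulop m a - mulop m b)%W.
Proof. apply W_ext; intros; simpl; ring. Qed.
Lemma star_plus a b : star (a + b)%W = (star a + star b)%W.
Proof. apply W_ext; intros; simpl; ring. Qed.
Lemma star_minus a b : star (a - b)%W = (star a - star b)%W.
Proof. apply W_ext; intros; simpl; ring. Qed.
Lemma star_star a : star (star a) = a.
Proof. apply W_ext; intros; simpl. now rewrite Z.opp_involutive. Qed.
Lemma star_mult a b : star (a * b)%W = (star a * star b)%W.
Proof.
  apply W_ext; intros; simpl. unfold conv.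
  rewrite <- sumZ_rev. apply sumZ_ext. intros k. simpl. f_equal. f_equal. lia.
Qed.
Lemma star_cst c : star (cst c) = cst c.
Proof. apply W_ext; intros; simpl. destruct (Z.eq_dec n 0), (Z.eq_dec (-n) 0); auto; lia. Qed.
Lemma cst_plus c d : cst (c + d) = (cst c + cst d)%W.
Proof. apply W_ext; intros; simpl. destruct (Z.eq_dec n 0); ring. Qed.
Lemma cst_opp c : cst (- c) = (- cst c)%W.
Proof. apply W_ext; intros; simpl. destruct (Z.eq_dec n 0); ring. Qed.
Lemma cst_minus c d : cst (c - d) = (cst c - cst d)%W.
Proof. apply W_ext; intros; simpl. destruct (Z.eq_dec n 0); ring. Qed.
Lemma delta_mult_coef m c a n : (delta m c * a)%W n = c * a (n - m)%Z.
Proof.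
  simpl. unfold conv.
  destruct (sumZ_single m (fun k => delta m c k * a (n - k)%Z)) as [_ E].
  - intros k Hk. simpl. destruct (Z.eq_dec k m); [contradiction|ring].
  - etransitivity; [exact E|]. simpl. destruct (Z.eq_dec m m) as [_|[]]; reflexivity.
Qed.
Lemma cst_mult_coef c a n : (cst c * a)%W n = c * a n.
Proof. unfold cst. rewrite delta_mult_coef. now rewrite Z.sub_0_r. Qed.
Lemma X_mult_coef a n : (X * a)%W n = a (n - 1)%Z.
Proof. unfold X. rewrite delta_mult_coef. ring. Qed.
Lemma cst_mult c d : cst (c * d) = (cst c * cst d)%W.
Proof.
  apply W_ext; intros. rewrite cst_mult_coef. simpl. destruct (Z.eq_dec n 0); ring.
Qed.

Lemma psum_lim (a : nat -> Z -> R) (l : Z -> R) N :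
  (forall n, is_lim_seq (fun m => a m n) (l n)) ->
  is_lim_seq (fun m => psum (a m) N) (psum l N).
Proof.
  intros H. induction N.
  - apply is_lim_seq_ext with (fun m => a m 0%Z); [intros; now rewrite psum_0|].
    rewrite psum_0. apply H.
  - apply is_lim_seq_ext with (fun m => psum (a m) N
       + (a m (Z.of_nat (S N)) + a m (- Z.of_nat (S N))%Z)); [intros; now rewrite psum_S|].
    rewrite psum_S. apply is_lim_seq_plus'; [exact IHN|]. apply is_lim_seq_plus'; apply H.
Qed.

(** Completeness in the form that suits a contraction of ratio 1/2. The coefficients converge
    separately; the norm bound passes to the limit on partial sums, and from there to the whole
    series. *)
Lemma W_complete (u : nat -> W) (K : R) : 0 <= K ->
  (forall k, nrm (u (S k) - u k)%W <= K * (1/2) ^ k) ->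
  exists l, forall k, nrm (l - u k)%W <= 2 * K * (1/2) ^ k.
Proof.
  intros HK H.
  assert (Hm : forall k m, nrm (u (k + m)%nat - u k)%W <= 2 * K * ((1/2)^k - (1/2)^(k + m))).
  { intros k. induction m.
    - rewrite Nat.add_0_r. replace (u k - u k)%W with (cst 0) by ring.
      rewrite nrm_cst, Rabs_R0. lra.
    - replace (u (k + S m)%nat - u k)%W
        with ((u (S (k + m)) - u (k + m)%nat) + (u (k + m)%nat - u k))%W.
      2:{ replace (k + S m)%nat with (S (k + m)) by lia. ring. }
      eapply Rle_trans; [apply nrm_plus|].
      replace (k + S m)%nat with (S (k + m)) by lia.
      specialize (H (k + m)%nat). simpl pow at 2. lra. }
  assert (Hp : forall k, 0 < (1/2)^k) by (intros; apply pow_lt; lra).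
  assert (Hl : forall n, { l : R | is_lim_seq (fun k => u k n) l }).
  { intros n. apply constructive_indefinite_description.
    apply ex_lim_seq_cauchy_corr. intros e.
    assert (exists N, 2 * K * (1/2)^N < e / 2) as [N HN].
    { destruct (pow_lt_1_zero (1/2) ltac:(rewrite Rabs_right; lra) (e / 2 / (2 * K + 1))) as [N HN].
      { apply Rdiv_lt_0_compat; [destruct e; simpl; lra|lra]. }
      exists N. specialize (HN N (le_n _)). rewrite Rabs_right in HN by (apply Rle_ge; left; auto).
      apply Rlt_div_r in HN; [|lra]. specialize (Hp N). nra. }
    assert (B : forall p, (N <= p)%nat -> Rabs (u p n - u N n) < e / 2).
    { intros p Hp'. generalize (coef_le (u p - u N)%W n). simpl.
      specialize (Hm N (p - N)%nat). replace (N + (p - N))%nat with p in Hm by lia.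
      generalize (Hp p) (Hp N). unfold Rminus in *. intros. nra. }
    exists N. intros p q Hp1 Hq1.
    replace (u p n - u q n) with ((u p n - u N n) - (u q n - u N n)) by ring.
    generalize (B p Hp1) (B q Hq1). intros B1 B2.
    apply Rabs_def2 in B1. apply Rabs_def2 in B2. apply Rabs_def1; lra. }
  set (l := fun n => proj1_sig (Hl n)).
  assert (Hlim : forall n, is_lim_seq (fun k => u k n) (l n)).
  { intros n. unfold l. destruct (Hl n) as [x Hx]. exact Hx. }
  assert (Hps : forall k N, psum (fun n => Rabs (l n - u k n) * wt n) N <= 2 * K * (1/2)^k).
  { intros k N.
    assert (is_lim_seq (fun m => psum (fun n => Rabs (u (k + m)%nat n - u k n) * wt n) N)
       (psum (fun n => Rabs (l n - u k n) * wt n) N)).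
    { assert (T : forall n, is_lim_seq (fun m => Rabs (u (k + m)%nat n - u k n) * wt n)
         (Rabs (l n - u k n) * wt n)).
      { intros n. apply (is_lim_seq_scal_r _ (wt n) (Finite _)).
        apply (is_lim_seq_abs _ (Finite _)). apply is_lim_seq_minus'.
        - apply is_lim_seq_ext with (fun m => u (m + k)%nat n).
          + intros; do 2 f_equal; lia.
          + apply (is_lim_seq_incr_n (fun k => u k n) k (Finite _)), Hlim.
        - apply is_lim_seq_const. }
      apply (psum_lim (fun m n => Rabs (u (k + m)%nat n - u k n) * wt n)), T. }
    refine (is_lim_seq_le _ (fun _ => 2 * K * (1/2)^k) _ (Finite _) _ H0 (is_lim_seq_const _)).
    intros m. eapply Rle_trans; [apply (psum_le_sumZ (fun n => Rabs ((u (k + m)%nat - u k)%W n) * wt n))|].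
    - intros n. apply Rmult_le_pos; [apply Rabs_pos|left; apply wt_pos].
    - apply W_summable_abs.
    - eapply Rle_trans; [apply (Hm k m)|]. generalize (Hp (k + m)%nat). intros. nra. }
  assert (Hpos : forall k n, 0 <= Rabs (l n - u k n) * wt n).
  { intros. apply Rmult_le_pos; [apply Rabs_pos|left; apply wt_pos]. }
  assert (Hsum : summable (fun n => l n * wt n)).
  { destruct (summable_bounded _ _ (Hpos 0%nat) (Hps 0%nat)) as [S1 _].
    apply summable_le with (2 := summable_plus _ _ S1 (W_summable_abs (u 0%nat))).
    intros n. rewrite Rabs_mult, (Rabs_right (wt n)) by (left; apply wt_pos).
    rewrite <- Rmult_plus_distr_r. apply Rmult_le_compat_r; [left; apply wt_pos|].
    replace (l n) with ((l n - u 0%nat n) + u 0%nat n) at 1 by ring. apply Rabs_triang. }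
  exists (mkW l Hsum). intros k.
  apply (summable_bounded _ _ (Hpos k) (Hps k)).
Qed.

(** * Contractions and strict differentiability in W * W *)

Definition E := (W * W)%type.
Definition subE (u v : E) : E := ((fst u - fst v)%W, (snd u - snd v)%W).
Definition addE (u v : E) : E := ((fst u + fst v)%W, (snd u + snd v)%W).
Definition E0 : E := (cst 0, cst 0).
Definition nE (u : E) : R := nrm (fst u) + nrm (snd u).

Lemma nE_pos u : 0 <= nE u.
Proof. unfold nE. generalize (nrm_pos (fst u)), (nrm_pos (snd u)). lra. Qed.

Lemma nE_plus u v : nE (addE u v) <= nE u + nE v.
Proof.
  unfold nE; simpl. generalize (nrm_plus (fst u) (fst v)), (nrm_plus (snd u) (snd v)). lra.
Qed.

Lemma nE_minus_sym u v : nE (subE u v) = nE (subE v u).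
Proof. unfold nE; simpl. now rewrite nrm_minus_sym, (nrm_minus_sym (snd u)). Qed.

Lemma nE_triang u v w : nE (subE u w) <= nE (subE u v) + nE (subE v w).
Proof.
  eapply Rle_trans; [|apply nE_plus]. right. f_equal.
  unfold addE, subE; simpl. f_equal; ring.
Qed.

Lemma subE_0 u : subE u E0 = u.
Proof. destruct u. unfold subE, E0; simpl. f_equal; ring. Qed.

Lemma nE_self u : nE (subE u u) = 0.
Proof.
  unfold nE; simpl.
  replace (fst u - fst u)%W with (cst 0) by ring.
  replace (snd u - snd u)%W with (cst 0) by ring. rewrite nrm_cst, Rabs_R0. ring.
Qed.

Lemma nE_eq u v : nE (subE u v) <= 0 -> u = v.
Proof.
  intros H. unfold nE in H; simpl in H.
  generalize (nrm_pos (fst u - fst v)%W), (nrm_pos (snd u - snd v)%W). intros.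
  assert (H2 : forall a b : W, nrm (a - b)%W <= 0 -> a = b).
  { intros a b Hab. apply W_ext. intros n. generalize (nrm_eq0 _ Hab n). simpl. lra. }
  destruct u, v; f_equal; apply H2; simpl in *; lra.
Qed.

(** Banach's fixed point theorem on a ball. With ratio 1/2, the bound rad / 2 on the image of the
    centre makes the ball invariant. *)
Lemma contraction (T : E -> E) (rad : R) : 0 <= rad ->
  (forall u v, nE u <= rad -> nE v <= rad ->
     nE (subE (T u) (T v)) <= / 2 * nE (subE u v)) ->
  nE (T E0) <= rad / 2 ->
  exists u, nE u <= rad /\ T u = u.
Proof.
  intros Hr HT H0.
  assert (Hz : nE E0 = 0) by (rewrite <- (subE_0 E0); apply nE_self).
  assert (Hball : forall u, nE u <= rad -> nE (T u) <= rad).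
  { intros u Hu. generalize (nE_triang (T u) (T E0) E0). rewrite !subE_0.
    assert (nE (subE (T u) (T E0)) <= / 2 * nE (subE u E0)) as H1 by (apply HT; lra).
    rewrite subE_0 in H1. lra. }
  set (x := fix x k := match k with O => E0 | S k => T (x k) end).
  assert (Hx : forall k, nE (x k) <= rad).
  { induction k; simpl; [lra|auto]. }
  assert (Hd : forall k, nE (subE (x (S k)) (x k)) <= rad * (1/2)^k).
  { induction k.
    - simpl. rewrite subE_0. lra.
    - change (x (S (S k))) with (T (x (S k))). change (x (S k)) with (T (x k)) at 2.
      eapply Rle_trans; [apply HT; apply Hx|]. simpl pow. lra. }
  destruct (W_complete (fun k => fst (x k)) rad Hr) as [l1 Hl1].
  { intros k. eapply Rle_trans; [|apply Hd]. unfold nE; simpl.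
    generalize (nrm_pos (snd (T (x k)) - snd (x k))%W). lra. }
  destruct (W_complete (fun k => snd (x k)) rad Hr) as [l2 Hl2].
  { intros k. eapply Rle_trans; [|apply Hd]. unfold nE; simpl.
    generalize (nrm_pos (fst (T (x k)) - fst (x k))%W). lra. }
  set (l := (l1, l2)).
  assert (Hl : forall k, nE (subE l (x k)) <= 4 * rad * (1/2)^k).
  { intros k. unfold nE; simpl. specialize (Hl1 k). specialize (Hl2 k). lra. }
  assert (Hlim : forall y C, 0 <= C -> (forall k, y <= C * (1/2)^k) -> y <= 0).
  { intros y C HC Hy. destruct (Rle_dec y 0) as [|Hn]; [assumption|]. exfalso.
    destruct (pow_lt_1_zero (1/2) ltac:(rewrite Rabs_right; lra) (y / (C + 1))) as [N HN].
    { apply Rdiv_lt_0_compat; lra. }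
    specialize (HN N (le_n _)). rewrite Rabs_right in HN by (apply Rle_ge, pow_le; lra).
    apply Rlt_div_r in HN; [|lra]. specialize (Hy N).
    assert (0 < (1/2)^N) by (apply pow_lt; lra). nra. }
  assert (Hlr : nE l <= rad).
  { assert (nE l - rad <= 0); [|lra]. apply Hlim with (4 * rad); [lra|]. intros k.
    generalize (nE_triang l (x k) E0), (Hl k), (Hx k). rewrite !subE_0. lra. }
  exists l. split; [exact Hlr|]. apply nE_eq. apply Hlim with (8 * rad); [lra|].
  intros k. generalize (nE_triang (T l) (x (S k)) l).
  assert (nE (subE (T l) (x (S k))) <= / 2 * nE (subE l (x k))) by (apply HT; auto).
  rewrite (nE_minus_sym (x (S k))). generalize (Hl k), (Hl (S k)), (nE_pos (subE l (x k))).
  simpl pow. lra.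
Qed.

(** Strict differentiability in u at b, uniform in the parameters e and g near 0: a single operator
    [L], the derivative at e = g = 0, approximates all increments of [M e g] near b, while
    dependence on the parameters at b is merely continuous. Contraction and Lipschitz estimates
    follow without derivatives at other points. The parameter e is one-sided because it stands for
    e^{-2H}. *)
Definition sdiff (M : R -> R -> E -> W) (b : E) (L : E -> W) : Prop :=
  (exists C, 0 <= C /\ forall h, nrm (L h) <= C * nE h) /\
  forall eta, 0 < eta -> exists delta, 0 < delta /\
    forall e g, 0 <= e < delta -> Rabs g < delta ->
      nrm (M e g b - M 0 0 b)%W <= eta /\
      forall u v, nE (subE u b) < delta -> nE (subE v b) < delta ->
        nrm (M e g u - M e g v - L (subE u v))%W <= eta * nE (subE u v).

Lemma sdiff_cont M b L : sdiff M b L -> forall eta, 0 < eta -> exists delta, 0 < delta /\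
  forall e g u, 0 <= e < delta -> Rabs g < delta -> nE (subE u b) < delta ->
    nrm (M e g u - M 0 0 b)%W <= eta.
Proof.
  intros [[C [HC HL]] H] eta Heta.
  destruct (H (Rmin (eta / 4) 1)) as [d [Hd Hd']]; [apply Rmin_glb_lt; lra|].
  assert (0 < eta / (4 * (C + 1))) by (apply Rdiv_lt_0_compat; lra).
  exists (Rmin d (eta / (4 * (C + 1)))). split; [apply Rmin_glb_lt; lra|].
  intros e g u He Hg Hu.
  assert (Hm1 := Rmin_l d (eta / (4 * (C + 1)))). assert (Hm2 := Rmin_r d (eta / (4 * (C + 1)))).
  destruct (Hd' e g) as [H1 H2]; [lra|lra|].
  assert (Hb : nE (subE b b) < d) by (rewrite nE_self; lra).
  specialize (H2 u b ltac:(lra) Hb). specialize (HL (subE u b)).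
  replace (M e g u - M 0 0 b)%W with ((M e g u - M e g b - L (subE u b)) + (L (subE u b))
     + (M e g b - M 0 0 b))%W by ring.
  eapply Rle_trans; [apply nrm_plus|].
  eapply Rle_trans; [apply Rplus_le_compat_r; apply nrm_plus|].
  assert (Hm3 := Rmin_l (eta / 4) 1). assert (Hm4 := Rmin_r (eta / 4) 1).
  assert (Hn := nE_pos (subE u b)).
  assert (nE (subE u b) * (4 * (C + 1)) < eta).
  { apply Rlt_div_r; lra. }
  assert (Rmin (eta / 4) 1 * nE (subE u b) <= 1 * nE (subE u b)) by (apply Rmult_le_compat_r; lra).
  nra.
Qed.

Lemma sdiff_const (c : R -> R -> W) b :
  (forall eta, 0 < eta -> exists delta, 0 < delta /\
    forall e g, 0 <= e < delta -> Rabs g < delta -> nrm (c e g - c 0 0)%W <= eta) ->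
  sdiff (fun e g _ => c e g) b (fun _ => cst 0).
Proof.
  intros H. split.
  - exists 0. split; [lra|]. intros. rewrite nrm_cst, Rabs_R0. lra.
  - intros eta He. destruct (H eta He) as [d [Hd Hd']]. exists d. split; [exact Hd|].
    intros e g H1 H2. split; [now apply Hd'|]. intros u v _ _.
    replace (c e g - c e g - cst 0)%W with (cst 0) by ring.
    rewrite nrm_cst, Rabs_R0. apply Rmult_le_pos; [lra|apply nE_pos].
Qed.

Lemma sdiff_cst (c : W) b : sdiff (fun _ _ _ => c) b (fun _ => cst 0).
Proof.
  apply sdiff_const. intros eta He. exists 1. split; [lra|]. intros.
  replace (c - c)%W with (cst 0) by ring. rewrite nrm_cst, Rabs_R0. lra.
Qed.

Lemma sdiff_lin (p : E -> W) b :
  (forall u v, p (subE u v) = (p u - p v)%W) -> (forall h, nrm (p h) <= nE h) ->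
  sdiff (fun _ _ u => p u) b p.
Proof.
  intros H1 H2. split.
  - exists 1. split; [lra|]. intros; generalize (H2 h); lra.
  - intros eta He. exists 1. split; [lra|]. intros e g _ _. split.
    + replace (p b - p b)%W with (cst 0) by ring. rewrite nrm_cst, Rabs_R0. lra.
    + intros u v _ _. rewrite H1.
      replace (p u - p v - (p u - p v))%W with (cst 0) by ring.
      rewrite nrm_cst, Rabs_R0. apply Rmult_le_pos; [lra|apply nE_pos].
Qed.

Lemma sdiff_fst b : sdiff (fun _ _ u => fst u) b fst.
Proof.
  apply sdiff_lin; [reflexivity|]. intros h. unfold nE. generalize (nrm_pos (snd h)). lra.
Qed.

Lemma sdiff_snd b : sdiff (fun _ _ u => snd u) b snd.
Proof.
  apply sdiff_lin; [reflexivity|]. intros h. unfold nE. generalize (nrm_pos (fst h)). lra.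
Qed.

Lemma sdiff_plus M1 M2 b L1 L2 : sdiff M1 b L1 -> sdiff M2 b L2 ->
  sdiff (fun e g u => M1 e g u + M2 e g u)%W b (fun h => L1 h + L2 h)%W.
Proof.
  intros [[C1 [HC1 HL1]] H1] [[C2 [HC2 HL2]] H2]. split.
  - exists (C1 + C2). split; [lra|]. intros h.
    eapply Rle_trans; [apply nrm_plus|]. specialize (HL1 h). specialize (HL2 h). lra.
  - intros eta He.
    destruct (H1 (eta / 2)) as [d1 [Hd1 K1]]; [lra|].
    destruct (H2 (eta / 2)) as [d2 [Hd2 K2]]; [lra|].
    exists (Rmin d1 d2). split; [now apply Rmin_glb_lt|].
    assert (Hm1 := Rmin_l d1 d2). assert (Hm2 := Rmin_r d1 d2).
    intros e g He' Hg.
    destruct (K1 e g) as [P1 Q1]; [lra|lra|]. destruct (K2 e g) as [P2 Q2]; [lra|lra|].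
    split.
    + replace (M1 e g b + M2 e g b - (M1 0 0 b + M2 0 0 b))%W
        with ((M1 e g b - M1 0 0 b) + (M2 e g b - M2 0 0 b))%W by ring.
      eapply Rle_trans; [apply nrm_plus|]. lra.
    + intros u v Hu Hv. specialize (Q1 u v ltac:(lra) ltac:(lra)). specialize (Q2 u v ltac:(lra) ltac:(lra)).
      replace (M1 e g u + M2 e g u - (M1 e g v + M2 e g v) - (L1 (subE u v) + L2 (subE u v)))%W
        with ((M1 e g u - M1 e g v - L1 (subE u v)) + (M2 e g u - M2 e g v - L2 (subE u v)))%W by ring.
      eapply Rle_trans; [apply nrm_plus|]. lra.
Qed.

(** The operators may depend on e provided that they differ from [O 0] by O(e) in operator norm.
    This is how finite depth becomes a regular perturbation of infinite depth. *)
Lemma sdiff_op (O : R -> W -> W) (C : R) M b L : 0 <= C ->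
  (forall e x y, O e (x - y)%W = (O e x - O e y)%W) ->
  (forall e x, 0 <= e < 1 -> nrm (O e x) <= C * nrm x) ->
  (forall e x, 0 <= e < 1 -> nrm (O e x - O 0 x)%W <= C * e * nrm x) ->
  sdiff M b L -> sdiff (fun e g u => O e (M e g u)) b (fun h => O 0 (L h)).
Proof.
  intros HC Hlin Hb Hc [[C1 [HC1 HL1]] H1].
  split.
  - exists (C * C1). split; [now apply Rmult_le_pos|]. intros h.
    eapply Rle_trans; [apply Hb; lra|]. rewrite Rmult_assoc. apply Rmult_le_compat_l; auto.
  - intros eta Heta.
    (* Large enough for e <= eta / K to absorb the errors made by replacing [O e] with [O 0], both
       at the base value and on increments. *)
    set (K := 2 * (C + 1) * (nrm (M 0 0 b) + C1 + 1)).
    assert (Hn := nrm_pos (M 0 0 b)).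
    assert (HK : 0 < K) by (unfold K; nra).
    destruct (H1 (eta / (2 * (C + 1)))) as [d1 [Hd1 K1]]; [apply Rdiv_lt_0_compat; lra|].
    assert (HeK : 0 < eta / K) by (apply Rdiv_lt_0_compat; lra).
    exists (Rmin (Rmin d1 1) (eta / K)). split; [repeat apply Rmin_glb_lt; lra|].
    assert (Hm1 := Rmin_l (Rmin d1 1) (eta / K)). assert (Hm2 := Rmin_r (Rmin d1 1) (eta / K)).
    assert (Hm3 := Rmin_l d1 1). assert (Hm4 := Rmin_r d1 1).
    intros e g He Hg. destruct (K1 e g) as [P1 Q1]; [lra|lra|].
    assert (HeK' : e * K <= eta).
    { apply Rle_div_r; lra. }
    assert (Hee : C * (eta / (2 * (C + 1))) <= eta / 2).
    { apply Rle_trans with ((C + 1) * (eta / (2 * (C + 1)))).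
      - apply Rmult_le_compat_r; [left; apply Rdiv_lt_0_compat; lra|lra].
      - right. field. lra. }
    split.
    + replace (O e (M e g b) - O 0 (M 0 0 b))%W
        with (O e (M e g b - M 0 0 b) + (O e (M 0 0 b) - O 0 (M 0 0 b)))%W by (rewrite Hlin; ring).
      eapply Rle_trans; [apply nrm_plus|].
      generalize (Hb e (M e g b - M 0 0 b)%W ltac:(lra)), (Hc e (M 0 0 b) ltac:(lra)). intros T1 T2.
      assert (C * nrm (M e g b - M 0 0 b)%W <= C * (eta / (2 * (C + 1)))) by (apply Rmult_le_compat_l; lra).
      assert (C * e * nrm (M 0 0 b) <= e * K / 2); [|lra].
      unfold K. assert (0 <= e * nrm (M 0 0 b)) by (apply Rmult_le_pos; lra).
      assert (0 <= C * e) by (apply Rmult_le_pos; lra).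
      assert (0 <= C * e * C1) by (apply Rmult_le_pos; lra).
      assert (0 <= e * C1) by (apply Rmult_le_pos; lra). nra.
    + intros u v Hu Hv. specialize (Q1 u v ltac:(lra) ltac:(lra)).
      set (h := subE u v) in *.
      replace (O e (M e g u) - O e (M e g v) - O 0 (L h))%W
        with (O e (M e g u - M e g v - L h) + (O e (L h) - O 0 (L h)))%W by (rewrite !Hlin; ring).
      eapply Rle_trans; [apply nrm_plus|].
      generalize (Hb e (M e g u - M e g v - L h)%W ltac:(lra)), (Hc e (L h) ltac:(lra)). intros T1 T2.
      assert (Hh := nE_pos h). specialize (HL1 h).
      assert (C * nrm (M e g u - M e g v - L h)%W <= eta / 2 * nE h).
      { apply Rle_trans with (C * (eta / (2 * (C + 1)) * nE h)); [apply Rmult_le_compat_l; lra|].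
        rewrite <- Rmult_assoc. now apply Rmult_le_compat_r. }
      assert (C * e * nrm (L h) <= eta / 2 * nE h); [|lra].
      apply Rle_trans with (C * e * (C1 * nE h)).
      { apply Rmult_le_compat_l; [apply Rmult_le_pos; lra|lra]. }
      rewrite <- Rmult_assoc. apply Rmult_le_compat_r; [lra|].
      assert (C * e * C1 <= e * K / 2); [|lra].
      unfold K. assert (0 <= e * nrm (M 0 0 b)) by (apply Rmult_le_pos; lra).
      assert (0 <= C * e) by (apply Rmult_le_pos; lra).
      assert (0 <= C * e * nrm (M 0 0 b)) by (apply Rmult_le_pos; lra).
      assert (0 <= e * C1) by (apply Rmult_le_pos; lra). nra.
Qed.

Lemma sdiff_mult M1 M2 b L1 L2 : sdiff M1 b L1 -> sdiff M2 b L2 ->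
  sdiff (fun e g u => M1 e g u * M2 e g u)%W b
    (fun h => L1 h * M2 0 0 b + M1 0 0 b * L2 h)%W.
Proof.
  intros S1 S2. pose proof (sdiff_cont _ _ _ S1) as Q1. pose proof (sdiff_cont _ _ _ S2) as Q2.
  destruct S1 as [[C1 [HC1 HL1]] H1]. destruct S2 as [[C2 [HC2 HL2]] H2].
  set (m1 := M1 0 0 b) in *. set (m2 := M2 0 0 b) in *.
  assert (N1 := nrm_pos m1). assert (N2 := nrm_pos m2).
  split.
  - exists (C1 * nrm m2 + nrm m1 * C2).
    split; [apply Rplus_le_le_0_compat; apply Rmult_le_pos; lra|]. intros h.
    eapply Rle_trans; [apply nrm_plus|].
    generalize (nrm_mult (L1 h) m2) (nrm_mult m1 (L2 h)). intros T1 T2.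
    specialize (HL1 h). specialize (HL2 h).
    assert (nrm (L1 h) * nrm m2 <= C1 * nE h * nrm m2) by (apply Rmult_le_compat_r; lra).
    assert (nrm m1 * nrm (L2 h) <= nrm m1 * (C2 * nE h)) by (apply Rmult_le_compat_l; lra).
    lra.
  - intros eta Heta.
    set (K := nrm m1 + nrm m2 + C1 + C2 + 2). assert (HK : 0 < K) by (unfold K; lra).
    set (th := Rmin 1 (eta / (4 * K))).
    assert (Hth : 0 < th).
    { unfold th. apply Rmin_glb_lt; [lra|]. apply Rdiv_lt_0_compat; lra. }
    assert (Hth1 : th <= 1) by apply Rmin_l.
    assert (HthK : th * (4 * K) <= eta).
    { apply Rle_div_r; [lra|]. apply Rmin_r. }
    destruct (H1 th Hth) as [d1 [Hd1 K1]]. destruct (H2 th Hth) as [d2 [Hd2 K2]].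
    destruct (Q1 th Hth) as [d3 [Hd3 K3]]. destruct (Q2 th Hth) as [d4 [Hd4 K4]].
    set (d := Rmin (Rmin d1 d2) (Rmin d3 d4)).
    assert (Hda := Rmin_l (Rmin d1 d2) (Rmin d3 d4)). assert (Hdb := Rmin_r (Rmin d1 d2) (Rmin d3 d4)).
    assert (Hdc := Rmin_l d1 d2). assert (Hdd := Rmin_r d1 d2).
    assert (Hde := Rmin_l d3 d4). assert (Hdf := Rmin_r d3 d4). fold d in Hda, Hdb.
    exists d. split; [unfold d; repeat apply Rmin_glb_lt; lra|].
    assert (HB : forall x y : W, nrm x <= th -> nrm (x * y)%W <= th * nrm y).
    { intros x y Hx. eapply Rle_trans; [apply nrm_mult|].
      apply Rmult_le_compat_r; [apply nrm_pos|lra]. }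
    intros e g He Hg. assert (Hbb : nE (subE b b) < d).
    { rewrite nE_self. unfold d; repeat apply Rmin_glb_lt; lra. }
    destruct (K1 e g) as [_ R1]; [lra|lra|]. destruct (K2 e g) as [_ R2]; [lra|lra|].
    split.
    + assert (P1 := K3 e g b ltac:(lra) ltac:(lra) ltac:(lra)).
      assert (P2 := K4 e g b ltac:(lra) ltac:(lra) ltac:(lra)).
      fold m1 m2.
      replace (M1 e g b * M2 e g b - m1 * m2)%W
        with ((M1 e g b - m1) * (M2 e g b - m2) + (M1 e g b - m1) * m2 + (M2 e g b - m2) * m1)%W by ring.
      eapply Rle_trans; [apply nrm_plus|].
      eapply Rle_trans; [apply Rplus_le_compat_r; apply nrm_plus|].
      generalize (HB _ m2 P1) (HB _ m1 P2) (HB _ (M2 e g b - m2)%W P1). intros.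
      assert (th * nrm (M2 e g b - m2)%W <= th * 1) by (apply Rmult_le_compat_l; lra).
      assert (th * K = th * nrm m1 + th * nrm m2 + th * C1 + th * C2 + th * 2) by (unfold K; ring).
      assert (0 <= th * C1) by (apply Rmult_le_pos; lra).
      assert (0 <= th * C2) by (apply Rmult_le_pos; lra).
      assert (0 <= th * nrm m1) by (apply Rmult_le_pos; lra).
      assert (0 <= th * nrm m2) by (apply Rmult_le_pos; lra).
      lra.
    + intros u v Hu Hv. specialize (R1 u v ltac:(lra) ltac:(lra)). specialize (R2 u v ltac:(lra) ltac:(lra)).
      assert (P1 := K3 e g v ltac:(lra) ltac:(lra) ltac:(lra)).
      assert (P2 := K4 e g u ltac:(lra) ltac:(lra) ltac:(lra)).
      set (h := subE u v) in *. assert (Hh := nE_pos h).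
      set (a1 := (M1 e g u - M1 e g v - L1 h)%W) in *. set (a2 := (M2 e g u - M2 e g v - L2 h)%W) in *.
      (* The increments of the factors are a1 + L1 h and a2 + L2 h with small a1 and a2; their
         coefficients M2 - m2 and M1 - m1 are small by continuity. *)
      replace (M1 e g u * M2 e g u - M1 e g v * M2 e g v - (L1 h * m2 + m1 * L2 h))%W
        with ((M2 e g u - m2) * (a1 + L1 h) + (M1 e g v - m1) * (a2 + L2 h) + a1 * m2 + a2 * m1)%W
        by (unfold a1, a2; ring).
      assert (B1 : nrm (a1 * m2)%W <= th * nE h * nrm m2).
      { eapply Rle_trans; [apply nrm_mult|]. apply Rmult_le_compat_r; lra. }
      assert (B2 : nrm (a2 * m1)%W <= th * nE h * nrm m1).
      { eapply Rle_trans; [apply nrm_mult|]. apply Rmult_le_compat_r; lra. }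
      assert (B3 := HB _ (a1 + L1 h)%W P2). assert (B4 := HB _ (a2 + L2 h)%W P1).
      assert (th * nE h <= 1 * nE h) by (apply Rmult_le_compat_r; lra).
      assert (B5 : th * nrm (a1 + L1 h)%W <= th * ((1 + C1) * nE h)).
      { apply Rmult_le_compat_l; [lra|]. eapply Rle_trans; [apply nrm_plus|].
        specialize (HL1 h). lra. }
      assert (B6 : th * nrm (a2 + L2 h)%W <= th * ((1 + C2) * nE h)).
      { apply Rmult_le_compat_l; [lra|]. eapply Rle_trans; [apply nrm_plus|].
        specialize (HL2 h). lra. }
      eapply Rle_trans; [apply nrm_plus|].
      eapply Rle_trans; [apply Rplus_le_compat_r; apply nrm_plus|].
      eapply Rle_trans; [apply Rplus_le_compat_r; apply Rplus_le_compat_r; apply nrm_plus|].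
      apply Rle_trans with (th * K * nE h); [unfold K; lra|].
      apply Rmult_le_compat_r; [lra|].
      assert (0 < th * K) by (apply Rmult_lt_0_compat; lra). lra.
Qed.

Lemma sdiff_ext M M' b L L' : (forall e g u, M e g u = M' e g u) -> (forall h, L h = L' h) ->
  sdiff M b L -> sdiff M' b L'.
Proof.
  intros H1 H2 H.
  replace M' with M by (do 3 (apply functional_extensionality; intro); auto).
  replace L' with L by (apply functional_extensionality; auto). exact H.
Qed.

(** * Projections onto ranges of frequencies and the corresponding supports *)

Definition Pi : W -> W := mulop (fun n => if (0 <? n)%Z then 1 else 0).
Definition Pi0 : W -> W := mulop (fun n => if (0 <=? n)%Z then 1 else 0).
Definition mean : W -> W := mulop (fun n => if (n =? 0)%Z then 1 else 0).

Lemma Pi_coef a n : Pi a n = if (0 <? n)%Z then a n else 0.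
Proof. simpl. destruct (0 <? n)%Z; rewrite ?clip_1, ?clip_0; ring. Qed.
Lemma Pi0_coef a n : Pi0 a n = if (0 <=? n)%Z then a n else 0.
Proof. simpl. destruct (0 <=? n)%Z; rewrite ?clip_1, ?clip_0; ring. Qed.
Lemma mean_cst a : mean a = cst (a 0%Z).
Proof.
  apply W_ext; intros n; simpl. destruct (Z.eqb_spec n 0), (Z.eq_dec n 0); subst;
   rewrite ?clip_1, ?clip_0; try ring; contradiction.
Qed.

Definition powser (a : W) : Prop := forall n, (n < 0)%Z -> a n = 0.
Definition strictpos (a : W) : Prop := forall n, (n <= 0)%Z -> a n = 0.
Definition nonpos (a : W) : Prop := forall n, (0 < n)%Z -> a n = 0.

Lemma strictpos_powser a : strictpos a -> powser a.
Proof. intros H n Hn. apply H. lia. Qed.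
Lemma powser_plus a b : powser a -> powser b -> powser (a + b)%W.
Proof. intros Ha Hb n Hn. simpl. rewrite Ha, Hb by auto. ring. Qed.
Lemma powser_opp a : powser a -> powser (- a)%W.
Proof. intros Ha n Hn. simpl. rewrite Ha by auto. ring. Qed.
Lemma powser_minus a b : powser a -> powser b -> powser (a - b)%W.
Proof. intros. now apply powser_plus, powser_opp. Qed.
Lemma powser_cst c : powser (cst c).
Proof. intros n Hn. simpl. destruct (Z.eq_dec n 0); [lia|reflexivity]. Qed.
Lemma powser_X : powser X.
Proof. intros n Hn. simpl. destruct (Z.eq_dec n 1); [lia|reflexivity]. Qed.
Lemma mult_coef0 (a b : W) n : (forall k, a k = 0 \/ b (n - k)%Z = 0) -> (a * b)%W n = 0.
Proof.
  intros H. simpl. unfold conv. rewrite (sumZ_ext _ (fun _ => 0)); [apply sumZ_0|].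
  intros k. destruct (H k) as [-> | ->]; ring.
Qed.
Lemma powser_mult a b : powser a -> powser b -> powser (a * b)%W.
Proof.
  intros Ha Hb n Hn. apply mult_coef0. intros k.
  destruct (Z_lt_dec k 0); [left; auto|right; apply Hb; lia].
Qed.
Lemma strictpos_mult a b : strictpos a -> powser b -> strictpos (a * b)%W.
Proof.
  intros Ha Hb n Hn. apply mult_coef0. intros k.
  destruct (Z_le_dec k 0); [left; auto|right; apply Hb; lia].
Qed.
Lemma nonpos_star a : powser a -> nonpos (star a).
Proof. intros H n Hn. simpl. apply H. lia. Qed.
Lemma nonpos_mult a b : nonpos a -> nonpos b -> nonpos (a * b)%W.
Proof.
  intros Ha Hb n Hn. apply mult_coef0. intros k.
  destruct (Z_lt_dec 0 k); [left; auto|right; apply Hb; lia].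
Qed.
Lemma strictpos_Pi a : strictpos (Pi a).
Proof. intros n Hn. rewrite Pi_coef. destruct (Z.ltb_spec 0 n); [lia|reflexivity]. Qed.
Lemma Pi_strictpos a : strictpos a -> Pi a = a.
Proof.
  intros H. apply W_ext; intros n. rewrite Pi_coef.
  destruct (Z.ltb_spec 0 n); [reflexivity|]. symmetry; now apply H.
Qed.
Lemma Pi_nonpos a : nonpos a -> Pi a = cst 0.
Proof.
  intros H. apply W_ext; intros n. rewrite Pi_coef. simpl.
  destruct (Z.ltb_spec 0 n), (Z.eq_dec n 0); auto.
Qed.
Lemma Pi_plus a b : Pi (a + b)%W = (Pi a + Pi b)%W.
Proof. apply mulop_plus. Qed.
Lemma Pi_minus a b : Pi (a - b)%W = (Pi a - Pi b)%W.
Proof. apply mulop_minus. Qed.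
Lemma Pi_Pi a : Pi (Pi a) = Pi a.
Proof. apply Pi_strictpos, strictpos_Pi. Qed.
Lemma Pi_cst_mult c a : Pi (cst c * a)%W = (cst c * Pi a)%W.
Proof.
  apply W_ext; intros n. rewrite Pi_coef, !cst_mult_coef, Pi_coef.
  destruct (0 <? n)%Z; ring.
Qed.
Lemma Pi_cst c : Pi (cst c) = cst 0.
Proof. apply Pi_nonpos. intros n Hn. simpl. destruct (Z.eq_dec n 0); [lia|reflexivity]. Qed.

(** * Geometric series and division by [X + A] *)

(** From e <= 3, since 1.32^4 > 3. *)
Lemma exp_quarter : exp (/ 4) <= 1.32.
Proof.
  destruct (Rle_dec (exp (/ 4)) 1.32) as [|H]; [assumption|]. exfalso.
  apply Rnot_le_lt in H.
  assert (E1 : exp 1 = (exp (/ 4) * exp (/ 4)) * (exp (/ 4) * exp (/ 4))).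
  { rewrite <- !exp_plus. f_equal. lra. }
  generalize exp_le_3. rewrite E1. intros.
  assert (1.32 * 1.32 < exp (/4) * exp (/4)) by nra.
  nra.
Qed.

(** Truncation to [-1/2, 1/2], which makes [geo] a total function of A. *)
Definition hclip (A : R) : R := clip (2 * A) / 2.
Lemma hclip_bound A : Rabs (hclip A) <= / 2.
Proof.
  unfold hclip. generalize (clip_bound (2 * A)). intros.
  unfold Rdiv. rewrite Rabs_mult, (Rabs_right (/ 2)) by lra. lra.
Qed.
Lemma hclip_id A : Rabs A <= / 2 -> hclip A = A.
Proof.
  intros H. unfold hclip. rewrite clip_id; [field|].
  rewrite Rabs_mult, (Rabs_right 2) by lra. lra.
Qed.

Definition geoc (A : R) (n : Z) : R :=
  if (0 <=? n)%Z then (- hclip A) ^ (Z.to_nat n) else 0.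

Lemma wt_pow n : wt (Z.of_nat n) = exp (/ 4) ^ n.
Proof.
  unfold wt. rewrite Z.abs_eq by lia. rewrite <- INR_IZR_INZ.
  rewrite <- Rpower_pow by apply exp_pos. unfold Rpower. rewrite ln_exp. f_equal; field.
Qed.

(** The weighted ratio is at most 1.32 / 2 = 0.66, and 0.34 = 1 - 0.66. *)
Lemma geo_psum A N : psum (fun n => Rabs (geoc A n) * wt n) N <= (1 - 0.66 ^ (S N)) / 0.34.
Proof.
  assert (T : forall n, Rabs (geoc A (Z.of_nat n)) * wt (Z.of_nat n) <= 0.66 ^ n).
  { intros n. unfold geoc. destruct (Z.leb_spec 0 (Z.of_nat n)); [|lia].
    rewrite Nat2Z.id, wt_pow, <- RPow_abs, <- Rpow_mult_distr.
    apply pow_incr. rewrite Rabs_Ropp.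
    generalize (hclip_bound A), exp_quarter, (exp_pos (/4)), (Rabs_pos (hclip A)). split; nra. }
  induction N.
  - rewrite psum_0. specialize (T 0%nat). simpl Z.of_nat in T. simpl pow in *. lra.
  - rewrite psum_S. specialize (T (S N)).
    assert (geoc A (- Z.of_nat (S N)) = 0) as ->.
    { unfold geoc. destruct (Z.leb_spec 0 (- Z.of_nat (S N))); [lia|reflexivity]. }
    rewrite Rabs_R0. simpl pow in *. lra.
Qed.

Lemma geo_bounded A : summable (fun n => Rabs (geoc A n) * wt n) /\
  sumZ (fun n => Rabs (geoc A n) * wt n) <= 3.
Proof.
  apply summable_bounded.
  - intros. apply Rmult_le_pos; [apply Rabs_pos|left; apply wt_pos].
  - intros N. eapply Rle_trans; [apply geo_psum|].
    assert (0 < 0.66 ^ (S N)) by (apply pow_lt; lra). lra.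
Qed.

Lemma geo_summable A : summable (fun n => geoc A n * wt n).
Proof.
  apply summable_le with (2 := proj1 (geo_bounded A)). intros n.
  rewrite Rabs_mult, (Rabs_right (wt n)); [lra|left; apply wt_pos].
Qed.

Definition geo (A : R) : W := mkW _ (geo_summable A).

Lemma nrm_geo A : nrm (geo A) <= 3.
Proof. apply geo_bounded. Qed.

Lemma powser_geo A : powser (geo A).
Proof. intros n Hn. simpl. unfold geoc. destruct (Z.leb_spec 0 n); [lia|reflexivity]. Qed.

Lemma geo_coef A n : Rabs A <= / 2 -> (0 <= n)%Z -> geo A n = (- A) ^ (Z.to_nat n).
Proof.
  intros HA Hn. simpl. unfold geoc. destruct (Z.leb_spec 0 n); [|lia]. now rewrite hclip_id.
Qed.

Lemma geo_inv A : Rabs A <= / 2 -> ((cst 1 + cst A * X) * geo A)%W = cst 1.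
Proof.
  intros HA. replace ((cst 1 + cst A * X) * geo A)%W with (geo A + cst A * (X * geo A))%W by ring.
  apply W_ext. intros n.
  change ((geo A + cst A * (X * geo A))%W n) with (geo A n + (cst A * (X * geo A))%W n).
  rewrite cst_mult_coef, X_mult_coef.
  destruct (Z_lt_dec n 0).
  - rewrite !powser_geo by lia. simpl. destruct (Z.eq_dec n 0); [lia|ring].
  - destruct (Z.eq_dec n 0) as [->|Hn0].
    + rewrite geo_coef, (powser_geo A (0 - 1)%Z) by (auto; lia). simpl. ring.
    + rewrite !geo_coef by (auto; lia). simpl. destruct (Z.eq_dec n 0); [lia|].
      replace (Z.to_nat n) with (S (Z.to_nat (n - 1))) by lia. simpl. ring.
Qed.

(* For a power series [a] in X, [ev A a] is its value at [- A]. *)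
Definition ev (A : R) (a : W) : R := (star a * geo A)%W 0%Z.

(** Coefficient m of the product is the sum over j >= 0 of a_j (-A)^{m+j}, from which (-A)^m factors
    out: on nonnegative frequencies this is a Hankel operator of rank one. It reduces the mixed
    products in the equations at a Crapper wave to a single scalar. *)
Lemma hankel A a m : Rabs A <= / 2 -> powser a -> (0 <= m)%Z ->
  (star a * geo A)%W m = (- A) ^ (Z.to_nat m) * ev A a.
Proof.
  intros HA Ha Hm. unfold ev. simpl. unfold conv. rewrite <- sumZ_scal.
  apply sumZ_ext. intros k.
  destruct (Z_lt_dec 0 k) as [Hk|Hk].
  - simpl. rewrite (Ha (- k)%Z) by lia. ring.
  - change (geoc A) with (cf (geo A)). rewrite !geo_coef by (auto; lia).
    replace (Z.to_nat (m - k)) with (Z.to_nat m + Z.to_nat (0 - k))%nat by lia.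
    rewrite pow_add. ring.
Qed.

Lemma hankel_Pi A a : Rabs A <= / 2 -> powser a ->
  Pi (star a * geo A)%W = (cst (ev A a) * Pi (geo A))%W.
Proof.
  intros HA Ha. apply W_ext. intros n. rewrite cst_mult_coef, !Pi_coef.
  destruct (Z.ltb_spec 0 n); [|ring].
  rewrite hankel, geo_coef by (auto; lia). ring.
Qed.

Definition Xi : W := delta (-1) 1.
Lemma X_Xi : (X * Xi)%W = cst 1.
Proof.
  apply W_ext. intros n. rewrite X_mult_coef. simpl.
  destruct (Z.eq_dec (n - 1) (-1)), (Z.eq_dec n 0); auto; lia.
Qed.
Lemma star_X : star X = Xi.
Proof.
  apply W_ext. intros n. simpl. destruct (Z.eq_dec (- n) 1), (Z.eq_dec n (-1)); auto; lia.
Qed.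

(** On the circle, 1 / (X + A) is X^{-1} / (1 + A X^{-1}), a series in negative powers. The
    nonnegative powers of a / (X + A) form the quotient of a by X + A, the remainder being the value
    of a at -A. *)
Definition quot (A : R) (a : W) : W := Pi0 (a * (Xi * star (geo A)))%W.

Lemma powser_Pi0 a : powser (Pi0 a).
Proof. intros n Hn. rewrite Pi0_coef. destruct (Z.leb_spec 0 n); [lia|reflexivity]. Qed.

Lemma quot_spec A a : Rabs A <= / 2 -> powser a ->
  ((X + cst A) * quot A a)%W = (a - cst (ev A a))%W.
Proof.
  intros HA Ha.
  set (j := (Xi * star (geo A))%W).
  assert (Hj : ((X + cst A) * j)%W = cst 1).
  { unfold j. replace ((X + cst A) * (Xi * star (geo A)))%W
      with ((X * Xi + cst A * Xi) * star (geo A))%W by ring.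
    rewrite X_Xi. generalize (f_equal star (geo_inv A HA)).
    rewrite star_mult, star_plus, star_mult, !star_cst, star_X. auto. }
  assert (Hq : quot A a = (a * j - cst (ev A a) * j)%W).
  { apply W_ext. intros n. unfold quot. rewrite Pi0_coef. fold j.
    change ((a * j - cst (ev A a) * j)%W n) with ((a * j)%W n - (cst (ev A a) * j)%W n).
    rewrite cst_mult_coef. unfold j at 3, Xi. rewrite delta_mult_coef.
    destruct (Z.leb_spec 0 n).
    - simpl (star _ _). unfold geoc. destruct (Z.leb_spec 0 (- (n - -1))); [lia|ring].
    (* Up to conjugation and a shift, the negative part of a * j is the product treated by [hankel],
       so it agrees with that of ev A a * j. *)
    - replace (a * j)%W with (Xi * star (star a * geo A))%W.
      2:{ unfold j. rewrite star_mult, star_star. ring. }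
      unfold Xi. rewrite delta_mult_coef.
      change (star (star a * geo A)%W (n - -1)%Z) with ((star a * geo A)%W (- (n - -1))%Z).
      change (star (geo A) (n - -1)%Z) with (geo A (- (n - -1))%Z).
      rewrite hankel, geo_coef by (auto; lia). ring. }
  rewrite Hq. transitivity (((X + cst A) * j) * (a - cst (ev A a)))%W; [ring|].
  rewrite Hj. ring.
Qed.

(** * The derivation [X d/dX] *)

(** A relation and not an operator, because X d/dX is unbounded on [W]. *)
Definition isD (a b : W) : Prop := forall n, b n = IZR n * a n.

Lemma isD_plus a b a' b' : isD a b -> isD a' b' -> isD (a + a')%W (b + b')%W.
Proof. intros H H' n. simpl. rewrite H, H'. ring. Qed.
Lemma isD_mult a b a' b' : isD a b -> isD a' b' -> isD (a * a')%W (b * a' + a * b')%W.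
Proof.
  intros H H' n. simpl. unfold conv.
  rewrite <- sumZ_plus by apply conv_summable. rewrite <- sumZ_scal.
  apply sumZ_ext. intros k. rewrite H, H', minus_IZR. ring.
Qed.
Lemma isD_cst c : isD (cst c) (cst 0).
Proof. intros n. simpl. destruct (Z.eq_dec n 0) as [->|]; ring. Qed.
Lemma isD_X : isD X X.
Proof. intros n. simpl. destruct (Z.eq_dec n 1) as [->|]; ring. Qed.

(** The candidate e satisfies (1 + A X) e = - A X geo and has no coefficients at n <= 0. This
    recurrence determines it, and n (-A)^n is its solution. *)
Lemma isD_geo A : Rabs A <= / 2 -> isD (geo A) (- (cst A * X * geo A * geo A))%W.
Proof.
  intros HA. set (e := (- (cst A * X * geo A * geo A))%W).
  assert (He : (e + cst A * (X * e))%W = (- (cst A * (X * geo A)))%W).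
  { unfold e. transitivity (- (cst A * X * geo A * ((cst 1 + cst A * X) * geo A)))%W; [ring|].
    rewrite geo_inv by auto. ring. }
  assert (Hn : strictpos e).
  { assert (strictpos (X * (- cst A * geo A * geo A))%W).
    { apply strictpos_mult; [intros n Hn; simpl; destruct (Z.eq_dec n 1); [lia|reflexivity]|].
      apply powser_mult; [|apply powser_geo]. apply powser_mult; [|apply powser_geo].
      apply powser_opp, powser_cst. }
    unfold e. replace (- (cst A * X * geo A * geo A))%W with (X * (- cst A * geo A * geo A))%W by ring.
    assumption. }
  assert (Hc : forall n, e n + A * e (n - 1)%Z = - (A * geo A (n - 1)%Z)).
  { intros n. generalize (f_equal (fun a : W => a n) He).
    change ((e + cst A * (X * e))%W n) with (e n + (cst A * (X * e))%W n).
    change ((- (cst A * (X * geo A)))%W n) with (- (cst A * (X * geo A))%W n).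
    now rewrite !cst_mult_coef, !X_mult_coef. }
  intros n. destruct (Z_lt_dec n 0).
  - rewrite powser_geo, Hn by lia. ring.
  - replace n with (Z.of_nat (Z.to_nat n)) by lia. generalize (Z.to_nat n). clear n n0.
    induction n.
    + rewrite Hn by lia. simpl Z.of_nat. ring.
    + specialize (Hc (Z.of_nat (S n))).
      replace (Z.of_nat (S n) - 1)%Z with (Z.of_nat n) in Hc by lia.
      rewrite IHn in Hc.
      rewrite geo_coef in Hc |- * by (auto; lia). rewrite Nat2Z.id in *.
      rewrite <- INR_IZR_INZ in *. rewrite S_INR. simpl pow. lra.
Qed.

(** * A right inverse of the linearization at the Crapper wave *)

(** The positive root of 1 - A^2 = 2 A, at which the numerator (1 - A^2)^2 - 4 A^2 sin^2 t of Re f^2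
    first reaches 0. *)
Definition A0 : R := sqrt 2 - 1.
(** Equal to (1 + A^2) / (1 - A^2) at A = A0; the Crapper wave there has the constant P = - 2
    kappa. *)
Definition kappa : R := 1 + A0.

Lemma A0_bounds : 0.41 < A0 < 0.42.
Proof.
  unfold A0. assert (H := sqrt_sqrt 2 ltac:(lra)). assert (H1 := sqrt_pos 2).
  split; nra.
Qed.

Lemma A0_sqr : A0 * A0 = 1 - 2 * A0.
Proof. unfold A0. assert (H := sqrt_sqrt 2 ltac:(lra)). lra. Qed.

Lemma A0_half : Rabs A0 <= / 2.
Proof. generalize A0_bounds. intros. rewrite Rabs_right; lra. Qed.

Lemma A0_half_opp : Rabs (- A0) <= / 2.
Proof. rewrite Rabs_Ropp. apply A0_half. Qed.

Definition i1 : W := geo A0.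
Definition i2 : W := geo (- A0).
Definition u1 : W := (cst 1 + cst A0 * X)%W.
Definition u2 : W := (cst 1 - cst A0 * X)%W.
(** The Blaschke factor (X + A0) / (1 + A0 X). [DS1] is its image under X d/dX, and [f0] is the
    Crapper function (1 - A0 X) / (1 + A0 X). *)
Definition S1 : W := ((X + cst A0) * i1)%W.
Definition DS1 : W := ((cst 1 - cst A0 * cst A0) * X * i1 * i1)%W.
Definition f0 : W := (i1 + i1 - cst 1)%W.

Lemma u1_i1 : (u1 * i1)%W = cst 1.
Proof. apply geo_inv, A0_half. Qed.
Lemma u2_i2 : (u2 * i2)%W = cst 1.
Proof.
  unfold i2. rewrite <- (geo_inv (- A0)) by apply A0_half_opp.
  unfold u2. rewrite cst_opp. ring.
Qed.
Lemma u1_f0 : (u1 * f0)%W = u2.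
Proof.
  unfold f0. replace (u1 * (i1 + i1 - cst 1))%W with (u1 * i1 + u1 * i1 - u1)%W by ring.
  rewrite u1_i1. unfold u1, u2. ring.
Qed.
Lemma star_f0 : ((X + cst A0) * star f0)%W = (X - cst A0)%W.
Proof.
  assert (H := f_equal star u1_f0). unfold u1, u2 in H.
  rewrite star_mult, star_plus, star_minus, !star_mult, !star_cst, star_X in H.
  replace ((X + cst A0) * star f0)%W with
    (X * ((cst 1 + cst A0 * Xi) * star f0) + cst A0 * (cst 1 - X * Xi) * star f0)%W by ring.
  rewrite H, X_Xi.
  replace (X * (cst 1 - cst A0 * Xi))%W with (X - cst A0 * (X * Xi))%W by ring.
  rewrite X_Xi. ring.
Qed.

Lemma isD_S1 : isD S1 DS1.
Proof.
  unfold S1. replace DS1 with ((X + cst 0) * i1 + (X + cst A0) * (- (cst A0 * X * i1 * i1)))%W.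
  - apply isD_mult; [apply isD_plus; [apply isD_X|apply isD_cst]|]. apply isD_geo, A0_half.
  - unfold DS1. transitivity (X * i1 * cst 1 - (X + cst A0) * cst A0 * X * i1 * i1)%W; [ring|].
    rewrite <- u1_i1 at 1. unfold u1. ring.
Qed.

(** Inverse of kappa X d/dX + 1 on strictly positive frequencies, where the multipliers lie between
    0 and 1 and clipping changes nothing. *)
Definition Vop : W -> W := mulop (fun n => if (0 <? n)%Z then / (kappa * IZR n + 1) else 0).

Lemma kappa_pos : 1 < kappa.
Proof. unfold kappa. generalize A0_bounds. lra. Qed.

Lemma Vop_coef a n : strictpos a -> (kappa * IZR n + 1) * Vop a n = a n.
Proof.
  intros Ha. simpl. destruct (Z.ltb_spec 0 n) as [Hn|Hn].
  - assert (0 < IZR n) by (apply IZR_lt; lia). assert (K := kappa_pos).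
    assert (0 < kappa * IZR n) by (apply Rmult_lt_0_compat; lra).
    rewrite clip_id; [field; lra|].
    rewrite Rabs_right by (apply Rle_ge; left; apply Rinv_0_lt_compat; lra).
    rewrite <- Rinv_1. apply Rinv_le_contravar; lra.
  - rewrite clip_0, Ha by auto. ring.
Qed.

(* On the analytic part, in the variable X = 1 / zeta, the linearized equation reads
   [- 2 kappa phi + gam f0^* + m (i1 - 1) = r] with [X gam' = 2 f0 phi], an ODE for gam
   whose homogeneous solution is S1^2 X^{-1/kappa}.  The substitution
   [gam = S1^2 v + t1 S1 X] turns it into [kappa X v' + v = Rr], which is diagonal; m and t1
   make the right-hand side divisible by (X + A0)^2. *)
Definition rho0 (r : W) : R := ev A0 r.
Definition rho1 (r : W) : R := ev A0 (quot A0 r).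
Definition rem2 (r : W) : W := quot A0 (quot A0 r).
(** The scalars [mc], [t1], [uc] and [wc] solve the four linear equations C0 to C3 in the proof of
    [key_poly], one for each power of X up to 3. The factors 2 + A0 come from 1 / A0 = 2 + A0. *)
Definition mc (r : W) : R :=
  - (2 + A0) * ((10 * A0 - 4) * (5 + 2 * A0)) * rho0 r - (2 + A0) * (12 * A0 - 4) * rho1 r.
Definition t1 (r : W) : R := 2 * (2 + A0) * rho0 r - mc r.
Definition uc (r : W) : R := t1 r - A0 * A0 * rho1 r.
Definition wc (r : W) : R := (2 + A0) * (2 + A0) * rho0 r + (2 + A0) * (2 + A0) * A0 * rho1 r.
Definition Rr (r : W) : W :=
  (- ((cst 1 - cst A0 * cst A0 * X * X) * rem2 r + cst (uc r) * X + cst (wc r)))%W.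
Definition vr (r : W) : W := Vop (Rr r).
Definition vD (r : W) : W := (cst (/ kappa) * (Rr r - vr r))%W.
Definition gam (r : W) : W := (S1 * (S1 * vr r + cst (t1 r) * X))%W.
Definition Dgam (r : W) : W :=
  (DS1 * (S1 * vr r + cst (t1 r) * X) + S1 * (DS1 * vr r + S1 * vD r + cst (t1 r) * X))%W.
Definition phi (r : W) : W := (cst (/ 2) * (u1 * i2) * Dgam r)%W.

(** Taylor expansion at X = - A0; the obstruction to divisibility by (X + A0)^2 consists of the two
    scalars [rho0] and [rho1]. *)
Lemma expand_r r : strictpos r ->
  r = (cst (rho0 r) + (X + cst A0) * cst (rho1 r) + (X + cst A0) * (X + cst A0) * rem2 r)%W.
Proof.
  intros Hr.
  assert (H1 := quot_spec A0 r A0_half (strictpos_powser _ Hr)).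
  assert (H2 := quot_spec A0 (quot A0 r) A0_half (powser_Pi0 _)).
  fold (rem2 r) in H2. fold (rho0 r) in H1. fold (rho1 r) in H2.
  transitivity ((r - cst (rho0 r)) + cst (rho0 r))%W; [ring|]. rewrite <- H1.
  transitivity ((X + cst A0) * ((quot A0 r - cst (rho1 r)) + cst (rho1 r)) + cst (rho0 r))%W; [ring|].
  rewrite <- H2. ring.
Qed.

Lemma powser_Rr r : powser (Rr r).
Proof.
  unfold Rr. apply powser_opp. repeat apply powser_plus.
  - apply powser_mult; [|apply powser_Pi0]. apply powser_minus; [apply powser_cst|].
    repeat apply powser_mult; auto using powser_cst, powser_X.
  - apply powser_mult; auto using powser_cst, powser_X.
  - apply powser_cst.
Qed.

Lemma Wplus_coef (a b : W) n : (a + b)%W n = a n + b n.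
Proof. reflexivity. Qed.
Lemma Wopp_coef (a : W) n : (- a)%W n = - a n.
Proof. reflexivity. Qed.
Lemma Wminus_coef (a b : W) n : (a - b)%W n = a n - b n.
Proof. reflexivity. Qed.
Lemma cst_coef0 c : cst c 0%Z = c.
Proof. reflexivity. Qed.

(** [Vop] solves the diagonal equation only for a right-hand side without constant term. As r
    vanishes at X = 0, its expansion gives rho0 + A0 rho1 = - A0^2 rem2(0), and [wc] equals (rho0 +
    A0 rho1) / A0^2, so the constant terms cancel. *)
Lemma strictpos_Rr r : strictpos r -> strictpos (Rr r).
Proof.
  intros Hr n Hn. destruct (Z.eq_dec n 0) as [->|]; [|apply powser_Rr; lia].
  assert (Hq : powser (rem2 r)) by apply powser_Pi0.
  assert (H := Hr 0%Z (Z.le_refl 0)). rewrite (expand_r r Hr) in H.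
  replace (cst (rho0 r) + (X + cst A0) * cst (rho1 r) + (X + cst A0) * (X + cst A0) * rem2 r)%W
   with (cst (rho0 r) + (X * cst (rho1 r) + cst A0 * cst (rho1 r)) +
     (X * (X * rem2 r) + X * (cst A0 * rem2 r) + (X * (cst A0 * rem2 r)) + cst A0 * (cst A0 * rem2 r)))%W in H by ring.
  rewrite !Wplus_coef, !X_mult_coef, !cst_mult_coef, ?X_mult_coef in H.
  rewrite (Hq (0 - 1)%Z), (Hq (0 - 1 - 1)%Z), (powser_cst (rho1 r) (0 - 1)%Z), !cst_coef0 in H by lia.
  unfold Rr.
  replace ((cst 1 - cst A0 * cst A0 * X * X) * rem2 r + cst (uc r) * X + cst (wc r))%W
    with (rem2 r - cst A0 * (cst A0 * (X * (X * rem2 r))) + X * cst (uc r) + cst (wc r))%W by ring.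
  rewrite Wopp_coef, !Wplus_coef, Wminus_coef, !cst_mult_coef, !X_mult_coef.
  rewrite (Hq (0 - 1 - 1)%Z), (powser_cst (uc r) (0 - 1)%Z), !cst_coef0 by lia.
  unfold wc. assert (HA := A0_sqr).
  assert (E : (2 + A0) * A0 = 1) by lra.
  replace (rem2 r 0%Z) with (((2 + A0) * A0) * ((2 + A0) * A0) * rem2 r 0%Z) by (rewrite E; ring).
  assert (rho0 r + A0 * rho1 r = - (A0 * (A0 * rem2 r 0%Z))) by lra.
  replace ((2 + A0) * (2 + A0) * rho0 r + (2 + A0) * (2 + A0) * A0 * rho1 r)
    with ((2 + A0) * (2 + A0) * (rho0 r + A0 * rho1 r)) by ring.
  rewrite H0. ring.
Qed.

Lemma vD_spec r : strictpos r -> isD (vr r) (vD r).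
Proof.
  intros Hr n. unfold vD. rewrite cst_mult_coef, Wminus_coef.
  rewrite <- (Vop_coef (Rr r)) by now apply strictpos_Rr. unfold vr.
  assert (K := kappa_pos). field. lra.
Qed.

Lemma kappa_vD r : (cst kappa * vD r)%W = (Rr r - vr r)%W.
Proof.
  unfold vD. transitivity ((cst kappa * cst (/ kappa)) * (Rr r - vr r))%W; [ring|].
  rewrite <- cst_mult, Rinv_r; [ring|]. generalize kappa_pos; lra.
Qed.

Lemma strictpos_X : strictpos X.
Proof. intros n Hn. simpl. destruct (Z.eq_dec n 1); [lia|reflexivity]. Qed.

Lemma strictpos_plus a b : strictpos a -> strictpos b -> strictpos (a + b)%W.
Proof. intros Ha Hb n Hn. simpl. rewrite Ha, Hb by auto. ring. Qed.

Lemma strictpos_mult_r a b : powser a -> strictpos b -> strictpos (a * b)%W.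
Proof.
  intros Ha Hb. replace (a * b)%W with (b * a)%W by ring. now apply strictpos_mult.
Qed.

Lemma powser_S1 : powser S1.
Proof.
  apply powser_mult; [|apply powser_geo]. apply powser_plus; [apply powser_X|apply powser_cst].
Qed.

Lemma strictpos_vr r : strictpos (vr r).
Proof.
  intros n Hn. simpl. destruct (Z.ltb_spec 0 n); [lia|]. rewrite clip_0. ring.
Qed.

Lemma strictpos_gam r : strictpos (gam r).
Proof.
  apply strictpos_mult_r; [apply powser_S1|]. apply strictpos_plus.
  - apply strictpos_mult_r; [apply powser_S1|apply strictpos_vr].
  - apply strictpos_mult_r; [apply powser_cst|apply strictpos_X].
Qed.

Lemma isD_gam r : strictpos r -> isD (gam r) (Dgam r).
Proof.
  intros Hr. unfold gam, Dgam. apply isD_mult; [apply isD_S1|]. apply isD_plus.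
  - apply isD_mult; [apply isD_S1|now apply vD_spec].
  - replace (cst (t1 r) * X)%W with (cst 0 * X + cst (t1 r) * X)%W at 2 by ring.
    apply isD_mult; [apply isD_cst|apply isD_X].
Qed.

Lemma strictpos_Dgam r : strictpos r -> strictpos (Dgam r).
Proof. intros Hr n Hn. rewrite isD_gam, strictpos_gam by auto. ring. Qed.

Lemma powser_u1 : powser u1.
Proof.
  apply powser_plus; [apply powser_cst|]. apply powser_mult; [apply powser_cst|apply powser_X].
Qed.

Lemma strictpos_phi r : strictpos r -> strictpos (phi r).
Proof.
  intros Hr. apply strictpos_mult_r; [|now apply strictpos_Dgam].
  unfold i2. repeat apply powser_mult; auto using powser_cst, powser_u1, powser_geo.
Qed.

Lemma f0_phi r : (cst 2 * (f0 * phi r))%W = Dgam r.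
Proof.
  unfold phi.
  transitivity ((cst 2 * cst (/ 2)) * ((u1 * f0) * i2 * Dgam r))%W; [ring|].
  rewrite u1_f0, u2_i2, <- cst_mult, Rinv_r by lra. ring.
Qed.

Lemma gam_star_f0 r : (gam r * star f0)%W = ((X - cst A0) * i1 * (S1 * vr r + cst (t1 r) * X))%W.
Proof.
  unfold gam. rewrite <- star_f0. unfold S1 at 1. ring.
Qed.

Lemma cst_A0_sqr : (cst A0 * cst A0)%W = (cst 1 - cst A0 - cst A0)%W.
Proof. rewrite <- cst_mult, A0_sqr, <- !cst_minus. f_equal. ring. Qed.

Lemma cst_double c : cst (2 * c) = (cst c + cst c)%W.
Proof. rewrite <- cst_plus. f_equal. ring. Qed.

Lemma i1_minus_1 : (i1 - cst 1)%W = (- (cst A0 * X * i1))%W.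
Proof. rewrite <- u1_i1. unfold u1. ring. Qed.

(* Polynomial identity left after clearing the denominators u1 and u2. *)
Lemma key_poly (rho0 rho1 : R) (r2 : W) :
  let m := - (2 + A0) * ((10 * A0 - 4) * (5 + 2 * A0)) * rho0 - (2 + A0) * (12 * A0 - 4) * rho1 in
  let t := 2 * (2 + A0) * rho0 - m in
  let u := t - A0 * A0 * rho1 in
  let w := (2 + A0) * (2 + A0) * rho0 + (2 + A0) * (2 + A0) * A0 * rho1 in
  let B := (X + cst A0)%W in
  (- (B * B * - ((cst 1 - cst A0 * cst A0 * X * X) * r2 + cst u * X + cst w))
   - cst (1 + A0) * cst t * X * (cst 2 * cst A0 * X + u1 * B)
   + u2 * (X - cst A0) * cst t * X - u2 * cst m * cst A0 * X)%W
  = (u2 * u1 * (cst rho0 + B * cst rho1 + B * B * r2))%W.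
Proof.
  intros m t u w B.
  assert (E2 : cst 2 = (cst 1 + cst 1)%W) by (rewrite <- cst_plus; f_equal; lra).
  assert (HA := A0_sqr).
  assert (C0 : w * (A0 * A0) = rho0 + rho1 * A0).
  { unfold w. assert (E : (2 + A0) * A0 = 1) by lra.
    transitivity (((2 + A0) * A0) * ((2 + A0) * A0) * (rho0 + A0 * rho1)); [ring|]. rewrite E. ring. }
  assert (C1 : u * (A0 * A0) + 2 * A0 * w - (1 + A0) * t * A0 - A0 * t - m * A0 = rho1).
  { unfold u, w, t, m. ring [HA]. }
  assert (C2 : 2 * A0 * u + w - (1 + A0) * t * (2 * A0 + 1 + A0 * A0) + t * (1 + A0 * A0) + m * A0 * A0
     = - (A0 * A0) * (rho0 + rho1 * A0)).
  { unfold u, w, t, m. ring [HA]. }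
  assert (C3 : u - (1 + A0) * t * A0 - t * A0 = - (A0 * A0) * rho1).
  { unfold u, w, t, m. ring [HA]. }
  (* The relation A0^2 = 1 - 2 A0 has been spent on the scalar equations. Moved to [W], they are the
     coefficients of 1, X, X^2 and X^3 of the identity, and [ring] can treat the constants as
     opaque. *)
  apply (f_equal cst) in C0, C1, C2, C3.
  unfold Rminus in C0, C1, C2, C3.
  repeat rewrite ?cst_plus, ?cst_mult, ?cst_opp in C0.
  repeat rewrite ?cst_plus, ?cst_mult, ?cst_opp in C1.
  repeat rewrite ?cst_plus, ?cst_mult, ?cst_opp in C2.
  repeat rewrite ?cst_plus, ?cst_mult, ?cst_opp in C3.
  rewrite E2 in *. rewrite cst_plus. unfold u1, u2, B.
  generalize dependent (cst u). generalize dependent (cst w). generalize dependent (cst t).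
  generalize dependent (cst m). clear m t u w HA. intros m t w C0 u C1 C2 C3.
  match goal with |- ?l = ?r => assert (Hz : (l - r)%W = cst 0) end.
  - match type of C0 with ?l0 = ?r0 => match type of C1 with ?l1 = ?r1 =>
    match type of C2 with ?l2 = ?r2 => match type of C3 with ?l3 = ?r3 =>
      transitivity ((l0 - r0) + (l1 - r1) * X + (l2 - r2) * X * X + (l3 - r3) * X * X * X)%W
    end end end end; [ring|].
    rewrite C0, C1, C2, C3. ring.
  - match goal with |- ?l = ?r => transitivity ((l - r) + r)%W; [ring|] end.
    rewrite Hz. ring.
Qed.

(** After multiplication by the invertible u1 * u2 the terms containing v cancel, by A0^2 + 2 A0 =
    1; this is the effect of the homogeneous factor S1^2 in [gam]. What remains is [key_poly]. *)
Lemma K_identity r : strictpos r ->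
  (- (cst 2 * cst kappa * phi r) + gam r * star f0 + cst (mc r) * (i1 - cst 1))%W = r.
Proof.
  intros Hr. rewrite gam_star_f0, i1_minus_1.
  set (B := (X + cst A0)%W). set (v := vr r). set (t := cst (t1 r)). set (m := cst (mc r)).
  assert (HS : (u1 * S1)%W = B).
  { unfold S1. fold B. transitivity ((u1 * i1) * B)%W; [ring|]. rewrite u1_i1. ring. }
  assert (H2A : (cst 1 - cst A0 * cst A0)%W = (cst 2 * cst A0)%W).
  { rewrite cst_A0_sqr, <- cst_mult, cst_double. ring. }
  assert (HDS : (u1 * (u1 * DS1))%W = (cst 2 * cst A0 * X)%W).
  { unfold DS1. rewrite H2A.
    transitivity (cst 2 * cst A0 * X * (u1 * i1) * (u1 * i1))%W; [ring|]. rewrite u1_i1. ring. }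
  assert (HDS1 : (u1 * DS1)%W = (cst 2 * cst A0 * X * i1)%W).
  { unfold DS1. rewrite H2A.
    transitivity (cst 2 * cst A0 * X * (u1 * i1) * i1)%W; [ring|]. rewrite u1_i1. ring. }
  assert (HD : (u1 * u1 * Dgam r)%W =
    (cst 2 * (B * (cst 2 * cst A0 * X * i1) * v) + B * B * vD r
      + t * X * (cst 2 * cst A0 * X + u1 * B))%W).
  { unfold Dgam. fold v t.
    transitivity ((u1 * S1) * (u1 * DS1) * v + (u1 * S1) * (u1 * DS1) * v
      + (u1 * S1) * (u1 * S1) * vD r + t * X * ((u1 * (u1 * DS1)) + u1 * (u1 * S1)))%W; [ring|].
    rewrite HS, HDS, HDS1. rewrite (cst_plus 1 1 : cst 2 = _). ring. }
  assert (Hmain : (u1 * u2 * (- (cst 2 * cst kappa * phi r) + (X - cst A0) * i1 * (S1 * v + t * X)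
     + m * - (cst A0 * X * i1)))%W = (u1 * u2 * r)%W).
  { assert (P1 : (u1 * u2 * (cst 2 * cst kappa * phi r))%W = (cst kappa * (u1 * u1 * Dgam r))%W).
    { unfold phi. transitivity ((cst 2 * cst (/2)) * (u2 * i2) * (cst kappa * (u1 * u1 * Dgam r)))%W; [ring|].
      rewrite u2_i2, <- cst_mult, Rinv_r by lra. ring. }
    assert (HS1 : S1 = (B * i1)%W) by reflexivity.
    transitivity (- (u1 * u2 * (cst 2 * cst kappa * phi r))
      + (u1 * i1) * (u2 * (X - cst A0) * (S1 * v + t * X) - u2 * m * cst A0 * X))%W; [ring|].
    rewrite P1, HD, u1_i1, HS1.
    assert (HK := kappa_vD r). fold v in HK.
    assert (Hk : cst kappa = (cst 1 + cst A0)%W) by apply cst_plus.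
    transitivity (- (B * B * (cst kappa * vD r))
      - cst kappa * t * X * (cst 2 * cst A0 * X + u1 * B)
      + u2 * (X - cst A0) * t * X - u2 * m * cst A0 * X
      + B * i1 * v * (u2 * (X - cst A0) - cst kappa * cst 2 * (cst 2 * cst A0 * X)))%W; [ring|].
    rewrite HK.
    transitivity (- (B * B * Rr r)
      - cst kappa * t * X * (cst 2 * cst A0 * X + u1 * B)
      + u2 * (X - cst A0) * t * X - u2 * m * cst A0 * X
      + B * v * (B * cst 1 + i1 * (u2 * (X - cst A0) - cst kappa * cst 2 * (cst 2 * cst A0 * X))))%W; [ring|].
    rewrite <- u1_i1 at 1.
    assert (Hbr : (u1 * B + u2 * (X - cst A0) - cst kappa * cst 2 * (cst 2 * cst A0 * X))%W = cst 0).
    { rewrite Hk, (cst_plus 1 1 : cst 2 = _). unfold u1, u2, B.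
      transitivity ((cst 1 + cst 1) * X * (cst A0 * cst A0 + cst 1 - (cst 1 + cst 1) * (cst A0 + cst A0 * cst A0)))%W; [ring|].
      rewrite cst_A0_sqr. ring. }
    transitivity (- (B * B * Rr r)
      - cst kappa * t * X * (cst 2 * cst A0 * X + u1 * B)
      + u2 * (X - cst A0) * t * X - u2 * m * cst A0 * X
      + B * v * i1 * (u1 * B + u2 * (X - cst A0) - cst kappa * cst 2 * (cst 2 * cst A0 * X)))%W; [ring|].
    rewrite Hbr. rewrite (expand_r r Hr) at 2.
    transitivity (u2 * u1 * (cst (rho0 r) + B * cst (rho1 r) + B * B * rem2 r))%W; [|unfold B; ring].
    unfold B. rewrite <- (key_poly (rho0 r) (rho1 r) (rem2 r)).
    unfold Rr, t, m, uc, wc, t1, mc, kappa. ring. }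
  fold v t m.
  match goal with |- ?l = r => transitivity ((u1 * i1) * (u2 * i2) * l)%W end.
  { rewrite u1_i1, u2_i2. ring. }
  match goal with |- (_ * _ * ?l)%W = r => transitivity (i1 * i2 * (u1 * u2 * l))%W; [ring|] end.
  rewrite Hmain. transitivity ((u1 * i1) * (u2 * i2) * r)%W; [ring|].
  rewrite u1_i1, u2_i2. ring.
Qed.

(** * The water wave equations in the Wiener algebra *)

Definition epsop (e : R) : W -> W := mulop (fun n => if (0 <? n)%Z then e ^ (Z.to_nat n) else 0).
(** Integration of the modes of f^2: the division by n comes from the primitive, the factor 1 - e^n
    from the mode reflected at the bottom. *)
Definition Jm (e : R) : W -> W :=
  mulop (fun n => if (0 <? n)%Z then (1 - e ^ (Z.to_nat n)) / IZR n else 0).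
Definition Jop (e : R) (a : W) : W := (Jm e a + star (Jm e a))%W.
(** For 0 <= e < 1 this vanishes exactly when coefficient -n is e^n times coefficient n for all n >
    0, the criterion for a holomorphic extension compatible with the flat bottom. *)
Definition Pr (e : R) (a : W) : W := (Pi (star a) - epsop e a)%W.
(** The result is invariant under [star], hence real on the circle, and its mean remains a free
    unknown. *)
Definition Sop (a : W) : W := (mean a + Pi a + star (Pi a))%W.
(* The first component of the unknown u : E carries the coefficients of f at positive
   powers of zeta = X, the second one those of P at nonnegative powers; e = e^{-2H},
   and Jop e (f * f) is 2 c y on the surface. *)
Definition fop (e : R) (x : W) : W := (cst 1 + Pi x + star (epsop e x))%W.
Definition q0 : R := - (2 * kappa).
Definition Pop (x : W) : W := (cst q0 + Sop x)%W.
Definition hop (e : R) (u : E) : W :=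
  (Pop (snd u) * star (fop e (fst u)) + Jop e (fop e (fst u) * fop e (fst u)) * fop e (fst u))%W.
(** [mean] produces c and [Jop] produces 2 c y, so this is twice P^2 / 2 + c^2 g y. Being invariant
    under [star], it is constant as soon as its strictly positive part [F2] vanishes; the value of
    the constant is left free. *)
Definition berop (e g : R) (u : E) : W :=
  (Pop (snd u) * Pop (snd u)
   + cst g * (mean (fop e (fst u) * fop e (fst u)) * Jop e (fop e (fst u) * fop e (fst u))))%W.
Definition F1 (e g : R) (u : E) : W := Pr e (hop e u).
Definition F2 (e g : R) (u : E) : W := Pi (berop e g u).

Lemma epsop0 x : epsop 0 x = cst 0.
Proof.
  apply W_ext. intros n. simpl. destruct (Z.ltb_spec 0 n).
  - rewrite pow_i by lia. rewrite clip_0. destruct (Z.eq_dec n 0); ring.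
  - rewrite clip_0. destruct (Z.eq_dec n 0); ring.
Qed.

Lemma pow_le_self e n : 0 <= e < 1 -> (0 < n)%nat -> 0 <= e ^ n <= e.
Proof.
  intros He Hn. destruct n as [|n]; [lia|]. simpl.
  assert (0 <= e ^ n) by (apply pow_le; lra).
  assert (e ^ n <= 1) by (rewrite <- (pow1 n); apply pow_incr; lra). nra.
Qed.

Lemma nrm_epsop e x : 0 <= e < 1 -> nrm (epsop e x) <= e * nrm x.
Proof.
  intros He. apply nrm_mulop_scal; [lra|]. intros n. destruct (Z.ltb_spec 0 n).
  - assert (H1 := pow_le_self e (Z.to_nat n) He ltac:(lia)). rewrite Rabs_right; lra.
  - rewrite Rabs_R0. lra.
Qed.

Lemma nrm_mulop_diff m1 m2 e a : 0 <= e ->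
  (forall n, Rabs (m1 n) <= 1) -> (forall n, Rabs (m2 n) <= 1) ->
  (forall n, Rabs (m1 n - m2 n) <= e) -> nrm (mulop m1 a - mulop m2 a)%W <= e * nrm a.
Proof.
  intros He H1 H2 H. unfold nrm. rewrite <- sumZ_scal.
  apply sumZ_le; [apply W_summable_abs|apply summable_scal, W_summable_abs|].
  intros n. simpl. rewrite !clip_id by auto.
  replace (m1 n * a n + - (m2 n * a n)) with ((m1 n - m2 n) * a n) by ring.
  rewrite Rabs_mult, Rmult_assoc. apply Rmult_le_compat_r; [|apply H].
  apply Rmult_le_pos; [apply Rabs_pos|left; apply wt_pos].
Qed.

Lemma inv_IZR n : (0 < n)%Z -> 0 < / IZR n <= 1.
Proof.
  intros Hn. assert (1 <= IZR n) by (apply IZR_le; lia). split.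
  - apply Rinv_0_lt_compat; lra.
  - rewrite <- Rinv_1. apply Rinv_le_contravar; lra.
Qed.

Lemma Jm_mult_bound e n : 0 <= e < 1 -> (0 < n)%Z -> Rabs ((1 - e ^ (Z.to_nat n)) / IZR n) <= 1.
Proof.
  intros He Hn. assert (H1 := pow_le_self e (Z.to_nat n) He ltac:(lia)).
  assert (H2 := inv_IZR n Hn). rewrite Rabs_right; unfold Rdiv; nra.
Qed.

Lemma Jm_coef e a n : 0 <= e < 1 ->
  Jm e a n = if (0 <? n)%Z then (1 - e ^ (Z.to_nat n)) / IZR n * a n else 0.
Proof.
  intros He. simpl. destruct (Z.ltb_spec 0 n); [|rewrite clip_0; ring].
  rewrite clip_id; [reflexivity|]. now apply Jm_mult_bound.
Qed.

Lemma Jm_diff e a : 0 <= e < 1 -> nrm (Jm e a - Jm 0 a)%W <= e * nrm a.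
Proof.
  intros He. apply nrm_mulop_diff; [lra| | |]; intros n; destruct (Z.ltb_spec 0 n) as [Hn|Hn];
    try (rewrite Rabs_R0; lra).
  - now apply Jm_mult_bound.
  - apply Jm_mult_bound; [lra|lia].
  - rewrite pow_i by lia.
    assert (H1 := pow_le_self e (Z.to_nat n) He ltac:(lia)). assert (H2 := inv_IZR n Hn).
    replace ((1 - e ^ Z.to_nat n) / IZR n - (1 - 0) / IZR n) with (- (e ^ Z.to_nat n * / IZR n))
      by (unfold Rdiv; ring).
    rewrite Rabs_Ropp, Rabs_right; nra.
  - rewrite Rminus_0_r, Rabs_R0. lra.
Qed.

(** The Crapper wave at A0, in coordinates whose origin stands for f = 1 and P = q0. *)
Definition b0 : E := ((f0 - cst 1)%W, cst 0).

Lemma strictpos_geo1 A : Rabs A <= / 2 -> strictpos (geo A + geo A - cst 1 - cst 1)%W.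
Proof.
  intros HA n Hn. simpl. destruct (Z.eq_dec n 0) as [->|]; unfold geoc; simpl; [ring|].
  destruct (Z.leb_spec 0 n); [lia|ring].
Qed.

Lemma Pi_geo1 A : Rabs A <= / 2 -> Pi (geo A + geo A - cst 1 - cst 1)%W = (geo A + geo A - cst 1 - cst 1)%W.
Proof. intros. now apply Pi_strictpos, strictpos_geo1. Qed.

Lemma fop_base A : Rabs A <= / 2 -> fop 0 (geo A + geo A - cst 1 - cst 1)%W = (geo A + geo A - cst 1)%W.
Proof.
  intros. unfold fop. rewrite Pi_geo1, epsop0, star_cst by auto. ring.
Qed.

Lemma Sop_cst c : Sop (cst c) = cst c.
Proof. unfold Sop. rewrite mean_cst, Pi_cst, star_cst, cst_coef0. ring. Qed.

(** * The equations linearized at the vertical Crapper wave *)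

Lemma sdiff_Pi M b L : sdiff M b L -> sdiff (fun e g u => Pi (M e g u)) b (fun h => Pi (L h)).
Proof.
  apply (sdiff_op (fun _ => Pi) 1); [lra| | |].
  - intros; apply Pi_minus.
  - intros. rewrite Rmult_1_l. apply nrm_mulop.
  - intros. replace (Pi x - Pi x)%W with (cst 0) by ring. rewrite nrm_cst, Rabs_R0.
    apply Rmult_le_pos; [lra|apply nrm_pos].
Qed.

Lemma sdiff_mean M b L : sdiff M b L -> sdiff (fun e g u => mean (M e g u)) b (fun h => mean (L h)).
Proof.
  apply (sdiff_op (fun _ => mean) 1); [lra| | |].
  - intros; apply mulop_minus.
  - intros. rewrite Rmult_1_l. apply nrm_mulop.
  - intros. replace (mean x - mean x)%W with (cst 0) by ring. rewrite nrm_cst, Rabs_R0.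
    apply Rmult_le_pos; [lra|apply nrm_pos].
Qed.

Lemma sdiff_star M b L : sdiff M b L -> sdiff (fun e g u => star (M e g u)) b (fun h => star (L h)).
Proof.
  apply (sdiff_op (fun _ => star) 1); [lra| | |].
  - intros; apply star_minus.
  - intros. rewrite nrm_star. lra.
  - intros. replace (star x - star x)%W with (cst 0) by ring. rewrite nrm_cst, Rabs_R0.
    apply Rmult_le_pos; [lra|apply nrm_pos].
Qed.

Lemma sdiff_epsop M b L : sdiff M b L -> sdiff (fun e g u => epsop e (M e g u)) b (fun h => cst 0).
Proof.
  intros H. refine (sdiff_ext _ _ _ _ _ (fun _ _ _ => eq_refl) (fun h => epsop0 (L h)) _).
  apply (sdiff_op epsop 1); [lra| | | |exact H].
  - intros; apply mulop_minus.
  - intros. rewrite Rmult_1_l. apply nrm_mulop.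
  - intros. rewrite epsop0. replace (epsop e x - cst 0)%W with (epsop e x) by ring.
    rewrite Rmult_1_l. now apply nrm_epsop.
Qed.

Lemma sdiff_Jop M b L : sdiff M b L -> sdiff (fun e g u => Jop e (M e g u)) b (fun h => Jop 0 (L h)).
Proof.
  intros H. assert (H1 : sdiff (fun e g u => Jm e (M e g u)) b (fun h => Jm 0 (L h))).
  { apply (sdiff_op Jm 1); [lra| | | |exact H].
    - intros; apply mulop_minus.
    - intros. rewrite Rmult_1_l. apply nrm_mulop.
    - intros. rewrite Rmult_1_l. now apply Jm_diff. }
  apply sdiff_plus; [exact H1|]. now apply sdiff_star.
Qed.

Lemma sdiff_f : sdiff (fun e g u => fop e (fst u)) b0 (fun h => Pi (fst h)).
Proof.
  pose proof (sdiff_plus _ _ _ _ _ (sdiff_plus _ _ _ _ _ (sdiff_cst (cst 1) b0)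
    (sdiff_Pi _ _ _ (sdiff_fst b0))) (sdiff_star _ _ _ (sdiff_epsop _ _ _ (sdiff_fst b0)))) as H.
  refine (sdiff_ext _ _ _ _ _ _ _ H); intros; cbv beta; [reflexivity|].
  rewrite star_cst. ring.
Qed.

Lemma fop_b0 : fop 0 (fst b0) = f0.
Proof. apply fop_base, A0_half. Qed.
Lemma Pop_b0 : Pop (snd b0) = cst q0.
Proof. unfold Pop; simpl. rewrite Sop_cst. ring. Qed.

Lemma sdiff_ff : sdiff (fun e g u => fop e (fst u) * fop e (fst u))%W b0
  (fun h => cst 2 * (f0 * Pi (fst h)))%W.
Proof.
  refine (sdiff_ext _ _ _ _ _ _ _ (sdiff_mult _ _ _ _ _ sdiff_f sdiff_f)); intros; cbv beta;
    [reflexivity|]. rewrite fop_b0, (cst_plus 1 1 : cst 2 = _). ring.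
Qed.

Lemma sdiff_P : sdiff (fun e g u => Pop (snd u)) b0 (fun h => Sop (snd h)).
Proof.
  pose proof (sdiff_Pi _ _ _ (sdiff_snd b0)) as HP.
  pose proof (sdiff_plus _ _ _ _ _ (sdiff_cst (cst q0) b0) (sdiff_plus _ _ _ _ _
    (sdiff_plus _ _ _ _ _ (sdiff_mean _ _ _ (sdiff_snd b0)) HP) (sdiff_star _ _ _ HP))) as H.
  refine (sdiff_ext _ _ _ _ _ _ _ H); intros; cbv beta; [reflexivity|].
  unfold Sop. ring.
Qed.

Definition Lh (h : E) : W :=
  (Sop (snd h) * star f0 + cst q0 * star (Pi (fst h))
   + (Jop 0 (cst 2 * (f0 * Pi (fst h))) * f0 + Jop 0 (f0 * f0) * Pi (fst h)))%W.
(** At e = 0 the part of [Pr] with [epsop] drops out, and at g = 0 so does gravity. Hence [L2]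
    involves P alone and the linear system is triangular. *)
Definition L1 (h : E) : W := Pi (star (Lh h)).
Definition L2 (h : E) : W := Pi (cst (2 * q0) * Sop (snd h))%W.

Lemma sdiff_h : sdiff (fun e g u => hop e u) b0 Lh.
Proof.
  pose proof (sdiff_plus _ _ _ _ _ (sdiff_mult _ _ _ _ _ sdiff_P (sdiff_star _ _ _ sdiff_f))
     (sdiff_mult _ _ _ _ _ (sdiff_Jop _ _ _ sdiff_ff) sdiff_f)) as H.
  refine (sdiff_ext _ _ _ _ _ _ _ H); intros; cbv beta; [reflexivity|]. unfold Lh. rewrite fop_b0, Pop_b0. reflexivity.
Qed.

Lemma sdiff_opp M b L : sdiff M b L -> sdiff (fun e g u => - M e g u)%W b (fun h => - L h)%W.
Proof.
  intros H. apply (sdiff_op (fun _ x => - x)%W 1); [lra| | | |exact H].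
  - intros; ring.
  - intros. rewrite nrm_opp. lra.
  - intros. replace (- x - - x)%W with (cst 0) by ring. rewrite nrm_cst, Rabs_R0.
    apply Rmult_le_pos; [lra|apply nrm_pos].
Qed.

Lemma sdiff_F1 : sdiff F1 b0 L1.
Proof.
  pose proof (sdiff_plus _ _ _ _ _ (sdiff_Pi _ _ _ (sdiff_star _ _ _ sdiff_h))
    (sdiff_opp _ _ _ (sdiff_epsop _ _ _ sdiff_h))) as H.
  refine (sdiff_ext _ _ _ _ _ _ _ H); intros; cbv beta; [reflexivity|]. unfold L1. ring.
Qed.

Lemma sdiff_g : sdiff (fun e g u => cst g) b0 (fun h => cst 0).
Proof.
  apply sdiff_const. intros eta He. exists eta. split; [lra|]. intros e g _ Hg.
  rewrite <- cst_minus, nrm_cst, Rminus_0_r. lra.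
Qed.

Lemma sdiff_F2 : sdiff F2 b0 L2.
Proof.
  pose proof (sdiff_Pi _ _ _ (sdiff_plus _ _ _ _ _ (sdiff_mult _ _ _ _ _ sdiff_P sdiff_P)
     (sdiff_mult _ _ _ _ _ sdiff_g
        (sdiff_mult _ _ _ _ _ (sdiff_mean _ _ _ sdiff_ff) (sdiff_Jop _ _ _ sdiff_ff))))) as H.
  refine (sdiff_ext _ _ _ _ _ _ _ H); intros; cbv beta; [reflexivity|].
  unfold L2. f_equal. rewrite Pop_b0, cst_double. ring.
Qed.

(** * The right inverse *)

(** The equation for P gives its positive part [kpi]. Moving the contribution of [kpi] to the
    right-hand side leaves [kr] as datum for the unknown f, solved by [phi]; the mean of P is chosen
    last. *)
Definition kpi (h : E) : W := (cst (/ (2 * q0)) * Pi (snd h))%W.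
Definition kr (h : E) : W := (Pi (fst h) - Pi ((kpi h + star (kpi h)) * f0))%W.
(** Solves 2 kdelta + 4 ev A0 (phi r) = mc r. The mean of P contributes 2 kdelta i1, the rank-one
    term of [hankel_Pi] contributes 4 ev i1, and together they supply the term mc i1 of
    [K_identity]. *)
Definition kdelta (h : E) : R := / 2 * mc (kr h) - 2 * ev A0 (phi (kr h)).
Definition K (h : E) : E := (phi (kr h), (cst (kdelta h) + kpi h)%W).

Lemma strictpos_kr h : strictpos (kr h).
Proof.
  intros n Hn. unfold kr. rewrite Wminus_coef, !strictpos_Pi by auto. ring.
Qed.

Lemma strictpos_kpi h : strictpos (kpi h).
Proof. apply strictpos_mult_r; [apply powser_cst|apply strictpos_Pi]. Qed.

Lemma mean_strictpos a : strictpos a -> mean a = cst 0.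
Proof. intros H. rewrite mean_cst. f_equal. apply H. lia. Qed.

Lemma Sop_K h : Sop (snd (K h)) = (cst (kdelta h) + (kpi h + star (kpi h)))%W.
Proof.
  unfold Sop, K; simpl snd. unfold mean. rewrite mulop_plus. fold mean.
  change (mulop _ (cst (kdelta h))) with (mean (cst (kdelta h))).
  change (mulop _ (kpi h)) with (mean (kpi h)).
  rewrite (mean_strictpos (kpi h)) by apply strictpos_kpi.
  rewrite mean_cst, cst_coef0, Pi_plus, Pi_cst, (Pi_strictpos (kpi h)) by apply strictpos_kpi.
  rewrite star_plus, star_cst. ring.
Qed.

Lemma star_Jop e a : star (Jop e a) = Jop e a.
Proof. unfold Jop. rewrite star_plus, star_star. ring. Qed.
Lemma star_Sop a : star (Sop a) = Sop a.
Proof. unfold Sop. rewrite mean_cst, !star_plus, star_star, star_cst. ring. Qed.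

Lemma Jm0_isD a b : strictpos a -> isD a b -> Jm 0 b = a.
Proof.
  intros Ha Hab. apply W_ext. intros n. rewrite Jm_coef by lra.
  destruct (Z.ltb_spec 0 n).
  - rewrite pow_i by lia. rewrite Hab. field. apply not_0_IZR. lia.
  - symmetry. now apply Ha.
Qed.

(** Since (2 geo - 1)^2 = 1 - 4 A X geo^2, and - A X geo^2 is the image of geo under X d/dX, the
    elevation of a Crapper wave is explicit. *)
Lemma Jm0_ff A : Rabs A <= / 2 ->
  Jm 0 ((geo A + geo A - cst 1) * (geo A + geo A - cst 1))%W = (cst 4 * (geo A - cst 1))%W.
Proof.
  intros HA.
  assert (Hs : strictpos (geo A - cst 1)%W).
  { intros n Hn. generalize (strictpos_geo1 A HA n Hn). simpl. lra. }
  assert (E4 : cst 4 = (cst 1 + cst 1 + cst 1 + cst 1)%W) by (rewrite <- !cst_plus; f_equal; lra).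
  assert (E1 : ((geo A + geo A - cst 1) * (geo A + geo A - cst 1))%W
    = (cst 4 * (- (cst A * X * geo A * geo A)) + cst 1)%W).
  { assert (HX : (cst A * X * geo A)%W = (cst 1 - geo A)%W) by (rewrite <- (geo_inv A HA); ring).
    rewrite HX, E4. ring. }
  rewrite E1. unfold Jm. rewrite mulop_plus. fold (Jm 0).
  change (Jm 0 (cst 4 * - (cst A * X * geo A * geo A))%W + Jm 0 (cst 1) = cst 4 * (geo A - cst 1))%W.
  rewrite (Jm0_isD (cst 4 * (geo A - cst 1))%W).
  - replace (Jm 0 (cst 1)) with (cst 0); [ring|]. apply W_ext. intros n.
    rewrite Jm_coef by lra. simpl. destruct (Z.ltb_spec 0 n), (Z.eq_dec n 0); try lia; ring.
  - apply strictpos_mult_r; [apply powser_cst|exact Hs].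
  - intros n. rewrite !cst_mult_coef.
    rewrite (isD_geo A HA n). rewrite Wminus_coef. simpl (cst 1 n).
    destruct (Z.eq_dec n 0) as [->|]; simpl; ring.
Qed.

Lemma LK2 h : L2 (K h) = Pi (snd h).
Proof.
  unfold L2. rewrite Sop_K, Pi_cst_mult, !Pi_plus, Pi_cst, (Pi_strictpos (kpi h)) by apply strictpos_kpi.
  rewrite (Pi_nonpos (star (kpi h))).
  2:{ apply nonpos_star, strictpos_powser, strictpos_kpi. }
  unfold kpi. transitivity ((cst (2 * q0) * cst (/ (2 * q0))) * Pi (snd h))%W; [ring|].
  rewrite <- cst_mult, Rinv_r; [ring|]. unfold q0. generalize kappa_pos. lra.
Qed.

Lemma powser_f0 : powser f0.
Proof.
  unfold f0. apply powser_minus; [|apply powser_cst]. apply powser_plus; apply powser_geo.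
Qed.

(** [Pi] removes products of conjugated power series, [hankel_Pi] reduces star phi * i1 to a
    multiple of [Pi i1], and [K_identity] replaces gam * star f0. The choice of [kdelta] cancels the
    remaining multiples of [Pi i1]. *)
Lemma LK1 h : L1 (K h) = Pi (fst h).
Proof.
  assert (Hr := strictpos_kr h). set (r := kr h) in *.
  assert (Hph := strictpos_phi r Hr).
  assert (E4 : cst 4 = (cst 2 * cst 2)%W) by (rewrite <- cst_mult; f_equal; lra).
  unfold L1, Lh. rewrite Sop_K. set (k := (kpi h + star (kpi h))%W).
  assert (Hk : star k = k) by (unfold k; rewrite star_plus, star_star; ring).
  change (fst (K h)) with (phi r). rewrite (Pi_strictpos (phi r)) by assumption.
  rewrite f0_phi.
  rewrite !star_plus, !star_mult, !star_plus, !star_Jop, !star_cst, !star_star, Hk.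
  unfold Jop. rewrite (Jm0_isD (gam r) (Dgam r)) by (auto using strictpos_gam, isD_gam).
  rewrite (Jm0_ff A0 A0_half : Jm 0 (f0 * f0)%W = _). fold i1.
  set (G := (cst 4 * (i1 - cst 1))%W).
  assert (HG : powser G).
  { apply powser_mult; [apply powser_cst|]. apply powser_minus; [apply powser_geo|apply powser_cst]. }
  transitivity (Pi ((cst (kdelta h) * (i1 + i1 - cst 1) + k * f0
     + cst q0 * phi r + gam r * star f0 + cst 4 * (star (phi r) * i1) - cst 4 * star (phi r))
    + (star (gam r) * star f0 + star G * star (phi r))))%W.
  { f_equal. unfold G, f0. ring. }
  rewrite Pi_plus, (Pi_nonpos (_ + _)%W).
  2:{ intros n Hn. rewrite Wplus_coef. rewrite !(nonpos_mult _ _) by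
       (auto; apply nonpos_star; auto using powser_f0, strictpos_powser, strictpos_gam). ring. }
  assert (Hgs : (gam r * star f0)%W = (r + cst 2 * cst kappa * phi r - cst (mc r) * i1 + cst (mc r))%W).
  { transitivity ((- (cst 2 * cst kappa * phi r) + gam r * star f0 + cst (mc r) * (i1 - cst 1))
      + cst 2 * cst kappa * phi r - cst (mc r) * (i1 - cst 1))%W; [ring|].
    rewrite (K_identity r Hr). ring. }
  rewrite Hgs.
  replace (cst 2 * cst kappa * phi r)%W with (cst (2 * kappa) * phi r)%W by (rewrite cst_mult; ring).
  repeat first [rewrite Pi_plus|rewrite Pi_minus|rewrite Pi_cst_mult|rewrite Pi_cst].
  rewrite (Pi_strictpos (phi r)), (Pi_strictpos r) by assumption.
  unfold i1 at 4. rewrite (hankel_Pi A0 (phi r) A0_half (strictpos_powser _ Hph)). fold i1.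
  rewrite (Pi_nonpos (star (phi r))) by (apply nonpos_star, strictpos_powser; assumption).
  unfold r at 2. unfold kr. fold k.
  unfold kdelta. fold r. unfold q0. rewrite cst_minus, !cst_mult, cst_opp, !cst_mult, E4.
  assert (E2 : cst 2 = (cst 1 + cst 1)%W) by apply cst_plus.
  assert (Eh : (cst (/2) * (cst 1 + cst 1))%W = cst 1).
  { rewrite <- E2, <- cst_mult. f_equal. lra. }
  rewrite E2.
  match goal with |- ?l = _ => transitivity (Pi (fst h) +
     (cst (/2) * (cst 1 + cst 1) - cst 1) * (cst (mc r) * Pi i1))%W end; [ring|].
  rewrite Eh. ring.
Qed.

(** * Boundedness and linearity of the right inverse *)

Definition blin (T : E -> W) : Prop :=
  (exists C, 0 <= C /\ forall h, nrm (T h) <= C * nE h) /\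
  (forall u v, T (subE u v) = (T u - T v)%W).
Definition blinR (T : E -> R) : Prop :=
  (exists C, 0 <= C /\ forall h, Rabs (T h) <= C * nE h) /\
  (forall u v, T (subE u v) = T u - T v).

Lemma blin_fst : blin fst.
Proof.
  split; [|reflexivity]. exists 1. split; [lra|]. intros h. unfold nE.
  generalize (nrm_pos (snd h)); lra.
Qed.
Lemma blin_snd : blin snd.
Proof.
  split; [|reflexivity]. exists 1. split; [lra|]. intros h. unfold nE.
  generalize (nrm_pos (fst h)); lra.
Qed.
Lemma blin_op (O : W -> W) C T : 0 <= C -> (forall x y, O (x - y)%W = (O x - O y)%W) ->
  (forall x, nrm (O x) <= C * nrm x) -> blin T -> blin (fun h => O (T h)).
Proof.
  intros HC HO HB [[D [HD H1]] H2]. split.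
  - exists (C * D). split; [now apply Rmult_le_pos|]. intros h.
    eapply Rle_trans; [apply HB|]. rewrite Rmult_assoc. now apply Rmult_le_compat_l.
  - intros. now rewrite H2, HO.
Qed.
Lemma blin_mulop m T : blin T -> blin (fun h => mulop m (T h)).
Proof.
  apply (blin_op (mulop m) 1); [lra|apply mulop_minus|].
  intros. rewrite Rmult_1_l. apply nrm_mulop.
Qed.
Lemma blin_star T : blin T -> blin (fun h => star (T h)).
Proof.
  apply (blin_op star 1); [lra|apply star_minus|]. intros. rewrite nrm_star. lra.
Qed.
Lemma blin_mult c T : blin T -> blin (fun h => c * T h)%W.
Proof.
  apply (blin_op (fun x => c * x)%W (nrm c)); [apply nrm_pos|intros; ring|].
  intros. apply nrm_mult.
Qed.
Lemma blin_mult_r c T : blin T -> blin (fun h => T h * c)%W.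
Proof.
  apply (blin_op (fun x => x * c)%W (nrm c)); [apply nrm_pos|intros; ring|].
  intros. rewrite Rmult_comm. apply nrm_mult.
Qed.
Lemma blin_opp T : blin T -> blin (fun h => - T h)%W.
Proof.
  apply (blin_op Wopp 1); [lra|intros; ring|]. intros. rewrite nrm_opp. lra.
Qed.
Lemma blin_plus T T' : blin T -> blin T' -> blin (fun h => T h + T' h)%W.
Proof.
  intros [[C [HC H1]] H2] [[D [HD H3]] H4]. split.
  - exists (C + D). split; [lra|]. intros h. eapply Rle_trans; [apply nrm_plus|].
    specialize (H1 h). specialize (H3 h). lra.
  - intros. rewrite H2, H4. ring.
Qed.
Lemma blin_minus T T' : blin T -> blin T' -> blin (fun h => T h - T' h)%W.
Proof. intros. apply blin_plus; auto using blin_opp. Qed.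
Lemma blin_cst T : blinR T -> blin (fun h => cst (T h)).
Proof.
  intros [[C [HC H1]] H2]. split.
  - exists C. split; auto. intros. now rewrite nrm_cst.
  - intros. now rewrite H2, cst_minus.
Qed.
Lemma blinR_coef n T : blin T -> blinR (fun h => T h n).
Proof.
  intros [[C [HC H1]] H2]. split.
  - exists C. split; auto. intros. eapply Rle_trans; [apply coef_le|apply H1].
  - intros. now rewrite H2.
Qed.
Lemma blinR_ev A T : blin T -> blinR (fun h => ev A (T h)).
Proof.
  intros H. apply (blinR_coef 0 (fun h => star (T h) * geo A)%W). now apply blin_mult_r, blin_star.
Qed.
Lemma blinR_scal c T : blinR T -> blinR (fun h => c * T h).
Proof.
  intros [[C [HC H1]] H2]. split.
  - exists (Rabs c * C). split; [apply Rmult_le_pos; auto using Rabs_pos|].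
    intros. rewrite Rabs_mult, Rmult_assoc. apply Rmult_le_compat_l; auto using Rabs_pos.
  - intros. rewrite H2. ring.
Qed.
Lemma blinR_plus T T' : blinR T -> blinR T' -> blinR (fun h => T h + T' h).
Proof.
  intros [[C [HC H1]] H2] [[D [HD H3]] H4]. split.
  - exists (C + D). split; [lra|]. intros h. eapply Rle_trans; [apply Rabs_triang|].
    specialize (H1 h). specialize (H3 h). lra.
  - intros. rewrite H2, H4. ring.
Qed.
Lemma blinR_minus T T' : blinR T -> blinR T' -> blinR (fun h => T h - T' h).
Proof.
  intros H H'. apply (blinR_scal (-1)) in H'.
  generalize (blinR_plus _ _ H H'). intros [[C [HC H1]] H2]. split.
  - exists C. split; auto. intros h. replace (T h - T' h) with (T h + -1 * T' h) by ring. auto.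
  - intros. generalize (H2 u v). lra.
Qed.

Lemma blin_kr : blin kr.
Proof.
  assert (blin kpi) by apply blin_mult, blin_mulop, blin_snd.
  apply blin_minus; [apply blin_mulop, blin_fst|].
  apply blin_mulop, blin_mult_r, blin_plus; auto using blin_star.
Qed.

Lemma blin_quot A T : blin T -> blin (fun h => quot A (T h)).
Proof. intros. now apply blin_mulop, blin_mult_r. Qed.

Lemma blinR_rho0 T : blin T -> blinR (fun h => rho0 (T h)).
Proof. apply blinR_ev. Qed.

Lemma blinR_rho1 T : blin T -> blinR (fun h => rho1 (T h)).
Proof. intros H. apply (blinR_ev A0 (fun h => quot A0 (T h))), blin_quot, H. Qed.

Lemma blin_rem2 T : blin T -> blin (fun h => rem2 (T h)).
Proof. intros H. apply (blin_quot A0 (fun h => quot A0 (T h))), blin_quot, H. Qed.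

Lemma blinR_mc T : blin T -> blinR (fun h => mc (T h)).
Proof.
  intros H. unfold mc.
  apply (blinR_minus (fun h => _ * rho0 (T h)) (fun h => _ * rho1 (T h))).
  - apply (blinR_scal _ (fun h => rho0 (T h))), blinR_rho0, H.
  - apply (blinR_scal _ (fun h => rho1 (T h))), blinR_rho1, H.
Qed.

Lemma blinR_t1 T : blin T -> blinR (fun h => t1 (T h)).
Proof.
  intros H. apply (blinR_minus (fun h => _ * rho0 (T h)) (fun h => mc (T h))).
  - apply (blinR_scal _ (fun h => rho0 (T h))), blinR_rho0, H.
  - apply blinR_mc, H.
Qed.

Lemma blin_Rr T : blin T -> blin (fun h => Rr (T h)).
Proof.
  intros H. unfold Rr.
  apply (blin_opp (fun h => _ * rem2 (T h) + cst (uc (T h)) * X + cst (wc (T h)))%W).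
  apply (blin_plus (fun h => _ * rem2 (T h) + cst (uc (T h)) * X)%W (fun h => cst (wc (T h)))).
  - apply (blin_plus (fun h => _ * rem2 (T h))%W (fun h => cst (uc (T h)) * X)%W).
    + apply (blin_mult _ (fun h => rem2 (T h))), blin_rem2, H.
    + apply (blin_mult_r X (fun h => cst (uc (T h)))), blin_cst. unfold uc.
      apply (blinR_minus (fun h => t1 (T h)) (fun h => _ * rho1 (T h))).
      * apply blinR_t1, H.
      * apply (blinR_scal _ (fun h => rho1 (T h))), blinR_rho1, H.
  - apply blin_cst. unfold wc.
    apply (blinR_plus (fun h => _ * rho0 (T h)) (fun h => _ * rho1 (T h))).
    + apply (blinR_scal _ (fun h => rho0 (T h))), blinR_rho0, H.
    + apply (blinR_scal _ (fun h => rho1 (T h))), blinR_rho1, H.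
Qed.

Lemma blin_phi T : blin T -> blin (fun h => phi (T h)).
Proof.
  intros H. assert (HR := blin_Rr T H).
  assert (HV : blin (fun h => vr (T h))) by now apply blin_mulop.
  assert (HD : blin (fun h => vD (T h))) by now apply blin_mult, blin_minus.
  assert (Ht : blin (fun h => cst (t1 (T h)) * X)%W) by now apply blin_mult_r, blin_cst, blinR_t1.
  apply blin_mult. apply blin_plus; apply blin_mult.
  - apply blin_plus; [now apply blin_mult|exact Ht].
  - apply blin_plus; [apply blin_plus; now apply blin_mult|exact Ht].
Qed.

Lemma K_bounded : (exists C, 0 <= C /\ forall h, nE (K h) <= C * nE h) /\
  forall u v, K (subE u v) = subE (K u) (K v).
Proof.
  assert (H1 : blin (fun h => fst (K h))) by apply blin_phi, blin_kr.
  assert (H2 : blin (fun h => snd (K h))).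
  { apply blin_plus; [apply blin_cst|apply blin_mult, blin_mulop, blin_snd].
    apply blinR_minus; apply blinR_scal; [apply blinR_mc, blin_kr|].
    apply blinR_ev, blin_phi, blin_kr. }
  destruct H1 as [[C [HC H1]] H1']. destruct H2 as [[D [HD H2]] H2']. split.
  - exists (C + D). split; [lra|]. intros h. unfold nE at 1. specialize (H1 h). specialize (H2 h). lra.
  - intros u v. specialize (H1' u v). specialize (H2' u v).
    rewrite (surjective_pairing (K (subE u v))), H1', H2'. reflexivity.
Qed.

(** * The Crapper waves *)

Definition fA (A : R) : W := (geo A + geo A - cst 1)%W.
(** Determined by 2 q + 4 (2 / (1 - A^2) - 1) = 0, the one scalar condition to which [F1_bA]
    reduces. *)
Definition qA (A : R) : R := - (2 * (1 + A * A)) / (1 - A * A).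
Definition bA (A : R) : E := ((fA A - cst 1)%W, cst (qA A - q0)).

Lemma sqr_half A : Rabs A <= / 2 -> A * A <= / 4.
Proof. intros H. apply Rabs_le_between in H. nra. Qed.

(** The Laurent series p = geo^* geo is symmetric, with p_1 = - A p_0 by [hankel]. The constant
    coefficient of (1 + A X) p = geo^* then reads (1 - A^2) p_0 = 1. *)
Lemma ev_geo A : Rabs A <= / 2 -> ev A (geo A) = / (1 - A * A).
Proof.
  intros HA. assert (H2 := sqr_half A HA).
  set (p := (star (geo A) * geo A)%W).
  assert (Hp : ((cst 1 + cst A * X) * p)%W = star (geo A)).
  { unfold p. transitivity (((cst 1 + cst A * X) * geo A) * star (geo A))%W; [ring|].
    rewrite geo_inv by auto. ring. }
  replace ((cst 1 + cst A * X) * p)%W with (p + cst A * (X * p))%W in Hp by ring.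
  apply (f_equal (fun a : W => a 0%Z)) in Hp.
  rewrite Wplus_coef, cst_mult_coef, X_mult_coef in Hp.
  replace (p (0 - 1)%Z) with (p 1%Z) in Hp.
  2:{ assert (Hs : star p = p) by (unfold p; rewrite star_mult, star_star; ring).
      rewrite <- Hs at 2. reflexivity. }
  unfold p in Hp at 2. rewrite (hankel A (geo A) 1) in Hp by (auto using powser_geo; lia).
  change (p 0%Z) with (ev A (geo A)) in Hp.
  change (star (geo A) 0%Z) with 1 in Hp. change (Z.to_nat 1) with 1%nat in Hp.
  apply Rmult_eq_reg_l with (1 - A * A); [|lra]. rewrite Rinv_r by lra. simpl in Hp. lra.
Qed.

Lemma qA_A0 : qA A0 = q0.
Proof.
  unfold qA, q0, kappa. assert (H := A0_sqr). assert (B := A0_bounds). rewrite H.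
  apply Rmult_eq_reg_r with (1 - (1 - 2 * A0)); [|lra]. field_simplify; [|lra]. nra.
Qed.

Lemma bA_A0 : bA A0 = b0.
Proof. unfold bA, b0. rewrite qA_A0, Rminus_diag. reflexivity. Qed.

Lemma powser_fA A : powser (fA A).
Proof.
  apply powser_minus; [|apply powser_cst]. apply powser_plus; apply powser_geo.
Qed.

Lemma fop_bA A : Rabs A <= / 2 -> fop 0 (fst (bA A)) = fA A.
Proof. apply fop_base. Qed.

Lemma Pop_bA A : Pop (snd (bA A)) = cst (qA A).
Proof. unfold Pop; simpl snd. rewrite Sop_cst, <- cst_plus. f_equal. ring. Qed.

(** As in [LK1], the projection leaves only multiples of [Pi (geo A)], and [qA] makes their sum
    vanish. *)
Lemma F1_bA A : Rabs A <= / 2 -> F1 0 0 (bA A) = cst 0.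
Proof.
  intros HA. unfold F1, Pr, hop. rewrite epsop0, fop_bA, Pop_bA by auto.
  unfold Jop. rewrite (Jm0_ff A HA : Jm 0 (fA A * fA A)%W = _).
  rewrite star_plus, !star_mult, star_plus, !star_mult, star_cst, !star_star, star_cst.
  assert (E4 : cst 4 = (cst 2 * cst 2)%W) by (rewrite <- cst_mult; f_equal; lra).
  assert (E2 : cst 2 = (cst 1 + cst 1)%W) by apply cst_plus.
  assert (H1 := sqr_half A HA).
  transitivity (Pi ((cst (qA A) * fA A + cst 4 * (star (fA A) * geo A) - cst 4 * star (fA A))
    + cst 4 * (star (geo A - cst 1) * star (fA A))))%W; [rewrite star_minus, star_cst|].
  { transitivity (Pi (cst (qA A) * fA A + cst 4 * (star (fA A) * geo A) - cst 4 * star (fA A)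
    + cst 4 * ((star (geo A) - cst 1) * star (fA A))))%W; [|reflexivity].
    match goal with |- (Pi ?x - cst 0)%W = _ => transitivity (Pi x); [ring|] end.
    f_equal. rewrite ?star_minus, ?star_cst. ring. }
  rewrite Pi_plus, Pi_minus, Pi_plus, !Pi_cst_mult, hankel_Pi by auto using powser_fA.
  rewrite (Pi_nonpos (star (fA A))) by (apply nonpos_star, powser_fA).
  rewrite (Pi_nonpos (star (geo A - cst 1) * star (fA A))%W).
  2:{ apply nonpos_mult; apply nonpos_star; [|apply powser_fA].
      apply powser_minus; [apply powser_geo|apply powser_cst]. }
  unfold fA at 1. rewrite Pi_minus, Pi_plus, Pi_cst.
  assert (Hev : ev A (fA A) = 2 * / (1 - A * A) - 1).
  { rewrite <- ev_geo by auto. unfold fA, ev.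
    replace (star (geo A + geo A - cst 1) * geo A)%W
      with (star (geo A) * geo A + star (geo A) * geo A - geo A)%W
      by (rewrite star_minus, star_plus, star_cst; ring).
    rewrite Wminus_coef, Wplus_coef. simpl (geo A 0%Z). unfold geoc. simpl. ring. }
  rewrite Hev.
  transitivity (cst (2 * qA A + 4 * (2 * / (1 - A * A) - 1)) * Pi (geo A))%W.
  - rewrite cst_plus, !cst_mult, E4, E2. ring.
  - replace (2 * qA A + 4 * (2 * / (1 - A * A) - 1)) with 0; [ring|].
    unfold qA. field. lra.
Qed.

Lemma F2_bA A : F2 0 0 (bA A) = cst 0.
Proof.
  unfold F2, berop. rewrite Pop_bA.
  transitivity (Pi (cst (qA A) * cst (qA A)))%W; [f_equal; ring|].
  rewrite <- cst_mult. apply Pi_cst.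
Qed.

Lemma wt_1 : wt 1 <= 1.32.
Proof. change 1%Z with (Z.of_nat 1). rewrite wt_pow. simpl. generalize exp_quarter. lra. Qed.

(** Resolvent identity geo A - geo B = (B - A) X geo A geo B; the constant 12 bounds 1.32 * 3 *
    3. *)
Lemma geo_lip A B : Rabs A <= / 2 -> Rabs B <= / 2 -> nrm (geo A - geo B)%W <= 12 * Rabs (A - B).
Proof.
  intros HA HB.
  assert (E1 : (geo A - geo B)%W = (cst (B - A) * (X * (geo A * geo B)))%W).
  { rewrite cst_minus.
    transitivity (geo A * cst 1 - cst 1 * geo B)%W; [ring|].
    rewrite <- (geo_inv B HB) at 1. rewrite <- (geo_inv A HA) at 2. ring. }
  rewrite E1. eapply Rle_trans; [apply nrm_mult|]. rewrite nrm_cst, Rabs_minus_sym, Rmult_comm.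
  apply Rmult_le_compat_r; [apply Rabs_pos|].
  eapply Rle_trans; [apply nrm_mult|]. unfold X. rewrite nrm_delta, Rabs_R1, Rmult_1_l.
  generalize (nrm_mult (geo A) (geo B)) (nrm_geo A) (nrm_geo B) (nrm_pos (geo A)) (nrm_pos (geo B)) wt_1
    (wt_pos 1) (nrm_pos (geo A * geo B)%W). intros.
  assert (nrm (geo A) * nrm (geo B) <= 3 * 3) by (apply Rmult_le_compat; lra).
  apply Rle_trans with (1.32 * 9); [apply Rmult_le_compat; lra|lra].
Qed.

Lemma bA_lip A B : Rabs A <= / 2 -> Rabs B <= / 2 -> nE (subE (bA A) (bA B)) <= 40 * Rabs (A - B).
Proof.
  intros HA HB. assert (HA2 := sqr_half A HA). assert (HB2 := sqr_half B HB). unfold nE.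
  assert (H1 : nrm (fst (subE (bA A) (bA B))) <= 24 * Rabs (A - B)).
  { simpl. unfold fA.
    replace (geo A + geo A - cst 1 - cst 1 - (geo B + geo B - cst 1 - cst 1))%W
      with ((geo A - geo B) + (geo A - geo B))%W by ring.
    eapply Rle_trans; [apply nrm_plus|]. generalize (geo_lip A B HA HB). lra. }
  assert (H2 : nrm (snd (subE (bA A) (bA B))) <= 8 * Rabs (A - B)).
  { simpl. rewrite <- cst_minus, nrm_cst.
    replace (qA A - q0 - (qA B - q0)) with ((A - B) * (- 4 * (A + B) * / ((1 - A * A) * (1 - B * B)))).
    2:{ unfold qA. field. lra. }
    rewrite Rabs_mult, Rmult_comm. apply Rmult_le_compat_r; [apply Rabs_pos|].
    apply Rabs_le_between in HA. apply Rabs_le_between in HB.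
    assert (Hd : 9/16 <= (1 - A * A) * (1 - B * B)) by nra.
    assert (Hi : 0 < / ((1 - A * A) * (1 - B * B)) <= 16/9).
    { split; [apply Rinv_0_lt_compat; lra|]. replace (16/9) with (/ (9/16)) by field.
      apply Rinv_le_contravar; lra. }
    apply Rabs_le. split; nra. }
  generalize (Rabs_pos (A - B)). lra.
Qed.

(** * Existence and Lipschitz dependence of the perturbed waves *)

Definition Fmap (e g : R) (u : E) : E := (F1 e g u, F2 e g u).
Definition Lmap (u : E) : E := (L1 u, L2 u).

Lemma sdiff_pair (eta : R) : 0 < eta -> exists delta, 0 < delta /\
  forall e g, 0 <= e < delta -> Rabs g < delta ->
    nE (subE (Fmap e g b0) (Fmap 0 0 b0)) <= eta /\
    forall u v, nE (subE u b0) < delta -> nE (subE v b0) < delta ->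
      nE (subE (subE (Fmap e g u) (Fmap e g v)) (Lmap (subE u v))) <= eta * nE (subE u v).
Proof.
  intros He.
  destruct (proj2 sdiff_F1 (eta / 2)) as [d1 [Hd1 K1]]; [lra|].
  destruct (proj2 sdiff_F2 (eta / 2)) as [d2 [Hd2 K2]]; [lra|].
  exists (Rmin d1 d2). split; [now apply Rmin_glb_lt|].
  assert (Hm1 := Rmin_l d1 d2). assert (Hm2 := Rmin_r d1 d2).
  intros e g He' Hg. destruct (K1 e g) as [P1 Q1]; [lra|lra|]. destruct (K2 e g) as [P2 Q2]; [lra|lra|].
  split.
  - unfold nE; simpl. lra.
  - intros u v Hu Hv. specialize (Q1 u v ltac:(lra) ltac:(lra)). specialize (Q2 u v ltac:(lra) ltac:(lra)).
    unfold nE at 1; simpl. lra.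
Qed.

Lemma Lmap_bounded : exists C, 0 <= C /\ forall h, nE (Lmap h) <= C * nE h.
Proof.
  destruct (proj1 sdiff_F1) as [C [HC H1]]. destruct (proj1 sdiff_F2) as [D [HD H2]].
  exists (C + D). split; [lra|]. intros h. unfold nE at 1; simpl.
  specialize (H1 h). specialize (H2 h). lra.
Qed.

Lemma Lmap_minus u v : Lmap (subE u v) = subE (Lmap u) (Lmap v).
Proof.
  assert (HS : forall x y, Sop (x - y)%W = (Sop x - Sop y)%W).
  { intros. unfold Sop, mean. rewrite mulop_minus, !Pi_minus, star_minus. ring. }
  assert (HJ : forall x y, Jop 0 (x - y)%W = (Jop 0 x - Jop 0 y)%W).
  { intros. unfold Jop, Jm. rewrite mulop_minus, star_minus. ring. }
  unfold Lmap, subE; simpl. f_equal.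
  - unfold L1. rewrite <- Pi_minus, <- star_minus. do 2 f_equal. unfold Lh; simpl.
    rewrite HS, !Pi_minus, star_minus.
    replace (cst 2 * (f0 * (Pi (fst u) - Pi (fst v))))%W
     with (cst 2 * (f0 * Pi (fst u)) - cst 2 * (f0 * Pi (fst v)))%W by ring.
    rewrite HJ. ring.
  - unfold L2; simpl. rewrite <- Pi_minus. f_equal. rewrite HS. ring.
Qed.

Definition PiE (r : E) : E := (Pi (fst r), Pi (snd r)).

Lemma LK r : Lmap (K r) = PiE r.
Proof. unfold Lmap, PiE. now rewrite LK1, LK2. Qed.

Lemma PiE_Fmap e g u : PiE (Fmap e g u) = Fmap e g u.
Proof.
  unfold PiE, Fmap; simpl. f_equal; [|apply Pi_Pi].
  apply Pi_strictpos. intros n Hn. unfold F1, Pr. rewrite Wminus_coef, strictpos_Pi by auto.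
  simpl. destruct (Z.ltb_spec 0 n); [lia|]. rewrite clip_0. ring.
Qed.

Ltac ering := unfold addE, subE; simpl; f_equal; ring.

(** The solution is sought as u = bA A + K r. As [Lmap] composed with [K] is the projection [PiE],
    the equation F(u) = 0 becomes the fixed point equation r = PiE r - F(bA A + K r), a contraction
    by strict differentiability. The bound eta * tau on the correction is decisive later: it is
    small relative to the range tau of the parameter and not merely small. *)
Lemma perturbed_crapper : exists C, 0 <= C /\ forall eta, 0 < eta -> exists tau0, 0 < tau0 <= 0.08 /\
  forall tau, 0 < tau <= tau0 -> exists delta, 0 < delta < 1 /\
  forall e g, 0 <= e < delta -> Rabs g < delta ->
  exists u : R -> E, (forall A, Rabs (A - A0) <= tau ->
      F1 e g (u A) = cst 0 /\ F2 e g (u A) = cst 0 /\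
      nE (subE (u A) (bA A)) <= eta * tau) /\
    (forall A B, Rabs (A - A0) <= tau -> Rabs (B - A0) <= tau ->
      nE (subE (u A) (u B)) <= C * Rabs (A - B)).
Proof.
  destruct K_bounded as [[CK [HCK HK]] HKlin]. destruct Lmap_bounded as [CL [HCL HL]].
  exists (40 + CK * (2 * ((CL + 1) * 40))).
  split.
  { apply Rplus_le_le_0_compat; [lra|]. apply Rmult_le_pos; [assumption|]. lra. }
  intros eta Heta.
  (* The three bounds give the contraction factor, the estimate CK * rad <= eta * tau for rad = 324
     * eta1 * tau, and eta1 <= 1 for a Lipschitz constant free of eta. *)
  set (eta1 := Rmin (Rmin (/ 4 / (CK + 1)) (eta / (324 * (CK + 1)))) 1).
  assert (He1 : 0 < eta1).
  { unfold eta1. repeat apply Rmin_glb_lt; try lra; repeat apply Rdiv_lt_0_compat; lra. }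
  assert (He1a : eta1 * (CK + 1) <= / 4).
  { apply Rle_div_r; [lra|]. eapply Rle_trans; [apply Rmin_l|apply Rmin_l]. }
  assert (He1b : eta1 * (324 * (CK + 1)) <= eta).
  { apply Rle_div_r; [lra|]. eapply Rle_trans; [apply Rmin_l|apply Rmin_r]. }
  assert (He1c : eta1 <= 1) by apply Rmin_r.
  destruct (sdiff_pair eta1 He1) as [d1 [Hd1 D1]].
  (* A corrected wave is within (40 + eta) * tau of [b0], hence inside the ball of radius d1; the
     bound 0.08 keeps A between 0.33 and 0.5. *)
  exists (Rmin 0.08 (d1 / (2 * (40 + eta)))).
  split; [split; [apply Rmin_glb_lt; [lra|apply Rdiv_lt_0_compat; lra]|apply Rmin_l]|].
  intros tau [Ht0 Ht].
  assert (Ht1 : tau <= 0.08) by (eapply Rle_trans; [exact Ht|apply Rmin_l]).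
  assert (Ht2 : tau * (40 + eta) < d1).
  { assert (tau * (2 * (40 + eta)) <= d1); [|nra].
    apply Rle_div_r; [lra|]. eapply Rle_trans; [exact Ht|apply Rmin_r]. }
  (* The parameters must be so small that the defect they cause at [b0] is of order eta1 * tau; this
     makes delta depend on tau. *)
  destruct (sdiff_pair (eta1 * tau)) as [d2 [Hd2 D2]]; [now apply Rmult_lt_0_compat|].
  set (delta := Rmin (Rmin d1 d2) (/ 2)).
  assert (Hda : delta <= d1) by (eapply Rle_trans; [apply Rmin_l|apply Rmin_l]).
  assert (Hdb : delta <= d2) by (eapply Rle_trans; [apply Rmin_l|apply Rmin_r]).
  assert (Hdc : delta <= / 2) by apply Rmin_r.
  exists delta. split; [split; [unfold delta; repeat apply Rmin_glb_lt; lra|lra]|].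
  intros e g He Hg.
  destruct (D1 e g ltac:(lra) ltac:(lra)) as [_ Dp].
  destruct (D1 0 0 ltac:(lra) ltac:(rewrite Rabs_R0; lra)) as [_ D0].
  destruct (D2 e g ltac:(lra) ltac:(lra)) as [Db _]. clear D1 D2.
  set (rad := 324 * eta1 * tau).
  assert (Hrad : 0 <= rad) by (unfold rad; nra).
  assert (HKrad : forall r, nE r <= rad -> nE (K r) <= eta * tau).
  { intros r Hr. eapply Rle_trans; [apply HK|].
    apply Rle_trans with (CK * rad); [now apply Rmult_le_compat_l|]. unfold rad. nra. }
  assert (Hhalf : forall A, Rabs (A - A0) <= tau -> Rabs A <= / 2).
  { intros A HA. apply Rabs_le_between in HA. generalize A0_bounds. intros.
    apply Rabs_le; lra. }
  assert (HbA : forall A, Rabs (A - A0) <= tau -> nE (subE (bA A) b0) <= 40 * tau).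
  { intros A HA. rewrite <- bA_A0. eapply Rle_trans; [apply bA_lip|lra].
    - now apply Hhalf.
    - apply A0_half. }
  set (x := fun A r => addE (bA A) (K r)).
  assert (Hx : forall A r, Rabs (A - A0) <= tau -> nE r <= rad -> nE (subE (x A r) b0) < d1).
  { intros A r HA Hr. generalize (HbA A HA) (HKrad r Hr). intros.
    replace (subE (x A r) b0) with (addE (subE (bA A) b0) (K r)) by (unfold x; ering).
    generalize (nE_plus (subE (bA A) b0) (K r)). lra. }
  set (T := fun A r => subE (PiE r) (Fmap e g (x A r))).
  assert (HxA : forall A r r', subE (x A r) (x A r') = K (subE r r')).
  { intros. rewrite HKlin. unfold x. ering. }
  (* The increment from [b0] to bA A is compared, for the perturbed and for the unperturbed map,
     with the same value of [Lmap], which cancels. As the unperturbed map vanishes at bA A, only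
     errors of order eta1 * tau are left, bounded by half of [rad]. *)
  assert (HFA : forall A, Rabs (A - A0) <= tau -> nE (Fmap e g (bA A)) <= 162 * eta1 * tau).
  { intros A HA. assert (HbA' := HbA A HA). assert (He' : 0 <= eta * tau) by nra.
    assert (H1 : nE (subE (bA A) b0) < d1) by lra.
    assert (H2 : nE (subE b0 b0) < d1) by (rewrite nE_self; lra).
    specialize (Dp (bA A) b0 H1 H2). specialize (D0 (bA A) b0 H1 H2).
    assert (HF0 : Fmap 0 0 (bA A) = E0) by (unfold Fmap; now rewrite F1_bA, F2_bA by auto).
    rewrite HF0 in D0.
    set (P := subE (subE (Fmap e g (bA A)) (Fmap e g b0)) (Lmap (subE (bA A) b0))) in *.
    set (Q := subE (subE E0 (Fmap 0 0 b0)) (Lmap (subE (bA A) b0))) in *.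
    assert (Heq : Fmap e g (bA A) = addE (subE P Q) (subE (Fmap e g b0) (Fmap 0 0 b0))).
    { rewrite (surjective_pairing (Fmap e g (bA A))). unfold P, Q, E0. ering. }
    rewrite Heq. eapply Rle_trans; [apply nE_plus|].
    assert (nE (subE P Q) <= nE P + nE Q).
    { generalize (nE_triang P E0 Q). rewrite subE_0, (nE_minus_sym E0), subE_0. lra. }
    nra. }
  assert (Hfix : forall A, exists r, Rabs (A - A0) <= tau -> nE r <= rad /\ T A r = r).
  { intros A. destruct (Rle_dec (Rabs (A - A0)) tau) as [HA|HA].
    2:{ exists E0. intros; contradiction. }
    destruct (contraction (T A) rad Hrad) as [r [Hr1 Hr2]].
    - intros r r' Hr Hr'.
      specialize (Dp (x A r) (x A r') (Hx A r HA Hr) (Hx A r' HA Hr')).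
      rewrite HxA, LK in Dp.
      replace (subE (T A r) (T A r')) with
        (subE (PiE (subE r r')) (subE (Fmap e g (x A r)) (Fmap e g (x A r')))).
      2:{ unfold T, PiE. rewrite (surjective_pairing r), (surjective_pairing r'). simpl fst; simpl snd.
          rewrite !Pi_minus. ering. }
      rewrite nE_minus_sym. eapply Rle_trans; [exact Dp|].
      generalize (HK (subE r r')) (nE_pos (subE r r')) (nE_pos (K (subE r r'))). intros.
      apply Rle_trans with (eta1 * (CK * nE (subE r r'))); [apply Rmult_le_compat_l; lra|].
      rewrite <- Rmult_assoc. apply Rmult_le_compat_r; nra.
    - assert (HK0 : K E0 = E0).
      { replace E0 with (subE E0 E0) at 1 by (unfold E0; ering). rewrite HKlin. 
        rewrite (surjective_pairing (K E0)). unfold E0 at 5. ering. }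
      unfold T, x. rewrite HK0.
      replace (addE (bA A) E0) with (bA A).
      2:{ rewrite (surjective_pairing (bA A)) at 1. unfold E0. ering. }
      replace (PiE E0) with E0 by (unfold PiE, E0; simpl; now rewrite Pi_cst).
      rewrite nE_minus_sym, subE_0. generalize (HFA A HA). unfold rad. lra.
    - exists r. auto. }
  apply choice in Hfix. destruct Hfix as [rA HrA].
  exists (fun A => x A (rA A)). split.
  - intros A HA. destruct (HrA A HA) as [Hr1 Hr2].
    assert (HF : Fmap e g (x A (rA A)) = E0).
    { rewrite <- (subE_0 (Fmap _ _ _)). 
      (* A fixed point is a value of [T], hence invariant under [PiE], after which r = PiE r - F
         says that F = 0. *)
      assert (HP : PiE (rA A) = rA A).
      { rewrite <- Hr2 at 1. rewrite <- Hr2 at 2. unfold T.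
        transitivity (subE (PiE (PiE (rA A))) (PiE (Fmap e g (x A (rA A))))).
        - unfold PiE, subE; simpl. now rewrite !Pi_minus.
        - rewrite PiE_Fmap. f_equal. unfold PiE; simpl. now rewrite !Pi_Pi. }
      unfold T in Hr2. rewrite HP in Hr2.
      apply nE_eq. rewrite subE_0.
      replace (Fmap e g (x A (rA A))) with (subE (rA A) (subE (rA A) (Fmap e g (x A (rA A))))).
      2:{ rewrite (surjective_pairing (Fmap e g (x A (rA A)))) at 2. ering. }
      rewrite Hr2, subE_0, nE_self. lra. }
    assert (H1 := f_equal fst HF). assert (H2 := f_equal snd HF). split; [exact H1|]. split; [exact H2|].
    replace (subE (x A (rA A)) (bA A)) with (K (rA A)).
    2:{ rewrite (surjective_pairing (K (rA A))) at 1. unfold x. ering. }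
    now apply HKrad.
  - intros A B HA HB. destruct (HrA A HA) as [Ha1 Ha2]. destruct (HrA B HB) as [Hb1 Hb2].
    set (r := rA A) in *. set (s := rA B) in *.
    assert (Hl := bA_lip A B (Hhalf A HA) (Hhalf B HB)).
    set (dl := subE (bA A) (bA B)) in *. set (dr := subE r s).
    assert (Hxx : subE (x A r) (x B s) = addE dl (K dr)).
    { unfold dr. rewrite HKlin. unfold x, dl. ering. }
    specialize (Dp (x A r) (x B s) (Hx A r HA Ha1) (Hx B s HB Hb1)). rewrite Hxx in Dp.
    assert (Hn : nE (addE dl (K dr)) <= 40 * Rabs (A - B) + CK * nE dr).
    { eapply Rle_trans; [apply nE_plus|]. generalize (HK dr). lra. }
    assert (HLsum : Lmap (addE dl (K dr)) = addE (Lmap dl) (PiE dr)).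
    { rewrite <- LK.
      assert (Hd : dl = subE (addE dl (K dr)) (K dr)).
      { rewrite (surjective_pairing dl) at 1. ering. }
      rewrite Hd at 2. rewrite Lmap_minus. rewrite (surjective_pairing (Lmap _)) at 1. ering. }
    rewrite HLsum in Dp.
    set (Dl := subE (subE (Fmap e g (x A r)) (Fmap e g (x B s))) (addE (Lmap dl) (PiE dr))) in *.
    (* In the difference of the two fixed point equations, PiE dr cancels against the same term in
       the linear part of the increment of F. *)
    assert (Hdr : dr = subE (subE E0 Dl) (Lmap dl)).
    { transitivity (subE (T A r) (T B s)); [unfold dr; now rewrite Ha2, Hb2|].
      unfold T, Dl, dr, PiE, E0. unfold subE at 6; simpl fst; simpl snd. rewrite !Pi_minus. ering. }
    assert (Hrr : nE dr <= nE Dl + nE (Lmap dl)).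
    { rewrite Hdr at 1. generalize (nE_triang (subE E0 Dl) E0 (Lmap dl)).
      rewrite subE_0, (nE_minus_sym E0), (nE_minus_sym E0), !subE_0. lra. }
    assert (Hd0 := nE_pos dr). assert (HLd := HL dl). assert (Hab := Rabs_pos (A - B)).
    assert (nE Dl <= eta1 * (40 * Rabs (A - B) + CK * nE dr)).
    { eapply Rle_trans; [exact Dp|]. apply Rmult_le_compat_l; lra. }
    assert (CL * nE dl <= CL * (40 * Rabs (A - B))) by now apply Rmult_le_compat_l.
    assert (eta1 * CK * nE dr <= / 4 * nE dr) by (apply Rmult_le_compat_r; nra).
    assert (nE dr <= 2 * ((CL + 1) * 40) * Rabs (A - B)) by nra.
    rewrite Hxx. eapply Rle_trans; [exact Hn|].
    assert (CK * nE dr <= CK * (2 * ((CL + 1) * 40) * Rabs (A - B))) by now apply Rmult_le_compat_l.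
    lra.
Qed.

(** * Complex differentiation *)

(** An epsilon-delta form in the modulus, in which the estimates are made; [cderiv_is_derive] passes
    to the derivative of the library. *)
Definition cderiv (f : C -> C) (w l : C) : Prop :=
  forall e, 0 < e -> exists d, 0 < d /\ forall v, Cmod (v - w)%C < d ->
    Cmod (f v - f w - l * (v - w))%C <= e * Cmod (v - w)%C.

Definition ccont (f : C -> C) (w : C) : Prop :=
  forall e, 0 < e -> exists d, 0 < d /\ forall v, Cmod (v - w)%C < d -> Cmod (f v - f w)%C < e.

Lemma Cmod_sym (a b : C) : Cmod (a - b)%C = Cmod (b - a)%C.
Proof. rewrite <- Cmod_opp. f_equal. ring. Qed.

Lemma Cmod_sub_triangle (a b c : C) : Cmod (a - c)%C <= Cmod (a - b)%C + Cmod (b - c)%C.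
Proof. replace (a - c)%C with ((a - b) + (b - c))%C by ring. apply Cmod_triangle. Qed.

Lemma Cmod_self (a : C) : Cmod (a - a)%C = 0.
Proof. replace (a - a)%C with (RtoC 0) by ring. apply Cmod_0. Qed.

Lemma Cmod_le_sum (a : C) : Cmod a <= Rabs (Re a) + Rabs (Im a).
Proof.
  destruct a as [x y]. unfold Cmod; simpl.
  apply Rsqr_incr_0_var; [|apply Rplus_le_le_0_compat; apply Rabs_pos].
  rewrite Rsqr_sqrt by nra. unfold Rsqr.
  generalize (Rabs_pos x) (Rabs_pos y) (Rsqr_abs x) (Rsqr_abs y). unfold Rsqr. nra.
Qed.

Lemma im_le_Cmod (c : C) : Rabs (Im c) <= Cmod c.
Proof. eapply Rle_trans; [apply Rmax_r|]. apply Rmax_Cmod. Qed.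

Lemma Cmod_eq0 (a b : C) : Cmod (a - b)%C <= 0 -> a = b.
Proof.
  intros H. assert (H1 : (a - b)%C = RtoC 0).
  { apply Cmod_eq_0. generalize (Cmod_ge_0 (a - b)%C). lra. }
  replace a with ((a - b) + b)%C by ring. rewrite H1. ring.
Qed.

Lemma locally_Cmod (p : C) (U : C -> Prop) :
  @locally C_UniformSpace p U <-> exists d, 0 < d /\ forall q, Cmod (q - p)%C < d -> U q.
Proof.
  split.
  - intros [d Hd]. exists d. split; [apply cond_pos|]. intros q Hq. apply Hd. split.
    + change (Rabs (Re q - Re p) < d). eapply Rle_lt_trans; [|exact Hq].
      apply (re_le_Cmod (q - p)%C).
    + change (Rabs (Im q - Im p) < d). eapply Rle_lt_trans; [|exact Hq].
      apply (im_le_Cmod (q - p)%C).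
  - intros [d [Hd H]]. assert (Hd2 : 0 < d / 2) by lra. exists (mkposreal _ Hd2).
    intros q [H1 H2]. apply H.
    change (Rabs (Re q - Re p) < d / 2) in H1. change (Rabs (Im q - Im p) < d / 2) in H2.
    eapply Rle_lt_trans; [apply Cmod_le_sum|].
    change (Re (q - p)%C) with (Re q - Re p). change (Im (q - p)%C) with (Im q - Im p). lra.
Qed.

Lemma cderiv_is_derive (f : C -> C) w l :
  cderiv f w l -> @is_derive C_AbsRing C_NormedModule f w l.
Proof.
  intros H. split; [apply @is_linear_scal_l|].
  intros x Hx. apply (@is_filter_lim_locally_unique C_AbsRing (AbsRing_NormedModule C_AbsRing)) in Hx. subst x.
  intros [e He]. destruct (H e He) as [d [Hd H1]].
  exists (mkposreal d Hd). intros v Hv. specialize (H1 v Hv). simpl.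
  eapply Rle_trans; [|exact H1]. right.
  change (Cmod (f v - f w - (v - w) * l)%C = Cmod (f v - f w - l * (v - w))%C). f_equal. ring.
Qed.

Lemma cderiv_ccont f w l : cderiv f w l -> ccont f w.
Proof.
  intros H e He. destruct (H 1 Rlt_0_1) as [d [Hd H1]].
  assert (Hl := Cmod_ge_0 l).
  exists (Rmin d (e / (2 + Cmod l))). split; [apply Rmin_glb_lt; [lra|apply Rdiv_lt_0_compat; lra]|].
  intros v Hv.
  assert (Hv1 : Cmod (v - w)%C < d) by (eapply Rlt_le_trans; [exact Hv|apply Rmin_l]).
  assert (Hv2 : Cmod (v - w)%C * (2 + Cmod l) < e).
  { apply Rlt_div_r; [lra|]. eapply Rlt_le_trans; [exact Hv|apply Rmin_r]. }
  specialize (H1 v Hv1). assert (Hp := Cmod_ge_0 (v - w)%C).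
  replace (f v - f w)%C with ((f v - f w - l * (v - w)) + l * (v - w))%C by ring.
  eapply Rle_lt_trans; [apply Cmod_triangle|]. rewrite Cmod_mult.
  destruct Hp as [Hp|Hp]; nra.
Qed.

Lemma cderiv_ext f g w l : (forall v, f v = g v) -> cderiv f w l -> cderiv g w l.
Proof.
  intros E H e He. destruct (H e He) as [d [Hd H1]]. exists d. split; auto.
  intros v Hv. rewrite <- !E. auto.
Qed.

Lemma cderiv_const c w : cderiv (fun _ => c) w 0.
Proof.
  intros e He. exists 1. split; [lra|]. intros v _.
  replace (c - c - 0 * (v - w))%C with (RtoC 0) by ring. rewrite Cmod_0.
  apply Rmult_le_pos; [lra|apply Cmod_ge_0].
Qed.

Lemma cderiv_id w : cderiv (fun v => v) w 1.
Proof.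
  intros e He. exists 1. split; [lra|]. intros v _.
  replace (v - w - 1 * (v - w))%C with (RtoC 0) by ring. rewrite Cmod_0.
  apply Rmult_le_pos; [lra|apply Cmod_ge_0].
Qed.

Lemma cderiv_plus f g w l m : cderiv f w l -> cderiv g w m ->
  cderiv (fun v => f v + g v)%C w (l + m)%C.
Proof.
  intros H1 H2 e He. destruct (H1 (e/2) ltac:(lra)) as [d1 [Hd1 K1]].
  destruct (H2 (e/2) ltac:(lra)) as [d2 [Hd2 K2]].
  exists (Rmin d1 d2). split; [now apply Rmin_glb_lt|]. intros v Hv.
  specialize (K1 v ltac:(eapply Rlt_le_trans; [exact Hv|apply Rmin_l])).
  specialize (K2 v ltac:(eapply Rlt_le_trans; [exact Hv|apply Rmin_r])).
  replace (f v + g v - (f w + g w) - (l + m) * (v - w))%C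
    with ((f v - f w - l * (v - w)) + (g v - g w - m * (v - w)))%C by ring.
  eapply Rle_trans; [apply Cmod_triangle|]. lra.
Qed.

Lemma cderiv_scal c f w l : cderiv f w l -> cderiv (fun v => c * f v)%C w (c * l)%C.
Proof.
  intros H e He. assert (Hc := Cmod_ge_0 c).
  destruct (H (e / (Cmod c + 1))) as [d [Hd K]]; [apply Rdiv_lt_0_compat; lra|].
  exists d. split; [auto|]. intros v Hv. specialize (K v Hv).
  replace (c * f v - c * f w - c * l * (v - w))%C with (c * (f v - f w - l * (v - w)))%C by ring.
  rewrite Cmod_mult.
  apply Rle_trans with ((Cmod c + 1) * (e / (Cmod c + 1) * Cmod (v - w)%C)).
  - apply Rmult_le_compat; [lra|apply Cmod_ge_0|lra|exact K].
  - right. field. lra.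
Qed.

Lemma cderiv_comp f g w l m : cderiv g w m -> cderiv f (g w) l ->
  cderiv (fun v => f (g v)) w (l * m)%C.
Proof.
  intros Hg Hf e He.
  assert (Hl := Cmod_ge_0 l). assert (Hm := Cmod_ge_0 m).
  set (e1 := e / (2 * (Cmod m + 1))).
  assert (He1 : 0 < e1) by (apply Rdiv_lt_0_compat; lra).
  destruct (Hf e1 He1) as [d1 [Hd1 K1]].
  set (e2 := Rmin 1 (e / (2 * (Cmod l + 1)))).
  assert (He2 : 0 < e2) by (apply Rmin_glb_lt; [lra|apply Rdiv_lt_0_compat; lra]).
  destruct (Hg e2 He2) as [d2 [Hd2 K2]].
  destruct (cderiv_ccont _ _ _ Hg d1 Hd1) as [d3 [Hd3 K3]].
  exists (Rmin d2 d3). split; [now apply Rmin_glb_lt|]. intros v Hv.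
  specialize (K2 v ltac:(eapply Rlt_le_trans; [exact Hv|apply Rmin_l])).
  specialize (K3 v ltac:(eapply Rlt_le_trans; [exact Hv|apply Rmin_r])).
  specialize (K1 _ K3). assert (Hp := Cmod_ge_0 (v - w)%C).
  assert (E1 : Cmod (g v - g w)%C <= (Cmod m + 1) * Cmod (v - w)%C).
  { replace (g v - g w)%C with ((g v - g w - m * (v - w)) + m * (v - w))%C by ring.
    eapply Rle_trans; [apply Cmod_triangle|]. rewrite Cmod_mult.
    assert (e2 <= 1) by apply Rmin_l. nra. }
  replace (f (g v) - f (g w) - l * m * (v - w))%C
    with ((f (g v) - f (g w) - l * (g v - g w)) + l * (g v - g w - m * (v - w)))%C by ring.
  eapply Rle_trans; [apply Cmod_triangle|]. rewrite Cmod_mult.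
  assert (T1 : e1 * Cmod (g v - g w)%C <= e / 2 * Cmod (v - w)%C).
  { apply Rle_trans with (e1 * ((Cmod m + 1) * Cmod (v - w)%C)); [apply Rmult_le_compat_l; lra|].
    right. unfold e1. field. lra. }
  assert (T2 : Cmod l * Cmod (g v - g w - m * (v - w))%C <= e / 2 * Cmod (v - w)%C).
  { apply Rle_trans with ((Cmod l + 1) * (e / (2 * (Cmod l + 1)) * Cmod (v - w)%C)).
    - apply Rmult_le_compat; [lra|apply Cmod_ge_0|lra|].
      eapply Rle_trans; [exact K2|]. apply Rmult_le_compat_r; [lra|apply Rmin_r].
    - right. field. lra. }
  lra.
Qed.

(** * One-sided exponential series *)

Lemma exp_le x y : x <= y -> exp x <= exp y.
Proof. intros [H| ->]; [left; now apply exp_increasing|right; reflexivity]. Qed.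

Lemma exp_sub1_bound x : Rabs (exp x - 1) <= Rabs x * exp (Rabs x).
Proof.
  assert (H1 := exp_ineq1_le x). assert (H2 := exp_ineq1_le (- x)).
  assert (H3 := exp_pos x). assert (H4 : exp x * exp (- x) = 1).
  { rewrite <- exp_plus. rewrite Rplus_opp_r. apply exp_0. }
  unfold Rabs at 2 3. destruct (Rcase_abs x).
  - assert (1 <= exp (- x)) by lra. apply Rabs_le; split; nra.
  - apply Rabs_le; split; nra.
Qed.

Lemma exp_sub2_bound x : Rabs (exp x - 1 - x) <= x * x * exp (Rabs x).
Proof.
  assert (H1 := exp_ineq1_le x). assert (H2 := exp_ineq1_le (- x)).
  assert (H3 := exp_pos x). assert (H4 : exp x * exp (- x) = 1).
  { rewrite <- exp_plus. rewrite Rplus_opp_r. apply exp_0. }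
  rewrite Rabs_right by lra.
  unfold Rabs. destruct (Rcase_abs x).
  - assert (1 <= exp (- x)) by lra.
    apply Rle_trans with (x * x); [|nra].
    assert (exp x * (1 - x) <= 1) by nra. nra.
  - assert (exp x - 1 <= x * exp x) by nra. nra.
Qed.

Lemma sin_abs_le x : Rabs (sin x) <= Rabs x.
Proof.
  assert (H : forall y, 0 < y -> Rabs (sin y) <= y).
  { intros y Hy. generalize (sin_lt_x y Hy). intros. apply Rabs_le. split; [|lra].
    destruct (Rle_dec y PI).
    - generalize (sin_ge_0 y ltac:(lra) r). lra.
    - generalize PI2_3_2 (SIN_bound y). lra. }
  destruct (Rtotal_order x 0) as [Hx|[->|Hx]].
  - rewrite <- Rabs_Ropp, <- sin_neg, (Rabs_left x) by assumption. apply H. lra.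
  - rewrite sin_0. lra.
  - rewrite (Rabs_right x) by lra. now apply H.
Qed.

Lemma cos_sub1_half x : 1 - cos x = 2 * (sin (x / 2) * sin (x / 2)).
Proof. replace x with (2 * (x / 2)) at 1 by field. rewrite cos_2a_sin. ring. Qed.

Lemma cos_sub1_bound x : Rabs (cos x - 1) <= x * x.
Proof.
  rewrite Rabs_minus_sym, cos_sub1_half.
  generalize (sin_abs_le (x / 2)) (Rabs_pos (sin (x/2))). intros.
  assert (Rabs (x/2) * Rabs (x/2) = x * x / 4).
  { rewrite <- Rabs_mult, Rabs_right; [field|]. nra. }
  assert (Rabs (sin (x/2)) * Rabs (sin (x/2)) = sin (x/2) * sin (x/2)).
  { rewrite <- Rabs_mult, Rabs_right; [reflexivity|]. nra. }
  rewrite Rabs_right by nra. nra.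
Qed.

Lemma cos_sub1_bound1 x : Rabs (cos x - 1) <= Rabs x.
Proof.
  rewrite Rabs_minus_sym, cos_sub1_half.
  generalize (sin_abs_le (x / 2)) (Rabs_pos (sin (x/2))) (SIN_bound (x/2)). intros.
  assert (Rabs (sin (x/2)) <= 1) by (apply Rabs_le; lra).
  assert (Rabs (sin (x/2)) * Rabs (sin (x/2)) = sin (x/2) * sin (x/2)).
  { rewrite <- Rabs_mult, Rabs_right; [reflexivity|]. nra. }
  assert (Rabs (x/2) = Rabs x / 2).
  { unfold Rdiv. rewrite Rabs_mult, (Rabs_right (/2)); lra. }
  rewrite Rabs_right by nra. nra.
Qed.

Lemma sin_sub_bound x : Rabs (sin x - x) <= x * x.
Proof.
  destruct (MVT_gen (fun y => sin y - y) 0 x (fun y => cos y - 1)) as [c [Hc E]].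
  - intros y _. auto_derive; [trivial|ring].
  - intros y _. apply continuity_pt_minus; [apply continuity_sin|apply derivable_continuous_pt, derivable_pt_id].
  - rewrite sin_0 in E. replace (sin x - x) with ((cos c - 1) * x) by lra.
    rewrite Rabs_mult. generalize (cos_sub1_bound1 c). intros.
    assert (Rabs c <= Rabs x).
    { unfold Rmin, Rmax in Hc. unfold Rabs. destruct (Rle_dec 0 x), (Rcase_abs c), (Rcase_abs x); lra. }
    assert (Rabs x * Rabs x = x * x) by (rewrite <- Rabs_mult, Rabs_right; [reflexivity|nra]).
    generalize (Rabs_pos x) (Rabs_pos (cos c - 1)). nra.
Qed.

(* ee w = e^{-iw} *)
Definition ee (w : C) : C := (exp (Im w) * cos (Re w), - (exp (Im w) * sin (Re w))).

Lemma ee_plus u v : ee (u + v)%C = (ee u * ee v)%C.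
Proof.
  destruct u as [a b], v as [c d]. unfold ee, Cmult, Cplus; simpl.
  rewrite exp_plus, cos_plus, sin_plus. f_equal; ring.
Qed.

Lemma Cmod_ee w : Cmod (ee w) = exp (Im w).
Proof.
  unfold Cmod, ee; simpl fst; simpl snd.
  rewrite <- (sqrt_Rsqr (exp (Im w))) at 3 by (left; apply exp_pos). f_equal. unfold Rsqr.
  generalize (sin2_cos2 (Re w)). unfold Rsqr. intros.
  transitivity (exp (Im w) * exp (Im w) * (sin (Re w) * sin (Re w) + cos (Re w) * cos (Re w))); [ring|].
  rewrite H. ring.
Qed.

(** Quadratic Taylor remainder of e^{-iu}, valid for all u, as termwise differentiation of an
    exponential series requires. *)
Lemma ee_bound u : Cmod (ee u - 1 + Ci * u)%C <= 3 * exp (Cmod u) * (Cmod u * Cmod u).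
Proof.
  assert (Hr := re_le_Cmod u). assert (Hi := im_le_Cmod u).
  assert (Hm : Cmod u * Cmod u = Re u * Re u + Im u * Im u).
  { unfold Cmod. rewrite sqrt_sqrt; [destruct u; simpl; ring|]. destruct u; simpl; nra. }
  eapply Rle_trans; [apply Cmod_le_sum|].
  destruct u as [x y]. simpl in Hr, Hi, Hm |- *.
  set (r := Cmod (x, y)) in *.
  replace (exp y * cos x + - (1) + (0 * x - 1 * y))
    with ((exp y - 1 - y) + exp y * (cos x - 1)) by ring.
  replace (- (exp y * sin x) + - 0 + (0 * y + 1 * x))
    with (- ((exp y - 1) * sin x) + - (sin x - x)) by ring.
  generalize (Rabs_triang (exp y - 1 - y) (exp y * (cos x - 1)))
    (Rabs_triang (- ((exp y - 1) * sin x)) (- (sin x - x))).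
  rewrite !Rabs_Ropp, !Rabs_mult, (Rabs_right (exp y)) by (left; apply exp_pos).
  generalize (exp_sub1_bound y) (exp_sub2_bound y) (cos_sub1_bound x) (sin_abs_le x) (sin_sub_bound x).
  intros B1 B2 B3 B4 B5 T1 T2.
  assert (Q1 : exp (Rabs y) <= exp r) by now apply exp_le.
  assert (Q2 : exp y <= exp r) by (apply exp_le; generalize (Rle_abs y); lra).
  assert (Q3 : 1 <= exp r) by (generalize (exp_ineq1_le r) (Rabs_pos x); lra).
  assert (P := exp_pos y). assert (P2 := exp_pos (Rabs y)).
  assert (X1 : Rabs x * Rabs x = x * x) by (rewrite <- Rabs_mult, Rabs_right; [reflexivity|nra]).
  assert (Y1 : Rabs y * Rabs y = y * y) by (rewrite <- Rabs_mult, Rabs_right; [reflexivity|nra]).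
  assert (Px := Rabs_pos x). assert (Py := Rabs_pos y).
  assert (Z1 : exp y * Rabs (cos x - 1) <= exp r * (x * x)).
  { apply Rmult_le_compat; [lra|apply Rabs_pos|lra|lra]. }
  assert (Z2 : Rabs (exp y - 1) * Rabs (sin x) <= (Rabs y * exp r) * Rabs x).
  { apply Rmult_le_compat; try apply Rabs_pos; [|lra]. nra. }
  assert (Z3 : y * y * exp (Rabs y) <= y * y * exp r) by (apply Rmult_le_compat_l; nra).
  rewrite Hm.
  assert (Sq := Rle_0_sqr (Rabs x - Rabs y)). unfold Rsqr in Sq.
  assert (Rabs y * Rabs x <= (x * x + y * y) / 2) by lra.
  assert (Rabs y * exp r * Rabs x <= exp r * ((x * x + y * y) / 2)).
  { replace (Rabs y * exp r * Rabs x) with (exp r * (Rabs y * Rabs x)) by ring.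
    apply Rmult_le_compat_l; lra. }
  assert (x * x <= exp r * (x * x)) by nra.
  assert (0 <= exp r * (x * x)) by nra. assert (0 <= exp r * (y * y)) by nra. lra.
Qed.

Lemma Series_pos x : (forall n, 0 <= x n) -> ex_series x -> 0 <= Series x.
Proof.
  intros H Hx. replace 0 with (Series (fun n => 0 * x n)) by (rewrite Series_scal_l; ring).
  apply Series_le; [|exact Hx]. intros n. specialize (H n). lra.
Qed.

Definition CSeries (c : nat -> C) : C := (Series (fun n => Re (c n)), Series (fun n => Im (c n))).

Lemma CSeries_bound c M : (forall n, Cmod (c n) <= M n) -> ex_series M ->
  ex_series (fun n => Re (c n)) /\ ex_series (fun n => Im (c n)) /\
  Cmod (CSeries c) <= 2 * Series M.
Proof.
  intros H HM.
  assert (H1 : forall n, Rabs (Re (c n)) <= M n) by (intros; eapply Rle_trans; [apply re_le_Cmod|auto]).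
  assert (H2 : forall n, Rabs (Im (c n)) <= M n) by (intros; eapply Rle_trans; [apply im_le_Cmod|auto]).
  assert (E1 : ex_series (fun n => Re (c n))) by (apply @ex_series_le with (b := M); auto).
  assert (E2 : ex_series (fun n => Im (c n))) by (apply @ex_series_le with (b := M); auto).
  split; [exact E1|]. split; [exact E2|].
  assert (B : forall x : nat -> R, (forall n, Rabs (x n) <= M n) -> Rabs (Series x) <= Series M).
  { intros x Hx. eapply Rle_trans; [apply Series_Rabs|].
    - apply @ex_series_le with (b := M); auto. intros n. change norm with Rabs. rewrite Rabs_Rabsolu; auto.
    - apply Series_le; auto. intros; split; auto using Rabs_pos. }
  eapply Rle_trans; [apply Cmod_le_sum|]. simpl.
  generalize (B _ H1) (B _ H2). lra.
Qed.

(** Absolute convergence, on the half plane Im w <= s, of the series with terms b_n e^{-inw}. *)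
Definition decay (s : R) (b : nat -> R) : Prop := ex_series (fun n => Rabs (b n) * exp (s * INR n)).

Definition nb (b : nat -> R) (n : nat) : R := INR n * b n.

Definition gterm (b : nat -> R) (w : C) (n : nat) : C := (b n * ee (INR n * w))%C.
Definition G1 (b : nat -> R) (w : C) : C := CSeries (gterm b w).

Lemma Im_scal (x : R) (w : C) : Im (x * w)%C = x * Im w.
Proof. destruct w; simpl. ring. Qed.

Lemma Cmod_gterm b w n : Cmod (gterm b w n) = Rabs (b n) * exp (Im w * INR n).
Proof.
  unfold gterm. rewrite Cmod_mult, Cmod_R, Cmod_ee, Im_scal. do 2 f_equal. ring.
Qed.

Lemma decay_term s b w : decay s b -> Im w <= s -> ex_series (fun n => Rabs (b n) * exp (Im w * INR n)).
Proof.
  intros H Hw. apply @ex_series_le with (2 := H). intros n. change norm with Rabs.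
  rewrite Rabs_right.
  2:{ apply Rle_ge, Rmult_le_pos; [apply Rabs_pos|left; apply exp_pos]. }
  apply Rmult_le_compat_l; [apply Rabs_pos|]. apply exp_le, Rmult_le_compat_r; [apply pos_INR|lra].
Qed.

Lemma lin_le_exp t n : 0 < t -> INR n <= / t * exp (t * INR n).
Proof.
  intros Ht. generalize (exp_ineq1_le (t * INR n)). intros.
  apply Rmult_le_reg_l with t; [lra|]. rewrite <- Rmult_assoc, Rinv_r by lra. lra.
Qed.

Lemma decay_diff s s' b : decay s b -> s' < s -> decay s' (nb b).
Proof.
  intros H Hs. unfold decay.
  apply @ex_series_le with (b := fun n => / (s - s') * (Rabs (b n) * exp (s * INR n))).
  2:{ apply (ex_series_scal_l (/ (s - s')) _ H). }
  intros n. change norm with Rabs. unfold nb.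
  assert (Hn := pos_INR n).
  rewrite !Rabs_mult, !Rabs_Rabsolu, (Rabs_right (INR n)), (Rabs_right (exp _)) by
    (try apply Rle_ge; try assumption; left; apply exp_pos).
  replace (s * INR n) with ((s - s') * INR n + s' * INR n) by ring. rewrite exp_plus.
  generalize (lin_le_exp (s - s') n ltac:(lra)). intros.
  replace (/ (s - s') * (Rabs (b n) * (exp ((s - s') * INR n) * exp (s' * INR n))))
    with ((/ (s - s') * exp ((s - s') * INR n)) * (Rabs (b n) * exp (s' * INR n))) by ring.
  replace (INR n * Rabs (b n) * exp (s' * INR n)) with (INR n * (Rabs (b n) * exp (s' * INR n))) by ring.
  apply Rmult_le_compat_r; [|assumption].
  apply Rmult_le_pos; [apply Rabs_pos|left; apply exp_pos].
Qed.

Lemma CSeries_lin c1 c2 c3 (k1 k2 k3 : C) :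
  ex_series (fun n => Re (c1 n)) -> ex_series (fun n => Im (c1 n)) ->
  ex_series (fun n => Re (c2 n)) -> ex_series (fun n => Im (c2 n)) ->
  ex_series (fun n => Re (c3 n)) -> ex_series (fun n => Im (c3 n)) ->
  CSeries (fun n => k1 * c1 n + k2 * c2 n + k3 * c3 n)%C
   = (k1 * CSeries c1 + k2 * CSeries c2 + k3 * CSeries c3)%C.
Proof.
  intros A1 A2 B1 B2 D1 D2.
  assert (L : forall (x1 x2 x3 x4 x5 x6 : nat -> R) a1 a2 a3 a4 a5 a6,
    ex_series x1 -> ex_series x2 -> ex_series x3 -> ex_series x4 -> ex_series x5 -> ex_series x6 ->
    Series (fun n => a1 * x1 n + (a2 * x2 n + (a3 * x3 n + (a4 * x4 n + (a5 * x5 n + a6 * x6 n)))))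
    = a1 * Series x1 + (a2 * Series x2 + (a3 * Series x3 + (a4 * Series x4 + (a5 * Series x5 + a6 * Series x6))))).
  { intros. assert (S : forall a x, ex_series x -> ex_series (fun n => a * x n)).
    { intros a x. apply (ex_series_scal_l a x). }
    assert (P : forall x y : nat -> R, ex_series x -> ex_series y -> ex_series (fun n => x n + y n)).
    { intros x y. apply (ex_series_plus x y). }
    rewrite !Series_plus, !Series_scal_l by auto 10. ring. }
  destruct k1 as [p1 q1], k2 as [p2 q2], k3 as [p3 q3].
  unfold CSeries, Cplus, Cmult; simpl. f_equal.
  - rewrite (Series_ext _ (fun n => p1 * Re (c1 n) + (- q1 * Im (c1 n) + (p2 * Re (c2 n)
      + (- q2 * Im (c2 n) + (p3 * Re (c3 n) + - q3 * Im (c3 n))))))).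
    + rewrite L by assumption. ring.
    + intros n. unfold Re, Im. ring.
  - rewrite (Series_ext _ (fun n => p1 * Im (c1 n) + (q1 * Re (c1 n) + (p2 * Im (c2 n)
      + (q2 * Re (c2 n) + (p3 * Im (c3 n) + q3 * Re (c3 n))))))).
    + rewrite L by assumption. ring.
    + intros n. unfold Re, Im. ring.
Qed.

Lemma G1_cderiv s b w : decay s b -> Im w < s ->
  cderiv (G1 b) w (- Ci * G1 (nb b) w)%C.
Proof.
  intros H Hw e He.
  (* One third of the gap to s pays for the displacement v - w, another one for the factor n^2 of
     the quadratic remainder. *)
  set (t := (s - Im w) / 3). assert (Ht : 0 < t) by (unfold t; lra).
  set (S := Series (fun n => Rabs (b n) * exp (s * INR n))).
  assert (HS : 0 <= S).
  { unfold S. apply Series_pos; [|exact H]. intros n. apply Rmult_le_pos; [apply Rabs_pos|left; apply exp_pos]. }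
  set (Kc := 6 * (/ t * / t * 4) * S + 1).
  assert (HK : 0 < Kc).
  { unfold Kc. assert (0 < / t) by now apply Rinv_0_lt_compat.
    assert (0 <= / t * / t * 4 * S) by (repeat apply Rmult_le_pos; lra). lra. }
  exists (Rmin t (e / Kc)). split; [apply Rmin_glb_lt; [lra|apply Rdiv_lt_0_compat; lra]|].
  intros v Hv. set (h := (v - w)%C).
  assert (Hv1 : Cmod h < t) by (eapply Rlt_le_trans; [exact Hv|apply Rmin_l]).
  assert (Hv2 : Cmod h * Kc < e).
  { apply Rlt_div_r; [lra|]. eapply Rlt_le_trans; [exact Hv|apply Rmin_r]. }
  assert (Hh := Cmod_ge_0 h).
  assert (Hv3 : Im v <= s).
  { replace (Im v) with (Im w + Im h) by (unfold h, Cminus, Cplus, Copp; simpl; unfold Im; ring).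
    generalize (im_le_Cmod h) (Rle_abs (Im h)). unfold t in Hv1. lra. }
  set (M := fun n => 3 * (/ t * / t * 4) * (Cmod h * Cmod h) * (Rabs (b n) * exp (s * INR n))).
  assert (HM : ex_series M) by apply (ex_series_scal_l (3 * (/ t * / t * 4) * (Cmod h * Cmod h)) _ H).
  assert (Hd : decay ((s + Im w) / 2) (nb b)) by (apply decay_diff with s; [auto|lra]).
  pose proof (fun c M Hc HM => CSeries_bound c M Hc HM) as CB.
  destruct (CB (gterm b v) _ (fun n => Req_le _ _ (Cmod_gterm b v n)) (decay_term s b v H Hv3)) as (A1 & A2 & _).
  destruct (CB (gterm b w) _ (fun n => Req_le _ _ (Cmod_gterm b w n)) (decay_term s b w H ltac:(lra))) as (B1 & B2 & _).
  destruct (CB (gterm (nb b) w) _ (fun n => Req_le _ _ (Cmod_gterm _ w n))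
    (decay_term _ _ w Hd ltac:(lra))) as (D1 & D2 & _).
  assert (E : (G1 b v - G1 b w - - Ci * G1 (nb b) w * h)%C
    = CSeries (fun n => 1 * gterm b v n + (-1)%R * gterm b w n + (Ci * h) * gterm (nb b) w n)%C).
  { rewrite CSeries_lin by assumption. unfold G1. ring. }
  fold h. rewrite E.
  destruct (CB (fun n => 1 * gterm b v n + (-1)%R * gterm b w n + (Ci * h) * gterm (nb b) w n)%C M)
    as (_ & _ & CBB).
  - intros n.
    replace (1 * gterm b v n + (-1)%R * gterm b w n + Ci * h * gterm (nb b) w n)%C
      with (gterm b w n * (ee (INR n * h) - 1 + Ci * (INR n * h)))%C.
    2:{ unfold gterm, nb. rewrite RtoC_mult. replace (INR n * v)%C with (INR n * w + INR n * h)%C by (unfold h; ring).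
        rewrite ee_plus. ring. }
    rewrite Cmod_mult, Cmod_gterm.
    assert (Hn := pos_INR n).
    assert (Hm : Cmod (INR n * h)%C = INR n * Cmod h) by (rewrite Cmod_mult, Cmod_R, Rabs_right; lra).
    assert (Hb := ee_bound (INR n * h)%C). rewrite Hm in Hb.
    unfold M.
    assert (Hn2 : INR n * INR n <= / t * / t * 4 * exp (t * INR n)).
    { generalize (lin_le_exp (t / 2) n ltac:(lra)). intros L.
      replace (exp (t * INR n)) with (exp (t / 2 * INR n) * exp (t / 2 * INR n)).
      2:{ rewrite <- exp_plus. f_equal. field. }
      replace (/ t * / t * 4 * (exp (t / 2 * INR n) * exp (t / 2 * INR n)))
        with ((/ (t / 2) * exp (t / 2 * INR n)) * (/ (t / 2) * exp (t / 2 * INR n))) by (field; lra).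
      apply Rmult_le_compat; lra. }
    assert (Hexp : exp (Im w * INR n) * exp (INR n * Cmod h) * exp (t * INR n) <= exp (s * INR n)).
    { rewrite <- !exp_plus. apply exp_le. unfold t in *. nra. }
    assert (P1 := exp_pos (Im w * INR n)). assert (P2 := exp_pos (INR n * Cmod h)).
    apply Rle_trans with (Rabs (b n) * exp (Im w * INR n) *
       (3 * exp (INR n * Cmod h) * (INR n * Cmod h * (INR n * Cmod h)))).
    { apply Rmult_le_compat_l; [|exact Hb]. apply Rmult_le_pos; [apply Rabs_pos|lra]. }
    replace (Rabs (b n) * exp (Im w * INR n) * (3 * exp (INR n * Cmod h) * (INR n * Cmod h * (INR n * Cmod h))))
      with ((3 * (Cmod h * Cmod h) * Rabs (b n)) * ((INR n * INR n) * (exp (Im w * INR n) * exp (INR n * Cmod h)))) by ring.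
    replace (3 * (/ t * / t * 4) * (Cmod h * Cmod h) * (Rabs (b n) * exp (s * INR n)))
      with ((3 * (Cmod h * Cmod h) * Rabs (b n)) * ((/ t * / t * 4) * exp (s * INR n))) by ring.
    assert (Hit : 0 < / t) by now apply Rinv_0_lt_compat.
    apply Rmult_le_compat_l.
    { apply Rmult_le_pos; [|apply Rabs_pos]. nra. }
    apply Rle_trans with ((/ t * / t * 4 * exp (t * INR n)) * (exp (Im w * INR n) * exp (INR n * Cmod h))).
    { apply Rmult_le_compat_r; [|exact Hn2]. apply Rmult_le_pos; lra. }
    rewrite Rmult_assoc. apply Rmult_le_compat_l; [|lra]. repeat apply Rmult_le_pos; lra.
  - exact HM.
  - eapply Rle_trans; [exact CBB|]. unfold M. rewrite Series_scal_l. fold S.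
    apply Rle_trans with (Cmod h * (Cmod h * Kc)).
    + unfold Kc. assert (0 <= Cmod h * Cmod h) by nra. nra.
    + nra.
Qed.

(** * Minima on rectangles and the minimum principle *)

Definition rcont (k : C -> R) (w : C) : Prop :=
  forall e, 0 < e -> exists d, 0 < d /\ forall v, Cmod (v - w)%C < d -> Rabs (k v - k w) < e.

Definition rect (a b c d : R) (w : C) : Prop := a <= Re w <= b /\ c <= Im w <= d.

(** Compactness of the rectangle: a constant that can be chosen locally, and may always be
    decreased, can be chosen once for all points. *)
Lemma rect_uniform a b c d (P : C -> R -> Prop) :
  (forall w e e', P w e -> 0 < e' <= e -> P w e') ->
  (forall w, rect a b c d w -> exists e, 0 < e /\ forall v, rect a b c d v -> Cmod (v - w)%C < e -> P v e) ->
  exists e, 0 < e /\ forall v, rect a b c d v -> P v e.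
Proof.
  intros Hmon H.
  assert (H' : forall w : C, exists e : posreal, rect a b c d w ->
     forall v, rect a b c d v -> Cmod (v - w)%C < e -> P v e).
  { intros w. destruct (classic (rect a b c d w)) as [Hw|Hw].
    - destruct (H w Hw) as [e [He He']]. exists (mkposreal e He). intros _. exact He'.
    - exists (mkposreal 1 Rlt_0_1). intros; contradiction. }
  apply choice in H'. destruct H' as [del Hdel].
  assert (Hh : forall e : posreal, 0 < e / 2) by (intros e; generalize (cond_pos e); lra).
  destruct (compactness_value_2d a b c d (fun u v => mkposreal _ (Hh (del (u, v))))) as [e He].
  exists e. split; [apply cond_pos|]. intros [x y] [Hx Hy]. simpl in Hx, Hy.
  apply NNPP. intros Hn. apply (He x y Hx Hy). intros (u & v & Hu & Hv & H1 & H2 & H3).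
  simpl in H1, H2, H3. apply Hn.
  assert (Hc := cond_pos (del (u, v))).
  apply Hmon with (del (u, v)).
  - apply (Hdel (u, v)); [split; assumption|split; assumption|].
    eapply Rle_lt_trans; [apply Cmod_le_sum|]. simpl.
    change (Rabs (x + - u) + Rabs (y + - v) < del (u, v)).
    fold (x - u) (y - v). lra.
  - split; [apply cond_pos|lra].
Qed.

Lemma rect_min a b c d (k : C -> R) : a <= b -> c <= d ->
  (forall w, rect a b c d w -> rcont k w) ->
  exists w, rect a b c d w /\ forall v, rect a b c d v -> k w <= k v.
Proof.
  intros Hab Hcd Hk.
  assert (Hbd : exists M, forall v, rect a b c d v -> M <= k v).
  (* Local lower bounds are written - 1 / e so that decreasing e weakens them. *)
  { destruct (rect_uniform a b c d (fun v e => - / e <= k v)) as [e [He H]].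
    - intros w e e' H He. assert (/ e <= / e') by (apply Rinv_le_contravar; lra). lra.
    - intros w Hw. destruct (Hk w Hw 1 Rlt_0_1) as [d1 [Hd1 H1]].
      set (m := / (1 + Rabs (k w))).
      assert (Hp := Rabs_pos (k w)).
      assert (Hm : 0 < m) by (apply Rinv_0_lt_compat; lra).
      exists (Rmin d1 m). split; [now apply Rmin_glb_lt|]. intros v _ Hv.
      specialize (H1 v ltac:(eapply Rlt_le_trans; [exact Hv|apply Rmin_l])).
      assert (1 + Rabs (k w) <= / Rmin d1 m).
      { replace (1 + Rabs (k w)) with (/ m) by (unfold m; apply Rinv_inv).
        apply Rinv_le_contravar; [now apply Rmin_glb_lt|apply Rmin_r]. }
      apply Rabs_def2 in H1. generalize (Rle_abs (- k w)). rewrite Rabs_Ropp. lra.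
    - exists (- / e). exact H. }
  destruct Hbd as [M HM].
  set (Sv := fun y => exists v, rect a b c d v /\ y = - k v).
  destruct (completeness Sv) as [m [Hm1 Hm2]].
  - exists (- M). intros y [v [Hv ->]]. specialize (HM v Hv). lra.
  - exists (- k (a, c)), (a, c). split; [|reflexivity]. split; simpl; lra.
  - apply NNPP. intros Hn.
    assert (Hlt : forall v, rect a b c d v -> - m < k v).
    { intros v Hv. assert (- k v <= m) by (apply Hm1; exists v; auto).
      destruct (Req_dec (k v) (- m)) as [E|E]; [|lra]. exfalso. apply Hn. exists v. split; auto.
      intros u Hu. assert (- k u <= m) by (apply Hm1; exists u; auto). lra. }
    (* If the infimum -m were not attained, k would exceed it by a uniform e. *)
    destruct (rect_uniform a b c d (fun v e => - m + e <= k v)) as [e [He H]].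
    + intros; lra.
    + intros w Hw. specialize (Hlt w Hw).
      destruct (Hk w Hw ((k w + m) / 2) ltac:(lra)) as [d1 [Hd1 H1]].
      exists (Rmin d1 ((k w + m) / 2)). split; [apply Rmin_glb_lt; lra|]. intros v _ Hv.
      specialize (H1 v ltac:(eapply Rlt_le_trans; [exact Hv|apply Rmin_l])).
      apply Rabs_def2 in H1. generalize (Rmin_r d1 ((k w + m) / 2)). lra.
    + assert (m <= m - e); [|lra]. apply Hm2. intros y [v [Hv ->]]. specialize (H v Hv). lra.
Qed.

Lemma rcont_plus k1 k2 w : rcont k1 w -> rcont k2 w -> rcont (fun v => k1 v + k2 v) w.
Proof.
  intros H1 H2 e He. destruct (H1 (e/2) ltac:(lra)) as [d1 [Hd1 K1]].
  destruct (H2 (e/2) ltac:(lra)) as [d2 [Hd2 K2]].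
  exists (Rmin d1 d2). split; [now apply Rmin_glb_lt|]. intros v Hv.
  specialize (K1 v ltac:(eapply Rlt_le_trans; [exact Hv|apply Rmin_l])).
  specialize (K2 v ltac:(eapply Rlt_le_trans; [exact Hv|apply Rmin_r])).
  replace (k1 v + k2 v - (k1 w + k2 w)) with ((k1 v - k1 w) + (k2 v - k2 w)) by ring.
  eapply Rle_lt_trans; [apply Rabs_triang|]. lra.
Qed.

Lemma rcont_ext k1 k2 w : (forall v, k1 v = k2 v) -> rcont k1 w -> rcont k2 w.
Proof.
  intros E H e He. destruct (H e He) as [d [Hd K]]. exists d. split; auto.
  intros v Hv. rewrite <- !E. auto.
Qed.

Lemma rcont_Re f w : ccont f w -> rcont (fun v => Re (f v)) w.
Proof.
  intros H e He. destruct (H e He) as [d [Hd K]]. exists d. split; auto.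
  intros v Hv. eapply Rle_lt_trans; [apply (re_le_Cmod (f v - f w)%C)|auto].
Qed.

Lemma rcont_Im f w : ccont f w -> rcont (fun v => Im (f v)) w.
Proof.
  intros H e He. destruct (H e He) as [d [Hd K]]. exists d. split; auto.
  intros v Hv. eapply Rle_lt_trans; [apply (im_le_Cmod (f v - f w)%C)|auto].
Qed.

Lemma rcont_comp (h : R -> R) k w : rcont k w -> continuity_pt h (k w) -> rcont (fun v => h (k v)) w.
Proof.
  intros Hk Hh e He. destruct (Hh e He) as [d1 [Hd1 K1]]. destruct (Hk d1 Hd1) as [d [Hd K]].
  exists d. split; auto. intros v Hv. specialize (K v Hv).
  destruct (Req_dec (k v) (k w)) as [E|E].
  - rewrite E. now rewrite Rminus_diag, Rabs_R0.
  - apply (K1 (k v)). split; [split; [exact I|auto]|exact K].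
Qed.

Lemma rcont_Cmod_sub f (p : C) w : ccont f w -> rcont (fun v => Cmod (f v - p)%C) w.
Proof.
  intros H e He. destruct (H e He) as [d [Hd K]]. exists d. split; auto.
  intros v Hv. specialize (K v Hv).
  generalize (Cmod_sub_triangle (f v) (f w) p) (Cmod_sub_triangle (f w) (f v) p).
  rewrite (Cmod_sym (f w) (f v)). intros. apply Rabs_def1; lra.
Qed.

Lemma ccont_id w : ccont (fun v => v) w.
Proof. intros e He. exists e. auto. Qed.

Lemma line_deriv f (p h : C) (t : R) (l : C) : cderiv f (p + t * h)%C l ->
  is_derive (fun s : R => Re (f (p + s * h)%C)) t (Re (l * h)%C) /\
  is_derive (fun s : R => Im (f (p + s * h)%C)) t (Im (l * h)%C).
Proof.
  intros H.
  assert (Hgen : forall e, 0 < e -> exists d, 0 < d /\ forall s, s <> 0 -> Rabs s < d ->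
     Cmod (f (p + (t + s)%R * h) - f (p + t * h) - s * (l * h))%C < e * Rabs s).
  { intros e He. assert (Hh := Cmod_ge_0 h).
    set (e1 := e / (2 * (Cmod h + 1))).
    destruct (H e1) as [d [Hd K]]; [apply Rdiv_lt_0_compat; lra|].
    exists (d / (Cmod h + 1)). split; [apply Rdiv_lt_0_compat; lra|]. intros s Hs0 Hs.
    assert (Hs' : Rabs s * (Cmod h + 1) < d) by (apply Rlt_div_r; lra).
    assert (Hsp := Rabs_pos_lt s Hs0).
    assert (E : (p + (t + s)%R * h - (p + t * h))%C = (s * h)%C) by (rewrite RtoC_plus; ring).
    specialize (K (p + (t + s)%R * h)%C). rewrite E, Cmod_mult, Cmod_R in K.
    specialize (K ltac:(nra)).
    replace (s * (l * h))%C with (l * (s * h))%C by ring.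
    eapply Rle_lt_trans; [exact K|].
    assert (e1 * (2 * (Cmod h + 1)) = e) by (unfold e1; field; lra).
    assert (0 < e1) by (apply Rdiv_lt_0_compat; lra).
    nra. }
  assert (HX : forall part : C -> R, (forall c, Rabs (part c) <= Cmod c) ->
     (forall a b : C, part (a - b)%C = part a - part b) -> (forall (s : R) a, part (s * a)%C = s * part a) ->
     is_derive (fun s : R => part (f (p + s * h)%C)) t (part (l * h)%C)).
  { intros part P1 P2 P3. apply is_derive_Reals. intros e He.
    destruct (Hgen e He) as [d [Hd K]]. exists (mkposreal d Hd). intros s Hs0 Hs.
    specialize (K s Hs0 Hs). assert (Hsp := Rabs_pos_lt s Hs0).
    replace ((part (f (p + (t + s)%R * h)%C) - part (f (p + t * h)%C)) / s - part (l * h)%C)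
      with (part (f (p + (t + s)%R * h) - f (p + t * h) - s * (l * h))%C / s).
    2:{ rewrite !P2, P3. field. assumption. }
    unfold Rdiv. rewrite Rabs_mult, Rabs_inv.
    apply Rmult_lt_reg_r with (Rabs s); [assumption|]. rewrite Rmult_assoc, Rinv_l, Rmult_1_r by lra.
    eapply Rle_lt_trans; [apply P1|exact K]. }
  split; apply HX.
  - apply re_le_Cmod.
  - intros; reflexivity.
  - intros; simpl; unfold Re; ring.
  - apply im_le_Cmod.
  - intros; reflexivity.
  - intros; simpl; unfold Im; ring.
Qed.

Lemma derive_min_zero (q : R -> R) (r l : R) : 0 < r -> is_derive q 0 l ->
  (forall t, Rabs t < r -> q 0 <= q t) -> l = 0.
Proof.
  intros Hr H1 Hmin.
  assert (Hd : derivable_pt_lim q 0 l) by now apply is_derive_Reals.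
    assert (Hs : forall s, (s = 1 \/ s = -1) -> 0 <= s * l).
    { intros s Hs. destruct (Rle_dec 0 (s * l)) as [|Hn]; [assumption|exfalso].
      assert (Hq : l <> 0) by (intros E; rewrite E in Hn; lra).
      destruct (Hd (Rabs l / 2)) as [[d Hdp] K].
      { generalize (Rabs_pos_lt _ Hq). lra. }
      set (t := Rmin d r / 2). assert (0 < Rmin d r) by now apply Rmin_glb_lt.
      assert (Ht1 : t < d) by (generalize (Rmin_l d r); unfold t; lra).
      assert (Ht2 : t < r) by (generalize (Rmin_r d r); unfold t; lra).
      assert (Ht : 0 < t) by (unfold t; lra).
      assert (Ha : Rabs (s * t) = t).
      { destruct Hs as [->| ->]; [rewrite Rabs_right|rewrite Rabs_left]; lra. }
      specialize (K (s * t)). simpl in K.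
      specialize (K ltac:(destruct Hs; subst; lra) ltac:(lra)).
      specialize (Hmin (s * t) ltac:(lra)). rewrite Rplus_0_l in K.
      apply Rabs_def2 in K. destruct K as [K1 K2].
      assert (E : q (s * t) - q 0 = (q (s * t) - q 0) / (s * t) * (s * t)).
      { field. destruct Hs; subst; lra. }
      set (X := (q (s * t) - q 0) / (s * t)) in *.
      destruct Hs as [->| ->].
      - rewrite Rabs_left in K1, K2 by lra. nra.
      - rewrite Rabs_right in K1, K2 by lra. nra. }
    generalize (Hs 1 (or_introl eq_refl)) (Hs (-1) (or_intror eq_refl)). lra.
Qed.

Lemma second_derivative_test (q q1 : R -> R) (r q2 : R) : 0 < r ->
  (forall t, Rabs t < r -> is_derive q t (q1 t)) -> is_derive q1 0 q2 ->
  (forall t, Rabs t < r -> q 0 <= q t) -> 0 <= q2.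
Proof.
  intros Hr H1 H2 Hmin.
  assert (Hq1 : q1 0 = 0).
  { apply (derive_min_zero q r); auto. apply H1. rewrite Rabs_R0. lra. }
  destruct (Rle_dec 0 q2) as [|Hn]; [assumption|exfalso].
  apply is_derive_Reals in H2. destruct (H2 (- q2 / 2) ltac:(lra)) as [[d Hd] K]. simpl in K.
  set (t := Rmin d r / 2). assert (0 < Rmin d r) by now apply Rmin_glb_lt.
  assert (Ht1 : t < d) by (generalize (Rmin_l d r); unfold t; lra).
  assert (Ht2 : t < r) by (generalize (Rmin_r d r); unfold t; lra).
  assert (Ht : 0 < t) by (unfold t; lra).
  destruct (MVT_cor2 q q1 0 t Ht) as [c [Hc1 Hc2]].
  { intros c Hc. apply is_derive_Reals, H1. rewrite Rabs_right; lra. }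
  specialize (K c ltac:(lra) ltac:(rewrite Rabs_right; lra)).
  rewrite Rplus_0_l, Hq1 in K. apply Rabs_def2 in K. destruct K as [K1 K2].
  assert (E : q1 c = (q1 c - 0) / c * c) by (field; lra).
  set (X := (q1 c - 0) / c) in *.
  assert (q1 c < 0) by nra.
  specialize (Hmin t ltac:(rewrite Rabs_right; lra)). nra.
Qed.

Lemma is_derive_Re_C f (p h : C) (t : R) (l : C) : cderiv f (p + t * h)%C l ->
  is_derive (fun s : R => Re (f (p + s * h)%C)) t (Re (l * h)%C).
Proof. intros. now apply line_deriv. Qed.

Lemma is_derive_Im_C f (p h : C) (t : R) (l : C) : cderiv f (p + t * h)%C l ->
  is_derive (fun s : R => Im (f (p + s * h)%C)) t (Im (l * h)%C).
Proof. intros. now apply line_deriv. Qed.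

Lemma periodic_reduce (g : C -> C) : (forall a b, g (a + 2 * PI, b) = g (a, b)) ->
  forall a, exists a', 0 <= a' <= 2 * PI /\ forall b, g (a, b) = g (a', b).
Proof.
  intros Hper.
  assert (Hpern : forall n a b, g (a + INR n * (2 * PI), b) = g (a, b)).
  { induction n; intros a b; [simpl; f_equal; f_equal; ring|].
    rewrite S_INR. replace (a + (INR n + 1) * (2 * PI)) with ((a + INR n * (2 * PI)) + 2 * PI) by ring.
    rewrite Hper. apply IHn. }
  intros a. assert (HP := PI_RGT_0).
    assert (Hn : exists n : nat, 0 <= a + INR n * (2 * PI)).
    { destruct (INR_unbounded (Rabs a / (2 * PI))) as [n Hn]. exists n.
      assert (Rabs a < INR n * (2 * PI)) by (apply Rlt_div_l in Hn; lra).
      generalize (Rle_abs (- a)). rewrite Rabs_Ropp. lra. }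
    destruct Hn as [n Hn]. set (x := a + INR n * (2 * PI)) in *.
    assert (Hm : exists m : nat, INR m * (2 * PI) <= x < (INR m + 1) * (2 * PI)).
    { assert (Hq : 0 <= x / (2 * PI)) by (apply Rle_div_r; lra).
      destruct (nfloor_ex _ Hq) as [m [Hm1 Hm2]]. exists m. split.
      - apply Rle_div_r in Hm1; lra.
      - apply Rlt_div_l in Hm2; lra. }
    destruct Hm as [m Hm]. exists (x - INR m * (2 * PI)). split; [lra|]. intros b.
    rewrite <- (Hpern m (x - INR m * (2 * PI)) b).
    replace (x - INR m * (2 * PI) + INR m * (2 * PI)) with x by ring.
    unfold x. now rewrite Hpern.
Qed.

(** Adding c Im w / H - m (Im w)^2 to the harmonic function Re g makes it strictly superharmonic.
    Its minimum over a period then lies on the boundary lines, where it is at least - m H^2, and m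
    tends to 0. For c > 0 the linear lower bound gives strict positivity inside the strip. *)
Lemma minimum_principle (H mu c : R) (g dg d2g : C -> C) : 0 < H -> 0 < mu -> 0 <= c ->
  (forall w, - H - mu < Im w < mu -> cderiv g w (dg w) /\ cderiv dg w (d2g w)) ->
  (forall a b, g (a + 2 * PI, b) = g (a, b)) ->
  (forall a, 0 <= Re (g (a, 0))) -> (forall a, c <= Re (g (a, - H))) ->
  forall a b, - H <= b <= 0 -> - c * b / H <= Re (g (a, b)).
Proof.
  intros HH Hmu Hc Hg Hper Htop Hbot.
  assert (Hred := periodic_reduce g Hper).
  assert (Key : forall m, 0 < m -> forall a b, - H <= b <= 0 ->
     - c * b / H - m * (H * H) <= Re (g (a, b))).
  { intros m Hm.
    set (v := fun w : C => Re (g w) + (c * Im w / H - m * (Im w * Im w))).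
    assert (Hreg : forall w, - H - mu < Im w < mu -> rcont v w).
    { intros w Hw. apply rcont_plus.
      - apply rcont_Re. eapply cderiv_ccont. apply Hg, Hw.
      - apply (rcont_comp (fun y => c * y / H - m * (y * y)) Im).
        + apply (rcont_Im (fun v => v)), ccont_id.
        + apply derivable_continuous_pt. apply ex_derive_Reals_0. auto_derive. lra. }
    destruct (rect_min 0 (2 * PI) (- H) 0 v) as [w0 [Hw0 Hmin]].
    - generalize PI_RGT_0; lra.
    - lra.
    - intros w [_ Hw]. apply Hreg. lra.
    - assert (Hglob : forall a b, - H <= b <= 0 -> v w0 <= v (a, b)).
      { intros a b Hb. destruct (Hred a) as [a' [Ha' E]].
        unfold v at 2. simpl. rewrite E. apply (Hmin (a', b)). split; simpl; lra. }
      assert (Hv0 : - m * (H * H) <= v w0).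
      { destruct w0 as [a0 y0]. destruct Hw0 as [_ Hw0]. simpl in Hw0.
        destruct (Req_dec y0 0) as [->|Hy0].
        { unfold v; simpl. generalize (Htop a0). intros. unfold Rdiv. nra. }
        destruct (Req_dec y0 (- H)) as [->|Hy1].
        { unfold v; simpl. generalize (Hbot a0). intros.
          replace (c * - H / H) with (- c) by (field; lra). nra. }
        exfalso.
        assert (Hbig : - H - mu < y0 < mu) by lra.
        (* At an interior minimum both pure second derivatives are nonnegative, yet they add up to -
           2 m. *)
        assert (Hx : 0 <= Re (d2g (a0, y0))).
        { apply (second_derivative_test (fun t => Re (g ((a0, y0) + t * 1)%C))
            (fun t => Re (dg ((a0, y0) + t * 1) * 1)%C) 1); [lra| | |].
          - intros t _. apply is_derive_Re_C. apply Hg. simpl. lra.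
          - apply (is_derive_ext (fun t : R => Re (dg ((a0, y0) + t * 1)%C))).
            { intros s. now rewrite (Cmult_1_r (dg _)). }
            replace (Re (d2g (a0, y0))) with (Re (d2g ((a0, y0) + 0 * 1) * 1)%C).
            2:{ rewrite (Cmult_1_r (d2g _)). do 2 f_equal. apply injective_projections; simpl; ring. }
            apply is_derive_Re_C. apply Hg. simpl. lra.
          - intros t _. generalize (Hglob (a0 + t) y0 ltac:(lra)). unfold v; simpl.
            replace ((a0, y0) + 0 * 1)%C with (a0, y0) by (apply injective_projections; simpl; ring).
            replace ((a0, y0) + t * 1)%C with (a0 + t, y0) by (apply injective_projections; simpl; ring).
            lra. }
        assert (Hy : 0 <= - Re (d2g (a0, y0)) - 2 * m).
        { set (r := Rmin (- y0) (y0 + H)).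
          assert (Hr : 0 < r) by (apply Rmin_glb_lt; lra).
          assert (Hr1 : r <= - y0) by apply Rmin_l. assert (Hr2 : r <= y0 + H) by apply Rmin_r.
          apply (second_derivative_test
            (fun t => Re (g ((a0, y0) + t * Ci)%C) + (c * (y0 + t) / H - m * ((y0 + t) * (y0 + t))))
            (fun t => Re (dg ((a0, y0) + t * Ci) * Ci)%C + (c / H - m * (2 * (y0 + t)))) r); [lra| | |].
          - intros t Ht. apply Rabs_def2 in Ht.
            apply (is_derive_plus (K := R_AbsRing) (V := R_NormedModule)).
            + apply is_derive_Re_C. apply Hg. simpl. lra.
            + auto_derive; [lra|]. field. lra.
          - replace (- Re (d2g (a0, y0)) - 2 * m) with (plus (- Re (d2g (a0, y0))) (- 2 * m)) by (unfold plus; simpl; ring).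
            apply (is_derive_plus (K := R_AbsRing) (V := R_NormedModule)).
            + apply (is_derive_ext (fun t : R => - Im (dg ((a0, y0) + t * Ci)%C))).
              { intros t. unfold Re, Im, Ci; simpl. ring. }
              apply (is_derive_opp (K := R_AbsRing) (V := R_NormedModule)).
              replace (Re (d2g (a0, y0))) with (Im (d2g ((a0, y0) + 0 * Ci) * Ci)%C).
              2:{ replace ((a0, y0) + 0 * Ci)%C with (a0, y0) by (apply injective_projections; simpl; ring).
                  unfold Re, Im, Ci; simpl. ring. }
              apply is_derive_Im_C. apply Hg. simpl. lra.
            + auto_derive; [trivial|]. ring.
          - intros t Ht. apply Rabs_def2 in Ht.
            generalize (Hglob a0 (y0 + t) ltac:(lra)). unfold v; simpl.
            replace ((a0, y0) + 0 * Ci)%C with (a0, y0) by (apply injective_projections; simpl; ring).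
            replace ((a0, y0) + t * Ci)%C with (a0, y0 + t) by (apply injective_projections; simpl; ring).
            rewrite Rplus_0_r. lra. }
        lra. }
      intros a b Hb. specialize (Hglob a b Hb). unfold v in Hglob at 2. simpl in Hglob.
      assert (0 <= m * (b * b)) by nra.
      replace (- c * b / H) with (- (c * b / H)) by (field; lra). lra. }
  intros a b Hb. apply Rnot_lt_le. intros Hlt.
  set (gap := - c * b / H - Re (g (a, b))).
  assert (Hgap : 0 < gap) by (unfold gap; lra).
  specialize (Key (gap / (2 * (H * H))) ltac:(apply Rdiv_lt_0_compat; nra) a b Hb).
  replace (gap / (2 * (H * H)) * (H * H)) with (gap / 2) in Key by (field; lra).
  unfold gap in *. lra.
Qed.

(** * Products, inverses and the passage to real derivatives *)

Lemma RtoC_m1 : RtoC (-1) = (- (1))%C.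
Proof. rewrite <- RtoC_opp. reflexivity. Qed.

Lemma cderiv_sqr w : cderiv (fun v => v * v)%C w (2 * w)%C.
Proof.
  intros e He. exists e. split; [auto|]. intros v Hv.
  replace (v * v - w * w - 2 * w * (v - w))%C with ((v - w) * (v - w))%C by ring.
  rewrite Cmod_mult. apply Rmult_le_compat_r; [apply Cmod_ge_0|lra].
Qed.

(** Polarization, 4 f g = (f + g)^2 - (f - g)^2, reduces the product to the square and the chain
    rule. *)
Lemma cderiv_mult f g w l m : cderiv f w l -> cderiv g w m ->
  cderiv (fun v => f v * g v)%C w (l * g w + f w * m)%C.
Proof.
  intros Hf Hg.
  assert (Hm := cderiv_plus _ _ _ _ _ Hf (cderiv_scal (RtoC (-1)) _ _ _ Hg)).
  assert (Hp := cderiv_plus _ _ _ _ _ Hf Hg).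
  assert (H1 := cderiv_comp _ _ _ _ _ Hp (cderiv_sqr _)).
  assert (H2 := cderiv_comp _ _ _ _ _ Hm (cderiv_sqr _)).
  assert (H := cderiv_scal (RtoC (/4)) _ _ _ (cderiv_plus _ _ _ _ _ H1 (cderiv_scal (RtoC (-1)) _ _ _ H2))).
  assert (E4 : (RtoC (/4) * (1 + 1 + 1 + 1))%C = RtoC 1).
  { rewrite <- !RtoC_plus, <- RtoC_mult. f_equal. field. }
  assert (E1 := RtoC_m1).
  assert (E2 : RtoC 2 = (1 + 1)%C) by (rewrite <- RtoC_plus; f_equal).
  cbv beta in H.
  match type of H with cderiv _ _ ?x => assert (Ex : (l * g w + f w * m)%C = x) end.
  { rewrite E1, E2.
    transitivity ((RtoC (/4) * (1 + 1 + 1 + 1)) * (l * g w + f w * m))%C; [rewrite E4; ring|ring]. }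
  rewrite Ex. eapply cderiv_ext; [|exact H]. intros v. cbv beta. rewrite E1.
  transitivity ((RtoC (/4) * (1 + 1 + 1 + 1)) * (f v * g v))%C; [ring|]. rewrite E4. ring.
Qed.

Lemma cderiv_Cinv (w : C) : w <> RtoC 0 -> cderiv (fun v => / v)%C w (- / (w * w))%C.
Proof.
  intros Hw e He. assert (Hm : 0 < Cmod w) by now apply Cmod_gt_0.
  set (K := 2 / (Cmod w * (Cmod w * Cmod w))).
  assert (HK : 0 < K) by (apply Rdiv_lt_0_compat; [lra|]; repeat apply Rmult_lt_0_compat; lra).
  exists (Rmin (Cmod w / 2) (e / K)). split; [apply Rmin_glb_lt; [lra|now apply Rdiv_lt_0_compat]|].
  intros v Hv.
  assert (Hv1 : Cmod (v - w)%C < Cmod w / 2) by (eapply Rlt_le_trans; [exact Hv|apply Rmin_l]).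
  assert (Hv2 : Cmod (v - w)%C * K < e).
  { apply Rlt_div_r; [lra|]. eapply Rlt_le_trans; [exact Hv|apply Rmin_r]. }
  assert (Hvm : Cmod w / 2 < Cmod v).
  { generalize (Cmod_triangle (w - v)%C v). replace (w - v + v)%C with w by ring.
    rewrite (Cmod_sym w v). lra. }
  assert (Hv0 : v <> RtoC 0) by (apply Cmod_gt_0; lra).
  replace (/ v - / w - - / (w * w) * (v - w))%C with ((v - w) * ((v - w) * / (v * (w * w))))%C
    by (field; auto).
  rewrite !Cmod_mult, Cmod_inv by (repeat apply Cmult_neq_0; auto). rewrite !Cmod_mult.
  rewrite Rmult_comm. apply Rmult_le_compat_r; [apply Cmod_ge_0|].
  apply Rle_trans with (Cmod (v - w)%C * K); [|lra].
  apply Rmult_le_compat_l; [apply Cmod_ge_0|]. unfold K.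
  replace (2 / (Cmod w * (Cmod w * Cmod w))) with (/ (Cmod w / 2 * (Cmod w * Cmod w))) by (field; lra).
  apply Rinv_le_contravar.
  - repeat apply Rmult_lt_0_compat; lra.
  - apply Rmult_le_compat_r; [|lra]. nra.
Qed.

Lemma continuous_on_C (A : C -> Prop) (f : C -> C) :
  (forall p, A p -> forall e, 0 < e -> exists d, 0 < d /\
     forall q, A q -> Cmod (q - p)%C < d -> Cmod (f q - f p)%C < e) ->
  @continuous_on C_UniformSpace C_UniformSpace A f.
Proof.
  intros H p Hp P HP. apply locally_Cmod in HP. destruct HP as [e [He HP]].
  destruct (H p Hp e He) as [d [Hd K]].
  apply (proj2 (locally_Cmod p _)). exists d. split; auto.
Qed.

Lemma continuous_on_R (A : C -> Prop) (f : C -> R) :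
  (forall p, A p -> forall e, 0 < e -> exists d, 0 < d /\
     forall q, A q -> Cmod (q - p)%C < d -> Rabs (f q - f p) < e) ->
  @continuous_on C_UniformSpace R_UniformSpace A f.
Proof.
  intros H p Hp P [[e He] HP]. destruct (H p Hp e He) as [d [Hd K]].
  apply (proj2 (locally_Cmod p _)). exists d. split; auto.
  intros q Hq HA. apply HP. apply K; auto.
Qed.

Lemma is_derive_C_R (f : R -> C) (a : R) (l : C) :
  is_derive (fun t => Re (f t)) a (Re l) -> is_derive (fun t => Im (f t)) a (Im l) ->
  @is_derive R_AbsRing C_R_NormedModule f a l.
Proof.
  intros H1 H2. split; [apply @is_linear_scal_l|].
  intros x Hx. apply (@is_filter_lim_locally_unique R_AbsRing (AbsRing_NormedModule R_AbsRing)) in Hx. subst x.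
  intros e.
  assert (He2 : 0 < e / 2) by (generalize (cond_pos e); lra).
  destruct H1 as [_ H1]. destruct H2 as [_ H2].
  specialize (H1 a (fun P H => H) (mkposreal _ He2)). specialize (H2 a (fun P H => H) (mkposreal _ He2)).
  generalize (filter_and _ _ H1 H2). apply filter_imp. intros t [K1 K2]. simpl in K1, K2.
  change (sqrt (Rabs (Re (f t) - Re (f a) - (t - a) * Re l) ^ 2
    + Rabs (Im (f t) - Im (f a) - (t - a) * Im l) ^ 2) <= e * Rabs (t - a)).
  change (Rabs (Re (f t) - Re (f a) - (t - a) * Re l) <= e / 2 * Rabs (t - a)) in K1.
  change (Rabs (Im (f t) - Im (f a) - (t - a) * Im l) <= e / 2 * Rabs (t - a)) in K2.
  eapply Rle_trans; [apply (Cmod_le_sum (Rabs (Re (f t) - Re (f a) - (t - a) * Re l),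
     Rabs (Im (f t) - Im (f a) - (t - a) * Im l)))|].
  simpl. rewrite !Rabs_Rabsolu. lra.
Qed.

Lemma continuity_2d_rcont (f : R -> R -> R) x y :
  rcont (fun p => f (Re p) (Im p)) (x, y) -> continuity_2d_pt f x y.
Proof.
  intros H e. destruct (H e (cond_pos e)) as [d [Hd K]].
  assert (Hd2 : 0 < d / 2) by lra. exists (mkposreal _ Hd2). simpl. intros u v Hu Hv.
  apply (K (u, v)). eapply Rle_lt_trans; [apply Cmod_le_sum|]. simpl.
  fold (u - x) (v - y). lra.
Qed.

Lemma open_locally_2d (A : C -> Prop) (P : R -> R -> Prop) x y : @open C_UniformSpace A -> A (x, y) ->
  (forall u v, A (u, v) -> P u v) -> locally_2d P x y.
Proof.
  intros HA Hp H. specialize (HA _ Hp). apply locally_Cmod in HA. destruct HA as [d [Hd K]].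
  assert (Hd2 : 0 < d / 2) by lra. exists (mkposreal _ Hd2). simpl. intros u v Hu Hv.
  apply H, K. eapply Rle_lt_trans; [apply Cmod_le_sum|]. simpl. fold (u - x) (v - y). lra.
Qed.

Lemma ex_diff_n_S (A : C -> Prop) (f f1 f2 : R -> R -> R) n x y :
  @open C_UniformSpace A -> A (x, y) ->
  (forall u v, A (u, v) -> is_derive (fun t => f t v) u (f1 u v) /\ is_derive (fun t => f u t) v (f2 u v)) ->
  rcont (fun p => f (Re p) (Im p)) (x, y) ->
  ex_diff_n f1 n x y -> ex_diff_n f2 n x y -> ex_diff_n f (S n) x y.
Proof.
  intros HA Hp H Hc H1 H2. simpl. destruct (H x y Hp) as [D1 D2].
  split; [now apply continuity_2d_rcont|].
  split; [exists (f1 x y); exact D1|]. split; [exists (f2 x y); exact D2|]. split.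
  - apply ex_diff_n_ext_loc with f1; [|exact H1].
    apply (open_locally_2d A); auto. intros u v Huv. symmetry. apply is_derive_unique. now apply H.
  - apply ex_diff_n_ext_loc with f2; [|exact H2].
    apply (open_locally_2d A); auto. intros u v Huv. symmetry. apply is_derive_unique. now apply H.
Qed.

Definition refl (w : C) : C := (- Re w, Im w).

(** * From a conformal parametrization to a water wave *)

Section Geometry.

(** z is the conformal map and F a complex potential in the variable w: the stream function is Im F
    - y^2, of Laplacian -2, so the vorticity constant is 2. Its gradient has modulus |F' / z' - 2
    y|, whence the form of [HBern]. All functions are holomorphic beyond the boundary lines by mu,
    so ordinary derivatives are available on these lines. The factor sin in [Hmono] locates the
    critical points of the elevation. *)
Context (G H B Qb mu : R) (z dz d2z d3z F dF d2F d3F : C -> C) (k : R -> R).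

Definition big (w : C) : Prop := - H - mu < Im w < mu.

Context (HH : 0 < H) (Hmu : 0 < mu).
Context (Hz1 : forall w, big w -> cderiv z w (dz w)) (Hz2 : forall w, big w -> cderiv dz w (d2z w))
  (Hz3 : forall w, big w -> cderiv d2z w (d3z w)).
Context (HF1 : forall w, big w -> cderiv F w (dF w)) (HF2 : forall w, big w -> cderiv dF w (d2F w))
  (HF3 : forall w, big w -> cderiv d2F w (d3F w)).
Context (Hper : forall w, z (w + RtoC (2 * PI))%C = (z w + RtoC (2 * PI))%C)
  (Hdper : forall w, dz (w + RtoC (2 * PI))%C = dz w)
  (Hsym : forall w, z (refl w) = refl (z w))
  (Hbot : forall a, Im (z (a, - H)) = - H)
  (HFper : forall w, Im (F (w + RtoC (2 * PI))%C) = Im (F w))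
  (HFsym : forall w, Im (F (refl w)) = Im (F w))
  (HFbot : forall a, Im (F (a, - H)) = Qb)
  (HFtop : forall a, Im (F (a, 0)) = Im (z (a, 0)) * Im (z (a, 0))).
Context (Htop : forall a, 0 <= Re (dz (a, 0))) (Hdz0 : forall a, dz (a, 0) <> RtoC 0)
  (Hdbot : forall a, / 2 <= Re (dz (a, - H)))
  (Hk : forall a, 0 < k a) (Hmono : forall a, Im (dz (a, 0)) = sin a * k a).
Context (HBern : forall a, / 2 * (Cmod (dF (a, 0) / dz (a, 0) - RtoC (2 * Im (z (a, 0))))%C
   * Cmod (dF (a, 0) / dz (a, 0) - RtoC (2 * Im (z (a, 0))))%C) + G * Im (z (a, 0)) = B).

Lemma closed_big w : strip_closed H w -> big w.
Proof. unfold strip_closed, big. lra. Qed.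

Lemma strip_is_closed w : strip H w -> strip_closed H w.
Proof. unfold strip_closed, strip. lra. Qed.

Lemma top_closed a : strip_closed H (a, 0).
Proof. unfold strip_closed; simpl. lra. Qed.

Lemma bot_closed a : strip_closed H (a, - H).
Proof. unfold strip_closed; simpl. lra. Qed.

Lemma shift_pair a b c : ((a, b) + RtoC c)%C = (a + c, b).
Proof. apply injective_projections; simpl; ring. Qed.

(** * Univalence, properness and openness of the conformal map *)

Lemma Re_dz_lower w : strip_closed H w -> - / 2 * Im w / H <= Re (dz w).
Proof.
  destruct w as [a b]. intros Hw. simpl.
  apply (minimum_principle H mu (/ 2) dz d2z d3z); auto; try lra.
  intros x y. rewrite <- shift_pair. apply Hdper.
Qed.

Lemma Re_dz_pos w : strip_closed H w -> Im w < 0 -> 0 < Re (dz w).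
Proof.
  intros Hw Hi. apply Rlt_le_trans with (2 := Re_dz_lower w Hw).
  replace (- / 2 * Im w / H) with ((- Im w) / (2 * H)) by (field; lra).
  apply Rdiv_lt_0_compat; lra.
Qed.

Lemma dz_neq0 w : strip_closed H w -> dz w <> RtoC 0.
Proof.
  intros Hw. destruct (Req_dec (Im w) 0) as [E|E].
  - destruct w as [a b]. simpl in E. subst b. apply Hdz0.
  - intros E0. assert (Hp := Re_dz_pos w Hw). rewrite E0 in Hp. simpl in Hp.
    unfold strip_closed in Hw. lra.
Qed.

Lemma path_point a b (t : R) : ((a, b) + t * 1)%C = (a + t, b).
Proof. apply injective_projections; simpl; ring. Qed.

Lemma path_point_i a b (t : R) : ((a, b) + t * Ci)%C = (a, b + t).
Proof. apply injective_projections; simpl; ring. Qed.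

Lemma deriv_hor f a b l : cderiv f (a, b) l ->
  is_derive (fun t => Re (f (t, b))) a (Re l) /\ is_derive (fun t => Im (f (t, b))) a (Im l).
Proof.
  intros Hf. assert (E : forall t : R, ((0, b) + t * 1)%C = (t, b)).
  { intros t. rewrite path_point. f_equal. ring. }
  rewrite <- (E a) in Hf. apply line_deriv in Hf. rewrite Cmult_1_r in Hf.
  destruct Hf as [H1 H2]. split; [apply is_derive_ext with (2 := H1)|apply is_derive_ext with (2 := H2)];
    intros t; cbv beta; now rewrite E.
Qed.

Lemma deriv_ver f a b l : cderiv f (a, b) l ->
  is_derive (fun t => Re (f (a, t))) b (- Im l) /\ is_derive (fun t => Im (f (a, t))) b (Re l).
Proof.
  intros Hf. assert (E : forall t : R, ((a, 0) + t * Ci)%C = (a, t)).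
  { intros t. rewrite path_point_i. f_equal. ring. }
  rewrite <- (E b) in Hf. apply line_deriv in Hf.
  replace (Re (l * Ci)%C) with (- Im l) in Hf by (unfold Re, Im, Ci; simpl; ring).
  replace (Im (l * Ci)%C) with (Re l) in Hf by (unfold Re, Im, Ci; simpl; ring).
  destruct Hf as [H1 H2]. split; [apply is_derive_ext with (2 := H1)|apply is_derive_ext with (2 := H2)];
    intros t; cbv beta; now rewrite E.
Qed.

Lemma top_hor a : is_derive (fun t => Re (z (t, 0))) a (Re (dz (a, 0))) /\
  is_derive (fun t => Im (z (t, 0))) a (Im (dz (a, 0))).
Proof. apply deriv_hor, Hz1, closed_big, top_closed. Qed.

(** The trace may have vertical points. If it took one value twice, y would have a critical point in
    between, while x, being monotone, would be constant there; z' would vanish at that point. *)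
Lemma top_inj_lt a b : a < b -> z (a, 0) <> z (b, 0).
Proof.
  intros Hab E.
  destruct (MVT_cor2 (fun t => Im (z (t, 0))) (fun t => Im (dz (t, 0))) a b Hab) as [c [Hc1 Hc2]].
  { intros c _. apply is_derive_Reals, top_hor. }
  rewrite E in Hc1. assert (Hi : Im (dz (c, 0)) = 0) by nra.
  assert (Hmon : forall s t, s < t -> Re (z (s, 0)) <= Re (z (t, 0))).
  { intros s t Hst.
    destruct (MVT_cor2 (fun t => Re (z (t, 0))) (fun t => Re (dz (t, 0))) s t Hst) as [c' [Hc1' Hc2']].
    { intros c' _. apply is_derive_Reals, top_hor. }
    generalize (Htop c'). nra. }
  assert (Hconst : forall t, a < t < b -> Re (z (t, 0)) = Re (z (a, 0))).
  { intros t Ht. generalize (Hmon a t ltac:(lra)) (Hmon t b ltac:(lra)). rewrite <- E. lra. }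
  assert (Hr : Re (dz (c, 0)) = 0).
  { apply (derive_min_zero (fun s => Re (z (c + s, 0))) (Rmin (c - a) (b - c))).
    - apply Rmin_glb_lt; lra.
    - apply (is_derive_ext (fun s : R => Re (z ((c, 0) + s * 1)%C))).
      { intros; now rewrite path_point. }
      replace (Re (dz (c, 0))) with (Re (dz ((c, 0) + 0 * 1) * 1)%C).
      + apply is_derive_Re_C, Hz1. rewrite path_point. apply closed_big, top_closed.
      + rewrite Cmult_1_r, path_point. do 3 f_equal. ring.
    - intros t Ht. apply Rabs_def2 in Ht.
      generalize (Rmin_l (c - a) (b - c)) (Rmin_r (c - a) (b - c)). intros.
      rewrite (Hconst (c + 0)), (Hconst (c + t)) by lra. lra. }
  apply (Hdz0 c). apply injective_projections; assumption.
Qed.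

(** Along a chord of direction h, Re (conj h * z) has derivative |h|^2 Re z'. Equal values at the
    ends force Re z' = 0 at an intermediate point, which lies on the top line by the minimum
    principle; so does then the whole chord. *)
Lemma z_inj w1 w2 : strip_closed H w1 -> strip_closed H w2 -> z w1 = z w2 -> w1 = w2.
Proof.
  intros H1 H2 E. apply NNPP. intros Hne. set (h := (w2 - w1)%C).
  assert (Hh : h <> RtoC 0).
  { intros E0. apply Hne. replace w2 with (h + w1)%C by (unfold h; ring). rewrite E0. ring. }
  assert (Hseg : forall t, 0 <= t <= 1 -> strip_closed H (w1 + t * h)%C).
  { intros t Ht. unfold strip_closed in *.
    replace (Im (w1 + t * h)%C) with ((1 - t) * Im w1 + t * Im w2)
      by (unfold h, Im; simpl; ring). split; nra. }
  destruct (MVT_cor2 (fun t : R => Re (Cconj h * z (w1 + t * h))%C)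
    (fun t : R => Re (Cconj h * dz (w1 + t * h) * h)%C) 0 1 Rlt_0_1) as [c [Hc1 Hc2]].
  { intros c Hc. apply is_derive_Reals.
    apply (is_derive_Re_C (fun v => Cconj h * z v)%C). apply cderiv_scal, Hz1, closed_big, Hseg, Hc. }
  replace (w1 + 1%R * h)%C with w2 in Hc1 by (unfold h; ring).
  replace (w1 + 0%R * h)%C with w1 in Hc1 by ring.
  rewrite E in Hc1. set (wc := (w1 + c * h)%C) in *.
  assert (Hre : Re (Cconj h * dz wc * h)%C = (Re h * Re h + Im h * Im h) * Re (dz wc)).
  { unfold Re, Im; simpl. ring. }
  assert (Hhp : 0 < Re h * Re h + Im h * Im h).
  { destruct (Req_dec (Re h) 0) as [E1|E1], (Req_dec (Im h) 0) as [E2|E2]; try nra.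
    exfalso. apply Hh. apply injective_projections; assumption. }
  assert (Hz : Re (dz wc) = 0) by (rewrite Hre in Hc1; nra).
  assert (Hwc : strip_closed H wc) by (apply Hseg; lra).
  assert (Him : Im wc = 0).
  { destruct (Req_dec (Im wc) 0) as [|Hn]; [assumption|].
    generalize (Re_dz_pos wc Hwc). unfold strip_closed in Hwc. lra. }
  replace (Im wc) with ((1 - c) * Im w1 + c * Im w2) in Him by (unfold wc, h, Im; simpl; ring).
  destruct w1 as [a1 b1], w2 as [a2 b2]. unfold strip_closed in H1, H2; simpl in H1, H2, Him.
  assert (b1 = 0) by nra. assert (b2 = 0) by nra. subst b1 b2.
  destruct (Rtotal_order a1 a2) as [Hlt|[->|Hlt]].
  - now apply (top_inj_lt a1 a2).
  - now apply Hne.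
  - apply (top_inj_lt a2 a1); auto.
Qed.

Lemma Im_z_above a b : - H < b <= 0 -> - H < Im (z (a, b)).
Proof.
  intros Hb.
  destruct (MVT_cor2 (fun t => Im (z (a, t))) (fun t => Re (dz (a, t))) (- H) b) as [c [Hc1 Hc2]].
  - lra.
  - intros c Hc. apply is_derive_Reals. apply deriv_ver, Hz1. unfold big; simpl; lra.
  - rewrite Hbot in Hc1.
    assert (0 < Re (dz (a, c))) by (apply Re_dz_pos; unfold strip_closed; simpl; lra). nra.
Qed.

(** z - w is periodic, hence bounded on the closed strip. Preimages of bounded sets are thereby
    confined to rectangles, where minima exist. *)
Lemma z_bounded : exists M, 0 < M /\ forall w, strip_closed H w -> Cmod (z w - w)%C <= M.
Proof.
  set (g := fun w => (z w - w)%C).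
  assert (Hg : forall a b, g (a + 2 * PI, b) = g (a, b)).
  { intros a b. unfold g. rewrite <- shift_pair, Hper. ring. }
  destruct (rect_min 0 (2 * PI) (- H) 0 (fun w => - Cmod (g w - 0)%C)) as [w0 [_ Hw0]].
  - generalize PI_RGT_0; lra.
  - lra.
  - intros w [_ Hw].
    apply (rcont_comp (fun x => - x) (fun w => Cmod (g w - 0)%C)).
    + apply rcont_Cmod_sub. apply cderiv_ccont with (dz w + RtoC (-1) * 1)%C.
      apply (cderiv_ext (fun v => z v + RtoC (-1) * v)%C).
      * intros v. unfold g. rewrite RtoC_m1. ring.
      * apply cderiv_plus; [apply Hz1; unfold big; lra|]. apply cderiv_scal, cderiv_id.
    + apply continuity_pt_opp, derivable_continuous_pt, derivable_pt_id.
  - exists (Cmod (g w0 - 0)%C + 1). split; [generalize (Cmod_ge_0 (g w0 - 0)%C); lra|].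
    intros [a b] Hw. destruct (periodic_reduce g Hg a) as [a' [Ha' E]].
    fold (g (a, b)). rewrite E. specialize (Hw0 (a', b)).
    replace (g (a', b)) with (g (a', b) - 0)%C by ring.
    assert (rect 0 (2 * PI) (- H) 0 (a', b)) by (split; [exact Ha'|exact Hw]).
    specialize (Hw0 H0). lra.
Qed.

Lemma Re_close M w p e : Cmod (z w - w)%C <= M -> Cmod (z w - p)%C <= e ->
  Re p - (M + e) <= Re w <= Re p + (M + e).
Proof.
  intros H1 H2. assert (H3 : Cmod (w - p)%C <= M + e).
  { generalize (Cmod_sub_triangle w (z w) p). rewrite (Cmod_sym w (z w)). lra. }
  generalize (re_le_Cmod (w - p)%C). change (Re (w - p)%C) with (Re w - Re p). intros H4.
  assert (H5 : Rabs (Re w - Re p) <= M + e) by lra. apply Rabs_le_between in H5. lra.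
Qed.

Lemma z_ccont w : strip_closed H w -> ccont z w.
Proof. intros Hw. eapply cderiv_ccont, Hz1, closed_big, Hw. Qed.

Lemma z_proper p : (forall e, 0 < e -> exists w, strip_closed H w /\ Cmod (z w - p)%C < e) ->
  exists w, strip_closed H w /\ z w = p.
Proof.
  intros Hp. destruct z_bounded as [M [HM Hb]].
  destruct (rect_min (Re p - (M + 1)) (Re p + (M + 1)) (- H) 0 (fun w => Cmod (z w - p)%C))
    as [w0 [Hw0 Hmin]]; try lra.
  - intros w [_ Hw]. apply rcont_Cmod_sub, z_ccont, Hw.
  - exists w0. split; [apply Hw0|]. apply Cmod_eq0. apply Rnot_lt_le. intros Hlt.
    destruct (Hp (Rmin 1 (Cmod (z w0 - p)%C))) as [w [Hw1 Hw2]]; [apply Rmin_glb_lt; lra|].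
    assert (A1 := Rmin_l 1 (Cmod (z w0 - p)%C)). assert (A2 := Rmin_r 1 (Cmod (z w0 - p)%C)).
    assert (Hr : rect (Re p - (M + 1)) (Re p + (M + 1)) (- H) 0 w).
    { split; [|exact Hw1]. apply (Re_close M w p 1); [now apply Hb|lra]. }
    specialize (Hmin w Hr). cbv beta in Hmin. lra.
Qed.

(** The continuous function |z w - z w0| + max (0, e - |w - w0|) vanishes nowhere, by injectivity;
    its minimum over a rectangle, cut at 1, serves as d. *)
Lemma inv_cont w0 e : strip_closed H w0 -> 0 < e -> exists d, 0 < d /\
  forall w, strip_closed H w -> Cmod (z w - z w0)%C < d -> Cmod (w - w0)%C < e.
Proof.
  intros Hw0 He. destruct z_bounded as [M [HM Hb]].
  set (kk := fun w => Cmod (z w - z w0)%C + Rmax 0 (e - Cmod (w - w0)%C)).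
  destruct (rect_min (Re (z w0) - (M + 1)) (Re (z w0) + (M + 1)) (- H) 0 kk) as [w1 [Hw1 Hmin]]; try lra.
  - intros w [_ Hw]. apply rcont_plus; [apply rcont_Cmod_sub, z_ccont, Hw|].
    apply (rcont_ext (fun w => (e - Cmod (w - w0)%C + Rabs (e - Cmod (w - w0)%C)) / 2)).
    + intros v. unfold Rmax, Rabs. destruct (Rle_dec 0 _), (Rcase_abs _); lra.
    + apply (rcont_comp (fun x => (e - x + Rabs (e - x)) / 2) (fun w => Cmod (w - w0)%C)).
      * apply (rcont_Cmod_sub (fun v => v)), ccont_id.
      * apply continuity_pt_mult; [|apply continuity_pt_const; intros ? ?; reflexivity].
        apply continuity_pt_plus.
        -- apply continuity_pt_minus; [apply continuity_pt_const; intros ? ?; reflexivity|].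
           apply derivable_continuous_pt, derivable_pt_id.
        -- apply (continuity_pt_comp (fun x => e - x) Rabs).
           ++ apply continuity_pt_minus; [apply continuity_pt_const; intros ? ?; reflexivity|].
              apply derivable_continuous_pt, derivable_pt_id.
           ++ apply Rcontinuity_abs.
  - assert (Hpos : 0 < kk w1).
    { unfold kk. assert (P1 := Cmod_ge_0 (z w1 - z w0)%C). assert (P2 := Rmax_l 0 (e - Cmod (w1 - w0)%C)).
      destruct P1 as [P1|P1]; [lra|].
      assert (E : w1 = w0).
      { apply z_inj; [apply Hw1|exact Hw0|]. apply Cmod_eq0. lra. }
      rewrite E, !Cmod_self, Rminus_0_r, Rmax_right by lra. lra. }
    exists (Rmin 1 (kk w1)). split; [now apply Rmin_glb_lt; [lra|]|]. intros w Hw Hd.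
    assert (A1 := Rmin_l 1 (kk w1)). assert (A2 := Rmin_r 1 (kk w1)).
    assert (Hr : rect (Re (z w0) - (M + 1)) (Re (z w0) + (M + 1)) (- H) 0 w).
    { split; [|exact Hw]. apply (Re_close M w (z w0) 1); [now apply Hb|lra]. }
    specialize (Hmin w Hr). apply Rnot_le_lt. intros Hle. unfold kk in Hmin at 2.
    rewrite Rmax_left in Hmin by lra. lra.
Qed.

(** For p close to z w0, the minimum of |z - p| over a small square is interior, because |z w - z
    w0| is at least |z' w0| |w - w0| / 2. It is 0, since otherwise a small step in the direction -
    (z w1 - p) / z' w1 would decrease it. *)
Lemma open_map w0 : strip H w0 -> exists r, 0 < r /\
  forall p, Cmod (p - z w0)%C < r -> exists w, strip H w /\ z w = p.
Proof.
  intros Hw0. assert (Hc0 := strip_is_closed _ Hw0).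
  assert (Hl := dz_neq0 w0 Hc0). set (l := dz w0) in *.
  assert (Hlp : 0 < Cmod l) by now apply Cmod_gt_0.
  destruct (Hz1 w0 (closed_big _ Hc0) (Cmod l / 2)) as [d [Hd K]]; [lra|]. fold l in K.
  unfold strip in Hw0.
  set (s := Rmin d (Rmin (- Im w0) (Im w0 + H)) / 4).
  assert (Hs0 : 0 < Rmin d (Rmin (- Im w0) (Im w0 + H))) by (repeat apply Rmin_glb_lt; lra).
  assert (Hs1 := Rmin_l d (Rmin (- Im w0) (Im w0 + H))).
  assert (Hs2 := Rmin_r d (Rmin (- Im w0) (Im w0 + H))).
  assert (Hs3 := Rmin_l (- Im w0) (Im w0 + H)). assert (Hs4 := Rmin_r (- Im w0) (Im w0 + H)).
  assert (Hs : 0 < s) by (unfold s; lra).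
  exists (Cmod l * s / 4). split; [nra|]. intros p Hp.
  assert (Hlow : forall v, Cmod (v - w0)%C < d -> Cmod l / 2 * Cmod (v - w0)%C <= Cmod (z v - z w0)%C).
  { intros v Hv. specialize (K v Hv).
    generalize (Cmod_triangle (z v - z w0)%C (- (z v - z w0 - l * (v - w0)))%C). rewrite Cmod_opp.
    replace (z v - z w0 + - (z v - z w0 - l * (v - w0)))%C with (l * (v - w0))%C by ring.
    rewrite Cmod_mult. lra. }
  destruct (rect_min (Re w0 - s) (Re w0 + s) (Im w0 - s) (Im w0 + s) (fun w => Cmod (z w - p)%C))
    as [w1 [[Hw1 Hw1'] Hmin]]; try lra.
  { intros w [_ Hw]. apply rcont_Cmod_sub, z_ccont. unfold strip_closed. unfold s in *. lra. }
  cbv beta in Hmin.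
  assert (Hstrip : strip H w1) by (unfold strip; unfold s in *; lra).
  exists w1. split; [exact Hstrip|]. apply Cmod_eq0, Rnot_lt_le. intros Hq.
  assert (Hk1 : Cmod (z w1 - p)%C < Cmod l * s / 4).
  { eapply Rle_lt_trans; [apply (Hmin w0); split; lra|]. now rewrite Cmod_sym. }
  assert (Hx : Cmod (w1 - w0)%C < s).
  { assert (Hd1 : Cmod (w1 - w0)%C < d).
    { eapply Rle_lt_trans; [apply Cmod_le_sum|].
      change (Re (w1 - w0)%C) with (Re w1 - Re w0). change (Im (w1 - w0)%C) with (Im w1 - Im w0).
      assert (Rabs (Re w1 - Re w0) <= s) by (apply Rabs_le; lra).
      assert (Rabs (Im w1 - Im w0) <= s) by (apply Rabs_le; lra). unfold s in *; lra. }
    specialize (Hlow w1 Hd1).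
    generalize (Cmod_sub_triangle (z w1) p (z w0)). nra. }
  assert (Hx1 : Rabs (Re w1 - Re w0) < s) by (eapply Rle_lt_trans; [apply (re_le_Cmod (w1 - w0)%C)|exact Hx]).
  assert (Hx2 : Rabs (Im w1 - Im w0) < s) by (eapply Rle_lt_trans; [apply (im_le_Cmod (w1 - w0)%C)|exact Hx]).
  apply Rabs_def2 in Hx1. apply Rabs_def2 in Hx2.
  set (q := (z w1 - p)%C) in *.
  assert (Hl1 := dz_neq0 w1 (strip_is_closed _ Hstrip)). set (l1 := dz w1) in *.
  set (h := (- (q / l1))%C).
  assert (Hh := Cmod_ge_0 h).
  set (e := Cmod q / (2 * (Cmod h + 1))).
  assert (He : 0 < e) by (apply Rdiv_lt_0_compat; lra).
  destruct (Hz1 w1 (closed_big _ (strip_is_closed _ Hstrip)) e He) as [d2 [Hd2 K2]]. fold l1 in K2.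
  set (g := Rmin (Rmin (s - (Re w1 - Re w0)) (s + (Re w1 - Re w0)))
                (Rmin (s - (Im w1 - Im w0)) (s + (Im w1 - Im w0)))).
  assert (Hg : 0 < g) by (unfold g; repeat apply Rmin_glb_lt; lra).
  assert (G1 : g <= s - (Re w1 - Re w0)) by (unfold g; eapply Rle_trans; [apply Rmin_l|apply Rmin_l]).
  assert (G2 : g <= s + (Re w1 - Re w0)) by (unfold g; eapply Rle_trans; [apply Rmin_l|apply Rmin_r]).
  assert (G3 : g <= s - (Im w1 - Im w0)) by (unfold g; eapply Rle_trans; [apply Rmin_r|apply Rmin_l]).
  assert (G4 : g <= s + (Im w1 - Im w0)) by (unfold g; eapply Rle_trans; [apply Rmin_r|apply Rmin_r]).
  set (t := Rmin (/ 2) (Rmin d2 g / (2 * (Cmod h + 1)))).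
  assert (Hm0 : 0 < Rmin d2 g) by now apply Rmin_glb_lt.
  assert (Ht : 0 < t).
  { apply Rmin_glb_lt; [lra|]. apply Rdiv_lt_0_compat; lra. }
  assert (Ht1 : t <= / 2) by apply Rmin_l.
  assert (Ht2 : t * (2 * (Cmod h + 1)) <= Rmin d2 g).
  { apply Rle_div_r; [lra|]. apply Rmin_r. }
  assert (Hm1 := Rmin_l d2 g). assert (Hm2 := Rmin_r d2 g).
  assert (Hth : Cmod (t * h)%C = t * Cmod h) by (rewrite Cmod_mult, Cmod_R, Rabs_right; lra).
  set (w2 := (w1 + t * h)%C).
  assert (E2 : (w2 - w1)%C = (t * h)%C) by (unfold w2; ring).
  specialize (K2 w2). rewrite E2, Hth in K2. specialize (K2 ltac:(nra)).
  assert (B1 : Rabs (Re (t * h)%C) <= t * Cmod h) by (rewrite <- Hth; apply re_le_Cmod).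
  assert (B2 : Rabs (Im (t * h)%C) <= t * Cmod h) by (rewrite <- Hth; apply im_le_Cmod).
  apply Rabs_le_between in B1. apply Rabs_le_between in B2.
  assert (R1 : Re w2 = Re w1 + Re (t * h)%C) by reflexivity.
  assert (R2 : Im w2 = Im w1 + Im (t * h)%C) by reflexivity.
  assert (Hmin2 := Hmin w2). assert (Hrect : rect (Re w0 - s) (Re w0 + s) (Im w0 - s) (Im w0 + s) w2).
  { split; nra. }
  specialize (Hmin2 Hrect).
  assert (E3 : (z w2 - p)%C = ((z w2 - z w1 - l1 * (t * h)) + (1 - t)%R * q)%C).
  { unfold h, q. rewrite RtoC_minus.
    transitivity ((z w2 - z w1) + (z w1 - p))%C; [ring|]. field. assumption. }
  rewrite E3 in Hmin2.
  assert (Cmod (z w2 - z w1 - l1 * (t * h) + (1 - t)%R * q)%C <= e * (t * Cmod h) + (1 - t) * Cmod q).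
  { eapply Rle_trans; [apply Cmod_triangle|]. rewrite (Cmod_mult (1 - t)%R q), Cmod_R, (Rabs_right (1 - t)) by lra.
    lra. }
  assert (e * (2 * (Cmod h + 1)) = Cmod q) by (unfold e; field; lra).
  assert (e * Cmod h <= Cmod q / 2) by nra. nra.
Qed.

(** * The fluid domain, its closure and its frontier *)

Definition fluid (p : C) : Prop := exists w, strip H w /\ z w = p.

Lemma fluid_open : @open C_UniformSpace fluid.
Proof.
  intros p [w [Hw <-]]. apply locally_Cmod. destruct (open_map w Hw) as [r [Hr K]].
  exists r. split; [exact Hr|]. exact K.
Qed.

Lemma closure_fluid p : closure fluid p <-> exists w, strip_closed H w /\ z w = p.
Proof.
  split.
  - intros Hp. apply z_proper. intros e He.
    destruct (Hp (fun q => Cmod (q - p)%C < e)) as [q [Hq [w [Hw <-]]]].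
    + apply (proj2 (locally_Cmod p _)). exists e. auto.
    + exists w. split; [now apply strip_is_closed|exact Hq].
  - intros [w [Hw <-]] U HU. apply (proj1 (locally_Cmod _ _)) in HU. destruct HU as [d [Hd HU]].
    destruct (z_ccont w Hw d Hd) as [d' [Hd' K]].
    set (t := Rmin (/ 2) (d' / (2 * H))).
    assert (Ht : 0 < t) by (apply Rmin_glb_lt; [lra|apply Rdiv_lt_0_compat; lra]).
    assert (Ht1 : t <= / 2) by apply Rmin_l.
    assert (Ht2 : t * (2 * H) <= d') by (apply Rle_div_r; [lra|apply Rmin_r]).
    unfold strip_closed in Hw.
    (* A small move towards the middle line Im = - H / 2 leads from the closed strip into the open
       one. *)
    set (v := (Re w, (1 - t) * Im w + t * (- H / 2)) : C).
    exists (z v). split.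
    + apply HU, K. eapply Rle_lt_trans; [apply Cmod_le_sum|].
      replace (Re (v - w)%C) with 0 by (unfold v, Re; simpl; ring).
      replace (Im (v - w)%C) with (t * (- H / 2 - Im w)) by (unfold v, Im; simpl; field).
      rewrite Rabs_R0, Rabs_mult, (Rabs_right t) by lra.
      assert (Rabs (- H / 2 - Im w) <= H) by (apply Rabs_le; lra). nra.
    + exists v. split; [|reflexivity]. unfold strip, v; simpl. split; nra.
Qed.

(** Two points are joined by the image of a segment; if U and V had no common point in the fluid,
    the supremum of the parameters mapped into U could belong neither to U nor to V. *)
Lemma fluid_connected : connected fluid.
Proof.
  intros U V HU HV Hcov [p1 [[w1 [Hw1 <-]] HU1]] [p2 [[w2 [Hw2 <-]] HV2]].
  apply NNPP. intros Hno. set (h := (w2 - w1)%C).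
  set (gam := fun t : R => (w1 + t * h)%C).
  assert (Hseg : forall t, 0 <= t <= 1 -> strip H (gam t)).
  { intros t Ht. unfold strip in *.
    replace (Im (gam t)) with ((1 - t) * Im w1 + t * Im w2) by (unfold gam, h, Im; simpl; ring). destruct (Rle_dec t (/2)); split; nra. }
  assert (Hpath : forall O : C -> Prop, @open C_UniformSpace O -> forall t, 0 <= t <= 1 -> O (z (gam t)) ->
     exists d, 0 < d /\ forall s, Rabs (s - t) < d -> O (z (gam s))).
  { intros O HO t Ht Hz. specialize (HO _ Hz). apply locally_Cmod in HO. destruct HO as [d [Hd HO]].
    destruct (z_ccont (gam t) (strip_is_closed _ (Hseg t Ht)) d Hd) as [d' [Hd' K]].
    assert (Hh := Cmod_ge_0 h).
    exists (d' / (Cmod h + 1)). split; [apply Rdiv_lt_0_compat; lra|]. intros s Hs.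
    assert (Hs' : Rabs (s - t) * (Cmod h + 1) < d') by (apply Rlt_div_r; lra).
    apply HO, K. replace (gam s - gam t)%C with ((s - t)%R * h)%C by (unfold gam; rewrite RtoC_minus; ring).
    rewrite Cmod_mult, Cmod_R. generalize (Rabs_pos (s - t)). nra. }
  assert (Hdisj : forall t, 0 <= t <= 1 -> U (z (gam t)) -> V (z (gam t)) -> False).
  { intros t Ht H1 H2. apply Hno. exists (z (gam t)). split; [|auto]. exists (gam t). auto. }
  assert (G0 : gam 0 = w1) by (unfold gam; ring).
  assert (G1' : gam 1 = w2) by (unfold gam, h; ring).
  set (T := fun t => 0 <= t <= 1 /\ U (z (gam t))).
  destruct (completeness T) as [tau [Ht1 Ht2]].
  - exists 1. intros t [Ht _]. lra.
  - exists 0. split; [lra|]. now rewrite G0.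
  - assert (T0 : T 0) by (split; [lra|now rewrite G0]).
    assert (Htau : 0 <= tau <= 1).
    { split; [now apply Ht1|]. apply Ht2. intros t [Ht _]. lra. }
    destruct (Hcov (z (gam tau))) as [Hu|Hv].
    + exists (gam tau). auto.
    + destruct (Hpath U HU tau Htau Hu) as [d [Hd K]].
      destruct (Req_dec tau 1) as [->|Hne].
      * apply (Hdisj 1 ltac:(lra) Hu). now rewrite G1'.
      * set (s := Rmin 1 (tau + d / 2)).
        assert (Hs : tau < s) by (apply Rmin_glb_lt; lra).
        assert (Hs1 : s <= 1) by apply Rmin_l. assert (Hs2 : s <= tau + d / 2) by apply Rmin_r.
        assert (HTs : T s) by (split; [lra|]; apply K; apply Rabs_def1; lra).
        apply Ht1 in HTs. lra.
    + destruct (Hpath V HV tau Htau Hv) as [d [Hd K]].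
      assert (tau <= tau - d); [|lra]. apply Ht2. intros t [Ht HtU].
      apply Rnot_lt_le. intros Hlt. apply (Hdisj t Ht HtU). apply K.
      assert (t <= tau) by (apply Ht1; split; auto). apply Rabs_def1; lra.
Qed.

Lemma not_fluid_top a : ~ fluid (z (a, 0)).
Proof.
  intros [w [Hw E]]. assert (E' : w = (a, 0)).
  { apply z_inj; auto using strip_is_closed, top_closed. }
  subst w. unfold strip in Hw; simpl in Hw. lra.
Qed.

Lemma fluid_above p : fluid p -> - H < Im p.
Proof. intros [[a b] [Hw <-]]. apply Im_z_above. unfold strip in Hw; simpl in Hw. lra. Qed.

Lemma bottom_image p : bottom H p <-> exists a : R, z (a, - H) = p.
Proof.
  unfold bottom. split.
  - intros Hp. destruct z_bounded as [M [HM Hb]].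
    assert (Hx : forall a, a - M <= Re (z (a, - H)) <= a + M).
    { intros a. generalize (Hb _ (bot_closed a)) (re_le_Cmod (z (a, (- H)%R) - (a, (- H)%R))%C).
      change (Re (z (a, (- H)%R) - (a, (- H)%R))%C) with (Re (z (a, - H)) - a). intros.
      assert (Hr : Rabs (Re (z (a, - H)) - a) <= M) by lra. apply Rabs_le_between in Hr. lra. }
    destruct (IVT_gen (fun a => Re (z (a, - H))) (Re p - M) (Re p + M) (Re p)) as [a [_ Ha]].
    + intros a. apply derivable_continuous_pt. apply ex_derive_Reals_0.
      exists (Re (dz (a, - H))). apply (deriv_hor z a (- H)), Hz1, closed_big, bot_closed.
    + generalize (Hx (Re p - M)) (Hx (Re p + M)). intros.
      split; [eapply Rle_trans; [apply Rmin_l|lra]|eapply Rle_trans; [|apply Rmax_r]; lra].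
    + exists a. apply injective_projections; [exact Ha|].
      change (Im (z (a, - H)) = Im p). now rewrite Hbot.
  - intros [a <-]. apply Hbot.
Qed.

Lemma fluid_frontier p : frontier fluid p <-> surface z p \/ bottom H p.
Proof.
  split.
  - intros [H1 H2]. apply closure_fluid in H1. destruct H1 as [[a b] [Hw E]].
    unfold strip_closed in Hw; simpl in Hw.
    destruct (Req_dec b 0) as [->|Hb0]; [left; exists a; auto|].
    destruct (Req_dec b (- H)) as [->|Hb1]; [right; unfold bottom; rewrite <- E; apply Hbot|].
    exfalso. assert (Hp : fluid p) by (exists (a, b); split; [unfold strip; simpl; lra|exact E]).
    destruct (H2 fluid (fluid_open p Hp)) as [q [Hq1 Hq2]]. contradiction.
  - assert (Hout : forall q, ~ fluid q -> closure (fun q => ~ fluid q) q).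
    { intros q Hq U HU. exists q. split; [|exact Hq]. now apply locally_singleton. }
    intros [[a ->]|Hb].
    + split; [apply closure_fluid; exists (a, 0); auto using top_closed|]. apply Hout, not_fluid_top.
    + split.
      * apply bottom_image in Hb. destruct Hb as [a <-]. apply closure_fluid.
        exists (a, - H). auto using bot_closed.
      * apply Hout. intros Hf. apply fluid_above in Hf. unfold bottom in Hb. lra.
Qed.

Lemma z_shift w (m : Z) : z (w + RtoC (IZR m * (2 * PI)))%C = (z w + RtoC (IZR m * (2 * PI)))%C.
Proof.
  assert (Hn : forall n w, z (w + RtoC (INR n * (2 * PI)))%C = (z w + RtoC (INR n * (2 * PI)))%C).
  { induction n; intros v.
    - simpl. rewrite Rmult_0_l, !Cplus_0_r. reflexivity.
    - rewrite S_INR. replace ((INR n + 1) * (2 * PI)) with (INR n * (2 * PI) + 2 * PI) by ring.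
      rewrite RtoC_plus, !Cplus_assoc, Hper, IHn. reflexivity. }
  destruct (Z_le_gt_dec 0 m).
  - replace m with (Z.of_nat (Z.to_nat m)) by lia. rewrite <- INR_IZR_INZ. apply Hn.
  - specialize (Hn (Z.to_nat (- m)) (w + RtoC (IZR m * (2 * PI)))%C).
    assert (E : RtoC (INR (Z.to_nat (- m)) * (2 * PI)) = (- RtoC (IZR m * (2 * PI)))%C).
    { rewrite INR_IZR_INZ, Z2Nat.id, opp_IZR, <- RtoC_opp by lia. f_equal. ring. }
    rewrite E in Hn. set (c := RtoC (IZR m * (2 * PI))) in *.
    replace (w + c + - c)%C with w in Hn by ring. rewrite Hn. ring.
Qed.

Lemma F_shift w (m : Z) : Im (F (w + RtoC (IZR m * (2 * PI)))%C) = Im (F w).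
Proof.
  assert (Hn : forall n w, Im (F (w + RtoC (INR n * (2 * PI)))%C) = Im (F w)).
  { induction n; intros v.
    - simpl. rewrite Rmult_0_l, Cplus_0_r. reflexivity.
    - rewrite S_INR. replace ((INR n + 1) * (2 * PI)) with (INR n * (2 * PI) + 2 * PI) by ring.
      rewrite RtoC_plus, Cplus_assoc, HFper, IHn. reflexivity. }
  destruct (Z_le_gt_dec 0 m).
  - replace m with (Z.of_nat (Z.to_nat m)) by lia. rewrite <- INR_IZR_INZ. apply Hn.
  - rewrite <- (Hn (Z.to_nat (- m)) (w + RtoC (IZR m * (2 * PI)))%C). do 2 f_equal.
    rewrite INR_IZR_INZ, Z2Nat.id, opp_IZR by lia. rewrite <- Cplus_assoc, <- RtoC_plus.
    replace (IZR m * (2 * PI) + - IZR m * (2 * PI)) with 0 by ring. ring.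
Qed.

Lemma conformal : is_conformal_parametrization H H fluid z.
Proof.
  constructor.
  - intros p. reflexivity.
  - intros w1 w2 H1 H2. apply z_inj; unfold strip_top, strip_closed in *; lra.
  - apply continuous_on_C. intros p Hp e He. destruct (z_ccont p Hp e He) as [d [Hd K]].
    exists d. auto.
  - apply bottom_image.
  - exists dz. split; [|split; [|split]].
    + intros w Hw. apply cderiv_is_derive, Hz1, closed_big, strip_is_closed, Hw.
    + apply continuous_on_C. intros p Hp e He.
      destruct (cderiv_ccont _ _ _ (Hz2 p ltac:(unfold strip_top, big in *; lra)) e He) as [d [Hd K]].
      exists d. auto.
    + intros a. apply is_derive_C_R; apply top_hor.
    + exact Hdz0.
  - intros a b _. rewrite <- shift_pair, Hper. unfold Re; simpl. ring.
  - intros a b _. rewrite <- shift_pair, Hper. unfold Im; simpl. ring.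
Qed.

Lemma fluid_domain : is_fluid_domain H fluid (surface z).
Proof.
  constructor.
  - apply fluid_open.
  - apply fluid_connected.
  - intros x y.
    assert (Hsh : forall m p, fluid p -> fluid (p + RtoC (IZR m * (2 * PI)))%C).
    { intros m p [w [Hw <-]]. exists (w + RtoC (IZR m * (2 * PI)))%C. split; [|apply z_shift].
      unfold strip in *. simpl. unfold Im in Hw. lra. }
    split; intros Hf.
    + replace (x, y) with (((x + 2 * PI)%R, y) + RtoC (IZR (-1) * (2 * PI)))%C; [now apply Hsh|].
      rewrite shift_pair. f_equal. ring.
    + replace (x + 2 * PI, y) with ((x, y) + RtoC (IZR 1 * (2 * PI)))%C; [now apply Hsh|].
      rewrite shift_pair. f_equal. ring.
  - intros p [Hp|[a ->]]; [now apply fluid_above|]. apply Im_z_above. lra.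
  - apply fluid_frontier.
Qed.

(** Choice of a preimage in the closed strip; the value is arbitrary outside the closure of the
    fluid. *)
Definition zinv (p : C) : C := epsilon (inhabits (RtoC 0)) (fun w => strip_closed H w /\ z w = p).

Lemma zinv_z w : strip_closed H w -> zinv (z w) = w.
Proof.
  intros Hw. assert (E : exists v, strip_closed H v /\ z v = z w) by (exists w; auto).
  apply (epsilon_spec (inhabits (RtoC 0))) in E. fold (zinv (z w)) in E.
  apply z_inj; tauto.
Qed.

Lemma zinv_cont (f : C -> C) w0 : strip_closed H w0 -> ccont f w0 ->
  forall e, 0 < e -> exists d, 0 < d /\ forall q, closure fluid q ->
    Cmod (q - z w0)%C < d -> Cmod (f (zinv q) - f (zinv (z w0)))%C < e.
Proof.
  intros Hw0 Hf e He. destruct (Hf e He) as [d1 [Hd1 K1]].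
  destruct (inv_cont w0 d1 Hw0 Hd1) as [d [Hd K]]. exists d. split; [exact Hd|].
  intros q Hq Hd'. apply closure_fluid in Hq. destruct Hq as [w [Hw <-]].
  rewrite !zinv_z by assumption. apply K1, K; assumption.
Qed.

Lemma fluid_closure p : fluid p -> closure fluid p.
Proof. intros Hp U HU. exists p. split; [now apply locally_singleton|exact Hp]. Qed.

Lemma zinv_ccont f w0 : strip H w0 -> ccont f w0 -> ccont (fun p => f (zinv p)) (z w0).
Proof.
  intros Hw0 Hf e He.
  destruct (zinv_cont f w0 (strip_is_closed _ Hw0) Hf e He) as [d [Hd K]].
  destruct (open_map w0 Hw0) as [r [Hr O]].
  exists (Rmin d r). split; [now apply Rmin_glb_lt|]. intros q Hq.
  apply K; [|eapply Rlt_le_trans; [exact Hq|apply Rmin_l]].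
  apply fluid_closure, O. eapply Rlt_le_trans; [exact Hq|apply Rmin_r].
Qed.

Lemma zinv_cderiv w0 : strip H w0 -> cderiv zinv (z w0) (/ dz w0)%C.
Proof.
  intros Hw0 e He. assert (Hc0 := strip_is_closed _ Hw0).
  assert (Hl := dz_neq0 w0 Hc0). set (l := dz w0) in *.
  assert (Hlp : 0 < Cmod l) by now apply Cmod_gt_0.
  set (e1 := Rmin (Cmod l / 2) (e * (Cmod l * Cmod l) / 2)).
  assert (He1 : 0 < e1).
  { apply Rmin_glb_lt; [lra|]. assert (0 < Cmod l * Cmod l) by nra. nra. }
  assert (He1a : e1 <= Cmod l / 2) by apply Rmin_l.
  assert (He1b : e1 <= e * (Cmod l * Cmod l) / 2) by apply Rmin_r.
  destruct (Hz1 w0 (closed_big _ Hc0) e1 He1) as [d1 [Hd1 K1]]. fold l in K1.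
  destruct (zinv_ccont (fun w => w) w0 Hw0 (ccont_id w0) d1 Hd1) as [d2 [Hd2 K2]].
  destruct (open_map w0 Hw0) as [r [Hr O]].
  exists (Rmin d2 r). split; [now apply Rmin_glb_lt|]. intros p Hp.
  specialize (K2 p ltac:(eapply Rlt_le_trans; [exact Hp|apply Rmin_l])).
  destruct (O p ltac:(eapply Rlt_le_trans; [exact Hp|apply Rmin_r])) as [w [Hw <-]].
  rewrite !zinv_z in * by auto using strip_is_closed.
  specialize (K1 w K2). assert (Hn := Cmod_ge_0 (w - w0)%C).
  assert (Hlow : Cmod l / 2 * Cmod (w - w0)%C <= Cmod (z w - z w0)%C).
  { generalize (Cmod_triangle (z w - z w0)%C (- (z w - z w0 - l * (w - w0)))%C). rewrite Cmod_opp.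
    replace (z w - z w0 + - (z w - z w0 - l * (w - w0)))%C with (l * (w - w0))%C by ring.
    rewrite Cmod_mult. nra. }
  replace (w - w0 - / l * (z w - z w0))%C with (- (/ l * (z w - z w0 - l * (w - w0))))%C
    by (field; assumption).
  rewrite Cmod_opp, Cmod_mult, Cmod_inv by assumption.
  apply Rmult_le_reg_l with (Cmod l); [lra|]. rewrite <- Rmult_assoc, Rinv_r, Rmult_1_l by lra.
  eapply Rle_trans; [exact K1|].
  apply Rle_trans with (e * (Cmod l * Cmod l) / 2 * Cmod (w - w0)%C); [now apply Rmult_le_compat_r|].
  assert (0 <= e * Cmod l) by nra. nra.
Qed.

(** * The stream function and its derivatives *)

Definition slope (w : C) : C := (dF w * / dz w)%C.
Definition slope1 (w : C) : C :=
  ((d2F w * / dz w + dF w * (- / (dz w * dz w) * d2z w)) * / dz w)%C.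

Lemma inv_dz_cderiv w : strip_closed H w ->
  cderiv (fun v => / dz v)%C w (- / (dz w * dz w) * d2z w)%C.
Proof.
  intros Hw. apply (cderiv_comp (fun v => / v)%C dz).
  - apply Hz2, closed_big, Hw.
  - apply cderiv_Cinv. now apply dz_neq0.
Qed.

Lemma slope_cderiv w : strip_closed H w ->
  cderiv slope w (d2F w * / dz w + dF w * (- / (dz w * dz w) * d2z w))%C.
Proof.
  intros Hw. apply (cderiv_mult dF (fun v => / dz v)%C); [apply HF2, closed_big, Hw|now apply inv_dz_cderiv].
Qed.

Lemma slope1_ccont w : strip_closed H w -> ccont slope1 w.
Proof.
  intros Hw. assert (Hi := inv_dz_cderiv w Hw). assert (Hb := closed_big w Hw).
  assert (Hd : cderiv dF w (d2F w)) by now apply HF2.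
  assert (Hd2 : cderiv d2F w (d3F w)) by now apply HF3.
  assert (Hd3 : cderiv d2z w (d3z w)) by now apply Hz3.
  assert (Hdd : cderiv (fun v => / (dz v * dz v))%C w
    (- / ((dz w * dz w) * (dz w * dz w)) * (d2z w * dz w + dz w * d2z w))%C).
  { apply (cderiv_comp (fun v => / v)%C (fun v => dz v * dz v)%C).
    - apply cderiv_mult; now apply Hz2.
    - apply cderiv_Cinv. apply Cmult_neq_0; now apply dz_neq0. }
  eapply cderiv_ccont.
  apply (cderiv_mult (fun v => d2F v * / dz v + dF v * (- / (dz v * dz v) * d2z v))%C (fun v => / dz v)%C);
    [|exact Hi].
  apply cderiv_plus; [apply cderiv_mult; eassumption|].
  apply cderiv_mult; [exact Hd|].
  apply (cderiv_ext (fun v => RtoC (-1) * (/ (dz v * dz v) * d2z v))%C).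
  { intros v. rewrite RtoC_m1. ring. }
  apply cderiv_scal, cderiv_mult; eassumption.
Qed.

(** By the Cauchy-Riemann equations the derivative [slope] of F composed with the inverse of z has
    the x-derivative of Im F as imaginary part and the y-derivative as real part. Its continuity on
    the closed strip extends the gradient of [psi] to the surface. *)
Definition psi (x y : R) : R := Im (F (zinv (x, y))) - y * y.
Definition psi_x (p : C) : R := Im (slope (zinv p)).
Definition psi_y (p : C) : R := Re (slope (zinv p)) - 2 * Im p.

Lemma psi_partials x y : fluid (x, y) ->
  is_derive (fun t => psi t y) x (psi_x (x, y)) /\ is_derive (fun t => psi x t) y (psi_y (x, y)).
Proof.
  intros [w [Hw E]].
  assert (HD : cderiv (fun p => F (zinv p)) (x, y) (slope (zinv (x, y)))).
  { rewrite <- E, zinv_z by auto using strip_is_closed. apply (cderiv_comp F zinv).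
    - now apply zinv_cderiv.
    - rewrite zinv_z by auto using strip_is_closed. apply HF1, closed_big, strip_is_closed, Hw. }
  split.
  - unfold psi_x. rewrite <- (Rminus_0_r (Im (slope _))).
    apply (is_derive_minus (K := R_AbsRing) (V := R_NormedModule) (fun t => Im (F (zinv (t, y)))) (fun _ => y * y)).
    + exact (proj2 (deriv_hor _ _ _ _ HD)).
    + apply (is_derive_const (K := R_AbsRing) (V := R_NormedModule)).
  - unfold psi_y; simpl.
    apply (is_derive_minus (K := R_AbsRing) (V := R_NormedModule) (fun t => Im (F (zinv (x, t)))) (fun t => t * t)).
    + exact (proj2 (deriv_ver _ _ _ _ HD)).
    + auto_derive; [trivial|]. simpl. ring.
Qed.

Lemma slope_zinv_cderiv x y : fluid (x, y) ->
  cderiv (fun p => slope (zinv p)) (x, y) (slope1 (zinv (x, y))).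
Proof.
  intros [w [Hw E]]. rewrite <- E, zinv_z by auto using strip_is_closed.
  apply (cderiv_comp slope zinv).
  - now apply zinv_cderiv.
  - rewrite zinv_z by auto using strip_is_closed. apply slope_cderiv, strip_is_closed, Hw.
Qed.

Lemma psi_partials2 x y : fluid (x, y) ->
  (is_derive (fun t => psi_x (t, y)) x (Im (slope1 (zinv (x, y)))) /\
   is_derive (fun t => psi_x (x, t)) y (Re (slope1 (zinv (x, y))))) /\
  (is_derive (fun t => psi_y (t, y)) x (Re (slope1 (zinv (x, y)))) /\
   is_derive (fun t => psi_y (x, t)) y (- Im (slope1 (zinv (x, y))) - 2)).
Proof.
  intros Hf. assert (HD := slope_zinv_cderiv x y Hf).
  destruct (deriv_hor _ _ _ _ HD) as [D1 D2]. destruct (deriv_ver _ _ _ _ HD) as [D3 D4].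
  split; split; [exact D2|exact D4| |].
  - replace (Re (slope1 (zinv (x, y)))) with (Re (slope1 (zinv (x, y))) - 0) by ring.
    apply (is_derive_minus (K := R_AbsRing) (V := R_NormedModule) (fun t => Re (slope (zinv (t, y)))) (fun _ => 2 * y)).
    + exact D1.
    + apply (is_derive_const (K := R_AbsRing) (V := R_NormedModule)).
  - apply (is_derive_minus (K := R_AbsRing) (V := R_NormedModule) (fun t => Re (slope (zinv (x, t)))) (fun t => 2 * t)).
    + exact D3.
    + auto_derive; [trivial|]. simpl. ring.
Qed.

Lemma rcont_zinv f x y : fluid (x, y) -> (forall w, strip_closed H w -> ccont f w) ->
  ccont (fun p => f (zinv p)) (x, y).
Proof. intros [w [Hw <-]] Hf. apply zinv_ccont; auto using strip_is_closed. Qed.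

Lemma F_ccont w : strip_closed H w -> ccont F w.
Proof. intros. eapply cderiv_ccont, HF1, closed_big; assumption. Qed.

Lemma slope_ccont w : strip_closed H w -> ccont slope w.
Proof. intros. eapply cderiv_ccont, slope_cderiv; assumption. Qed.

Lemma rcont_pairs (f : C -> R) p : rcont f p -> rcont (fun q => f (Re q, Im q)) p.
Proof. apply rcont_ext. now intros [a b]. Qed.

Lemma rcont_Im_sub (f : C -> R) (h : R -> R) p : rcont f p -> continuity_pt h (Im p) ->
  rcont (fun q => f q - h (Im q)) p.
Proof.
  intros Hf Hh. apply rcont_plus; [exact Hf|].
  apply (rcont_comp (fun x => - h x) Im).
  - apply (rcont_Im (fun v => v)), ccont_id.
  - now apply continuity_pt_opp.
Qed.

Lemma psi_ex_diff x y : fluid (x, y) -> ex_diff_n psi 2 x y.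
Proof.
  intros Hf.
  assert (R1 : ccont (fun p => slope1 (zinv p)) (x, y)) by (apply rcont_zinv; auto using slope1_ccont).
  assert (R2 : ccont (fun p => slope (zinv p)) (x, y)) by (apply rcont_zinv; auto using slope_ccont).
  assert (R3 : ccont (fun p => F (zinv p)) (x, y)) by (apply rcont_zinv; auto using F_ccont).
  assert (Hlin : forall c, continuity_pt (fun t => c * t) y).
  { intros c. apply derivable_continuous_pt, ex_derive_Reals_0. auto_derive. trivial. }
  apply (ex_diff_n_S fluid psi (fun u v => psi_x (u, v)) (fun u v => psi_y (u, v)));
    auto using fluid_open.
  - intros. now apply psi_partials.
  - unfold psi. apply (rcont_Im_sub (fun q => Im (F (zinv (Re q, Im q)))) (fun t => t * t)).
    + apply (rcont_pairs (fun q => Im (F (zinv q)))). now apply rcont_Im.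
    + simpl. apply derivable_continuous_pt, ex_derive_Reals_0. auto_derive. trivial.
  - apply (ex_diff_n_S fluid _ (fun u v => Im (slope1 (zinv (u, v)))) (fun u v => Re (slope1 (zinv (u, v)))));
      auto using fluid_open.
    + intros. now apply psi_partials2.
    + apply (rcont_pairs psi_x). now apply rcont_Im.
    + split; [|exact I]. apply continuity_2d_rcont, (rcont_pairs (fun p => Im (slope1 (zinv p)))).
      now apply rcont_Im.
    + split; [|exact I]. apply continuity_2d_rcont, (rcont_pairs (fun p => Re (slope1 (zinv p)))).
      now apply rcont_Re.
  - apply (ex_diff_n_S fluid _ (fun u v => Re (slope1 (zinv (u, v)))) (fun u v => - Im (slope1 (zinv (u, v))) - 2));
      auto using fluid_open.
    + intros. now apply psi_partials2.
    + apply (rcont_pairs psi_y).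
      apply (rcont_Im_sub (fun p => Re (slope (zinv p))) (fun t => 2 * t)); [now apply rcont_Re|apply Hlin].
    + split; [|exact I]. apply continuity_2d_rcont, (rcont_pairs (fun p => Re (slope1 (zinv p)))).
      now apply rcont_Re.
    + split; [|exact I]. apply continuity_2d_rcont, (rcont_pairs (fun p => - Im (slope1 (zinv p)) - 2)).
      apply (rcont_comp (fun t => - t - 2) (fun p => Im (slope1 (zinv p)))); [now apply rcont_Im|].
      apply derivable_continuous_pt, ex_derive_Reals_0. auto_derive. trivial.
Qed.

Lemma psi_laplace x y : fluid (x, y) ->
  Derive_n (fun t => psi t y) 2 x + Derive_n (fun t => psi x t) 2 y = - 2.
Proof.
  intros Hf. simpl.
  assert (Hloc := open_locally_2d fluid
    (fun u v => Derive (fun t => psi t v) u = psi_x (u, v) /\ Derive (fun t => psi u t) v = psi_y (u, v))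
    x y fluid_open Hf).
  destruct Hloc as [d Hd].
  { intros u v Huv. destruct (psi_partials u v Huv) as [D1 D2].
    split; now apply is_derive_unique. }
  destruct (psi_partials2 x y Hf) as [[D1 _] [_ D2]].
  rewrite (Derive_ext_loc (Derive (fun t => psi t y)) (fun t => psi_x (t, y))).
  2:{ exists d. intros t Ht. apply Hd; [exact Ht|]. rewrite Rminus_diag, Rabs_R0. apply cond_pos. }
  rewrite (Derive_ext_loc (Derive (fun t => psi x t)) (fun t => psi_y (x, t))).
  2:{ exists d. intros t Ht. apply Hd; [|exact Ht]. rewrite Rminus_diag, Rabs_R0. apply cond_pos. }
  apply is_derive_unique in D1. apply is_derive_unique in D2.
  transitivity (Im (slope1 (zinv (x, y))) + (- Im (slope1 (zinv (x, y))) - 2)); [|ring].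
  f_equal; assumption.
Qed.

Lemma surface_closure p : fluid p \/ surface z p -> closure fluid p.
Proof.
  intros [Hp|[a ->]]; [now apply fluid_closure|]. apply closure_fluid. exists (a, 0). auto using top_closed.
Qed.

Lemma zinv_rcont_on (part : C -> R) f p0 e : (forall c, Rabs (part c) <= Cmod c) ->
  (forall a b : C, part (a - b)%C = part a - part b) ->
  (forall w, strip_closed H w -> ccont f w) -> closure fluid p0 -> 0 < e ->
  exists d, 0 < d /\ forall q, closure fluid q -> Cmod (q - p0)%C < d ->
    Rabs (part (f (zinv q)) - part (f (zinv p0))) < e.
Proof.
  intros P1 P2 Hf Hp He. apply closure_fluid in Hp. destruct Hp as [w [Hw <-]].
  destruct (zinv_cont f w Hw (Hf w Hw) e He) as [d [Hd K]]. exists d. split; [exact Hd|].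
  intros q Hq Hd'. rewrite <- P2. eapply Rle_lt_trans; [apply P1|]. now apply K.
Qed.

Lemma stream : is_stream_function G 2 B (Qb - H * H) H fluid (surface z) psi.
Proof.
  constructor.
  - apply continuous_on_R. intros p Hp e He.
    destruct (zinv_rcont_on Im F p (e / 2) im_le_Cmod (fun _ _ => eq_refl) F_ccont Hp ltac:(lra)) as [d1 [Hd1 K1]].
    assert (Hc : rcont (fun q => Im q * Im q) p).
    { apply (rcont_comp (fun t => t * t) Im); [apply (rcont_Im (fun v => v)), ccont_id|].
      apply derivable_continuous_pt, ex_derive_Reals_0. auto_derive. trivial. }
    destruct (Hc (e / 2) ltac:(lra)) as [d2 [Hd2 K2]].
    exists (Rmin d1 d2). split; [now apply Rmin_glb_lt|]. intros q Hq Hd.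
    specialize (K1 q Hq ltac:(eapply Rlt_le_trans; [exact Hd|apply Rmin_l])).
    specialize (K2 q ltac:(eapply Rlt_le_trans; [exact Hd|apply Rmin_r])).
    unfold psi. destruct p as [x0 y0], q as [x y]. simpl in *.
    replace (Im (F (zinv (x, y))) - y * y - (Im (F (zinv (x0, y0))) - y0 * y0))
      with ((Im (F (zinv (x, y))) - Im (F (zinv (x0, y0)))) - (y * y - y0 * y0)) by ring.
    unfold Rminus at 1. eapply Rle_lt_trans; [apply Rabs_triang|]. rewrite Rabs_Ropp. lra.
  - apply psi_ex_diff.
  - intros x y Hxy. apply closure_fluid in Hxy. destruct Hxy as [w [Hw E]].
    unfold psi. rewrite <- shift_pair, <- E, <- Hper, !zinv_z, HFper; trivial.
    unfold strip_closed in *. simpl. unfold Im in Hw. lra.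
  - apply psi_laplace.
  - intros p [a ->]. unfold psi. replace (Re (z (a, 0)), Im (z (a, 0))) with (z (a, 0)) by now destruct (z (a, 0)).
    rewrite zinv_z by apply top_closed. rewrite HFtop. ring.
  - exists psi_x, psi_y. split; [|split; [|split; [|split]]].
    + intros x y Hf. symmetry. apply is_derive_unique. now apply psi_partials.
    + intros x y Hf. symmetry. apply is_derive_unique. now apply psi_partials.
    + apply continuous_on_R. intros p Hp e He.
      destruct (zinv_rcont_on Im slope p e im_le_Cmod (fun _ _ => eq_refl) slope_ccont (surface_closure p Hp) He) as [d [Hd K]].
      exists d. split; [exact Hd|]. intros q Hq. apply K. now apply surface_closure.
    + apply continuous_on_R. intros p Hp e He.
      destruct (zinv_rcont_on Re slope p (e / 2) re_le_Cmod (fun _ _ => eq_refl) slope_ccont (surface_closure p Hp) ltac:(lra)) as [d [Hd K]].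
      exists (Rmin d (e / 4)). split; [apply Rmin_glb_lt; lra|]. intros q Hq Hd'.
      specialize (K q (surface_closure q Hq) ltac:(eapply Rlt_le_trans; [exact Hd'|apply Rmin_l])).
      assert (Hi : Rabs (Im q - Im p) < e / 4).
      { eapply Rle_lt_trans; [apply (im_le_Cmod (q - p)%C)|]. eapply Rlt_le_trans; [exact Hd'|apply Rmin_r]. }
      unfold psi_y. apply Rabs_def2 in K. apply Rabs_def2 in Hi. apply Rabs_def1; lra.
    + intros p [a ->]. unfold psi_x, psi_y. rewrite zinv_z by apply top_closed.
      rewrite <- (HBern a). f_equal. f_equal. unfold slope, Cdiv. set (s := (dF (a, 0) * / dz (a, 0))%C).
      set (y := Im (z (a, 0))).
      transitivity (Re (s - RtoC (2 * y))%C * Re (s - RtoC (2 * y))%C + Im (s - RtoC (2 * y))%C * Im (s - RtoC (2 * y))%C).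
      * unfold Re, Im; simpl. ring.
      * set (c := (s - RtoC (2 * y))%C). unfold Cmod. rewrite sqrt_sqrt; [unfold Re, Im; ring|]. nra.
  - intros p Hp. apply bottom_image in Hp. destruct Hp as [a <-].
    unfold psi. replace (Re (z (a, - H)), Im (z (a, - H))) with (z (a, - H)) by now destruct (z (a, - H)).
    rewrite zinv_z by apply bot_closed. rewrite HFbot, Hbot. ring.
Qed.

(** * Symmetry about crests and troughs *)

Lemma extremum_multiple a : Im (dz (a, 0)) = 0 -> exists m : Z, a = IZR m * PI.
Proof.
  intros E. rewrite Hmono in E. specialize (Hk a).
  assert (Hs : sin a = 0) by nra. now apply sin_eq_0_0.
Qed.

(** The reflection w -> - conj w followed by m periods fixes the parameter m PI, hence also the
    abscissa of its image. *)
Lemma Re_z_multiple m : Re (z (IZR m * PI, 0)) = IZR m * PI.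
Proof.
  set (w := (IZR m * PI, 0) : C).
  assert (E1 := Hsym w). assert (E2 := z_shift (refl w) m).
  replace (refl w + RtoC (IZR m * (2 * PI)))%C with w in E2.
  2:{ unfold refl, w; simpl. rewrite shift_pair. f_equal. ring. }
  rewrite E1 in E2. apply (f_equal Re) in E2. unfold refl in E2. simpl in E2. unfold Re in *. lra.
Qed.

(** The reflection in the line x = m PI is that in x = 0 followed by m periods, and both lift to the
    strip. *)
Lemma symmetric_multiple m : symmetric_about (IZR m * PI) fluid psi.
Proof.
  assert (Hrefl : forall w x y, z w = (x, y) ->
     z (refl w + RtoC (IZR m * (2 * PI)))%C = (2 * (IZR m * PI) - x, y)).
  { intros w x y E. rewrite z_shift, Hsym, E. unfold refl; simpl.
    rewrite shift_pair. f_equal. ring. }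
  assert (Him : forall w, Im (refl w + RtoC (IZR m * (2 * PI)))%C = Im w).
  { intros w. unfold refl, Im; simpl. ring. }
  assert (Hf : forall x y, fluid (x, y) -> fluid (2 * (IZR m * PI) - x, y)).
  { intros x y [w [Hw E]]. exists (refl w + RtoC (IZR m * (2 * PI)))%C. split; [|now apply Hrefl].
    unfold strip. now rewrite Him. }
  split.
  - intros x y. split; [|apply Hf]. intros Hx. apply Hf in Hx.
    replace (2 * (IZR m * PI) - (2 * (IZR m * PI) - x)) with x in Hx by ring. exact Hx.
  - intros x y Hc. apply closure_fluid in Hc. destruct Hc as [w [Hw E]].
    unfold psi. rewrite <- (Hrefl w x y E), <- E.
    rewrite !zinv_z; [|exact Hw|unfold strip_closed; now rewrite Him].
    now rewrite F_shift, HFsym.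
Qed.

Lemma water_wave : is_water_wave G H 2 B (Qb - H * H) H fluid psi z.
Proof.
  constructor.
  - exact HH.
  - apply fluid_domain.
  - apply conformal.
  - apply stream.
  - intros p Hp.
    (* At an extremum of the elevation its derivative sin a * k a vanishes, so the parameter a is a
       multiple of PI. *)
    assert (Hm : exists m : Z, p = z (IZR m * PI, 0)).
    { destruct Hp as [[[a ->] Hmax]|[[a ->] Hmin]].
      - destruct (extremum_multiple a) as [m ->]; [|now exists m].
        assert (- Im (dz (a, 0)) = 0); [|lra].
        apply (derive_min_zero (fun s => - Im (z (a + s, 0))) 1); [lra| |].
        + apply (is_derive_opp (K := R_AbsRing) (V := R_NormedModule) (fun s => Im (z (a + s, 0)))).
          apply (is_derive_ext (fun s : R => Im (z ((a, 0) + s * 1)%C))).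
          { intros; now rewrite path_point. }
          replace (Im (dz (a, 0))) with (Im (dz ((a, 0) + 0 * 1) * 1)%C).
          * apply is_derive_Im_C, Hz1. rewrite path_point. apply closed_big, top_closed.
          * rewrite Cmult_1_r, path_point. do 3 f_equal. ring.
        + intros t _. rewrite Rplus_0_r.
          generalize (Hmax (z (a + t, 0)) ltac:(eexists; reflexivity)). lra.
      - destruct (extremum_multiple a) as [m ->]; [|now exists m].
        apply (derive_min_zero (fun s => Im (z (a + s, 0))) 1); [lra| |].
        + apply (is_derive_ext (fun s : R => Im (z ((a, 0) + s * 1)%C))).
          { intros; now rewrite path_point. }
          replace (Im (dz (a, 0))) with (Im (dz ((a, 0) + 0 * 1) * 1)%C).
          * apply is_derive_Im_C, Hz1. rewrite path_point. apply closed_big, top_closed.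
          * rewrite Cmult_1_r, path_point. do 3 f_equal. ring.
        + intros t _. rewrite Rplus_0_r.
          apply (Hmin (z (a + t, 0)) ltac:(eexists; reflexivity)). }
    destruct Hm as [m ->]. rewrite Re_z_multiple. apply symmetric_multiple.
Qed.

End Geometry.

(** * Evaluation on the unit circle *)

Definition evR (a : W) (t : R) : R := sumZ (fun n => a n * cos (IZR n * t)).
Definition evI (a : W) (t : R) : R := sumZ (fun n => a n * - sin (IZR n * t)).
(** The value of the Laurent series at X = e^{-it}, that is at the surface parameter t. *)
Definition evT (a : W) (t : R) : C := (evR a t, evI a t).

Lemma trig_summable (a : W) (q : Z -> R) : (forall n, Rabs (q n) <= 1) -> summable (fun n => a n * q n).
Proof.
  intros H. apply summable_le with (2 := summable_abs _ (W_summable a)). intros n.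
  rewrite Rabs_mult. rewrite <- (Rmult_1_r (Rabs (a n))) at 2.
  apply Rmult_le_compat_l; [apply Rabs_pos|apply H].
Qed.

Lemma cos_abs x : Rabs (cos x) <= 1.
Proof. apply Rabs_le. generalize (COS_bound x). lra. Qed.
Lemma sin_abs x : Rabs (- sin x) <= 1.
Proof. rewrite Rabs_Ropp. apply Rabs_le. generalize (SIN_bound x). lra. Qed.

Lemma evR_summable (a : W) t : summable (fun n => a n * cos (IZR n * t)).
Proof. apply (trig_summable a (fun n => cos (IZR n * t))). intros; apply cos_abs. Qed.
Lemma evI_summable (a : W) t : summable (fun n => a n * - sin (IZR n * t)).
Proof. apply (trig_summable a (fun n => - sin (IZR n * t))). intros; apply sin_abs. Qed.

Lemma evR_bound (a : W) t : Rabs (evR a t) <= nrm a.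
Proof.
  eapply Rle_trans; [apply sumZ_abs, evR_summable|].
  eapply Rle_trans; [|apply sum_abs_le]. apply sumZ_le.
  - apply summable_abs, evR_summable.
  - apply summable_abs, W_summable.
  - intros n. rewrite Rabs_mult. rewrite <- (Rmult_1_r (Rabs (a n))) at 2.
    apply Rmult_le_compat_l; [apply Rabs_pos|apply cos_abs].
Qed.

Lemma IZR_le_wt n : Rabs (IZR n) <= 4 * wt n.
Proof.
  rewrite <- abs_IZR. unfold wt. generalize (exp_ineq1_le (IZR (Z.abs n) / 4)). lra.
Qed.

Lemma sin_nat_mult n t : Rabs (sin (INR n * t)) <= INR n * Rabs (sin t).
Proof.
  induction n.
  - simpl. rewrite Rmult_0_l, sin_0, Rabs_R0. lra.
  - rewrite S_INR. replace ((INR n + 1) * t) with (INR n * t + t) by ring. rewrite sin_plus.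
    eapply Rle_trans; [apply Rabs_triang|]. rewrite !Rabs_mult.
    generalize (cos_abs t) (cos_abs (INR n * t)) (Rabs_pos (sin t)) (Rabs_pos (sin (INR n * t))). intros. nra.
Qed.

Lemma sin_Z_mult n t : Rabs (sin (IZR n * t)) <= Rabs (IZR n) * Rabs (sin t).
Proof.
  destruct (Z_le_gt_dec 0 n).
  - replace n with (Z.of_nat (Z.to_nat n)) by lia. rewrite <- INR_IZR_INZ.
    rewrite (Rabs_right (INR _)) by (apply Rle_ge, pos_INR). apply sin_nat_mult.
  - replace n with (- Z.of_nat (Z.to_nat (- n)))%Z by lia. rewrite opp_IZR, <- INR_IZR_INZ.
    rewrite Ropp_mult_distr_l_reverse, sin_neg, !Rabs_Ropp.
    rewrite (Rabs_right (INR _)) by (apply Rle_ge, pos_INR). apply sin_nat_mult.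
Qed.

(** From |sin (n t)| <= |n| |sin t| and |n| <= 4 wt n. The factor sin t matters: at crests and
    troughs the slope of a Crapper wave vanishes, so a perturbation must be controlled relative to
    sin t for the sign to persist. *)
Lemma evI_bound (a : W) t : Rabs (evI a t) <= 4 * nrm a * Rabs (sin t).
Proof.
  eapply Rle_trans; [apply sumZ_abs, evI_summable|].
  replace (4 * nrm a * Rabs (sin t)) with (sumZ (fun n => 4 * Rabs (sin t) * (Rabs (a n) * wt n))).
  2:{ rewrite sumZ_scal. unfold nrm. ring. }
  apply sumZ_le.
  - apply summable_abs, evI_summable.
  - apply summable_scal, W_summable_abs.
  - intros n. rewrite Rabs_mult, Rabs_Ropp.
    generalize (sin_Z_mult n t) (IZR_le_wt n) (Rabs_pos (sin t)) (Rabs_pos (a n)). intros.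
    replace (4 * Rabs (sin t) * (Rabs (a n) * wt n)) with (Rabs (a n) * ((4 * wt n) * Rabs (sin t))) by ring.
    apply Rmult_le_compat_l; [assumption|]. eapply Rle_trans; [eassumption|].
    apply Rmult_le_compat_r; assumption.
Qed.

Lemma evT_plus a b t : evT (a + b)%W t = (evT a t + evT b t)%C.
Proof.
  unfold evT, evR, evI, Cplus; simpl. f_equal; rewrite <- sumZ_plus;
    try apply evR_summable; try apply evI_summable; apply sumZ_ext; intros; ring.
Qed.

Lemma evT_opp a t : evT (- a)%W t = (- evT a t)%C.
Proof.
  unfold evT, evR, evI, Copp; simpl. f_equal; rewrite <- sumZ_opp; apply sumZ_ext; intros; ring.
Qed.

Lemma evT_minus a b t : evT (a - b)%W t = (evT a t - evT b t)%C.
Proof. unfold Wminus. rewrite evT_plus, evT_opp. reflexivity. Qed.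

Lemma evT_star a t : evT (star a) t = Cconj (evT a t).
Proof.
  unfold evT, evR, evI, Cconj; simpl. f_equal.
  - rewrite <- sumZ_rev. apply sumZ_ext. intros n. rewrite Z.opp_involutive, opp_IZR.
    rewrite Ropp_mult_distr_l_reverse, cos_neg. reflexivity.
  - rewrite <- sumZ_opp, <- sumZ_rev. apply sumZ_ext. intros n. rewrite Z.opp_involutive, opp_IZR.
    rewrite Ropp_mult_distr_l_reverse, sin_neg. ring.
Qed.

Lemma evT_delta m c t : evT (delta m c) t = (c * cos (IZR m * t), - (c * sin (IZR m * t))).
Proof.
  assert (H : forall q : Z -> R, sumZ (fun n => delta m c n * q n) = c * q m).
  { intros q. destruct (sumZ_single m (fun n => delta m c n * q n)) as [_ E].
    - intros n Hn. simpl. destruct (Z.eq_dec n m); [contradiction|ring].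
    - rewrite E. simpl. destruct (Z.eq_dec m m) as [_|[]]; reflexivity. }
  unfold evT, evR, evI. rewrite (H (fun n => cos (IZR n * t))), (H (fun n => - sin (IZR n * t))).
  f_equal. ring.
Qed.

Lemma evT_cst c t : evT (cst c) t = RtoC c.
Proof.
  unfold cst. rewrite evT_delta. simpl. rewrite Rmult_0_l, cos_0, sin_0.
  apply injective_projections; simpl; ring.
Qed.

Lemma evT_X t : evT X t = (cos t, - sin t).
Proof. unfold X. rewrite evT_delta. apply injective_projections; simpl; rewrite ?Rmult_1_l; ring. Qed.

Lemma char_fubini (a b : W) (q : Z -> Z -> R) : (forall k n, Rabs (q k n) <= 1) ->
  sumZ (fun n => sumZ (fun k => a k * b (n - k)%Z * q k n)) =
  sumZ (fun k => sumZ (fun n => a k * b n * q k (n + k)%Z)).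
Proof.
  intros Hq.
  set (A := fun k n => a k * b (n - k)%Z * q k n).
  assert (HA : forall k n, Rabs (A k n) <= Rabs (a k) * Rabs (b (n - k)%Z)).
  { intros. unfold A. rewrite !Rabs_mult.
    rewrite <- (Rmult_1_r (Rabs (a k) * Rabs _)) at 2.
    apply Rmult_le_compat_l; [|apply Hq]. apply Rmult_le_pos; apply Rabs_pos. }
  assert (Hb : forall k, summable (fun n => Rabs (b (n - k)%Z)) /\
     sumZ (fun n => Rabs (b (n - k)%Z)) = sumZ (fun n => Rabs (b n))).
  { intros k. apply (shifted (fun n => Rabs (b n))), summable_abs, W_summable. }
  assert (S1 : forall k, summable (A k)).
  { intros k. apply summable_le with (1 := HA k). apply summable_scal, Hb. }
  destruct (fubini A S1) as (_ & _ & E).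
  - apply summable_le with (b := fun k => sumZ (fun n => Rabs (b n)) * Rabs (a k)).
    + intros k. rewrite Rabs_right.
      2:{ apply Rle_ge, sumZ_pos; [intros; apply Rabs_pos|now apply summable_abs]. }
      rewrite Rmult_comm, <- (proj2 (Hb k)), <- sumZ_scal.
      apply sumZ_le; [now apply summable_abs|apply summable_scal, Hb|apply HA].
    + apply summable_scal, summable_abs, W_summable.
  - unfold A in E at 1. rewrite E. apply sumZ_ext. intros k.
    destruct (sumZ_shift _ k (S1 k)) as [_ <-]. apply sumZ_ext. intros n. unfold A.
    replace (n + k - k)%Z with n by lia. reflexivity.
Qed.

(** Evaluation is a character: the addition formulas split the double sum of [char_fubini] into
    products. *)
Lemma evT_mult a b t : evT (a * b)%W t = (evT a t * evT b t)%C.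
Proof.
  assert (Hdist : forall (q : Z -> R), (forall n, Rabs (q n) <= 1) ->
     sumZ (fun n => (a * b)%W n * q n) = sumZ (fun k => sumZ (fun n => a k * b n * q (n + k)%Z))).
  { intros q Hq. rewrite <- (char_fubini a b (fun _ n => q n)) by auto.
    apply sumZ_ext. intros n. simpl. unfold conv. rewrite Rmult_comm, <- sumZ_scal.
    apply sumZ_ext. intros; ring. }
  assert (HR := evR_summable b t). assert (HI := evI_summable b t).
  unfold evT at 1, evR, evI.
  rewrite (Hdist (fun n => cos (IZR n * t))), (Hdist (fun n => - sin (IZR n * t)))
    by (intros; apply cos_abs || apply sin_abs).
  unfold evT, Cmult; simpl fst; simpl snd. f_equal.
  - transitivity (sumZ (fun k => evR b t * (a k * cos (IZR k * t)) + - evI b t * (a k * - sin (IZR k * t)))).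
    + apply sumZ_ext. intros k.
      rewrite (sumZ_ext _ (fun n => (a k * cos (IZR k * t)) * (b n * cos (IZR n * t))
         + (- (a k * - sin (IZR k * t))) * (b n * - sin (IZR n * t)))).
      * rewrite sumZ_plus, !sumZ_scal by now apply summable_scal. unfold evR, evI. ring.
      * intros n. rewrite plus_IZR, Rmult_plus_distr_r, cos_plus. ring.
    + rewrite sumZ_plus, !sumZ_scal by (apply summable_scal; apply evR_summable || apply evI_summable).
      fold (evR a t) (evI a t). ring.
  - transitivity (sumZ (fun k => evI b t * (a k * cos (IZR k * t)) + evR b t * (a k * - sin (IZR k * t)))).
    + apply sumZ_ext. intros k.
      rewrite (sumZ_ext _ (fun n => (a k * cos (IZR k * t)) * (b n * - sin (IZR n * t))
         + (a k * - sin (IZR k * t)) * (b n * cos (IZR n * t)))).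
      * rewrite sumZ_plus, !sumZ_scal by now apply summable_scal. unfold evR, evI. ring.
      * intros n. rewrite plus_IZR, Rmult_plus_distr_r, sin_plus. ring.
    + rewrite sumZ_plus, !sumZ_scal by (apply summable_scal; apply evR_summable || apply evI_summable).
      fold (evR a t) (evI a t). ring.
Qed.

Lemma evI_star_inv a t : star a = a -> evI a t = 0.
Proof.
  intros H. assert (E := evT_star a t). rewrite H in E. unfold evT, Cconj in E. simpl in E.
  apply (f_equal snd) in E. simpl in E. lra.
Qed.

(** * Holomorphic extension to the strip *)

(** Coefficients at positive powers; [pd] divides them by n to form a primitive, and its value at n
    = 0 is 0. *)
Definition pc (a : W) (n : nat) : R := match n with O => 0 | S _ => a (Z.of_nat n) end.
Definition pd (a : W) (n : nat) : R := pc a n / INR n.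

Lemma pc_decay a : decay (/ 4) (pc a).
Proof.
  unfold decay. apply @ex_series_le with (2 := W_summable_abs a). intros n.
  change norm with Rabs. rewrite Rabs_right.
  2:{ apply Rle_ge, Rmult_le_pos; [apply Rabs_pos|left; apply exp_pos]. }
  destruct n as [|n].
  - simpl. rewrite Rabs_R0, Rmult_0_l. rewrite Rabs_right; [|apply Rle_ge]; apply Rmult_le_pos;
      auto using Rabs_pos; left; apply wt_pos.
  - unfold fold, pc. rewrite (Rabs_right (Rabs (a (Z.of_nat (S n))) * _)), (Rabs_right (Rabs (a (- _)%Z) * _))
      by (apply Rle_ge, Rmult_le_pos; [apply Rabs_pos|left; apply wt_pos]).
    assert (0 <= Rabs (a (- Z.of_nat (S n))%Z) * wt (- Z.of_nat (S n))).
    { apply Rmult_le_pos; [apply Rabs_pos|left; apply wt_pos]. }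
    unfold wt at 1. rewrite Z.abs_eq, <- INR_IZR_INZ by lia.
    replace (/ 4 * INR (S n)) with (INR (S n) / 4) by field. lra.
Qed.

Lemma pd_decay a : decay (/ 4) (pd a).
Proof.
  unfold decay. apply @ex_series_le with (2 := pc_decay a). intros n.
  change norm with Rabs. rewrite Rabs_right.
  2:{ apply Rle_ge, Rmult_le_pos; [apply Rabs_pos|left; apply exp_pos]. }
  apply Rmult_le_compat_r; [left; apply exp_pos|]. unfold pd.
  destruct n as [|n]; [simpl; unfold Rdiv; rewrite Rmult_0_l, Rabs_R0; lra|].
  assert (1 <= INR (S n)) by (rewrite S_INR; generalize (pos_INR n); lra).
  unfold Rdiv. rewrite Rabs_mult, (Rabs_right (/ _)) by (left; apply Rinv_0_lt_compat; lra).
  rewrite <- (Rmult_1_r (Rabs (pc a (S n)))) at 2. apply Rmult_le_compat_l; [apply Rabs_pos|].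
  rewrite <- Rinv_1. apply Rinv_le_contravar; lra.
Qed.

Lemma nb_pd a : nb (pd a) = pc a.
Proof.
  apply functional_extensionality. intros [|n]; unfold nb, pd.
  - simpl. ring.
  - field. apply not_0_INR. lia.
Qed.

Lemma cderiv_val f w l m : l = m -> cderiv f w l -> cderiv f w m.
Proof. now intros ->. Qed.

Section Strip.

Context (H : R) (HH : 0 < H).

(** The half turn about - i H. It is holomorphic and satisfies e^{-in rf(w)} = e^{-2nH} e^{inw}, so
    the negative powers of a series compatible with the flat bottom are the positive ones evaluated
    at [rf w]. One-sided series therefore suffice. *)
Definition rf (w : C) : C := (- w - RtoC (2 * H) * Ci)%C.

Lemma Im_rf w : Im (rf w) = - Im w - 2 * H.
Proof. unfold rf, Im, Ci; simpl. ring. Qed.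

Definition Msum (b : nat -> R) (w : C) : C := (G1 b w + G1 b (rf w))%C.
Definition Mdif (b : nat -> R) (w : C) : C := (G1 b w + (-1)%R * G1 b (rf w))%C.

Lemma rf_cderiv w : cderiv rf w (-1)%R.
Proof.
  apply (cderiv_ext (fun v => RtoC (-1) * v + - (RtoC (2 * H) * Ci))%C).
  { intros v. unfold rf. rewrite RtoC_m1. ring. }
  apply (cderiv_val _ _ (RtoC (-1) * 1 + 0)%C); [ring|].
  apply cderiv_plus; [apply cderiv_scal, cderiv_id|apply cderiv_const].
Qed.

Lemma G1_rf_cderiv s b w : decay s b -> - 2 * H - s < Im w ->
  cderiv (fun v => G1 b (rf v)) w (Ci * G1 (nb b) (rf w))%C.
Proof.
  intros Hb Hw.
  replace (Ci * G1 (nb b) (rf w))%C with ((- Ci * G1 (nb b) (rf w)) * RtoC (-1))%C.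
  2:{ rewrite RtoC_m1. ring. }
  apply (cderiv_comp (G1 b) rf); [apply rf_cderiv|]. apply G1_cderiv with s; [exact Hb|].
  rewrite Im_rf. lra.
Qed.

Lemma Msum_cderiv s b w : decay s b -> - 2 * H - s < Im w < s ->
  cderiv (Msum b) w (- Ci * Mdif (nb b) w)%C.
Proof.
  intros Hb Hw.
  replace (- Ci * Mdif (nb b) w)%C with (- Ci * G1 (nb b) w + Ci * G1 (nb b) (rf w))%C.
  2:{ unfold Mdif. rewrite RtoC_m1. ring. }
  apply cderiv_plus; [apply G1_cderiv with s|apply G1_rf_cderiv with s]; auto; lra.
Qed.

Lemma Mdif_cderiv s b w : decay s b -> - 2 * H - s < Im w < s ->
  cderiv (Mdif b) w (- Ci * Msum (nb b) w)%C.
Proof.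
  intros Hb Hw.
  replace (- Ci * Msum (nb b) w)%C with (- Ci * G1 (nb b) w + (-1)%R * (Ci * G1 (nb b) (rf w)))%C.
  2:{ unfold Msum. rewrite RtoC_m1. ring. }
  apply cderiv_plus; [apply G1_cderiv with s|apply cderiv_scal, G1_rf_cderiv with s]; auto; lra.
Qed.

(** A primitive of [dhol]. On the bottom line [rf] coincides with the reflection in the vertical
    axis, and since the coefficients are real, Im is constant there; c adjusts the constant. *)
Definition hol (a : W) (c : R) (w : C) : C := (a 0%Z * w + (Ci * Mdif (pd a) w + c * Ci))%C.
Definition dhol (a : W) (w : C) : C := (a 0%Z + Msum (pc a) w)%C.
Definition d2hol (a : W) (w : C) : C := (- Ci * Mdif (nb (pc a)) w)%C.
Definition d3hol (a : W) (w : C) : C := (- Ci * (- Ci * Msum (nb (nb (pc a))) w))%C.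

Lemma Ci_sqr : (Ci * - Ci)%C = RtoC 1.
Proof. apply injective_projections; simpl; ring. Qed.

Lemma hol_cderiv a c w : big H (/ 16) w -> cderiv (hol a c) w (dhol a w).
Proof.
  intros Hw. unfold big in Hw.
  replace (dhol a w) with (a 0%Z * 1 + (Ci * (- Ci * Msum (nb (pd a)) w) + 0))%C.
  2:{ rewrite nb_pd, Cmult_assoc, Ci_sqr. unfold dhol. ring. }
  apply cderiv_plus; [apply cderiv_scal, cderiv_id|].
  apply cderiv_plus; [|apply cderiv_const]. apply cderiv_scal.
  apply Mdif_cderiv with (/ 4); [apply pd_decay|lra].
Qed.

Lemma dhol_cderiv a w : big H (/ 16) w -> cderiv (dhol a) w (d2hol a w).
Proof.
  intros Hw. unfold big in Hw.
  replace (d2hol a w) with (0 + - Ci * Mdif (nb (pc a)) w)%C by (unfold d2hol; ring).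
  apply cderiv_plus; [apply cderiv_const|].
  apply Msum_cderiv with (/ 4); [apply pc_decay|lra].
Qed.

Lemma d2hol_cderiv a w : big H (/ 16) w -> cderiv (d2hol a) w (d3hol a w).
Proof.
  intros Hw. unfold big in Hw. apply cderiv_scal.
  apply Mdif_cderiv with (/ 8); [apply decay_diff with (/ 4); [apply pc_decay|lra]|lra].
Qed.

Lemma ee_period n w : ee (INR n * (w + RtoC (2 * PI)))%C = ee (INR n * w)%C.
Proof.
  unfold ee.
  replace (Re (INR n * (w + RtoC (2 * PI)))%C) with (Re (INR n * w)%C + 2 * INR n * PI)
    by (unfold Re; simpl; ring).
  replace (Im (INR n * (w + RtoC (2 * PI)))%C) with (Im (INR n * w)%C) by (unfold Im; simpl; ring).
  now rewrite cos_period, sin_period.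
Qed.

Lemma CSeries_ext c d : (forall n, c n = d n) -> CSeries c = CSeries d.
Proof. intros E. unfold CSeries. f_equal; apply Series_ext; intros; now rewrite E. Qed.

Lemma G1_period b w : G1 b (w + RtoC (2 * PI))%C = G1 b w.
Proof. apply CSeries_ext. intros n. unfold gterm. now rewrite ee_period. Qed.

Lemma G1_rf_period b w : G1 b (rf (w + RtoC (2 * PI)))%C = G1 b (rf w).
Proof.
  rewrite <- (G1_period b (rf (w + RtoC (2 * PI)))%C). f_equal. unfold rf. ring.
Qed.

Lemma hol_period a c w : hol a c (w + RtoC (2 * PI))%C = (hol a c w + RtoC (a 0%Z * (2 * PI)))%C.
Proof. unfold hol, Mdif. rewrite G1_period, G1_rf_period, !RtoC_mult. ring. Qed.

Lemma dhol_period a w : dhol a (w + RtoC (2 * PI))%C = dhol a w.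
Proof. unfold dhol, Msum. now rewrite G1_period, G1_rf_period. Qed.

Lemma ee_refl n w : ee (INR n * refl w)%C = Cconj (ee (INR n * w)%C).
Proof.
  unfold ee, Cconj.
  replace (Re (INR n * refl w)%C) with (- Re (INR n * w)%C) by (unfold refl, Re; simpl; ring).
  replace (Im (INR n * refl w)%C) with (Im (INR n * w)%C) by (unfold refl, Re, Im; simpl; ring).
  rewrite cos_neg, sin_neg. simpl. f_equal. ring.
Qed.

Lemma G1_refl b w : G1 b (refl w) = Cconj (G1 b w).
Proof.
  unfold G1. rewrite (CSeries_ext _ (fun n => Cconj (gterm b w n))).
  - unfold CSeries, Cconj; simpl. f_equal. rewrite <- Series_opp. apply Series_ext. reflexivity.
  - intros n. unfold gterm. rewrite ee_refl. unfold Cconj, Cmult; simpl. f_equal; ring.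
Qed.

Lemma rf_refl w : rf (refl w) = refl (rf w).
Proof. apply injective_projections; unfold rf, refl, Re, Im, Ci; simpl; ring. Qed.

Lemma hol_refl a c w : hol a c (refl w) = refl (hol a c w).
Proof.
  unfold hol, Mdif. rewrite rf_refl, !G1_refl.
  apply injective_projections; unfold refl, Re, Im, Ci; simpl; ring.
Qed.

Lemma rf_bot a : rf (a, - H) = refl (a, - H).
Proof. apply injective_projections; unfold rf, refl, Re, Im, Ci; simpl; ring. Qed.

Lemma hol_bot a c t : Im (hol a c (t, - H)) = - (a 0%Z * H) + c.
Proof.
  unfold hol, Mdif. rewrite rf_bot, G1_refl. unfold Im, Re, Ci; simpl. ring.
Qed.

Lemma dhol_bot a t : Re (dhol a (t, - H)) = a 0%Z + 2 * Re (G1 (pc a) (t, - H)).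
Proof. unfold dhol, Msum. rewrite rf_bot, G1_refl. unfold Re; simpl. ring. Qed.

(** On Im w = - H every mode with n >= 1 carries a factor at most e^{-H}; this keeps Re z' close to
    its mean 1 on a deep bottom. *)
Lemma G1_bot_bound a t : Cmod (G1 (pc a) (t, - H)) <= 2 * (exp (- H) * nrm a).
Proof.
  assert (Hs : ex_series (fun n => exp (- H) * fold (fun n => Rabs (a n) * wt n) n)).
  { apply (ex_series_scal_l (exp (- H)) (fold (fun n => Rabs (a n) * wt n))).
    apply ex_series_fold, W_summable_abs. }
  assert (Hp : forall k, 0 <= Rabs (a k) * wt k).
  { intros. apply Rmult_le_pos; [apply Rabs_pos|left; apply wt_pos]. }
  unfold nrm, sumZ. rewrite <- Series_scal_l.
  apply (CSeries_bound (gterm (pc a) (t, - H))); [|exact Hs].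
  intros n. rewrite Cmod_gterm. simpl Im. assert (Pe := exp_pos (- H)).
  destruct n as [|n].
  - simpl. rewrite Rabs_R0, Rmult_0_l. apply Rmult_le_pos; [lra|apply Hp].
  - unfold pc, fold.
    assert (Hn : 1 <= INR (S n)) by (rewrite S_INR; generalize (pos_INR n); lra).
    rewrite Rmult_comm. apply Rmult_le_compat; [left; apply exp_pos|apply Rabs_pos|apply exp_le; nra|].
    generalize (Hp (- Z.of_nat (S n))%Z) (wt_ge1 (Z.of_nat (S n))) (Rabs_pos (a (Z.of_nat (S n)))). nra.
Qed.

Definition adm (a : W) : Prop := forall n : Z, a (- n)%Z = exp (- (2 * H * IZR n)) * a n.

Lemma adm_intro (a : W) : (forall n, (0 < n)%Z -> a (- n)%Z = exp (- (2 * H)) ^ Z.to_nat n * a n) -> adm a.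
Proof.
  intros Ha.
  assert (Hpos : forall n, (0 < n)%Z -> a (- n)%Z = exp (- (2 * H * IZR n)) * a n).
  { intros n Hn. rewrite (Ha n Hn). f_equal. rewrite <- Rpower_pow by apply exp_pos.
    unfold Rpower. rewrite ln_exp, INR_IZR_INZ, Z2Nat.id by lia. f_equal. ring. }
  intros n. destruct (Z_lt_ge_dec 0 n); [now apply Hpos|].
  destruct (Z.eq_dec n 0) as [->|].
  - simpl. rewrite Rmult_0_r, Ropp_0, exp_0. ring.
  - specialize (Hpos (- n)%Z ltac:(lia)). rewrite Z.opp_involutive in Hpos. rewrite Hpos.
    rewrite opp_IZR, <- Rmult_assoc, <- exp_plus.
    replace (- (2 * H * IZR n) + - (2 * H * - IZR n)) with 0 by ring. rewrite exp_0. ring.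
Qed.

(** The factor e^{-2nH} is multiplicative in n and hence passes through convolutions. *)
Lemma adm_mult a b : adm a -> adm b -> adm (a * b)%W.
Proof.
  intros Ha Hb n. simpl. unfold conv. rewrite <- sumZ_scal, <- sumZ_rev. apply sumZ_ext. intros k.
  replace (- n - - k)%Z with (- (n - k))%Z by lia. rewrite Ha, Hb, minus_IZR.
  replace (- (2 * H * IZR n)) with (- (2 * H * IZR k) + - (2 * H * (IZR n - IZR k))) by ring.
  rewrite exp_plus. ring.
Qed.

Lemma adm_cst_mult c a : adm a -> adm (cst c * a)%W.
Proof. intros Ha n. rewrite !cst_mult_coef, Ha. ring. Qed.

Lemma gterm_top b t n : gterm b (t, 0) n = (b n * cos (INR n * t), - (b n * sin (INR n * t))).
Proof.
  unfold gterm, ee.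
  replace (Im (INR n * (t, 0))%C) with 0 by (unfold Im; simpl; ring).
  replace (Re (INR n * (t, 0))%C) with (INR n * t) by (unfold Re; simpl; ring).
  rewrite exp_0. apply injective_projections; simpl; ring.
Qed.

Lemma gterm_rf_top b t n : gterm b (rf (t, 0)) n =
  (exp (- (2 * H * INR n)) * (b n * cos (INR n * t)), exp (- (2 * H * INR n)) * (b n * sin (INR n * t))).
Proof.
  unfold gterm, ee.
  replace (Im (INR n * rf (t, 0))%C) with (- (2 * H * INR n)) by (unfold rf, Im, Ci; simpl; ring).
  replace (Re (INR n * rf (t, 0))%C) with (- (INR n * t)) by (unfold rf, Re, Ci; simpl; ring).
  rewrite cos_neg, sin_neg. apply injective_projections; simpl; ring.
Qed.

Lemma gterm_ex b w : decay (/ 4) b -> Im w <= / 4 ->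
  ex_series (fun n => Re (gterm b w n)) /\ ex_series (fun n => Im (gterm b w n)).
Proof.
  intros Hb Hw.
  destruct (CSeries_bound (gterm b w) _ (fun n => Req_le _ _ (Cmod_gterm b w n)) (decay_term _ b w Hb Hw))
    as (A1 & A2 & _). auto.
Qed.

Lemma Series_head (x y : nat -> R) c : ex_series y -> x 0%nat = c + y 0%nat ->
  (forall n, x (S n) = y (S n)) -> Series x = c + Series y.
Proof.
  intros Hy H0 HS. rewrite (Series_incr_1 y Hy), (Series_incr_1 x), H0.
  - rewrite (Series_ext (fun k => x (S k)) (fun k => y (S k))) by exact HS. ring.
  - apply (ex_series_incr_1 x). apply (ex_series_ext (fun k => y (S k))); [intros; symmetry; apply HS|].
    now apply (ex_series_incr_1 y).
Qed.

(** By [adm], the series evaluated at [rf] reproduces the negative frequencies. *)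
Lemma dhol_top a t : adm a -> dhol a (t, 0) = evT a t.
Proof.
  intros Ha.
  destruct (gterm_ex (pc a) (t, 0) (pc_decay a) ltac:(simpl; lra)) as [A1 A2].
  destruct (gterm_ex (pc a) (rf (t, 0)) (pc_decay a) ltac:(rewrite Im_rf; simpl; lra)) as [B1 B2].
  assert (Hadm : forall n, a (- Z.of_nat n)%Z = exp (- (2 * H * INR n)) * a (Z.of_nat n)).
  { intros n. rewrite Ha, INR_IZR_INZ. reflexivity. }
  apply injective_projections.
  - change (a 0%Z + (Series (fun n => Re (gterm (pc a) (t, 0) n))
      + Series (fun n => Re (gterm (pc a) (rf (t, 0)) n))) = evR a t).
    rewrite <- Series_plus by assumption. unfold evR, sumZ. symmetry. apply Series_head.
    + now apply (ex_series_plus (fun n => Re (gterm (pc a) (t, 0) n))).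
    + rewrite gterm_top, gterm_rf_top. unfold Re; simpl. rewrite Rmult_0_l, cos_0. ring.
    + intros n. rewrite gterm_top, gterm_rf_top. unfold fold, pc. rewrite Hadm.
      rewrite opp_IZR, <- INR_IZR_INZ, Ropp_mult_distr_l_reverse, cos_neg. unfold Re; cbn [fst snd]. ring.
  - change (0 + (Series (fun n => Im (gterm (pc a) (t, 0) n))
      + Series (fun n => Im (gterm (pc a) (rf (t, 0)) n))) = evI a t).
    rewrite <- Series_plus by assumption. unfold evI, sumZ. symmetry. apply Series_head.
    + now apply (ex_series_plus (fun n => Im (gterm (pc a) (t, 0) n))).
    + rewrite gterm_top, gterm_rf_top. unfold Im; simpl. rewrite Rmult_0_l, sin_0. ring.
    + intros n. rewrite gterm_top, gterm_rf_top. unfold fold, pc. rewrite Hadm.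
      rewrite opp_IZR, <- INR_IZR_INZ, Ropp_mult_distr_l_reverse, sin_neg. unfold Im; cbn [fst snd]. ring.
Qed.

(** The hypotheses describe [Jop] applied to a, which is thus identified with twice the elevation of
    the surface. *)
Lemma hol_top_Im (a : W) (t : R) (J : W) : star J = J -> J 0%Z = 0 ->
  (forall n, (0 < n)%Z -> J n = (1 - exp (- (2 * H * IZR n))) / IZR n * a n) ->
  2 * Im (hol a 0 (t, 0)) = evR J t.
Proof.
  intros Hs H0 HJ.
  destruct (gterm_ex (pd a) (t, 0) (pd_decay a) ltac:(simpl; lra)) as [A1 _].
  destruct (gterm_ex (pd a) (rf (t, 0)) (pd_decay a) ltac:(rewrite Im_rf; simpl; lra)) as [B1 _].
  assert (E : Im (hol a 0 (t, 0)) = Series (fun n => Re (gterm (pd a) (t, 0) n))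
     - Series (fun n => Re (gterm (pd a) (rf (t, 0)) n))).
  { unfold hol, Mdif, G1, CSeries, Im, Re, Ci; simpl. ring. }
  rewrite E, <- Series_minus, <- Series_scal_l by assumption. unfold evR, sumZ. apply Series_ext.
  intros n. rewrite gterm_top, gterm_rf_top. destruct n as [|n].
  - simpl. unfold pd; simpl. rewrite H0. unfold Rdiv. ring.
  - unfold fold. assert (Hm : J (- Z.of_nat (S n))%Z = J (Z.of_nat (S n))).
    { rewrite <- Hs at 1. simpl. reflexivity. }
    rewrite Hm, HJ by lia. rewrite opp_IZR, <- INR_IZR_INZ, Ropp_mult_distr_l_reverse, cos_neg.
    unfold pd, pc, Re. cbn [fst snd]. field. apply not_0_INR. lia.
Qed.

End Strip.

(** * Water waves from solutions in the Wiener algebra *)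

(** z' = f^2 / c, of mean 1, so that z advances by 2 PI over a period. [Fw] is the derivative h f /
    c^2 of the potential, with h = P f^* + 2 c y f, which gives F' / z' = 2 y + (P / c) f^* / f. *)
Definition Zw (f : W) : W := (cst (/ (f * f)%W 0%Z) * (f * f))%W.
Definition fu (e : R) (u : E) : W := fop e (fst u).
Definition Fw (e : R) (u : E) : W :=
  (cst (/ ((fu e u * fu e u)%W 0%Z * (fu e u * fu e u)%W 0%Z)) * (hop e u * fu e u))%W.

Lemma exp_neg_bounds H : 0 < H -> 0 <= exp (- (2 * H)) < 1.
Proof.
  intros HH. split; [left; apply exp_pos|]. rewrite <- exp_0. apply exp_increasing. lra.
Qed.

Lemma epsop_coef e a n : 0 <= e < 1 -> epsop e a n = if (0 <? n)%Z then e ^ Z.to_nat n * a n else 0.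
Proof.
  intros He. simpl. destruct (Z.ltb_spec 0 n); [|rewrite clip_0; ring].
  rewrite clip_id; [reflexivity|].
  assert (H1 := pow_le_self e (Z.to_nat n) He ltac:(lia)). rewrite Rabs_right; lra.
Qed.

Lemma adm_fop H x : 0 < H -> adm H (fop (exp (- (2 * H))) x).
Proof.
  intros HH. apply adm_intro. intros n Hn. unfold fop.
  rewrite !Wplus_coef, !Pi_coef.
  change (star (epsop (exp (- (2 * H))) x) (- n)%Z) with (epsop (exp (- (2 * H))) x (- - n)%Z).
  change (star (epsop (exp (- (2 * H))) x) n) with (epsop (exp (- (2 * H))) x (- n)%Z).
  rewrite Z.opp_involutive, !epsop_coef by now apply exp_neg_bounds.
  destruct (Z.ltb_spec 0 n); [|lia]. destruct (Z.ltb_spec 0 (- n)); [lia|].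
  simpl (cst 1 _). destruct (Z.eq_dec (- n) 0); [lia|]. destruct (Z.eq_dec n 0); [lia|]. ring.
Qed.

Lemma adm_hop H g u : 0 < H -> F1 (exp (- (2 * H))) g u = cst 0 -> adm H (hop (exp (- (2 * H))) u).
Proof.
  intros HH HF. apply adm_intro. intros n Hn.
  apply (f_equal (fun a : W => a n)) in HF. unfold F1, Pr in HF.
  rewrite Wminus_coef, Pi_coef, epsop_coef in HF by now apply exp_neg_bounds.
  destruct (Z.ltb_spec 0 n); [|lia].
  change (star (hop (exp (- (2 * H))) u) n) with (hop (exp (- (2 * H))) u (- n)%Z) in HF.
  simpl (cst 0 n) in HF. destruct (Z.eq_dec n 0); lra.
Qed.

Lemma star_Pop x : star (Pop x) = Pop x.
Proof. unfold Pop. now rewrite star_plus, star_cst, star_Sop. Qed.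

Lemma berop_const e g u : F2 e g u = cst 0 -> exists c, berop e g u = cst c.
Proof.
  intros HF. exists (berop e g u 0%Z).
  assert (Hs : star (berop e g u) = berop e g u).
  { unfold berop. rewrite mean_cst, star_plus, !star_mult, star_Jop, star_Pop, !star_cst. reflexivity. }
  assert (Hp : forall n, (0 < n)%Z -> berop e g u n = 0).
  { intros n Hn. apply (f_equal (fun a : W => a n)) in HF. unfold F2 in HF. rewrite Pi_coef in HF.
    destruct (Z.ltb_spec 0 n); [|lia]. rewrite HF. simpl. destruct (Z.eq_dec n 0); reflexivity. }
  apply W_ext. intros n. simpl (cst _ n). destruct (Z.eq_dec n 0) as [->|]; [reflexivity|].
  destruct (Z_lt_ge_dec 0 n); [now apply Hp|].
  rewrite <- Hs. change (star (berop e g u) n) with (berop e g u (- n)%Z). apply Hp. lia.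
Qed.

Lemma Jop_coef e a n : 0 <= e < 1 -> (0 < n)%Z ->
  Jop e a n = (1 - e ^ Z.to_nat n) / IZR n * a n.
Proof.
  intros He Hn. unfold Jop. rewrite Wplus_coef.
  change (star (Jm e a) n) with (Jm e a (- n)%Z). rewrite !Jm_coef by assumption.
  destruct (Z.ltb_spec 0 n); [|lia]. destruct (Z.ltb_spec 0 (- n)); [lia|]. ring.
Qed.

Lemma Jop_coef0 e a : 0 <= e < 1 -> Jop e a 0%Z = 0.
Proof.
  intros He. unfold Jop. rewrite Wplus_coef. change (star (Jm e a) 0%Z) with (Jm e a 0%Z).
  rewrite !Jm_coef by assumption. simpl. ring.
Qed.

Lemma evT_real a t : star a = a -> evT a t = RtoC (evR a t).
Proof. intros Ha. unfold evT. now rewrite evI_star_inv. Qed.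

Lemma is_derive_sqr (q : R -> R) (t l : R) :
  is_derive q t l -> is_derive (fun s => q s * q s) t (2 * q t * l).
Proof.
  intros H. auto_derive; [intuition; exists l; exact H|]. apply is_derive_unique in H. change (Derive (fun x => q x) t) with (Derive q t). rewrite H. ring.
Qed.

(** On the surface F' / z' - 2 y is P / c times a number of modulus 1, so Bernoulli's law is the
    constancy of [berop]. Moreover F' - 2 y z' is real there, because P |f|^2 is; hence Im F - y^2
    is constant along the surface, and [C0] makes it 0. The smallness hypothesis gives Re z' >= 1 -
    4 / 8 on the bottom. *)
Lemma wave_of_solution H g u (k : R -> R) : 0 < H ->
  let e := exp (- (2 * H)) in
  F1 e g u = cst 0 -> F2 e g u = cst 0 -> (fu e u * fu e u)%W 0%Z <> 0 ->
  exp (- H) * nrm (Zw (fu e u)) <= / 8 ->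
  (forall t, 0 <= evR (Zw (fu e u)) t) -> (forall t, evT (Zw (fu e u)) t <> RtoC 0) ->
  (forall t, 0 < k t) -> (forall t, evI (Zw (fu e u)) t = sin t * k t) ->
  exists B Q D psi z, is_water_wave g H 2 B Q H D psi z /\
    forall a, x_alpha z a = evR (Zw (fu e u)) a.
Proof.
  intros HH e HF1 HF2 Hc Hsmall Hpos Hne Hk HkI.
  assert (He : 0 <= e < 1) by now apply exp_neg_bounds.
  assert (Hadmh : adm H (hop e u)) by now apply adm_hop with g.
  destruct (berop_const e g u HF2) as [c0 Hber].
  assert (Hhop : hop e u = (Pop (snd u) * star (fu e u) + Jop e (fu e u * fu e u) * fu e u)%W) by reflexivity.
  unfold berop in Hber. rewrite mean_cst in Hber.
  set (f := fu e u) in *. assert (Hadm : adm H f) by now apply adm_fop.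
  change (fop e (fst u)) with f in Hber.
  set (P := Pop (snd u)) in *. assert (HPs : star P = P) by apply star_Pop.
  set (c := (f * f)%W 0%Z) in *. set (J := Jop e (f * f)%W) in *.
  assert (HJs : star J = J) by apply star_Jop.
  set (Z := Zw f) in *.
  assert (HZ : Z = (cst (/ c) * (f * f))%W) by reflexivity.
  assert (HZadm : adm H Z) by (rewrite HZ; now apply adm_cst_mult, adm_mult).
  assert (HZ0 : Z 0%Z = 1) by (rewrite HZ, cst_mult_coef; now apply Rinv_l).
  set (Fp := Fw e u).
  assert (HFp : Fp = (cst (/ (c * c)) * (hop e u * f))%W) by reflexivity.
  assert (HFadm : adm H Fp) by (rewrite HFp; now apply adm_cst_mult, adm_mult).
  assert (Hy : forall t, Im (hol H Z 0 (t, 0)) = evR J t / (2 * c)).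
  { intros t. assert (E : 2 * Im (hol H Z 0 (t, 0)) = evR (cst (/ c) * J)%W t).
    { apply hol_top_Im.
      - exact HH.
      - now rewrite star_mult, star_cst, HJs.
      - rewrite cst_mult_coef. unfold J. rewrite Jop_coef0 by assumption. ring.
      - intros n Hn. rewrite HZ, !cst_mult_coef. unfold J. rewrite Jop_coef by assumption.
        unfold e. rewrite <- Rpower_pow by apply exp_pos. unfold Rpower.
        rewrite ln_exp, INR_IZR_INZ, Z2Nat.id by lia.
        replace (IZR n * - (2 * H)) with (- (2 * H * IZR n)) by ring. unfold Rdiv. ring. }
    assert (E2 : evR (cst (/ c) * J)%W t = / c * evR J t).
    { generalize (evT_mult (cst (/ c)) J t). rewrite evT_cst. intros E3. apply (f_equal fst) in E3.
      unfold evT in E3. simpl in E3. lra. }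
    rewrite E2 in E. apply Rmult_eq_reg_l with 2; [|lra]. rewrite E. field. assumption. }
  assert (HdzT : forall t, dhol H Z (t, 0) = evT Z t) by (intros; now apply dhol_top).
  assert (HdFT : forall t, dhol H Fp (t, 0) = evT Fp t) by (intros; now apply dhol_top).
  assert (HcC : RtoC c <> RtoC 0) by (intros E; apply Hc; now apply RtoC_inj in E).
  assert (Hic : RtoC (/ c) = (/ RtoC c)%C) by now apply RtoC_inv.
  assert (HZT : forall t, evT Z t = (/ c * (evT f t * evT f t))%C).
  { intros t. rewrite HZ, !evT_mult, evT_cst, Hic. reflexivity. }
  assert (HfT : forall t, evT f t <> RtoC 0).
  { intros t E. apply (Hne t). rewrite HZT, E. ring. }
  assert (HFT : forall t, evT Fp t = (/ c * (/ c * (evR P t * (Cconj (evT f t) * evT f t)))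
      + RtoC (2 * Im (hol H Z 0 (t, 0))) * evT Z t)%C).
  { intros t. rewrite Hy, HFp, evT_mult, evT_cst, evT_mult, Hhop, evT_plus, !evT_mult, evT_star,
      (evT_real P), (evT_real J), HZT by assumption.
    replace (2 * (evR J t / (2 * c))) with (evR J t * / c) by (field; assumption).
    rewrite RtoC_mult, Hic, (Rinv_mult c c), RtoC_mult, Hic. field. assumption. }
  set (C0 := Im (hol H Z 0 (0, 0)) * Im (hol H Z 0 (0, 0)) - Im (hol H Fp 0 (0, 0))).
  assert (HC0 : forall w, Im (hol H Fp C0 w) = Im (hol H Fp 0 w) + C0).
  { intros w. unfold hol, Im, Ci; simpl. ring. }
  assert (HFtop : forall t, Im (hol H Fp C0 (t, 0)) = Im (hol H Z 0 (t, 0)) * Im (hol H Z 0 (t, 0))).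
  { set (q := fun t => Im (hol H Fp C0 (t, 0)) - Im (hol H Z 0 (t, 0)) * Im (hol H Z 0 (t, 0))).
    assert (Hbig : forall t, big H (/ 16) (t, 0)) by (intros; unfold big; simpl; lra).
    assert (Hq : forall t, derivable_pt_lim q t 0).
    { intros t. apply is_derive_Reals.
      assert (D1 := proj2 (deriv_hor _ _ _ _ (hol_cderiv H HH Fp C0 (t, 0) (Hbig t)))).
      assert (D2 := proj2 (deriv_hor _ _ _ _ (hol_cderiv H HH Z 0 (t, 0) (Hbig t)))).
      rewrite HdFT, HFT, <- !Hic in D1. rewrite HdzT in D2.
      assert (D3 := is_derive_sqr _ _ _ D2).
      assert (D4 := is_derive_minus (K := R_AbsRing) (V := R_NormedModule) _ _ t _ _ D1 D3).
      cbv beta in D4. match type of D4 with is_derive _ _ ?l => replace 0 with l; [exact D4|] end.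
      match goal with |- minus ?l _ = 0 =>
        change (l - 2 * Im (hol H Z 0 (t, 0)) * Im (evT Z t) = 0) end.
      generalize (Im (hol H Z 0 (t, 0))) (evT Z t) (evT f t) (evR P t). intros y zt ft pt.
      unfold Im, Cconj; simpl. ring. }
    assert (Hqc : forall t, q t = q 0).
    { intros t. destruct (Req_dec t 0) as [->|Hn]; [reflexivity|].
      destruct (MVT_gen q 0 t (fun _ => 0)) as [x [_ E]].
      - intros x _. apply is_derive_Reals, Hq.
      - intros x _. apply derivable_continuous_pt. exists 0. apply Hq.
      - lra. }
    intros t. specialize (Hqc t). unfold q in Hqc. rewrite (HC0 (0, 0)) in Hqc. unfold C0 in Hqc at 2. lra. }
  assert (HBern : forall t, / 2 * (Cmod (dhol H Fp (t, 0) / dhol H Z (t, 0) - RtoC (2 * Im (hol H Z 0 (t, 0))))%C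
     * Cmod (dhol H Fp (t, 0) / dhol H Z (t, 0) - RtoC (2 * Im (hol H Z 0 (t, 0))))%C)
     + g * Im (hol H Z 0 (t, 0)) = c0 / (2 * (c * c))).
  { intros t. rewrite HdFT, HdzT.
    assert (Hfc : Cconj (evT f t) <> RtoC 0).
    { intros E. apply (HfT t). rewrite <- (Cconj_conj (evT f t)), E. apply injective_projections; simpl; ring. }
    assert (E1 : (evT Fp t / evT Z t - RtoC (2 * Im (hol H Z 0 (t, 0))))%C
       = (/ c * evR P t * (Cconj (evT f t) / evT f t))%C).
    { rewrite HFT. rewrite HZT. specialize (HfT t). field. auto. }
    rewrite E1, !Cmod_mult, Cmod_div, Cmod_conj, Cmod_inv, !Cmod_R by auto.
    assert (Hm : Cmod (evT f t) <> 0) by (apply Rgt_not_eq, Cmod_gt_0, HfT).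
    assert (Hb : evR P t * evR P t + g * (c * evR J t) = c0).
    { generalize (f_equal (fun a => evT a t) Hber). cbv beta.
      rewrite evT_plus, !evT_mult, !evT_cst, (evT_real P), (evT_real J) by assumption.
      intros E. rewrite <- !RtoC_mult, <- RtoC_plus in E. apply RtoC_inj in E. exact E. }
    rewrite Hy.
    assert (Habs : forall x : R, Rabs x * Rabs x = x * x).
    { intros x. rewrite <- Rabs_mult. apply Rabs_right. nra. }
    replace (Cmod (evT f t) / Cmod (evT f t)) with 1 by (field; assumption).
    replace (/ Rabs c * Rabs (evR P t) * 1 * (/ Rabs c * Rabs (evR P t) * 1))
      with ((Rabs (evR P t) * Rabs (evR P t)) * / (Rabs c * Rabs c)).
    2:{ field. now apply Rabs_no_R0. }
    rewrite !Habs, <- Hb. field. assumption. }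
  (* The constant c0 of [berop] is 2 c^2 times the Bernoulli expression. *)
  exists (c0 / (2 * (c * c))).
  eexists. eexists. eexists. exists (hol H Z 0). split.
  - apply (water_wave g H (c0 / (2 * (c * c))) (- (Fp 0%Z * H) + C0) (/ 16)
      (hol H Z 0) (dhol H Z) (d2hol H Z) (d3hol H Z) (hol H Fp C0) (dhol H Fp) (d2hol H Fp) (d3hol H Fp) k).
    + exact HH.
    + lra.
    + intros; now apply hol_cderiv.
    + intros; now apply dhol_cderiv.
    + intros; now apply d2hol_cderiv.
    + intros; now apply hol_cderiv.
    + intros; now apply dhol_cderiv.
    + intros; now apply d2hol_cderiv.
    + intros w. rewrite hol_period, HZ0, Rmult_1_l. reflexivity.
    + intros; apply dhol_period.
    + intros; apply hol_refl.
    + intros a. rewrite hol_bot, HZ0. ring.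
    + intros w. rewrite hol_period. unfold Im; simpl. ring.
    + intros w. rewrite hol_refl. reflexivity.
    + intros a. rewrite hol_bot. reflexivity.
    + exact HFtop.
    + intros a. rewrite HdzT. apply Hpos.
    + intros a. rewrite HdzT. apply Hne.
    + intros a. rewrite dhol_bot, HZ0.
      generalize (G1_bot_bound H HH Z a) (re_le_Cmod (G1 (pc Z) (a, - H))) (Rle_abs (- Re (G1 (pc Z) (a, - H)))).
      rewrite Rabs_Ropp. lra.
    + exact Hk.
    + intros a. rewrite HdzT. apply HkI.
    + exact HBern.
  - intros a. unfold x_alpha. rewrite <- (f_equal Re (HdzT a) : _ = evR Z a).
    apply is_derive_unique. apply (proj1 (deriv_hor _ _ _ _ (hol_cderiv H HH Z 0 (a, 0)
      ltac:(unfold big; simpl; lra)))).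
Qed.

(** * The first vertical profile *)

(** At the supremum s of the parameters with nonnegative profile, the Lipschitz bound in the
    parameter keeps the profile nonnegative. Its minimum is attained on one period, and if it were
    positive it would remain so slightly beyond s. *)
Lemma first_touch (X : R -> R -> R) (a1 a2 L : R) : a1 < a2 -> 0 <= L ->
  (forall a b t, a1 <= a <= a2 -> a1 <= b <= a2 -> Rabs (X a t - X b t) <= L * Rabs (a - b)) ->
  (forall a t, a1 <= a <= a2 -> continuity_pt (X a) t) ->
  (forall a t, a1 <= a <= a2 -> X a (t + 2 * PI) = X a t) ->
  (forall t, 0 <= X a1 t) -> (exists t, X a2 t < 0) ->
  exists a, a1 <= a <= a2 /\ (forall t, 0 <= X a t) /\ exists t, X a t = 0.
Proof.
  intros H12 HL Hlip Hcont Hper H1 [t2 H2].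
  set (T := fun a => a1 <= a <= a2 /\ forall t, 0 <= X a t).
  assert (T1 : T a1) by (split; [lra|exact H1]).
  destruct (completeness T) as [s [Hs1 Hs2]].
  - exists a2. intros a [Ha _]. lra.
  - exists a1. exact T1.
  - assert (Hs : a1 <= s <= a2).
    { split; [now apply Hs1|]. apply Hs2. intros a [Ha _]. lra. }
    assert (Hpos : forall t, 0 <= X s t).
    { intros t. apply Rnot_lt_le. intros Hneg.
      assert (Hd : 0 < - X s t / (L + 1)) by (apply Rdiv_lt_0_compat; lra).
      assert (s <= s - - X s t / (L + 1)); [|lra]. apply Hs2. intros a [Ha Hp].
      apply Rnot_lt_le. intros Hlt. assert (Has : a <= s) by (apply Hs1; split; auto).
      specialize (Hlip a s t Ha Hs). specialize (Hp t).
      rewrite (Rabs_left1 (a - s)) in Hlip by lra.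
      assert (Hm : (s - a) * (L + 1) < - X s t) by (apply Rlt_div_r; lra).
      generalize (Rle_abs (X a t - X s t)). nra. }
    exists s. split; [exact Hs|]. split; [exact Hpos|]. apply NNPP. intros Hno.
    assert (Hsa : s < a2).
    { destruct (Req_dec s a2) as [E|E]; [|lra]. subst s. specialize (Hpos t2). lra. }
    destruct (continuity_ab_min (X s) 0 (2 * PI)) as [tm [Hmin Htm]].
    + generalize PI_RGT_0; lra.
    + intros; now apply Hcont.
    + assert (Hm : 0 < X s tm).
      { destruct (Req_dec (X s tm) 0) as [E|E]; [exfalso; apply Hno; now exists tm|].
        specialize (Hpos tm). lra. }
      assert (Hglob : forall t, X s tm <= X s t).
      { intros t. destruct (periodic_reduce (fun w => RtoC (X s (Re w)))) with (a := t) as [t' [Ht' E]].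
        - intros a b. simpl. now rewrite Hper.
        - specialize (E 0). simpl in E. apply RtoC_inj in E. rewrite E. now apply Hmin. }
      set (d := Rmin (a2 - s) (X s tm / (L + 1))).
      assert (Hd : 0 < d) by (apply Rmin_glb_lt; [lra|apply Rdiv_lt_0_compat; lra]).
      assert (Hd1 : d <= a2 - s) by apply Rmin_l.
      assert (Hd2 : d * (L + 1) <= X s tm) by (apply Rle_div_r; [lra|apply Rmin_r]).
      assert (s + d <= s); [|lra]. apply Hs1. split; [lra|]. intros t.
      specialize (Hlip (s + d) s t ltac:(lra) Hs). specialize (Hglob t).
      replace (s + d - s) with d in Hlip by ring. rewrite (Rabs_right d) in Hlip by lra.
      generalize (Rle_abs (- (X (s + d) t - X s t))). rewrite Rabs_Ropp. nra.
Qed.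

(** * Quantitative closeness to the Crapper waves *)

Lemma nrm_sqr_diff f f' : nrm f <= 9 -> nrm f' <= 9 ->
  nrm (f * f - f' * f')%W <= 18 * nrm (f - f')%W.
Proof.
  intros Hf Hf'. replace (f * f - f' * f')%W with ((f - f') * (f + f'))%W by ring.
  eapply Rle_trans; [apply nrm_mult|]. rewrite Rmult_comm. apply Rmult_le_compat_r; [apply nrm_pos|].
  eapply Rle_trans; [apply nrm_plus|]. lra.
Qed.

(** Both f^2 and the normalizing factor vary: 2 * 18 + 4 * 18 * 81 is below 6000. *)
Lemma Zw_lip f f' : nrm f <= 9 -> nrm f' <= 9 -> / 2 <= (f * f)%W 0%Z -> / 2 <= (f' * f')%W 0%Z ->
  nrm (Zw f - Zw f')%W <= 6000 * nrm (f - f')%W.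
Proof.
  intros Hf Hf' Hc Hc'. assert (Hd := nrm_sqr_diff f f' Hf Hf').
  unfold Zw. set (c := (f * f)%W 0%Z) in *. set (c' := (f' * f')%W 0%Z) in *.
  assert (Hcc : Rabs (c - c') <= 18 * nrm (f - f')%W).
  { eapply Rle_trans; [|exact Hd]. apply (coef_le (f * f - f' * f')%W 0). }
  replace (cst (/ c) * (f * f) - cst (/ c') * (f' * f'))%W
    with (cst (/ c) * (f * f - f' * f') + cst (/ c - / c') * (f' * f'))%W
    by (rewrite cst_minus; ring).
  assert (Hi : forall x, / 2 <= x -> 0 < / x <= 2).
  { intros x Hx. split; [apply Rinv_0_lt_compat; lra|]. rewrite <- (Rinv_inv 2).
    apply Rinv_le_contravar; lra. }
  assert (I1 := Hi c Hc). assert (I2 := Hi c' Hc').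
  assert (E : Rabs (/ c - / c') <= 4 * Rabs (c - c')).
  { replace (/ c - / c') with ((/ c * / c') * (c' - c)) by (field; lra).
    rewrite Rabs_mult, (Rabs_minus_sym c'). apply Rmult_le_compat_r; [apply Rabs_pos|].
    rewrite Rabs_right by nra. nra. }
  eapply Rle_trans; [apply nrm_plus|].
  generalize (nrm_mult (cst (/ c)) (f * f - f' * f')%W) (nrm_mult (cst (/ c - / c')) (f' * f')%W)
    (nrm_mult f' f').
  rewrite !nrm_cst, (Rabs_right (/ c)) by lra. intros B1 B2 B3.
  assert (N1 := nrm_pos (f - f')%W). assert (N2 := nrm_pos (f * f - f' * f')%W).
  assert (N3 := nrm_pos f'). assert (N4 := nrm_pos (f' * f')%W). assert (N5 := Rabs_pos (/ c - / c')).
  assert (C1 : / c * nrm (f * f - f' * f')%W <= 2 * (18 * nrm (f - f')%W)) by (apply Rmult_le_compat; lra).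
  assert (C2 : nrm (f' * f')%W <= 81) by nra.
  assert (C3 : Rabs (/ c - / c') * nrm (f' * f')%W <= (4 * (18 * nrm (f - f')%W)) * 81)
    by (apply Rmult_le_compat; lra).
  lra.
Qed.

Lemma nrm_fA A : nrm (fA A) <= 7.
Proof.
  unfold fA. eapply Rle_trans; [apply nrm_minus|].
  generalize (nrm_plus (geo A) (geo A)) (nrm_geo A). rewrite nrm_cst, Rabs_R1. lra.
Qed.

Lemma fA_sqr_0 A : Rabs A <= / 2 -> (fA A * fA A)%W 0%Z = 1.
Proof.
  intros HA. assert (Hs := strictpos_geo1 A HA).
  replace (fA A * fA A)%W with (cst 1 + (geo A + geo A - cst 1 - cst 1) * (fA A + cst 1))%W
    by (unfold fA; ring).
  rewrite Wplus_coef, (strictpos_mult _ (fA A + cst 1)%W Hs).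
  - simpl. ring.
  - apply powser_plus; [apply powser_fA|apply powser_cst].
  - lia.
Qed.

Lemma Zw_fA A : Rabs A <= / 2 -> Zw (fA A) = (fA A * fA A)%W.
Proof. intros HA. unfold Zw. rewrite fA_sqr_0, Rinv_1 by assumption. ring. Qed.

(** Multiplying (1 + A X) f = 1 - A X by the conjugate of 1 + A X, whose squared modulus is D, gives
    D f = 1 - A^2 + 2 i A sin t; it remains to square. *)
Lemma crapper_eval A t : Rabs A <= / 2 ->
  let D := 1 + 2 * A * cos t + A * A in
  evR (fA A * fA A)%W t * (D * D) = (1 - A * A) * (1 - A * A) - 4 * (A * A) * (sin t * sin t) /\
  evI (fA A * fA A)%W t * (D * D) = 4 * A * (1 - A * A) * sin t.
Proof.
  intros HA D.
  assert (E : ((cst 1 + cst A * X) * fA A)%W = (cst 1 - cst A * X)%W).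
  { unfold fA. transitivity ((cst 1 + cst A * X) * geo A + (cst 1 + cst A * X) * geo A - (cst 1 + cst A * X))%W; [ring|].
    rewrite geo_inv by assumption. ring. }
  apply (f_equal (fun a => evT a t)) in E.
  rewrite evT_mult, evT_plus, evT_minus, evT_mult, evT_cst, evT_cst, evT_X in E.
  assert (E2 := evT_mult (fA A) (fA A) t).
  unfold evT at 1 in E2. destruct (evT (fA A) t) as [p q].
  assert (Er := f_equal fst E). assert (Ei := f_equal snd E).
  assert (Fr := f_equal fst E2). assert (Fi := f_equal snd E2). simpl in Er, Ei, Fr, Fi.
  assert (Hsc := sin2_cos2 t). unfold Rsqr in Hsc.
  set (s := sin t) in *. set (c := cos t) in *.
  assert (P1 : D * p = 1 - A * A).
  { assert (D * p = (1 + A * c) * (1 - A * c) - (A * s) * (A * s)).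
    { transitivity ((1 + A * c) * ((1 + A * c) * p + A * s * q) - A * s * ((1 + A * c) * q - A * s * p)).
      - unfold D. transitivity ((1 + 2 * A * c + A * A * (s * s + c * c)) * p); [rewrite Hsc; ring|ring].
      - replace ((1 + A * c) * p + A * s * q) with (1 - A * c) by lra.
        replace ((1 + A * c) * q - A * s * p) with (A * s) by lra. ring. }
    rewrite H. transitivity (1 - A * A * (s * s + c * c)); [ring|]. rewrite Hsc. ring. }
  assert (P2 : D * q = 2 * A * s).
  { transitivity ((1 + A * c) * ((1 + A * c) * q - A * s * p) + A * s * ((1 + A * c) * p + A * s * q)).
    - unfold D. transitivity ((1 + 2 * A * c + A * A * (s * s + c * c)) * q); [rewrite Hsc; ring|ring].
    - replace ((1 + A * c) * p + A * s * q) with (1 - A * c) by lra.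
      replace ((1 + A * c) * q - A * s * p) with (A * s) by lra. ring. }
  rewrite Fr, Fi. split.
  - transitivity ((D * p) * (D * p) - (D * q) * (D * q)); [ring|]. rewrite P1, P2. ring.
  - transitivity (2 * (D * p) * (D * q)); [ring|]. rewrite P1, P2. ring.
Qed.

Lemma crapper_D A t : 0.33 <= A <= 0.5 ->
  let D := 1 + 2 * A * cos t + A * A in 0 < D * D <= 5.07.
Proof.
  intros HA D. generalize (COS_bound t). intros Hc.
  assert (0.25 <= D) by (unfold D; nra). assert (D <= 2.25) by (unfold D; nra). nra.
Qed.

(* Re f^2 is a positive multiple of (1 - A^2)^2 - 4 A^2 (sin t)^2, whose minimum, at
   t = PI / 2, vanishes for A = A0. *)
Lemma crapper_margin_low tau t : 0 < tau <= 0.08 ->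
  tau / 3 <= evR (fA (A0 - tau) * fA (A0 - tau))%W t.
Proof.
  intros Ht. assert (B := A0_bounds). assert (S := A0_sqr).
  set (A := A0 - tau). assert (HA : 0.33 <= A <= 0.5) by (unfold A; lra).
  destruct (crapper_eval A t) as [E _]; [rewrite Rabs_right; lra|].
  assert (HD := crapper_D A t HA). cbv zeta in E, HD.
  set (DD := (1 + 2 * A * cos t + A * A) * (1 + 2 * A * cos t + A * A)) in *.
  assert (Hs : sin t * sin t <= 1) by (generalize (SIN_bound t); nra).
  (* At sin t = 1 the numerator is (1 - A^2 - 2 A)(1 - A^2 + 2 A), whose first factor vanishes at A0
     with slope below -2. Division by at most 5.07 leaves more than tau / 3. *)
  assert (H1 : 2 * tau <= 1 - A * A - 2 * A) by (unfold A; nra).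
  assert (H2 : 1 <= 1 - A * A + 2 * A) by nra.
  assert (H3 : 2 * tau <= (1 - A * A) * (1 - A * A) - 4 * (A * A) * (sin t * sin t)).
  { apply Rle_trans with ((1 - A * A - 2 * A) * (1 - A * A + 2 * A)); [nra|].
    assert (4 * (A * A) * (sin t * sin t) <= 4 * (A * A)) by nra. lra. }
  rewrite <- E in H3. apply Rnot_lt_le. intros Hlt. nra.
Qed.

Lemma crapper_margin_high tau : 0 < tau <= 0.08 ->
  evR (fA (A0 + tau) * fA (A0 + tau))%W (PI / 2) <= - (tau / 3).
Proof.
  intros Ht. assert (B := A0_bounds). assert (S := A0_sqr).
  set (A := A0 + tau). assert (HA : 0.33 <= A <= 0.5) by (unfold A; lra).
  destruct (crapper_eval A (PI / 2)) as [E _]; [rewrite Rabs_right; lra|].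
  assert (HD := crapper_D A (PI / 2) HA). cbv zeta in E, HD.
  rewrite sin_PI2 in E.
  set (DD := (1 + 2 * A * cos (PI / 2) + A * A) * (1 + 2 * A * cos (PI / 2) + A * A)) in *.
  assert (H1 : 1 - A * A - 2 * A <= - (2 * tau)) by (unfold A; nra).
  assert (H2 : 1 <= 1 - A * A + 2 * A) by nra.
  assert (H3 : (1 - A * A) * (1 - A * A) - 4 * (A * A) * (1 * 1) <= - (2 * tau)).
  { replace ((1 - A * A) * (1 - A * A) - 4 * (A * A) * (1 * 1))
      with ((1 - A * A - 2 * A) * (1 - A * A + 2 * A)) by ring. nra. }
  rewrite <- E in H3. apply Rnot_lt_le. intros Hlt. nra.
Qed.

Lemma evR_minus a b t : evR (a - b)%W t = evR a t - evR b t.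
Proof. exact (f_equal fst (evT_minus a b t)). Qed.
Lemma evI_minus a b t : evI (a - b)%W t = evI a t - evI b t.
Proof. exact (f_equal snd (evT_minus a b t)). Qed.

(** The distance from f to the Crapper function is at most theta from the unknown plus 0.9 theta
    from the depth, as e <= theta / 10 and the norm is at most 9; [Zw_lip] turns 2 theta into 12000
    theta. *)
Lemma near_crapper A e u theta : 0.33 <= A <= 0.5 -> 0 < theta <= / 10000000 ->
  0 <= e <= theta / 10 -> nE (subE u (bA A)) <= theta ->
  nrm (fu e u) <= 9 /\ / 2 <= (fu e u * fu e u)%W 0%Z /\
  nrm (Zw (fu e u) - fA A * fA A)%W <= 12000 * theta.
Proof.
  intros HA Hth He Hu. assert (HA2 : Rabs A <= / 2) by (rewrite Rabs_right; lra).
  assert (Hx : nrm (fst u - fst (bA A))%W <= theta).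
  { unfold nE in Hu; simpl in Hu. generalize (nrm_pos (snd u - cst (qA A - q0))%W). simpl. lra. }
  assert (Hb : nrm (fst (bA A)) <= 8).
  { simpl. eapply Rle_trans; [apply nrm_minus|]. rewrite nrm_cst, Rabs_R1. generalize (nrm_fA A). lra. }
  assert (Hn : nrm (fst u) <= 9).
  { replace (fst u) with ((fst u - fst (bA A)) + fst (bA A))%W by ring.
    eapply Rle_trans; [apply nrm_plus|]. lra. }
  assert (Hf : nrm (fu e u - fA A)%W <= 2 * theta).
  { rewrite <- (fop_bA A HA2). unfold fu, fop. rewrite epsop0, star_cst.
    replace (cst 1 + Pi (fst u) + star (epsop e (fst u)) - (cst 1 + Pi (fst (bA A)) + cst 0))%W
      with (Pi (fst u - fst (bA A)) + star (epsop e (fst u)))%W by (rewrite Pi_minus; ring).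
    eapply Rle_trans; [apply nrm_plus|]. rewrite nrm_star.
    generalize (nrm_mulop (fun n => if (0 <? n)%Z then 1 else 0) (fst u - fst (bA A))%W)
      (nrm_epsop e (fst u) ltac:(lra)). unfold Pi. intros B1 B2.
    assert (e * nrm (fst u) <= theta / 10 * 9) by (apply Rmult_le_compat; try lra; apply nrm_pos). lra. }
  assert (HfA := nrm_fA A).
  assert (Hfn : nrm (fu e u) <= 9).
  { replace (fu e u) with ((fu e u - fA A) + fA A)%W by ring.
    eapply Rle_trans; [apply nrm_plus|]. lra. }
  assert (Hc : / 2 <= (fu e u * fu e u)%W 0%Z).
  { generalize (coef_le (fu e u * fu e u - fA A * fA A)%W 0)
      (nrm_sqr_diff (fu e u) (fA A) Hfn ltac:(lra)).
    rewrite Wminus_coef, fA_sqr_0 by assumption.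
    intros B1 B2. generalize (Rle_abs (- ((fu e u * fu e u)%W 0%Z - 1))). rewrite Rabs_Ropp. lra. }
  split; [exact Hfn|]. split; [exact Hc|].
  rewrite <- Zw_fA by assumption.
  eapply Rle_trans; [apply Zw_lip; auto; [lra|rewrite fA_sqr_0 by assumption; lra]|]. lra.
Qed.

(** For the Crapper wave Im z' is sin t times a factor of at least 0.19, which the perturbation
    changes by at most 4 d <= 0.04. So z' could vanish only where sin t = 0, but there Re z' is
    close to the positive number ((1 - A^2) / D)^2. *)
Lemma near_crapper_profile A Z d : 0.33 <= A <= 0.5 -> 0 <= d <= / 100 ->
  nrm (Z - fA A * fA A)%W <= d ->
  (exists k : R -> R, (forall t, 0 < k t) /\ forall t, evI Z t = sin t * k t) /\
  forall t, evT Z t <> RtoC 0.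
Proof.
  intros HA Hd HZ. assert (HA2 : Rabs A <= / 2) by (rewrite Rabs_right; lra).
  assert (HI : forall t, exists r, evI Z t = sin t * r /\ 0 < r \/ sin t = 0 /\ evI Z t = 0).
  { intros t. destruct (crapper_eval A t HA2) as [_ E]. assert (HD := crapper_D A t HA).
    cbv zeta in E, HD.
    set (DD := (1 + 2 * A * cos t + A * A) * (1 + 2 * A * cos t + A * A)) in *.
    assert (Hb := evI_bound (Z - fA A * fA A)%W t). rewrite evI_minus in Hb.
    set (w := evI (fA A * fA A)%W t) in *. clearbody DD w.
    assert (Hb' : Rabs (evI Z t - w) <= 4 * d * Rabs (sin t)).
    { eapply Rle_trans; [exact Hb|]. apply Rmult_le_compat_r; [apply Rabs_pos|lra]. }
    assert (Hw : w = (4 * A * (1 - A * A) / DD) * sin t) by (unfold Rdiv; apply Rmult_eq_reg_r with DD; [rewrite E; field; lra|lra]).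
    destruct (Req_dec (sin t) 0) as [Es|Es].
    - exists 0. right. split; [exact Es|]. rewrite Hw, Es, Rabs_R0, !Rmult_0_r, Rminus_0_r in Hb'.
      generalize (Rabs_pos (evI Z t)). intros.
      destruct (Req_dec (evI Z t) 0) as [|E0]; [assumption|]. generalize (Rabs_pos_lt _ E0). lra.
    - exists (evI Z t / sin t). left. split; [field; assumption|].
      replace (evI Z t / sin t) with (4 * A * (1 - A * A) / DD + (evI Z t - w) / sin t)
        by (rewrite Hw; field; split; (assumption || lra)).
      assert (H0 : 0.99 <= 4 * A * (1 - A * A)).
      { assert (0.75 <= 1 - A * A) by nra. nra. }
      assert (H1 : 0.19 <= 4 * A * (1 - A * A) / DD) by (apply (proj1 (Rle_div_r 0.19 (4 * A * (1 - A * A)) DD ltac:(lra))); lra).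
      assert (H2 : Rabs ((evI Z t - w) / sin t) <= 4 * d).
      { unfold Rdiv. rewrite Rabs_mult, Rabs_inv.
        apply Rmult_le_reg_r with (Rabs (sin t)); [now apply Rabs_pos_lt|].
        rewrite Rmult_assoc, Rinv_l, Rmult_1_r by now apply Rabs_no_R0. exact Hb'. }
      generalize (Rle_abs (- ((evI Z t - w) / sin t))). rewrite Rabs_Ropp. lra. }
  split.
  (* At multiples of PI the equation reads 0 = 0, and the default value 1 keeps k positive. *)
  - exists (fun t => if Req_EM_T (sin t) 0 then 1 else evI Z t / sin t). split.
    + intros t. destruct (Req_EM_T (sin t) 0) as [|Es]; [lra|].
      destruct (HI t) as [r [[E Hr]|[E _]]]; [|contradiction].
      rewrite E. replace (sin t * r / sin t) with r by (field; assumption). exact Hr.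
    + intros t. destruct (Req_EM_T (sin t) 0) as [Es|Es]; [|field; assumption].
      destruct (HI t) as [r [[E _]|[_ E]]]; rewrite E; [rewrite Es|rewrite Es]; ring.
  - intros t E. assert (Ei := f_equal snd E). assert (Er := f_equal fst E).
    unfold evT in Ei, Er; simpl in Ei, Er.
    destruct (HI t) as [r [[E1 Hr]|[Es _]]].
    + assert (Es : sin t = 0) by (rewrite Ei in E1; nra).
      revert Es. generalize Er. clear - HA HA2 Hd HZ. intros Er Es.
      destruct (crapper_eval A t HA2) as [E _]. assert (HD := crapper_D A t HA). cbv zeta in E, HD.
      rewrite Es in E. generalize (evR_bound (Z - fA A * fA A)%W t). rewrite evR_minus, Er. intros Hb.
      generalize (Rle_abs (- (0 - evR (fA A * fA A)%W t))). rewrite Rabs_Ropp. intros. nra.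
    + destruct (crapper_eval A t HA2) as [E0 _]. assert (HD := crapper_D A t HA). cbv zeta in E0, HD.
      rewrite Es in E0. generalize (evR_bound (Z - fA A * fA A)%W t). rewrite evR_minus, Er. intros Hb.
      generalize (Rle_abs (- (0 - evR (fA A * fA A)%W t))). rewrite Rabs_Ropp. intros. nra.
Qed.

Theorem corollary10 :
  exists eps0 : R, 0 < eps0 /\
  forall eps : R, 0 < eps < eps0 ->
  forall G : R, - eps < G < eps ->
  exists H0 : R, 0 < H0 /\
  forall H : R, H0 < H ->
  exists (Omega B Q d : R) (D : C -> Prop) (psi : R -> R -> R) (z : C -> C),
    is_water_wave G H Omega B Q d D psi z /\
    vertical_at_a_point z /\
    never_overhanging z.
Proof.
  destruct perturbed_crapper as [CF [HCF Hfam]].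
  (* With eta = 10^{-6} the correction is at most theta = 10^{-6} tau, and 12000 theta is well below
     the margin tau / 3 of the Crapper waves at both ends of the interval. *)
  destruct (Hfam (/ 1000000) ltac:(lra)) as [tau [Htau Hfam']]. clear Hfam.
  destruct (Hfam' tau ltac:(lra)) as [delta [Hdel Hsol]]. clear Hfam'.
  exists delta. split; [lra|]. intros eps Heps G HG.
  set (theta := / 1000000 * tau) in *.
  assert (Hth : 0 < theta <= / 10000000) by (unfold theta; lra).
  (* m will bound e^{-H}, and thus e = e^{-2H}: delta is for the existence of the family, theta / 10
     for [near_crapper], and 1 / 2000 for the bottom, where the norm of z' is at most 162 and 162 /
     2000 < 1 / 8. *)
  set (m := Rmin (Rmin delta (theta / 10)) (/ 2000)).
  assert (Hm : 0 < m) by (unfold m; repeat apply Rmin_glb_lt; lra).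
  assert (Hm1 : m <= delta) by (eapply Rle_trans; [apply Rmin_l|apply Rmin_l]).
  assert (Hm2 : m <= theta / 10) by (eapply Rle_trans; [apply Rmin_l|apply Rmin_r]).
  assert (Hm3 : m <= / 2000) by apply Rmin_r.
  exists (- ln m). split.
  { assert (ln m < ln 1) by (apply ln_increasing; lra). rewrite ln_1 in *. lra. }
  intros H HH.
  assert (Hem : exp (- H) < m).
  { rewrite <- (exp_ln m Hm). apply exp_increasing. lra. }
  assert (Hpe := exp_pos (- H)).
  set (e := exp (- (2 * H))) in *.
  assert (He : 0 <= e < m).
  { unfold e. replace (- (2 * H)) with (- H + - H) by ring. rewrite exp_plus. split; nra. }
  assert (HH0 : 0 < H).
  { assert (ln m < ln 1) by (apply ln_increasing; lra). rewrite ln_1 in *. lra. }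
  destruct (Hsol e G ltac:(lra) ltac:(apply Rabs_def1; lra)) as [u [Hu Hul]]. clear Hsol.
  assert (B := A0_bounds).
  assert (Hrange : forall A, A0 - tau <= A <= A0 + tau -> Rabs (A - A0) <= tau /\ 0.33 <= A <= 0.5).
  { intros A HA. split; [apply Rabs_le; lra|lra]. }
  set (ZA := fun A => Zw (fu e (u A))).
  assert (Hnear : forall A, A0 - tau <= A <= A0 + tau ->
    nrm (fu e (u A)) <= 9 /\ / 2 <= (fu e (u A) * fu e (u A))%W 0%Z /\
    nrm (ZA A - fA A * fA A)%W <= 12000 * theta).
  { intros A HA. destruct (Hrange A HA) as [R1 R2]. apply near_crapper; auto; [lra|].
    now apply Hu. }
  assert (Hev : forall A t, A0 - tau <= A <= A0 + tau ->
     Rabs (evR (ZA A) t - evR (fA A * fA A)%W t) <= 12000 * theta).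
  { intros A t HA. rewrite <- evR_minus. eapply Rle_trans; [apply evR_bound|]. now apply Hnear. }
  assert (Hadm : forall A, adm H (ZA A)).
  { intros A. unfold ZA, Zw. apply adm_cst_mult, adm_mult; now apply adm_fop. }
  assert (Hder : forall A t, exists l : R, is_derive (evR (ZA A)) t l).
  { intros A t. assert (Hb : big H (/ 16) (t, 0)) by (unfold big; simpl; lra).
    assert (D1 := proj1 (deriv_hor _ _ _ _ (dhol_cderiv H HH0 (ZA A) (t, 0) Hb))).
    eexists. eapply is_derive_ext; [|exact D1]. intros s. cbv beta. now rewrite dhol_top. }
  (* The Lipschitz constant is 6000 from [Zw_lip] times 2 CF, since [Pi] and [epsop] each pass on
     the variation of the unknown once. *)
  destruct (first_touch (fun A => evR (ZA A)) (A0 - tau) (A0 + tau) (12000 * CF)) as [A [HA [Hpos [t0 Ht0]]]].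
  - lra.
  - lra.
  - intros a b t Ha Hb. rewrite <- evR_minus. eapply Rle_trans; [apply evR_bound|].
    destruct (Hnear a Ha) as [A1 [A2 _]]. destruct (Hnear b Hb) as [B1 [B2 _]].
    eapply Rle_trans; [now apply Zw_lip|].
    assert (Hf : nrm (fu e (u a) - fu e (u b))%W <= 2 * (CF * Rabs (a - b))).
    { assert (Hx : nrm (fst (u a) - fst (u b))%W <= CF * Rabs (a - b)).
      { eapply Rle_trans; [|apply Hul; now apply Hrange]. unfold nE; simpl.
        generalize (nrm_pos (snd (u a) - snd (u b))%W). lra. }
      unfold fu, fop.
      replace (cst 1 + Pi (fst (u a)) + star (epsop e (fst (u a))) -
        (cst 1 + Pi (fst (u b)) + star (epsop e (fst (u b)))))%W
        with (Pi (fst (u a) - fst (u b)) + star (epsop e (fst (u a) - fst (u b))))%W.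
      2:{ unfold epsop. rewrite Pi_minus, mulop_minus, star_minus. ring. }
      eapply Rle_trans; [apply nrm_plus|]. rewrite nrm_star. unfold Pi, epsop.
      generalize (nrm_mulop (fun n => if (0 <? n)%Z then 1 else 0) (fst (u a) - fst (u b))%W)
        (nrm_mulop (fun n => if (0 <? n)%Z then e ^ Z.to_nat n else 0) (fst (u a) - fst (u b))%W). lra. }
    lra.
  - intros a t _. destruct (Hder a t) as [l D1]. apply derivable_continuous_pt, ex_derive_Reals_0.
    exists l. exact D1.
  - intros a t _.
    assert (E := f_equal Re (dhol_period H (ZA a) (t, 0))). rewrite shift_pair, !dhol_top in E by auto.
    exact E.
  - intros t. generalize (Hev (A0 - tau) t ltac:(lra)) (crapper_margin_low tau t ltac:(lra)). intros E1 E2.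
    generalize (Rle_abs (- (evR (ZA (A0 - tau)) t - evR (fA (A0 - tau) * fA (A0 - tau))%W t))).
    rewrite Rabs_Ropp. unfold theta in *. lra.
  - exists (PI / 2). generalize (Hev (A0 + tau) (PI / 2) ltac:(lra)) (crapper_margin_high tau ltac:(lra)). intros E1 E2.
    generalize (Rle_abs (evR (ZA (A0 + tau)) (PI / 2) - evR (fA (A0 + tau) * fA (A0 + tau))%W (PI / 2))).
    unfold theta in *. lra.
  - destruct (Hrange A HA) as [R1 R2]. destruct (Hnear A HA) as [N1 [N2 N3]].
    destruct (Hu A R1) as [U1 [U2 _]].
    destruct (near_crapper_profile A (ZA A) (12000 * theta) R2 ltac:(lra) N3) as [[k [Hk1 Hk2]] Hne].
    destruct (wave_of_solution H G (u A) k HH0 U1 U2) as (Bc & Q & D & psi & z & Hw & Hx).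
    + change (fop _ (fst (u A))) with (fu e (u A)) in *. fold e. lra.
    + fold e. assert (Hz : nrm (Zw (fu e (u A))) <= 162).
      { unfold Zw. eapply Rle_trans; [apply nrm_mult|]. rewrite nrm_cst.
        assert (Hi : 0 < / (fu e (u A) * fu e (u A))%W 0%Z <= 2).
        { split; [apply Rinv_0_lt_compat; lra|]. rewrite <- (Rinv_inv 2). apply Rinv_le_contravar; lra. }
        rewrite Rabs_right by lra.
        generalize (nrm_mult (fu e (u A)) (fu e (u A))) (nrm_pos (fu e (u A))) (nrm_pos (fu e (u A) * fu e (u A))%W).
        intros. assert (nrm (fu e (u A) * fu e (u A))%W <= 81) by nra. nra. }
      generalize (nrm_pos (Zw (fu e (u A)))). intros. nra.
    + exact Hpos.
    + exact Hne.
    + exact Hk1.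
    + exact Hk2.
    (* The vorticity 2 comes from the term - y^2 of the stream function; the conformal depth equals
       H because z' has mean 1. *)
    + exists 2, Bc, Q, H, D, psi, z. split; [exact Hw|]. split.
      * exists t0. rewrite Hx. exact Ht0.
      * intros a. rewrite Hx. apply Hpos.
Qed.
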